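(* Let $1<p<q$, $2\le q<\infty$, and $0<s=n\left(\frac1p-\frac1q\right)<1$. Then $\mathcal R_{s,q}$ is of weak type $(p,p)$: there is $C$ depending only on fixed parameters such that for every $\alpha>0$ and $f\in L^p(\mathbb R^n)$, $$\mathcal L^n(\{x\in\mathbb R^n:\mathcal R_{s,q}(f)(x)>\alpha\})\le C\alpha^{-p}\|f\|_{L^p(\mathbb R^n)}^p.$$
   Context: $P_t(x)=C_0t(t^2+|x|^2)^{-\frac{n+1}{2}}$, $C_0=\Gamma(\frac{n+1}{2})\pi^{-\frac{n+1}{2}}$, $\mathscr P(f;x,t)=f*P_t(x)$, $\partial_{n+1}=\partial/\partial t$. $\mathcal R_{s,q}(f)(x)=\left(\int_{\mathbb R^n}\frac{1}{|x-y|^{n+sq}}\left(\int_0^{2|x-y|}|\partial_{n+1}\mathscr P(f;y,t)|t^s\,dt\right)^q dy\right)^{1/q}$. *)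

(* Defs.v *)
From HB Require Import structures.
From mathcomp Require Import all_boot all_order all_algebra.
From mathcomp Require Import all_classical all_reals all_analysis.
Set Implicit Arguments. Unset Strict Implicit. Unset Printing Implicit Defensive.
Import Order.TTheory GRing.Theory Num.Theory numFieldNormedType.Exports.
Local Open Scope classical_set_scope.
Local Open Scope ring_scope.

Section Defs.
Variable R : realType.

Definition Rn (n : nat) : Type := g_sigma_algebraType (@open 'rV[R]_n).

Definition enorm n (x : 'rV[R]_n) : R := Num.sqrt (\sum_(i < n) x ord0 i ^+ 2).

Definition box n (a b : 'rV[R]_n) : set (Rn n) :=
  [set x : Rn n | forall i, a ord0 i <= (x : 'rV[R]_n) ord0 i <= b ord0 i].
Definition vol n (a b : 'rV[R]_n) : R := \prod_(i < n) (b ord0 i - a ord0 i).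

Definition lebn n (A : set (Rn n)) : \bar R :=
  ereal_inf [set S : \bar R | exists (a b : nat -> 'rV[R]_n),
    [/\ (forall k i, a k ord0 i <= b k ord0 i),
        A `<=` \bigcup_k box (a k) (b k) &
        S = (\sum_(k <oo) (vol (a k) (b k))%:E)%E]].
Arguments lebn n A : clear implicits.

Definition Gamma (z : R) : R :=
  fine (\int[lebesgue_measure]_(t in [set t : R | (0 < t)%R])
          (powR t (z - 1) * expR (- t))%R%:E)%E.

Definition C0 (n : nat) : R :=
  Gamma (n.+1%:R / 2) * pi `^ (- (n.+1%:R / 2)).

Definition Pker n (t : R) (x : 'rV[R]_n) : R :=
  C0 n * t * (t ^+ 2 + enorm x ^+ 2) `^ (- (n.+1%:R / 2)).

Definition poissonI n (f : Rn n -> R) (x : 'rV[R]_n) (t : R) : R :=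
  fine (\int[lebn n]_y (f y * Pker t (x - (y : 'rV[R]_n)))%R%:E)%E.

Definition dtP n (f : Rn n -> R) (y : 'rV[R]_n) (t : R) : R :=
  derive1 (fun t' => poissonI f y t') t.

Definition Rsq n (s q : R) (f : Rn n -> R) (x : 'rV[R]_n) : \bar R :=
  poweR (\int[lebn n]_y
      ((powR (enorm (x - (y : 'rV[R]_n))) (- (n%:R + s * q)))%:E *
       poweR (\int[lebesgue_measure]_(t in [set t : R | (0 < t < 2 * enorm (x - (y : 'rV[R]_n)))%R])
          (`|dtP f y t| * powR t s)%:E) q)%E) q^-1.

End Defs.
Arguments lebn {R} n A.

(* Main.v *)
Require Import Defs.
From HB Require Import structures.
From mathcomp Require Import all_boot all_order all_algebra.
From mathcomp Require Import all_classical all_reals all_analysis.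
From mathcomp Require Import measurable_realfun.
From mathcomp Require Import ring lra.
Set Implicit Arguments. Unset Strict Implicit. Unset Printing Implicit Defensive.
Import Order.TTheory GRing.Theory Num.Theory numFieldNormedType.Exports.
Local Open Scope classical_set_scope.
Local Open Scope ring_scope.

(* Put Tf = int K_t(y - z) f(z) dz with K_t = d/dt P_t, up to the constant C0, and let Om be the
   open set where some centred average of |f|^p exceeds alpha^p; its measure is at most
   C alpha^-p int |f|^p.  On Om replace f by averages at the scale of the distance d to the
   complement, which gives g with |g| <= C alpha.

   Good part: TT* and Schur's test give int int t |Tg|^2 dt dy <= C int g^2; as t |Tg| <= C sup |g|,
   splitting g at height lambda and the layer cake formula improve this to
   int int t^(q-1) |Tg|^q dt dy <= C int |g|^q <= C alpha^(q-p) int |f|^p, and a Hardy inequality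
   bounds the q-th power of the operator by that double integral.

   Bad part: |T(f - g)(y,t)| is at most C (far + near), far being the integral of
   |f(z)| d(z) (t + d(z) + |y-z|)^-(n+2) over Om and near that of (|f| + C alpha) (t + |y-z|)^-(n+1)
   over the z in Om with |y-z| < 2 d(y).  As t far <= C alpha and int int far <= C int_Om |f|,
   the far part obeys the estimate of the good part.  For x outside Om only y in Om with
   d(y) <= |x-y| see the near part, and bounding it both by the maximal function divided by t and
   by alpha d^(n/p) t^(-n/p-1) gives int near t^s dt <= C d^s alpha^(1-p/q) M^(p/q), as in
   Hedberg's inequality; the L^p bound for the maximal function M concludes by Chebyshev. *)

(** Write N for the dimension. The size (t + |y-z|)^-(N+1) of K_t gives no orthogonality between
    scales: in Schur's test it leaves a divergent integral of dt'/t'. Smoothness is therefore used,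
    but only to order 1/2: the factor sqrt |z-y'| is absorbed by the second kernel, which stays
    integrable, and the order gained makes both ranges of t' converge.

    The value s = N (1/p - 1/q) is what lets the two bounds of the near part balance: splitting the
    t-integral where they agree yields exactly d^s alpha^(1-p/q) M^(p/q), whose q-th power is linear
    in M^p. For x inside Om this would fail, since |x-y|^-(N+sq) is not integrable across x = y;
    outside Om, |x-y| >= d(y), and the integral in x is of order d(y)^-(sq), which cancels d^(sq).

    Off Om one needs |f| <= C alpha almost everywhere. As any constant C will do, a pigeonhole
    argument on coverings by boxes takes the place of the differentiation theorem. In the same
    spirit neither the volume of a unit cube nor the integral of the Poisson kernel is computed:
    scaling alone is used. *)

Lemma natSinv_lt (R : realType) (r : R) :
  0 < r -> exists2 m : nat, 0 < m.+1%:R^-1 :> R & m.+1%:R^-1 < r.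
Proof.
move=> r0; have [m _ hm] := near_infty_natSinv_lt (PosNum r0).
by exists m; [rewrite invr_gt0|exact: hm m (leqnn _)].
Qed.

(** * [lebn] as an outer measure; open sets are Caratheodory measurable *)

Section lebn_outer.
Variables (R : realType) (n : nat).
Local Notation V := 'rV[R]_n.+1.
Local Notation Rn := (Rn R n.+1).

Lemma vol_ge0 (a b : V) : (forall i, a ord0 i <= b ord0 i) -> 0 <= vol a b.
Proof. by move=> ab; apply: prodr_ge0 => i _; rewrite subr_ge0. Qed.

Lemma lebn_ge0 (A : set Rn) : (0 <= lebn n.+1 A)%E.
Proof.
apply: le_ereal_inf_tmp => _ [a [b [ab _ ->]]]; apply: nneseries_ge0 => k _ _.
by rewrite lee_fin vol_ge0.
Qed.

Lemma lebn_le_cover (A : set Rn) (a b : nat -> V) :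
  (forall k i, a k ord0 i <= b k ord0 i) -> A `<=` \bigcup_k box (a k) (b k) ->
  (lebn n.+1 A <= \sum_(k <oo) (vol (a k) (b k))%:E)%E.
Proof. by move=> ab Aab; apply: ereal_inf_lbound; exists a, b. Qed.

(** The successor dimension matters: a degenerate box has a side of length 0, hence volume 0. In
    dimension 0 every box has volume 1, the empty product, and all covers have infinite total
    volume. *)
Lemma lebn_set0 : lebn n.+1 (set0 : set Rn) = 0%E.
Proof.
apply/eqP; rewrite eq_le lebn_ge0 andbT.
have -> : 0%E = (\sum_(k <oo) (vol (0 : V) (0 : V))%:E)%E :> \bar R.
  rewrite eseries0// => k _ _; congr EFin.
  by rewrite /vol big_ord_recl subrr mul0r.
exact: lebn_le_cover.
Qed.

Lemma le_lebn : {homo @lebn R n.+1 : A B / A `<=` B >-> (A <= B)%E}.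
Proof.
move=> A B AB; apply: le_ereal_inf_tmp => _ [a [b [ab Bab ->]]].
by apply: lebn_le_cover => //; exact: subset_trans Bab.
Qed.

(** If all measures are finite, covers of the [A m] with excess e / 2^(m+1) are merged into a single
    sequence of boxes through a bijection between nat and nat * nat. *)
Lemma lebn_sigma_subadditive : sigma_subadditive (@lebn R n.+1).
Proof.
move=> A; have [[i ioo]|] := pselect (exists i, lebn n.+1 (A i) = +oo%E).
  rewrite (eseries_pinfty _ _ ioo) ?leey// => k _.
  by rewrite -ltNye (lt_le_trans _ (lebn_ge0 _)).
rewrite -forallNE => Aoo.
suff add2e (e : {posnum R}) :
    (lebn n.+1 (\bigcup_n A n) <= \sum_(i <oo) lebn n.+1 (A i) + e%:num%:E)%E.
  by apply/lee_addgt0Pr => _/posnumP[].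
rewrite (le_trans _ (epsilon_trick _ _ _))//; last first.
  by move=> k; exact: lebn_ge0.
pose P m (c : (nat -> V) * (nat -> V)) :=
  [/\ (forall k i, c.1 k ord0 i <= c.2 k ord0 i),
      A m `<=` \bigcup_k box (c.1 k) (c.2 k) &
  (\sum_(k <oo) (vol (c.1 k) (c.2 k))%:E
    <= lebn n.+1 (A m) + (e%:num / (2 ^ m.+1)%:R)%:E)%E].
have [G PG] : {G : nat -> (nat -> V) * (nat -> V) & forall m, P m (G m)}.
  apply: (@choice _ _ P) => m; rewrite /P.
  have en1 : (0 < e%:num / (2 ^ m.+1)%:R)%R by [].
  have fA : lebn n.+1 (A m) \is a fin_num.
    by rewrite ge0_fin_numE ?lebn_ge0// ltey; apply/eqP; exact: Aoo.
  have [x [a [b [ab Aab xE]] xS]] := lb_ereal_inf_adherent en1 fA.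
  by exists (a, b); split => //=; rewrite -xE ltW.
pose W (ij : nat * nat) : \bar R := (vol ((G ij.1).1 ij.2) ((G ij.1).2 ij.2))%:E.
have W0 x : (0 <= W x)%E by case: (PG x.1) => h _ _; rewrite lee_fin vol_ge0.
apply: (@le_trans _ _ (\esum_(i in setT) W i)%E).
  have /card_esym/ppcard_eqP[f] := card_nat2.
  apply: (@le_trans _ _ (\sum_(k <oo) W (f k))%E).
    apply: lebn_le_cover => [k i|t [i _]]; first by case: (PG (f k).1).
    have [_ /(_ t) h _] := PG i; move=> /h[j _ Bt].
    by exists (f^-1%FUN (i, j)) => //=; rewrite invK ?inE.
  rewrite -(esum_pred_image W f xpredT) ?[fun=> _]set_true//.
  by rewrite image_eq.
rewrite (_ : (\esum_(i in _) W i)%E = (\sum_(i <oo) \sum_(j <oo) W (i, j))%E); last first.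
  pose J : nat -> set (nat * nat) := fun i => [set (i, j) | j in setT].
  rewrite (_ : setT = \bigcup_k J k); last first.
    by rewrite predeqE => -[a b]; split => // _; exists a => //; exists b.
  rewrite esum_bigcupT /=; last 2 first.
    - apply/trivIsetP => i j _ _ ij.
      rewrite predeqE => -[k m] /=; split => //= -[] [_] _ [<-{k} _].
      by move=> [m' _] [] /esym/eqP; rewrite (negbTE ij).
    - by move=> /= [k m]; exact: W0.
  rewrite -(image_id [set: nat]) -fun_true esum_pred_image//; last first.
    by move=> k _; exact: esum_ge0.
  apply: eq_eseriesr => /= j _.
  rewrite -(esum_pred_image W (pair j) predT)//=; last first.
    by move=> ? ? _ _; exact: (@can_inj _ _ _ snd).
  by congr esum; rewrite predeqE => -[a b]; split; move=> [i _ <-]; exists i.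
by apply: lee_nneseries => [i _ _|i _]; [exact: nneseries_ge0|case: (PG i)].
Qed.

HB.instance Definition _ := isOuterMeasure.Build R Rn (@lebn R n.+1)
  lebn_set0 lebn_ge0 le_lebn lebn_sigma_subadditive.

Local Notation mu := (@lebn R n.+1 : {outer_measure set Rn -> \bar R}).

(* A box cut by a hyperplane is the union of two boxes of the same total volume. *)
Lemma caratheodory_halfspace (i : 'I_n.+1) (c : R) :
  mu.-caratheodory [set x : Rn | (x : V) ord0 i <= c].
Proof.
apply: le_caratheodory_measurable => X /=.
apply: le_ereal_inf_tmp => _ [a [b [ab Xab ->]]].
(* The cut height is clamped to the side of the box, so both pieces keep ordered corners when the
   hyperplane misses the box; one of them then has volume 0. *)
pose b1 k : V := \row_j if j == i then Num.max (a k ord0 i) (Num.min (b k ord0 i) c) else b k ord0 j.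
pose a1 k : V := \row_j if j == i then Num.min (b k ord0 i) (Num.max (a k ord0 i) c) else a k ord0 j.
have ab1 k j : a k ord0 j <= b1 k ord0 j.
  by rewrite mxE; case: eqP => [->|_]; rewrite ?le_max ?lexx ?ab.
have a1b k j : a1 k ord0 j <= b k ord0 j.
  by rewrite mxE; case: eqP => [->|_]; rewrite ?ge_min ?lexx ?ab.
have volE k : vol (a k) (b k) = vol (a k) (b1 k) + vol (a1 k) (b k).
  rewrite /vol (bigD1 i)//= [X in _ = X + _](bigD1 i)//= [X in _ = _ + X](bigD1 i)//=.
  rewrite [X in _ = _ * X + _](eq_bigr (fun j => b k ord0 j - a k ord0 j)); last first.
    by move=> j /negbTE ji; rewrite mxE ji.
  rewrite [X in _ = _ + _ * X](eq_bigr (fun j => b k ord0 j - a k ord0 j)); last first.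
    by move=> j /negbTE ji; rewrite mxE ji.
  rewrite -mulrDl !mxE eqxx; congr (_ * _).
  by have := ab k i; rewrite /Num.max /Num.min; repeat case: ifPn; lra.
rewrite (eq_eseriesr (g := fun k => ((vol (a k) (b1 k))%:E + (vol (a1 k) (b k))%:E)%E)); last first.
  by move=> k _; rewrite -EFinD volE.
rewrite nneseriesD; try by move=> k _ _; rewrite lee_fin vol_ge0.
apply: leeD; apply: lebn_le_cover => //.
  move=> x [/Xab[k _ xk] /= xc]; exists k => // j; have /andP[h1 h2] := xk j.
  rewrite h1 mxE; case: eqP => [ji|//]; subst j.
  by rewrite le_max le_min h2 xc orbT.
move=> x [/Xab[k _ xk] /= /negP]; rewrite -ltNge => xc.
exists k => // j; have /andP[h1 h2] := xk j.
rewrite h2 andbT mxE; case: eqP => [ji|//]; subst j.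
by rewrite ge_min ge_max h1 (ltW xc) orbT.
Qed.

(** The norm of a row vector is the largest absolute value of its entries, so [dst] is the sup
    distance and [dball] an open cube. All geometry is done with cubes; the Euclidean norm survives
    only inside the Poisson kernel and in [Rsq]. *)
Definition dst (y z : V) : R := `|y - z|.
Definition dball (y : V) (r : R) : set Rn := [set z | dst y z < r].

Lemma dst_ge0 y z : 0 <= dst y z. Proof. exact: normr_ge0. Qed.
Lemma dstC y z : dst y z = dst z y. Proof. exact: distrC. Qed.
Lemma dst_triangle x y z : dst y z <= dst y x + dst x z.
Proof. exact: ler_distD. Qed.
Lemma dstxx x : dst x x = 0. Proof. by rewrite /dst subrr normr0. Qed.

Lemma dst_coord (y z : V) i : `|y ord0 i - z ord0 i| <= dst y z.
Proof.
rewrite /dst /Num.norm/= mx_normrE.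
have := le_bigmax_cond 0 (fun ij : 'I_1 * 'I_n.+1 => `|(y - z) ij.1 ij.2|) (j := (ord0, i)) (P := xpredT).
by rewrite /= !mxE; exact.
Qed.

Lemma dst_ltP (y z : V) r : reflect (0 < r /\ forall i, `|y ord0 i - z ord0 i| < r) (dst y z < r).
Proof.
apply: (iffP idP) => [h|[r0 h]].
  split; first exact: le_lt_trans (dst_ge0 y z) h.
  by move=> i; apply: le_lt_trans (dst_coord _ _ _) h.
rewrite /dst /Num.norm/= mx_normrE; apply: bigmax_lt => // -[j i] _ /=.
by rewrite (ord1 j) !mxE.
Qed.

Lemma dst_leP (y z : V) r : reflect (0 <= r /\ forall i, `|y ord0 i - z ord0 i| <= r) (dst y z <= r).
Proof.
apply: (iffP idP) => [h|[r0 h]].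
  split; first exact: le_trans (dst_ge0 y z) h.
  by move=> i; apply: le_trans (dst_coord _ _ _) h.
rewrite /dst /Num.norm/= mx_normrE; apply: bigmax_le => // -[j i] _ /=.
by rewrite (ord1 j) !mxE.
Qed.

Lemma open_dstP (U : set V) : open U <->
  forall x, U x -> exists2 r, 0 < r & forall z, dst x z < r -> U z.
Proof.
rewrite openE; split=> h x /h.
  by rewrite /interior => /nbhs_normP[r /= r0 hr]; exists r => // z; exact: hr.
by move=> [r r0 hr]; apply/(@nbhs_normP R V); exists r => //= z; exact: hr.
Qed.

Lemma dst_rat (x : V) (e : R) : 0 < e -> exists q : 'rV[rat]_n.+1, dst x (map_mx ratr q) < e.
Proof.
move=> e0; have h i : exists q : rat, `|x ord0 i - ratr q| < e.
  have [q] := @rat_in_itvoo R (x ord0 i - e) (x ord0 i + e) ltac:(lra).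
  by rewrite in_itv/= => /andP[? ?]; exists q; rewrite ltr_norml; lra.
have [g Pg] := choice h; exists (\row_i g i); apply/dst_ltP; split => // i.
by rewrite !mxE.
Qed.

(** A countable base of the topology, through which open sets become countable unions of measurable
    cubes. *)
Definition qball (qm : 'rV[rat]_n.+1 * nat) : set Rn := dball (map_mx ratr qm.1) qm.2.+1%:R^-1.

Lemma open_qballE (U : set V) : open U -> U = \bigcup_(qm in [set qm | qball qm `<=` U]) qball qm.
Proof.
move=> /open_dstP oU; apply/seteqP; split => [x /oU[r r0 hr]|x [qm /= h /h]//].
have [m m0 hm] := natSinv_lt (divr_gt0 r0 (ltr0Sn R 1)).
have [q hq] := dst_rat x m0.
exists (q, m) => /=; last by rewrite /qball/dball/= dstC.
move=> z; rewrite /qball/dball/= => hz; apply: hr.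
apply: le_lt_trans (dst_triangle (map_mx ratr q) x z) _.
rewrite (splitr r); apply: ltrD; [exact: lt_trans hq hm|exact: lt_trans hz hm].
Qed.

(** Only half-spaces with a non-strict upper bound are available. The strict lower bounds of a cube
    are complements of such half-spaces, the strict upper bounds countable unions of them with gaps
    1/(k+1). *)
Lemma dball_caratheodory y r : mu.-caratheodory (dball y r).
Proof.
suff : mu.-cara.-measurable (dball y r) by [].
have [r0|r0] := leP r 0.
  rewrite (_ : dball y r = set0); first exact: measurable0.
  by rewrite -subset0 => z; rewrite /dball/= => h; have := dst_ge0 y z; lra.
have -> : dball y r = \bigcap_(i in [set: 'I_n.+1])
   (~` [set z : Rn | (z : V) ord0 i <= y ord0 i - r] `&`
     ~` ~` \bigcup_k [set z : Rn | (z : V) ord0 i <= y ord0 i + r - k.+1%:R^-1]).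
  apply/seteqP; split => z.
    move=> /dst_ltP[_ h] i _; have := h i; rewrite ltr_norml => /andP[h1 h2].
    split; first by apply/negP; rewrite -ltNge; lra.
    rewrite setCK.
    have h0 : 0 < y ord0 i + r - (z : V) ord0 i by lra.
    have [m _ hm] := natSinv_lt h0.
    by exists m => //=; move: hm; set e := m.+1%:R^-1; lra.
  move=> h; apply/dst_ltP; split => // i; have [] := h i Logic.I.
  move=> /negP; rewrite -ltNge => h1; rewrite setCK => -[k _ /= h2].
  have m0 : 0 < k.+1%:R^-1 :> R by rewrite invr_gt0.
  by rewrite ltr_norml; move: m0 h2; set e := k.+1%:R^-1; lra.
apply: fin_bigcap_measurable => [|i _]; first exact: finite_finset.
apply: measurableI; first by apply: measurableC; exact: caratheodory_halfspace.
rewrite setCK; apply: bigcup_measurable => k _; exact: caratheodory_halfspace.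
Qed.

Lemma measurable_caratheodory (A : set Rn) : measurable A -> mu.-caratheodory A.
Proof.
rewrite /measurable/=; apply: smallest_sub.
  exact: (sigma_algebra_measurable (caratheodory_type mu)).
move=> U oU; suff : mu.-cara.-measurable (U : set Rn) by [].
rewrite (open_qballE oU) bigcup_mkcond.
apply: countable_bigcupT_measurable; first exact: countableP.
move=> qm; case: ifP => _; first exact: dball_caratheodory.
exact: measurable0.
Qed.

Lemma lebn_semi_sigma_additive : semi_sigma_additive (@lebn R n.+1).
Proof.
move=> A mA tA mU.
apply: (@caratheodory_measure_sigma_additive R V mu A) => //.
- by move=> i; exact: measurable_caratheodory.
- exact: measurable_caratheodory.
Qed.

HB.instance Definition _ := isMeasure.Build _ Rn R (@lebn R n.+1)
  lebn_set0 lebn_ge0 lebn_semi_sigma_additive.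

End lebn_outer.

(** * Monotonicity and Tonelli's theorem for nonnegative integrands *)

Section nonneg_integral.
Context d (T : measurableType d) (R : realType).
Implicit Types (mu : {measure set T -> \bar R}) (D : set T).
Local Open Scope ereal_scope.

(** The integral of a nonnegative function is a supremum over the simple functions below it, hence
    monotone for arbitrary functions on arbitrary domains. Most comparisons of integrals below go
    through this lemma and need no measurability proof. *)
Lemma ge0_le_integral_any mu D (f g : T -> \bar R) :
  (forall x, D x -> 0 <= f x) -> (forall x, D x -> f x <= g x) ->
  \int[mu]_(x in D) f x <= \int[mu]_(x in D) g x.
Proof.
move=> f0 fg.
have g0 x : D x -> 0 <= g x by move=> Dx; exact: le_trans (f0 _ Dx) (fg _ Dx).
have h0 (h : T -> \bar R) : (forall x, D x -> 0 <= h x) -> forall x, 0 <= (h \_ D) x.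
  by move=> hp x; rewrite patchE; case: ifPn => // /set_mem; exact: hp.
rewrite integral_mkcond [leRHS]integral_mkcond !ge0_integralTE//; try exact: h0.
apply: ereal_sup_le => _ [h /= hf <-]; exists h => // x.
apply: le_trans (hf x) _; rewrite !patchE; case: ifPn => // /set_mem; exact: fg.
Qed.

Lemma ge0_subset_integral_any mu D E (f : T -> \bar R) : D `<=` E ->
  (forall x, E x -> 0 <= f x) ->
  \int[mu]_(x in D) f x <= \int[mu]_(x in E) f x.
Proof.
move=> DE f0; rewrite integral_mkcond [leRHS]integral_mkcond.
apply: ge0_le_integral_any => x _; rewrite !patchE.
  by case: ifPn => // /set_mem/DE; exact: f0.
case: ifPn => [/set_mem/DE/mem_set ->//|_].
by case: ifPn => // /set_mem; exact: f0.
Qed.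

Lemma integral_if mu D (P : T -> bool) (f : T -> \bar R) :
  \int[mu]_(x in D) (if P x then f x else 0) = \int[mu]_(x in D `&` [set x | P x]) f x.
Proof.
rewrite integral_mkcondr; apply: eq_integral => x _; rewrite patchE.
by case: ifPn => Px; [rewrite mem_set|rewrite memNset//; exact/negP].
Qed.

End nonneg_integral.

Lemma tonelli_dom d1 d2 (T1 : measurableType d1) (T2 : measurableType d2) (R : realType)
  (m1 : {sigma_finite_measure set T1 -> \bar R}) (m2 : {sigma_finite_measure set T2 -> \bar R})
  (D1 : set T1) (D2 : set T2) (F : T1 -> T2 -> \bar R) :
  measurable D1 -> measurable D2 ->
  measurable_fun [set: T1 * T2] (fun z => F z.1 z.2) ->
  (forall x y, (0 <= F x y)%E) ->
  (\int[m1]_(x in D1) \int[m2]_(y in D2) F x y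
   = \int[m2]_(y in D2) \int[m1]_(x in D1) F x y)%E.
Proof.
move=> mD1 mD2 mF F0.
pose G (z : T1 * T2) := ((fun z => F z.1 z.2) \_ (D1 `*` D2)) z.
have mG : measurable_fun setT G.
  by apply/(measurable_restrictT _ (measurableX mD1 mD2)); exact: measurable_funTS.
have G0 z : (0 <= G z)%E by rewrite /G patchE; case: ifP.
have /= H := fubini_tonelli (m1 := m1) (m2 := m2) G mG G0.
have E1 : (\int[m1]_(x in D1) \int[m2]_(y in D2) F x y = \int[m1]_x \int[m2]_y G (x, y))%E.
  rewrite integral_mkcond; apply: eq_integral => x _; rewrite patchE.
  case: ifPn => Dx.
    rewrite integral_mkcond; apply: eq_integral => y _; rewrite /G !patchE.
    by rewrite in_setX Dx.
  rewrite integral0_eq// => y _; rewrite /G patchE in_setX.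
  by rewrite (negbTE Dx).
have E2 : (\int[m2]_(y in D2) \int[m1]_(x in D1) F x y = \int[m2]_y \int[m1]_x G (x, y))%E.
  rewrite integral_mkcond; apply: eq_integral => x _; rewrite patchE.
  case: ifPn => Dx.
    rewrite integral_mkcond; apply: eq_integral => y _; rewrite /G !patchE.
    by rewrite in_setX Dx andbT.
  rewrite integral0_eq// => y _; rewrite /G patchE in_setX.
  by rewrite (negbTE Dx) andbF.
by rewrite E1 E2.
Qed.

(** * Integrals of powers near 0 and at infinity *)

Section powR_integrals.
Variable R : realType.
Implicit Types a t r x y : R.
Local Notation leb := (@lebesgue_measure R).

Lemma powRD_gt0 x a b : 0 < x -> x `^ (a + b) = x `^ a * x `^ b.
Proof. by move=> x0; rewrite powRD// (gt_eqF x0) implybT. Qed.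

Lemma ler_powRN x y a : 0 <= a -> 0 < x -> x <= y -> y `^ (- a) <= x `^ (- a).
Proof.
move=> a0 x0 xy; have y0 := lt_le_trans x0 xy.
rewrite !powRN lef_pV2 ?posrE ?powR_gt0//.
by apply: ge0_ler_powR; rewrite ?nnegrE; lra.
Qed.

Lemma is_derive_shift_powR t a x : 0 < t + x ->
  is_derive x 1 (fun r => (t + r) `^ a) (a * (t + x) `^ (a - 1)).
Proof.
move=> tx.
have H1 : is_derive x 1 (fun r : R => t + r) 1 by rewrite -[X in is_derive _ _ _ X]add0r; exact: (is_deriveD (is_derive_cst t x 1) (is_derive_id x 1)).
have := is_derive1_comp (f := fun x => x `^ a) (is_derive1_powR a tx) H1.
by rewrite mulr1.
Qed.

Lemma continuous_shift_powR t a x : 0 < t + x -> {for x, continuous (fun r => (t + r) `^ a)}.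
Proof.
move=> tx; apply: differentiable_continuous; apply/derivable1_diffP.
by have [] := is_derive_shift_powR a tx.
Qed.

Lemma powRN_cvg0 t a : 0 < a -> (t + r) `^ (- a) @[r --> +oo] --> (0 : R).
Proof.
move=> a0; apply/cvgrPdist_lt => e e0.
near=> r; rewrite sub0r normrN ger0_norm ?powR_ge0//.
have tr : e `^ (- a^-1) < t + r.
  by rewrite -ltrBlDl; near: r; exact: nbhs_pinfty_gt (num_real _).
have e1 : 0 < e `^ (- a^-1) by rewrite powR_gt0.
rewrite [ltRHS](_ : e = (e `^ (- a^-1)) `^ (- a)); last first.
  by rewrite -powRrM mulrNN mulVf ?gt_eqF// powRr1// ltW.
have tr0 := lt_trans e1 tr.
rewrite (powRN (t + r)) (powRN (e `^ _)) ltf_pV2 ?posrE ?powR_gt0//.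
by apply: gt0_ltr_powR => //; rewrite nnegrE ltW.
Unshelve. all: end_near. Qed.

Lemma integral_shift_powR t a r : 0 < a -> 0 < t + r ->
  (\int[leb]_(x in `]r, +oo[) ((t + x) `^ (- a - 1))%:E = (a^-1 * (t + r) `^ (- a))%:E)%E.
Proof.
move=> a0 tr.
have mf D : measurable_fun D (fun x : R => ((t + x) `^ (- a - 1))%:E).
  apply/measurable_EFinP; apply: measurable_funTS.
  apply: (measurableT_comp (measurable_powR _)).
  exact: measurable_funD.
rewrite integral_itv_obnd_cbnd//.
have der x : r < x -> is_derive x 1 (fun x => - (a^-1 * (t + x) `^ (- a))) ((t + x) `^ (- a - 1)).
  move=> rx; have tx : 0 < t + x by lra.
  have H := is_derive_shift_powR (- a) tx.
  have -> : (fun x => - (a^-1 * (t + x) `^ (- a))) = (- a^-1) \*: (fun x => (t + x) `^ (- a)).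
    by apply/funext => z; rewrite /= /GRing.scale/= mulNr.
  apply: is_derive_eq; rewrite /GRing.scale/= mulrA mulrNN mulVf ?gt_eqF// mul1r//.
rewrite (@ge0_continuous_FTC2y R _ (fun x => - (a^-1 * (t + x) `^ (- a))) r 0) //.
- by rewrite sub0e -EFinN opprK.
- by move=> x _; exact: powR_ge0.
- apply: continuous_in_subspaceT => x; rewrite inE/= in_itv/= andbT => rx.
  by apply: continuous_shift_powR; lra.
- rewrite -oppr0; apply: cvgN; rewrite -(mulr0 a^-1); apply: cvgM; first exact: cvg_cst.
  exact: powRN_cvg0.
- by move=> x /der[].
- apply: cvg_at_right_filter; apply: cvgN; apply: cvgM; first exact: cvg_cst.
  exact: continuous_shift_powR.
- move=> x; rewrite in_itv/= andbT => /der rx; rewrite derive1E.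
  by rewrite derive_val.
Qed.

(** For a < 1 the integrand blows up at 0. The fundamental theorem of calculus is applied on compact
    intervals away from 0, where discarding the lower boundary term gives a uniform bound, and
    monotone convergence extends it to ]0, r[. *)
Lemma integral_powR_lt a r : 0 < a -> 0 < r ->
  (\int[leb]_(x in `]0%R, r[) (x `^ (a - 1))%:E <= (a^-1 * r `^ a)%:E)%E.
Proof.
move=> a0 r0.
have mf D : measurable_fun D (fun x : R => (x `^ (a - 1))%:E).
  by apply/measurable_EFinP; apply: measurable_funTS; exact: measurable_powR.
(* The shift [k.+2] makes the left end strictly smaller than r already for k = 0. *)
pose F (k : nat) : set (measurableTypeR R) := `[r * k.+2%:R^-1, r]%classic.
have F0 k : 0 < r * k.+2%:R^-1 by rewrite mulr_gt0.
have Fr k : r * k.+2%:R^-1 < r.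
  by rewrite -[ltRHS]mulr1 ltr_pM2l// invf_lt1// ltr1n.
have bound k : (\int[leb]_(x in F k) (x `^ (a - 1))%:E <= (a^-1 * r `^ a)%:E)%E.
  have der x : 0 < x -> is_derive x 1 (fun x => a^-1 * x `^ a) (x `^ (a - 1)).
    move=> x0; have H := is_derive1_powR a x0.
    rewrite [X in is_derive _ _ _ X](_ : _ = a^-1 *: (a * x `^ (a - 1))); last first.
      by rewrite /GRing.scale/= mulrA mulVf ?gt_eqF// mul1r.
    exact: (is_deriveZ a^-1 H).
  have cont x b : 0 < x -> {for x, continuous (fun x : R => x `^ b)}.
    move=> x0; apply: differentiable_continuous; apply/derivable1_diffP.
    by have [] := is_derive1_powR b x0.
  rewrite (@continuous_FTC2 R _ (fun x => a^-1 * x `^ a) _ _ (Fr k)).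
  - by rewrite -EFinB lee_fin gerBl mulr_ge0 ?powR_ge0// invr_ge0 ltW.
  - apply: continuous_in_subspaceT => x; rewrite inE/= in_itv/= => /andP[x1 _].
    by apply: cont; apply: lt_le_trans x1.
  - split.
    + move=> x; rewrite in_itv/= => /andP[x1 _].
      by have [] := der x (lt_trans (F0 k) x1).
    + apply: cvg_at_right_filter; apply: cvgM; first exact: cvg_cst.
      exact: cont.
    + apply: cvg_at_left_filter; apply: cvgM; first exact: cvg_cst.
      exact: cont.
  - move=> x; rewrite in_itv/= => /andP[x1 _]; rewrite derive1E.
    have := der x (lt_trans (F0 k) x1) => H.
    by rewrite derive_val.
have sub : `](0 : R), r[%classic `<=` \bigcup_k F k.
  move=> x /=; rewrite in_itv/= => /andP[x0 xr].
  have [m _ hm] := natSinv_lt (divr_gt0 x0 r0).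
  exists m => //; rewrite /F/= in_itv/= (ltW xr) andbT -ler_pdivlMl// mulrC.
  apply: le_trans (ltW hm); rewrite lef_pV2 ?posrE// ler_nat//.
apply: (@le_trans _ _ (\int[leb]_(x in \bigcup_k F k) (x `^ (a - 1))%:E)%E).
  by apply: ge0_subset_integral_any => // x _; rewrite lee_fin powR_ge0.
have cv := @ge0_nondecreasing_set_cvg_integral _ (measurableTypeR R) R F (fun x => (x `^ (a - 1))%:E) leb.
have ndF i j : (i <= j)%N -> F i `<=` F j.
  move=> ij x; rewrite /F/= !in_itv/= => /andP[x1 ->]; rewrite andbT.
  by apply: le_trans x1; rewrite ler_pM2l// lef_pV2 ?posrE// ler_nat.
have {}cv : (\int[leb]_(x in F i) (x `^ (a - 1))%:E)%E @[i --> \oo] -->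
    (\int[leb]_(x in \bigcup_i F i) (x `^ (a - 1))%:E)%E.
  apply: cv => [i j ij|i|i|i x _].
  - by apply/subsetPset; exact: ndF.
  - exact: measurable_itv.
  - exact: mf.
  - by rewrite lee_fin powR_ge0.
rewrite -(cvg_lim _ cv)//; apply: lime_le; last by apply: nearW => k; exact: bound.
apply: ereal_nondecreasing_is_cvgn => i j ij.
apply: ge0_subset_integral_any => [|x _]; last by rewrite lee_fin powR_ge0.
exact: ndF.
Qed.

End powR_integrals.

(** * Cubes, dilations and radial integrals under [lebn] *)

Section lebn_ball.
Variables (R : realType) (n : nat).
Local Notation V := 'rV[R]_n.+1.
Local Notation Rn := (Rn R n.+1).
Local Notation mu := (@lebn R n.+1).

Lemma measurable_open (U : set V) : open U -> measurable (U : set Rn).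
Proof. exact: sub_gen_smallest. Qed.

Lemma open_dball (y : V) r : open (dball y r : set V).
Proof.
apply/open_dstP => x; rewrite /dball/= => xr; exists (r - dst y x); first by rewrite subr_gt0.
by move=> z zx; apply: le_lt_trans (dst_triangle x _ _) _; rewrite -ltrBrDl.
Qed.

Lemma measurable_dball (y : V) r : measurable (dball y r).
Proof. by apply: measurable_open; exact: open_dball. Qed.

Lemma measurable_coord (i : 'I_n.+1) : measurable_fun [set: Rn] (fun x : Rn => (x : V) ord0 i).
Proof.
apply: (measurability _ (RGenOInfty.measurableE R)) => _ [_ [c ->] <-].
rewrite setTI; apply: measurable_open; apply/open_dstP => x /=.
rewrite in_itv/= andbT => cx; exists (x ord0 i - c); first by rewrite subr_gt0.
move=> z xz; rewrite in_itv/= andbT.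
by have := le_lt_trans (dst_coord x z i) xz; rewrite ltr_norml; lra.
Qed.

Lemma measurable_fun_dst d (T : measurableType d) (f g : T -> Rn) :
  measurable_fun setT f -> measurable_fun setT g ->
  measurable_fun setT (fun x => dst (f x) (g x)).
Proof.
move=> mf mg; apply: (measurability _ (RGenOInfty.measurableE R)) => _ [_ [c ->] <-].
rewrite setTI; have [c0|c0] := ltP c 0.
  rewrite (_ : _ @^-1` _ = setT); first exact: measurableT.
  by apply/seteqP; split => // x _ /=; rewrite in_itv/= andbT (lt_le_trans c0 (dst_ge0 _ _)).
rewrite (_ : _ @^-1` _ =
    \bigcup_i [set x | c < `|(f x : V) ord0 i - (g x : V) ord0 i|]); last first.
  apply/seteqP; split => x /=; rewrite in_itv/= andbT.
    move=> h; apply: contrapT => /forall2NP H; suff : dst (f x) (g x) <= c by lra.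
    apply/dst_leP; split => // i; case: (H i) => [/(_ Logic.I)//|/= /negP].
    by rewrite -leNgt.
  by move=> [i _ /= h]; apply: lt_le_trans h (dst_coord _ _ _).
apply: countable_bigcupT_measurable; first exact: countableP.
move=> i; rewrite -[X in measurable X]setTI.
have mh : measurable_fun [set: T] (fun x => `|(f x : V) ord0 i - (g x : V) ord0 i|).
  apply: measurableT_comp => //; apply: measurable_funB.
    exact: (measurableT_comp (measurable_coord i)).
  exact: (measurableT_comp (measurable_coord i)).
have := mh measurableT `]c, +oo[%classic (measurable_itv _).
by congr measurable; apply/seteqP; split => x /=; rewrite in_itv/= andbT.
Qed.

Lemma box_dball (x y : V) r : 0 < r -> dball y r x -> box (y - const_mx r) (y + const_mx r) x.
Proof.
move=> r0 /dst_ltP[_ h] i; rewrite !mxE; have := h i; rewrite ltr_norml => /andP[? ?].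
by apply/andP; split; lra.
Qed.

Lemma lebn_box_le (a b : V) : (forall i, a ord0 i <= b ord0 i) ->
  (mu (box a b) <= (vol a b)%:E)%E.
Proof.
move=> ab.
pose A (k : nat) : V := if k is 0 then a else 0.
pose B (k : nat) : V := if k is 0 then b else 0.
have AB k i : A k ord0 i <= B k ord0 i by case: k => //=; rewrite lexx.
apply: le_trans (lebn_le_cover AB _) _; first by move=> x xab; exists 0%N.
rewrite nneseries_recl//; last by move=> k _; rewrite lee_fin vol_ge0.
rewrite eseries0 ?adde0// => k k0 _; case: k k0 => //= k _; congr EFin.
by rewrite /vol big_ord_recl subrr mul0r.
Qed.

Lemma lebn_dball_le (y : V) r : 0 < r -> (mu (dball y r) <= ((2 * r) ^+ n.+1)%:E)%E.
Proof.
move=> r0.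
have ab i : (y - const_mx r) ord0 i <= (y + const_mx r) ord0 i by rewrite !mxE; lra.
apply: (@le_trans _ _ (mu (box (y - const_mx r) (y + const_mx r)))).
  by apply: le_lebn => x; exact: box_dball.
apply: le_trans (lebn_box_le ab) _; rewrite lee_fin /vol.
rewrite (eq_bigr (fun=> 2 * r)); last by move=> i _; rewrite !mxE; ring.
by rewrite prodr_const card_ord.
Qed.

Lemma lebn_sigma_finite : sigma_finite [set: Rn] mu.
Proof.
exists (fun k => dball 0 k.+1%:R).
  apply/seteqP; split => // x _; exists (Num.truncn (dst 0 x)) => //=.
  by rewrite /dball/= truncnS_gt.
move=> k; split; first exact: measurable_dball.
by apply: le_lt_trans (lebn_dball_le _ _) _; rewrite ?ltry.
Qed.

HB.instance Definition _ := Measure_isSigmaFinite.Build _ Rn R mu lebn_sigma_finite.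

Definition aff (u : V) (l : R) (x : Rn) : Rn := u + l *: (x : V).

Lemma lebn_aff_le u l (A : set Rn) : 0 < l ->
  ((l ^+ n.+1)%:E * mu (aff u l @^-1` A) <= mu A)%E.
Proof.
move=> l0; apply: le_ereal_inf_tmp => _ [a [b [ab Aab ->]]].
pose a' k : V := l^-1 *: (a k - u).
pose b' k : V := l^-1 *: (b k - u).
have ab' k i : a' k ord0 i <= b' k ord0 i.
  by rewrite !mxE ler_pM2l ?invr_gt0// lerB.
have ln0 : 0 < l ^+ n.+1 by rewrite exprn_gt0.
rewrite muleC -lee_pdivlMr//.
apply: le_trans (lebn_le_cover ab' _) _.
  move=> x /Aab[k _ xk]; exists k => // i; have := xk i; rewrite !mxE.
  rewrite ler_pdivrMl// ler_pdivlMl//; lra.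
rewrite muleC -nneseriesZl; last by move=> k _; rewrite lee_fin vol_ge0.
apply: lee_nneseries => [k _ _|k _]; first by rewrite lee_fin vol_ge0.
rewrite -EFinM lee_fin /vol -exprVn.
rewrite (_ : l^-1 ^+ n.+1 = \prod_(i < n.+1) l^-1); last by rewrite prodr_const card_ord.
rewrite -big_split/=; apply: ler_prod => i _; rewrite !mxE.
have il : 0 < l^-1 by rewrite invr_gt0.
rewrite -mulrBr mulr_ge0 ?(ltW il)//=; last by have := ab k i; lra.
by rewrite ler_pM2l//; lra.
Qed.

(** Dilating a cover gives one inequality; the other is the same inequality for the inverse affine
    map, applied to the preimage. *)
Lemma lebn_aff u l (A : set Rn) : 0 < l ->
  mu (aff u l @^-1` A) = ((l ^- n.+1)%:E * mu A)%E.
Proof.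
move=> l0; have il : 0 < l^-1 by rewrite invr_gt0.
have ln0 : 0 < l ^+ n.+1 by rewrite exprn_gt0.
apply/eqP; rewrite eq_le; apply/andP; split.
  by rewrite muleC lee_pdivlMr// muleC; exact: lebn_aff_le.
have := @lebn_aff_le (- (l^-1 *: u)) l^-1 (aff u l @^-1` A) il.
rewrite exprVn; congr (_ * mu _ <= _)%E; apply/seteqP; split => x /=;
  by rewrite /aff scalerDr scalerN !scalerA mulfV ?gt_eqF// !scale1r addrA subrr add0r.
Qed.

Lemma measurable_aff u l : 0 < l -> measurable_fun setT (aff u l).
Proof.
move=> l0; apply: (@measurability _ _ Rn Rn setT (aff u l) (@open V)) => //= _ [U oU <-]; rewrite setTI.
apply: measurable_open; move/open_dstP : oU => oU; apply/open_dstP => x /= Ux.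
have [r r0 h] := oU _ Ux; exists (r / l); first by rewrite divr_gt0.
move=> z xz; apply: h; rewrite /dst /aff opprD addrACA subrr add0r -scalerBr normrZ.
by rewrite gtr0_norm// -ltr_pdivlMl// mulrC.
Qed.

Lemma ge0_integral_aff u l (f : Rn -> \bar R) : 0 < l -> measurable_fun setT f ->
  (forall x, 0 <= f x)%E ->
  (\int[mu]_x f (aff u l x) = (l ^- n.+1)%:E * \int[mu]_x f x)%E.
Proof.
move=> l0 mf f0; have ln0 : 0 <= l ^- n.+1 by rewrite invr_ge0 exprn_ge0// ltW.
rewrite -(ge0_integral_mscale mu measurableT (NngNum ln0))//.
rewrite -[LHS](@ge0_integral_pushforward _ _ _ _ R _ (measurable_aff u l0) mu setT f)//.
apply: eq_measure_integral => [|mphi A mA _].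
  exact: measurable_aff.
by rewrite /mscale /pushforward /=; exact: lebn_aff.
Qed.

(** The measure of the unit cube, left unevaluated: dilations express the measure of every cube
    through it. The cases [cball = 0] and [0 < cball] are separated only in the final theorem. *)
Definition cball : R := fine (mu (dball 0 1)).

Lemma lebn_dball (y : V) r : 0 < r -> mu (dball y r) = (cball * r ^+ n.+1)%:E.
Proof.
move=> r0; have ir : 0 < r^-1 by rewrite invr_gt0.
have -> : dball y r = aff (- (r^-1 *: y)) r^-1 @^-1` dball 0 1.
  apply/seteqP; split => x; rewrite /dball /aff /dst /= sub0r opprD opprK -scalerBr normrZ;
    by rewrite gtr0_norm// ltr_pdivrMl// mulr1.
rewrite lebn_aff// exprVn invrK mulrC EFinM; congr (_ * _)%E.
rewrite /cball fineK// ge0_fin_numE ?lebn_ge0//.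
by apply: le_lt_trans (lebn_dball_le _ _) _; rewrite ?ltry.
Qed.

Lemma cball_ge0 : 0 <= cball. Proof. exact: fine_ge0 (lebn_ge0 _). Qed.

Lemma lebn_cball0 (A : set Rn) : cball = 0 -> mu A = 0%E.
Proof.
move=> c0; apply/eqP; rewrite eq_le lebn_ge0 andbT.
apply: (@le_trans _ _ (mu (\bigcup_k dball 0 k.+1%:R))).
  apply: le_lebn => x _; exists (Num.truncn (dst 0 x)) => //=.
  by rewrite /dball/= truncnS_gt.
apply: le_trans (lebn_sigma_subadditive _) _; rewrite eseries0// => k _ _.
by rewrite lebn_dball// c0 mul0r.
Qed.

(* Writes (t + r)^-m as the integral of m (t + rho)^(-m-1) over rho > r. *)
Lemma ge0_integral_dst_powR (v : Rn -> \bar R) (y : V) (A t a b : R) :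
  measurable_fun setT v -> (forall z, 0 <= v z)%E -> 0 <= A -> 0 < t -> 0 < a -> 0 <= b ->
  (forall r, 0 < r -> (\int[mu]_(z in dball y r) v z <= (A * r `^ b)%:E)%E) ->
  (\int[mu]_z (v z * ((t + dst y z) `^ (- (b + a)))%:E) <= ((b + a) / a * A * t `^ (- a))%:E)%E.
Proof.
move=> mv v0 A0 t0 a0 b0 hv.
pose m := b + a; have m0 : 0 < m by rewrite /m; lra.
pose W (z : Rn) (r : R) : \bar R :=
  if (0 < r) && (dst y z < r) then (v z * (m * (t + r) `^ (- m - 1))%:E)%E else 0%E.
have c1 : measurable_fun setT (fun z : Rn * R => z.1) by exact: measurable_fst.
have c2 : measurable_fun setT (fun z : Rn * R => z.2) by exact: measurable_snd.
have mW : measurable_fun setT (fun z : Rn * R => W z.1 z.2).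
  apply: measurable_fun_ifT => //.
    apply: measurable_and; apply: measurable_fun_ltr => //.
    exact: (measurable_fun_dst (measurable_cst (y : Rn)) c1).
  apply: emeasurable_funM; first exact: (measurableT_comp mv).
  apply/measurable_EFinP; apply: measurable_funM => //.
  by apply: (measurableT_comp (measurable_powR _)); exact: measurable_funD.
have W0 z r : (0 <= W z r)%E.
  by rewrite /W; case: ifP => // _; rewrite mule_ge0// lee_fin mulr_ge0 ?powR_ge0// ltW.
have E z : (v z * ((t + dst y z) `^ (- (b + a)))%:E = \int[lebesgue_measure]_r W z r)%E.
  rewrite /W (integral_if _ setT) setTI.
  rewrite (_ : [set x | _] = `]dst y z, +oo[%classic); last first.
    apply/seteqP; split => [r /= /andP[_]|r /=]; rewrite in_itv/= andbT// => h.
    by rewrite h (le_lt_trans (dst_ge0 _ _) h).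
  rewrite ge0_integralZl//; last 2 first.
    - apply/measurable_EFinP; apply: measurable_funM => //.
      by apply: measurable_funTS; apply: (measurableT_comp (measurable_powR _)); exact: measurable_funD.
    - by move=> r _; rewrite lee_fin mulr_ge0 ?powR_ge0// ltW.
  congr (_ * _)%E; under eq_integral do rewrite EFinM.
  rewrite ge0_integralZl_EFin//; last 3 first.
    - by move=> r _; rewrite lee_fin powR_ge0.
    - apply/measurable_EFinP.
      by apply: measurable_funTS; apply: (measurableT_comp (measurable_powR _)); exact: measurable_funD.
    - exact: ltW.
  rewrite integral_shift_powR//; last by have := dst_ge0 y z; lra.
  by rewrite -EFinM mulrA mulfV ?gt_eqF// mul1r.
rewrite (eq_integral (fun z => (\int[lebesgue_measure]_r W z r)%E)); last by move=> z _; exact: E.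
rewrite (tonelli_dom (mu : {sigma_finite_measure set Rn -> \bar R}) lebesgue_measure)//.
apply: (@le_trans _ _ (\int[lebesgue_measure]_(r in `]0%R, +oo[) (m * A * (t + r) `^ (- a - 1))%:E)%E).
  rewrite [leRHS]integral_mkcond; apply: ge0_le_integral_any => r _.
    exact: integral_ge0.
  rewrite patchE; case: ifPn => [|/negP nr].
    move=> /set_mem/=; rewrite in_itv/= andbT => r0.
    rewrite /W r0/= (integral_if _ setT) setTI.
    rewrite (_ : [set x | _] = dball y r)//.
    rewrite (eq_integral (fun z => ((m * (t + r) `^ (- m - 1))%:E * v z)%E)); last first.
      by move=> z _; rewrite muleC.
    have k0 : 0 <= m * (t + r) `^ (- m - 1) by rewrite mulr_ge0 ?powR_ge0// ltW.
    rewrite ge0_integralZl_EFin//; last 2 first.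
      exact: measurable_dball.
      exact: measurable_funTS.
    apply: le_trans (lee_wpmul2l _ (hv _ r0)) _; first by rewrite lee_fin.
    (* The hypothesis bounds the mass of the cube by A r^b, and r^b <= (t + r)^b lowers the decay
       from m + 1 to a + 1, which is still integrable in r at infinity. *)
    rewrite -EFinM lee_fin (_ : - a - 1 = b + (- m - 1)); last by rewrite /m; lra.
    have tr : 0 < t + r by lra.
    rewrite powRD_gt0//.
    rewrite [leLHS](_ : _ = (m * A * (t + r) `^ (- m - 1)) * r `^ b); last by ring.
    rewrite [leRHS](_ : _ = (m * A * (t + r) `^ (- m - 1)) * (t + r) `^ b); last by ring.
    rewrite ler_wpM2l//; first by rewrite !mulr_ge0// ?powR_ge0// ltW.
    by apply: ge0_ler_powR => //; rewrite ?nnegrE; lra.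
  rewrite integral0_eq// => z _; rewrite /W; case: ifP => // /andP[r0 _].
  by exfalso; apply: nr; rewrite inE/= in_itv/= r0.
under eq_integral do rewrite EFinM.
rewrite ge0_integralZl_EFin//; last 3 first.
  - by move=> r _; rewrite lee_fin powR_ge0.
  - apply/measurable_EFinP.
    by apply: measurable_funTS; apply: (measurableT_comp (measurable_powR _)); exact: measurable_funD.
  - by rewrite mulr_ge0// ltW.
rewrite integral_shift_powR ?addr0// -EFinM lee_fin /m.
by rewrite le_eqVlt; apply/orP; left; apply/eqP; ring.
Qed.

End lebn_ball.

(** * Size and smoothness of the t-derivative of the Poisson kernel *)

Section kernel.
Variables (R : realType) (n : nat).
Local Notation V := 'rV[R]_n.+1.
Local Notation Rn := (Rn R n.+1).
Local Notation N := (n.+1%:R : R).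
Local Notation e := (n.+2%:R / 2 : R).
Implicit Types (t a b : R) (y z : V).

(** By convexity x^(-a) lies above its tangents. With u = y / x this is u^(-a) >= 1 - a (u - 1),
    obtained from exp v >= 1 + v and ln u <= u - 1. *)
Lemma powR_Bernoulli (x y a : R) : 0 < x -> x <= y -> 0 <= a ->
  x `^ (- a) - y `^ (- a) <= a * (y - x) * x `^ (- a - 1).
Proof.
move=> x0 xy a0; have y0 := lt_le_trans x0 xy.
have u0 : 0 < y / x by rewrite divr_gt0.
have -> : y = y / x * x by rewrite mulfVK// gt_eqF.
rewrite powRM ?(ltW u0) ?(ltW x0)// (powRD_gt0 (- a) (- 1) x0) powR_inv1 ?(ltW x0)//.
set u := y / x in u0 *.
have h : 1 - a * (u - 1) <= u `^ (- a).
  rewrite /powR (gt_eqF u0); apply: le_trans (expR_ge1Dx _); rewrite mulNr lerD2l lerN2.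
  by rewrite ler_wpM2l//; have := le_ln1Dx (x := u - 1); rewrite subrKC; apply; lra.
have -> : a * (u * x - x) * (x `^ (- a) / x) = a * (u - 1) * x `^ (- a).
  by field; rewrite gt_eqF.
have p0 : 0 <= x `^ (- a) by exact: powR_ge0.
rewrite -[X in X - _]mul1r -mulrBl ler_wpM2r//; lra.
Qed.

Lemma powR_sub_le (x y m a : R) : 0 < m -> m <= x -> m <= y -> 0 <= a ->
  `|x `^ (- a) - y `^ (- a)| <= a * `|x - y| * m `^ (- a - 1).
Proof.
move=> m0.
wlog xy : x y / x <= y.
  move=> H mx my a0; have [xy|/ltW xy] := leP x y; first exact: H.
  by rewrite distrC [X in _ * X * _]distrC; exact: H.
move=> mx my a0; have x0 := lt_le_trans m0 mx.
rewrite ger0_norm; last by rewrite subr_ge0 ler_powRN.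
rewrite distrC ger0_norm ?subr_ge0//.
apply: le_trans (powR_Bernoulli x0 xy a0) _.
rewrite ler_wpM2l ?mulr_ge0 ?subr_ge0// (_ : - a - 1 = - (a + 1)); last by ring.
by apply: ler_powRN => //; lra.
Qed.

Lemma powR_sq (x a : R) : 0 <= x -> (x ^+ 2) `^ a = x `^ (2 * a).
Proof. by move=> x0; rewrite -powR_mulrn// -powRrM. Qed.

Definition sqdist (y z : V) : R := \sum_(i < n.+1) (y ord0 i - z ord0 i) ^+ 2.
Definition Abase (t : R) (y z : V) : R := t ^+ 2 + sqdist y z.
(** The derivative in t of [Pbase], which is the Poisson kernel without the factor C0. The space has
    dimension n + 1, so [e] = (n + 2) / 2 is the exponent of the Poisson kernel, and differentiating
    t^2 produces the coefficient 2 e = n + 2. *)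
Definition Kern (t : R) (y z : V) : R :=
  Abase t y z `^ (- e) - n.+2%:R * t ^+ 2 * Abase t y z `^ (- e - 1).
Definition Pbase (t : R) (y z : V) : R := t * Abase t y z `^ (- e).
(** The model majorant: a is the decay beyond the dimension, and the integral in z is of order
    t^(-a). [Kern] has size a = 1 and its increments have a = 2. *)
Definition Wk (a t : R) (y z : V) : R := (t + dst y z) `^ (- (N + a)).

Lemma sqdist_ge (y z : V) : dst y z ^+ 2 <= sqdist y z.
Proof.
have s0 : 0 <= sqdist y z by apply: sumr_ge0 => i _; exact: sqr_ge0.
rewrite -(sqr_sqrtr s0) ler_sqr ?nnegrE ?dst_ge0 ?sqrtr_ge0//.
apply/dst_leP; split => [|i]; first exact: sqrtr_ge0.
rewrite -sqrtr_sqr ler_sqrt// /sqdist (bigD1 i)//= lerDl.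
by apply: sumr_ge0 => j _; exact: sqr_ge0.
Qed.

Lemma sqdist_le (y z : V) : sqdist y z <= N * dst y z ^+ 2.
Proof.
apply: (@le_trans _ _ (\sum_(i < n.+1) dst y z ^+ 2)).
  apply: ler_sum => i _; rewrite -[leLHS]real_normK ?num_real//.
  by rewrite ler_sqr ?nnegrE ?dst_ge0//; exact: dst_coord.
by rewrite mulr_natl sumr_const card_ord.
Qed.

Lemma sqdist_sub (y z z' : V) :
  `|sqdist y z - sqdist y z'| <= N * (dst z z' * (dst y z + dst y z')).
Proof.
rewrite /sqdist -sumrB; apply: le_trans (ler_norm_sum _ _ _) _.
apply: (@le_trans _ _ (\sum_(i < n.+1) dst z z' * (dst y z + dst y z'))).
  apply: ler_sum => i _; rewrite subr_sqr normrM ler_pM//.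
    rewrite (_ : _ - _ = z' ord0 i - z ord0 i); last by ring.
    by rewrite dstC; exact: dst_coord.
  apply: le_trans (ler_normD _ _) _; apply: lerD; exact: dst_coord.
by rewrite mulr_natl sumr_const card_ord.
Qed.

Lemma sqdistE (y z : V) : enorm (y - z) ^+ 2 = sqdist y z.
Proof.
rewrite /enorm sqr_sqrtr; last by apply: sumr_ge0 => i _; exact: sqr_ge0.
by apply: eq_bigr => i _; rewrite !mxE.
Qed.

Lemma dst_le_enorm (y z : V) : dst y z <= enorm (y - z).
Proof.
have e0 : 0 <= enorm (y - z) by exact: sqrtr_ge0.
by rewrite -ler_sqr ?nnegrE ?dst_ge0// sqdistE sqdist_ge.
Qed.

Lemma enorm_le_dst (y z : V) : enorm (y - z) <= N * dst y z.
Proof.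
have e0 : 0 <= enorm (y - z) by exact: sqrtr_ge0.
rewrite -ler_sqr ?nnegrE ?mulr_ge0 ?dst_ge0// sqdistE.
apply: le_trans (sqdist_le y z) _; rewrite exprMn ler_wpM2r ?sqr_ge0//.
by rewrite expr2 ler_peMl// ler1n.
Qed.

Lemma Abase_ge t y z : 0 < t -> (t + dst y z) ^+ 2 / 2 <= Abase t y z.
Proof.
move=> t0; have := sqdist_ge y z; rewrite /Abase; have := dst_ge0 y z.
set d := dst y z; set s := sqdist y z => d0 ds.
by have := sqr_ge0 (t - d); rewrite !expr2 in ds *; lra.
Qed.

Lemma Abase_gt0 t y z : 0 < t -> 0 < Abase t y z.
Proof.
move=> t0; apply: lt_le_trans (Abase_ge y z t0).
by rewrite divr_gt0// exprn_gt0// ltr_wpDr// dst_ge0.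
Qed.

(** Since t^2 <= [Abase], the two terms of [Kern] contribute 1 and n + 2 times the same power; 2^e
    is the loss in comparing [Abase] with (t + dst y z)^2 / 2. *)
Definition KernC : R := (1 + n.+2%:R) * 2 `^ e.
Lemma KernC_ge0 : 0 <= KernC.
Proof. by rewrite mulr_ge0 ?powR_ge0. Qed.

Lemma Wk_ge0 a t y z : 0 <= Wk a t y z. Proof. exact: powR_ge0. Qed.

Lemma WkE1 t y z : 0 < t -> ((t + dst y z) ^+ 2) `^ (- e) = Wk 1 t y z.
Proof.
move=> t0; have d0 := dst_ge0 y z.
rewrite powR_sq; last by lra.
by rewrite /Wk (_ : 2 * - e = - (N + 1))// natr1; field.
Qed.

Lemma Kern_le t y z : 0 < t -> `|Kern t y z| <= KernC * Wk 1 t y z.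
Proof.
move=> t0; have A0 := Abase_gt0 y z t0; have d0 := dst_ge0 y z.
have tA : t ^+ 2 <= Abase t y z.
  by rewrite /Abase lerDl; apply: sumr_ge0 => i _; exact: sqr_ge0.
have h : `|Kern t y z| <= (1 + n.+2%:R) * Abase t y z `^ (- e).
  have pA : 0 <= Abase t y z `^ (- e) by exact: powR_ge0.
  apply: le_trans (ler_normB _ _) _; rewrite [leRHS]mulrDl mul1r.
  apply: lerD; first by rewrite ger0_norm.
  rewrite ger0_norm; last by rewrite mulr_ge0 ?powR_ge0// mulr_ge0// sqr_ge0.
  rewrite -mulrA ler_wpM2l// (powRD_gt0 _ (-1) A0) powR_inv1 ?(ltW A0)//.
  by rewrite mulrCA ler_piMr ?powR_ge0// ler_pdivrMr// mul1r.
apply: le_trans h _; rewrite /KernC -mulrA ler_wpM2l//.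
have td : 0 < (t + dst y z) ^+ 2 by rewrite exprn_gt0//; lra.
apply: le_trans (ler_powRN _ _ (Abase_ge y z t0)) _; [by []|by rewrite divr_gt0|].
rewrite powRM ?(ltW td)// WkE1// mulrC ler_wpM2r ?Wk_ge0//.
by rewrite -powR_inv1// -powRrM mulN1r opprK.
Qed.

(** 3 N bounds the increment of [Abase], e and 16 e (e + 1) come from the two terms of [Kern], and
    8^(e+1) from the common lower bound T^2 / 8 of [Abase]. *)
Definition KernC2 : R := 3 * N * (e + 16 * e * (e + 1)) * 8 `^ (e + 1).
Lemma KernC2_ge0 : 0 <= KernC2.
Proof. by rewrite !mulr_ge0 ?powR_ge0// addr_ge0// !mulr_ge0// addr_ge0. Qed.

(** Put T = t + |y-z| and h = |z-z'|. A displacement of at most T / 2 changes [Abase] by O(h T)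
    while both values stay of order T^2. The tangent bound then gives h T T^(-2e-2) = h T^(-(N+2));
    in the second term the extra factor t^2 compensates the extra negative power. *)
Lemma Kern_sub_le t y z z' : 0 < t -> dst z z' <= (t + dst y z) / 2 ->
  `|Kern t y z - Kern t y z'| <= KernC2 * (dst z z' * Wk 2 t y z).
Proof.
move=> t0 hz; have d0 := dst_ge0 y z; have h0 := dst_ge0 z z'.
set T := t + dst y z in hz *; have T0 : 0 < T by rewrite /T; lra.
(* At z the base is at least T^2 / 2; at z' one only has t + dst y z' >= T / 2, hence the bound T^2
   / 8 for both. *)
pose m := T ^+ 2 / 8; have m0 : 0 < m by rewrite divr_gt0// exprn_gt0.
have d1 : dst y z' <= dst y z + dst z z' by exact: dst_triangle.
have d2 : dst y z <= dst y z' + dst z z' by rewrite (dstC z z'); exact: dst_triangle.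
have mA : m <= Abase t y z.
  by apply: le_trans (Abase_ge y z t0); rewrite /m -/T ler_wpM2l ?sqr_ge0//; lra.
have mB : m <= Abase t y z'.
  apply: le_trans (Abase_ge y z' t0).
  have : T / 2 <= t + dst y z' by rewrite /T in hz *; lra.
  move=> /(@lerXn2r _ 2); rewrite !nnegrE => /(_ _ _) H.
  have := H ltac:(lra) ltac:(have := dst_ge0 y z'; lra).
  by rewrite expr_div_n /m; lra.
have AB : `|Abase t y z - Abase t y z'| <= 3 * N * (dst z z' * T).
  rewrite /Abase opprD addrACA subrr add0r; apply: le_trans (sqdist_sub y z z') _.
  rewrite [leRHS](_ : _ = N * (dst z z' * (3 * T))); last by ring.
  rewrite ler_wpM2l// ler_wpM2l//.
  by rewrite /T in hz *; lra.
have e0 : 0 <= e by [].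
have B1 := powR_sub_le m0 mA mB e0.
have B2 := powR_sub_le m0 mA mB (addr_ge0 e0 ler01).
have tm : t ^+ 2 <= 8 * m.
  rewrite /m mulrCA mulfV// mulr1 lerXn2r ?nnegrE//; [exact: ltW|exact: ltW|].
  by rewrite /T; lra.
set D := `|Abase t y z - Abase t y z'| in B1 B2 AB.
have D0 : 0 <= D by exact: normr_ge0.
have -> : Kern t y z - Kern t y z' = (Abase t y z `^ (- e) - Abase t y z' `^ (- e))
    - n.+2%:R * t ^+ 2 * (Abase t y z `^ (- (e + 1)) - Abase t y z' `^ (- (e + 1))).
  by rewrite /Kern (opprD e 1); ring.
apply: le_trans (ler_normB _ _) _; rewrite normrM (ger0_norm (x := n.+2%:R * t ^+ 2)); last first.
  by rewrite mulr_ge0// sqr_ge0.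
have p0 : 0 <= m `^ (- e - 1) by exact: powR_ge0.
have H : `|Abase t y z `^ (- e) - Abase t y z' `^ (- e)| + n.+2%:R * t ^+ 2
    * `|Abase t y z `^ (- (e + 1)) - Abase t y z' `^ (- (e + 1))|
   <= (e + 16 * e * (e + 1)) * D * m `^ (- e - 1).
  rewrite [leRHS](_ : _ = e * D * m `^ (- e - 1) + 16 * e * (e + 1) * D * m `^ (- e - 1)); last by ring.
  apply: lerD; first exact: B1.
  apply: le_trans (ler_wpM2l _ B2) _; first by rewrite mulr_ge0// sqr_ge0.
  rewrite (_ : - (e + 1) - 1 = (- e - 1) + -1); last by ring.
  rewrite (powRD_gt0 _ (-1) m0) powR_inv1 ?(ltW m0)//.
  rewrite [leLHS](_ : _ = (n.+2%:R * (e + 1) * D * m `^ (- e - 1)) * (t ^+ 2 / m)); last by ring.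
  rewrite [leRHS](_ : _ = (n.+2%:R * (e + 1) * D * m `^ (- e - 1)) * 8); last by field.
  rewrite ler_wpM2l//; last by rewrite ler_pdivrMr.
  by rewrite !mulr_ge0// addr_ge0.
apply: le_trans H _.
have -> : m `^ (- e - 1) = 8 `^ (e + 1) * (T ^-1 * Wk 2 t y z).
  rewrite /m powRM ?sqr_ge0// mulrC -powR_inv1// -powRrM; congr (_ `^ _ * _); first by ring.
  rewrite powR_sq ?(ltW T0)// /Wk -/T -(powR_inv1 (ltW T0)) -powRD_gt0//; congr powR.
  by rewrite -!natr1; field.
have -> : KernC2 * (dst z z' * Wk 2 t y z) =
   (e + 16 * e * (e + 1)) * (3 * N * (dst z z' * T)) * (8 `^ (e + 1) * (T^-1 * Wk 2 t y z)).
  by rewrite /KernC2; field; rewrite gt_eqF.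
rewrite ler_wpM2r//.
  by rewrite !mulr_ge0 ?powR_ge0 ?invr_ge0 ?(ltW T0).
by rewrite ler_wpM2l// addr_ge0// !mulr_ge0// addr_ge0.
Qed.

Definition KernC3 : R := KernC2 + 4 * KernC.

Lemma Wk_split a b t y z : 0 < t -> Wk (a + b) t y z = Wk a t y z * (t + dst y z) `^ (- b).
Proof.
move=> t0; rewrite /Wk -powRD_gt0; last by have := dst_ge0 y z; lra.
by congr powR; ring.
Qed.

(** The terms D and W' are slack, added so that small and large displacements lead to the same
    right-hand side. *)
Lemma sqrt_near_le (h T W W' C D : R) : 0 <= h -> 0 < T -> h <= T / 2 -> 0 <= W -> 0 <= W' ->
  0 <= C -> 0 <= D ->
  C * (h * (W * T `^ (- (1/2)))) <= (C + D) * (Num.sqrt h * (W + W')).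
Proof.
move=> h0 T0 hT W0 W'0 C0 D0; have s0 := sqrtr_ge0 h.
have sT : 0 < Num.sqrt T by rewrite sqrtr_gt0.
have sh : Num.sqrt h <= Num.sqrt T by rewrite ler_sqrt//; lra.
rewrite powRN div1r powR12_sqrt ?(ltW T0)//.
apply: (@le_trans _ _ (C * (Num.sqrt h * W))); last first.
  by apply: ler_pM; rewrite ?mulr_ge0 ?lerDl// ler_wpM2l// lerDl.
rewrite ler_wpM2l// -{1}(sqr_sqrtr h0) expr2 -mulrA ler_wpM2l// mulrCA ler_piMr//.
by rewrite ler_pdivrMr ?mul1r.
Qed.

Lemma sqrt_far_le (h u W C : R) : 0 < u -> u <= 3 * h -> 0 <= W -> 0 <= C ->
  C * W <= 2 * C * (Num.sqrt h * (W * u `^ (- (1/2)))).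
Proof.
move=> u0 uh W0 C0; have su : 0 < Num.sqrt u by rewrite sqrtr_gt0.
rewrite powRN div1r powR12_sqrt ?(ltW u0)//.
have h1 : 1 <= 2 * (Num.sqrt h / Num.sqrt u).
  rewrite mulrA ler_pdivlMr// mul1r.
  have -> : 2 = Num.sqrt 4 :> R by rewrite (_ : 4 = 2 ^+ 2) ?sqrtr_sqr ?ger0_norm//; ring.
  by rewrite -sqrtrM// ler_sqrt; lra.
rewrite [leRHS](_ : _ = (C * W) * (2 * (Num.sqrt h / Num.sqrt u))); last by ring.
by rewrite ler_peMr// mulr_ge0.
Qed.

(** A Hoelder bound of order 1/2 without restriction on the displacement h. For small h the
    Lipschitz bound is weakened by h <= sqrt h sqrt T; for large h the sizes are estimated
    separately and multiplied by sqrt (h / T), which is bounded below. Order 1/2 is chosen because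
    [sqrt_dst_Wk_le] can absorb sqrt h into the other kernel. *)
Lemma Kern_sub_sqrt_le t y z z' : 0 < t ->
  `|Kern t y z - Kern t y z'| <=
  KernC3 * (Num.sqrt (dst z z') * (Wk (3/2) t y z + Wk (3/2) t y z')).
Proof.
move=> t0; have d0 := dst_ge0 y z; have h0 := dst_ge0 z z'.
have d1 : dst y z' <= dst y z + dst z z' by exact: dst_triangle.
have T0 : 0 < t + dst y z by rewrite ltr_wpDr.
have C40 : 0 <= 4 * KernC by rewrite mulr_ge0// KernC_ge0.
have [hz|hz] := leP (dst z z') ((t + dst y z) / 2).
  apply: le_trans (Kern_sub_le t0 hz) _.
  rewrite (_ : Wk 2 t y z = Wk (3/2 + 1/2) t y z); last by congr Wk; field.
  rewrite (Wk_split _ _ _ _ t0).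
  have W0 := Wk_ge0 (3/2) t y z; have W0' := Wk_ge0 (3/2) t y z'.
  exact: (sqrt_near_le h0 T0 hz W0 W0' KernC2_ge0 C40).
(* As t + dst y z < 2 h, both w = z and w = z' satisfy t + dst y w <= 3 h, the hypothesis of
   [sqrt_far_le]. *)
have KK w : dst y w <= dst y z + dst z z' -> `|Kern t y w| <= 2 * KernC * (Num.sqrt (dst z z') * Wk (3/2) t y w).
  move=> hw; apply: le_trans (Kern_le y w t0) _.
  have dw := dst_ge0 y w.
  rewrite (_ : Wk (3/2) t y w = Wk (1 + 1/2) t y w); last by congr Wk; field.
  rewrite Wk_split//; apply: (sqrt_far_le _ _ (Wk_ge0 _ _ _ _) KernC_ge0).
    by clear -t0 dw; lra.
  by clear -hw hz; lra.
apply: le_trans (ler_normB _ _) _; apply: le_trans (lerD (KK z _) (KK z' d1)) _.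
  by rewrite lerDl.
rewrite -mulrDr -mulrDr; apply: ler_wpM2r.
  by rewrite mulr_ge0 ?sqrtr_ge0// addr_ge0 ?Wk_ge0.
apply: (@le_trans _ _ (4 * KernC)); first by rewrite ler_wpM2r ?KernC_ge0// ler_nat.
by rewrite /KernC3 lerDr KernC2_ge0.
Qed.

Lemma is_derive_Pbase t y z : 0 < t -> is_derive t 1 (fun t : R => Pbase t y z) (Kern t y z).
Proof.
move=> t0; rewrite /Pbase /Kern.
have A0 := Abase_gt0 y z t0.
have H1 : is_derive t 1 (fun t : R => Abase t y z) (2 * t).
  rewrite /Abase; apply: is_derive_eq.
  by rewrite /GRing.scale/=; ring.
have H2 := is_derive1_comp (f := fun x => x `^ (- e)) (g := fun t : R => Abase t y z) (is_derive1_powR (- e) A0) H1.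
have H3 := is_deriveM (is_derive_id t 1) H2.
move: H3; rewrite [X in is_derive _ _ _ X -> _](_ : _ =
   Abase t y z `^ (- e) - n.+2%:R * t ^+ 2 * Abase t y z `^ (- e - 1))//.
by rewrite /GRing.scale/=; field.
Qed.

Lemma Pker_sub (t : R) (y z : V) : Pker t (y - z) = C0 R n.+1 * Pbase t y z.
Proof. by rewrite /Pker /Pbase sqdistE mulrA. Qed.

Lemma measurable_Wk d (T : measurableType d) a (ft : T -> R) (fy fz : T -> Rn) :
  measurable_fun setT ft -> measurable_fun setT fy -> measurable_fun setT fz ->
  measurable_fun setT (fun x => Wk a (ft x) (fy x) (fz x)).
Proof.
move=> mt my mz; apply: (measurableT_comp (measurable_powR _)).
by apply: measurable_funD => //; exact: measurable_fun_dst.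
Qed.

Lemma measurable_Abase d (T : measurableType d) (ft : T -> R) (fy fz : T -> Rn) :
  measurable_fun setT ft -> measurable_fun setT fy -> measurable_fun setT fz ->
  measurable_fun setT (fun x => Abase (ft x) (fy x) (fz x)).
Proof.
move=> mt my mz; apply: measurable_funD; first exact: measurable_funX.
apply: measurable_sum => i; apply: measurable_funX; apply: measurable_funB.
  exact: (measurableT_comp (measurable_coord i)).
exact: (measurableT_comp (measurable_coord i)).
Qed.

Lemma measurable_Kern d (T : measurableType d) (ft : T -> R) (fy fz : T -> Rn) :
  measurable_fun setT ft -> measurable_fun setT fy -> measurable_fun setT fz ->
  measurable_fun setT (fun x => Kern (ft x) (fy x) (fz x)).
Proof.
move=> mt my mz; have mA := measurable_Abase mt my mz.
apply: measurable_funB; first exact: (measurableT_comp (measurable_powR _)).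
apply: measurable_funM; last exact: (measurableT_comp (measurable_powR _)).
by apply: measurable_funM => //; exact: measurable_funX.
Qed.

Lemma measurable_Pbase d (T : measurableType d) (ft : T -> R) (fy fz : T -> Rn) :
  measurable_fun setT ft -> measurable_fun setT fy -> measurable_fun setT fz ->
  measurable_fun setT (fun x => Pbase (ft x) (fy x) (fz x)).
Proof.
move=> mt my mz; have mA := measurable_Abase mt my mz.
by apply: measurable_funM => //; exact: (measurableT_comp (measurable_powR _)).
Qed.

Definition WkC a : R := (N + a) / a * 2 ^+ n.+1.
Lemma WkC_ge0 a : 0 < a -> 0 <= WkC a.
Proof. by move=> a0; rewrite !mulr_ge0 ?exprn_ge0 ?invr_ge0 ?addr_ge0// ltW. Qed.

Lemma integral_Wk a t y : 0 < a -> 0 < t ->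
  (\int[lebn n.+1]_z (Wk a t y z)%:E <= (WkC a * t `^ (- a))%:E)%E.
Proof.
move=> a0 t0.
have := @ge0_integral_dst_powR R n (fun=> 1%E) y (2 ^+ n.+1) t a N.
under eq_integral do rewrite mul1e.
apply => //.
move=> r r0; rewrite integral_cst; last exact: measurable_dball.
rewrite mul1e; apply: le_trans (lebn_dball_le y r0) _.
by rewrite exprMn powR_mulrn// ltW.
Qed.

End kernel.

Lemma EFin_mulI (R : realType) (c : R) (x y : \bar R) : c != 0 ->
  (c%:E * x = c%:E * y)%E -> x = y.
Proof.
move=> c0 /(congr1 (fun u => (c^-1)%:E * u)%E).
by rewrite !muleA -!EFinM mulVf// !mul1e.
Qed.

(** * Poisson integrals, their t-derivative, and the cancellation of the kernel *)

Section poisson.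
Variables (R : realType) (n : nat).
Local Notation V := 'rV[R]_n.+1.
Local Notation Rn := (Rn R n.+1).
Local Notation mu := (@lebn R n.+1).
Local Notation N := (n.+1%:R : R).
Local Notation e := (n.+2%:R / 2 : R).
Implicit Types (t a b : R) (f g : Rn -> R).

Lemma measurable_integral_param d (X : measurableType d) (F : X -> Rn -> \bar R) :
  measurable_fun [set: X * Rn] (fun x => F x.1 x.2) -> (forall x z, 0 <= F x z)%E ->
  measurable_fun setT (fun x => \int[mu]_z F x z)%E.
Proof.
move=> mF F0.
by have := measurable_fun_fubini_tonelli_F (m2 := mu) (fun x : X * Rn => F x.1 x.2) mF (fun x => F0 x.1 x.2).
Qed.

Lemma measurable_Rintegral_param d (X : measurableType d) (F : X -> Rn -> R) :
  measurable_fun [set: X * Rn] (fun x => F x.1 x.2) ->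
  measurable_fun setT (fun x => \int[mu]_z F x z).
Proof.
move=> mF; rewrite /Rintegral; apply: measurableT_comp => //.
under eq_fun do rewrite integralE.
have mE : measurable_fun [set: X * Rn] (fun x => (F x.1 x.2)%:E) by exact/measurable_EFinP.
apply: emeasurable_funB; apply: measurable_integral_param => //.
  rewrite [Y in measurable_fun _ Y](_ : _ = (fun u : X * Rn => (F u.1 u.2)%:E)^\+%E).
    exact: measurable_funepos.
  by apply/funext => u; rewrite ?funeposE ?funenegE.
rewrite [Y in measurable_fun _ Y](_ : _ = (fun u : X * Rn => (F u.1 u.2)%:E)^\-%E).
  exact: measurable_funeneg.
by apply/funext => u; rewrite ?funeposE ?funenegE.
Qed.

(** Absolute convergence of the Poisson integral and of its t-derivative at all points: [Wk 1 t]
    dominates [Kern t] and, up to a factor depending on t, [Pbase t]. *)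
Definition poisson_integrable f := measurable_fun setT f /\
  forall y t, 0 < t -> (\int[mu]_z (`|f z| * Wk 1 t y z)%:E < +oo)%E.

Definition Tk f (y : V) (t : R) : R := \int[mu]_z (f z * Kern t y z).

Lemma measurable_Tk f : measurable_fun setT f ->
  measurable_fun [set: Rn * R] (fun x => Tk f x.1 x.2).
Proof.
move=> mf; apply: measurable_Rintegral_param.
apply: measurable_funM; first exact: (measurableT_comp mf measurable_snd).
apply: measurable_Kern.
- exact: (measurableT_comp measurable_snd measurable_fst).
- exact: (measurableT_comp measurable_fst measurable_fst).
- exact: measurable_snd.
Qed.

Lemma Wk_le a t (y z : V) : 0 < t -> 0 < a -> Wk a t y z <= t `^ (- (N + a)).
Proof.
move=> t0 a0; apply: ler_powRN => //; first by rewrite addr_ge0// ltW.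
by rewrite lerDl dst_ge0.
Qed.

Lemma le_Wk a t t' (y z : V) : 0 < t -> t <= t' -> 0 < a -> Wk a t' y z <= Wk a t y z.
Proof.
move=> t0 tt a0; apply: ler_powRN; first by rewrite addr_ge0// ltW.
  by rewrite ltr_wpDr// dst_ge0.
by rewrite lerD2r.
Qed.

Lemma measurable_WkE a t y : measurable_fun setT (fun z : Rn => (Wk a t y z)%:E).
Proof.
apply/measurable_EFinP; apply: (measurable_Wk a (ft := cst t) (fy := cst (y : Rn)) (fz := id)) => //.
Qed.

Lemma measurable_KernE t y : measurable_fun setT (fun z : Rn => Kern t y z).
Proof. by apply: (measurable_Kern (ft := cst t) (fy := cst (y : Rn)) (fz := id)). Qed.

(** Where |f| <= 1 the integrability of [Wk] suffices; where |f| > 1 one has |f| <= |f|^p, and [Wk]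
    is bounded for fixed t. *)
Lemma poisson_integrable_Lp f p : 1 <= p -> measurable_fun setT f ->
  (\int[mu]_z (`|f z| `^ p)%:E < +oo)%E -> poisson_integrable f.
Proof.
move=> p1 mf fp; split => // y t t0.
have mfp : measurable_fun setT (fun z => (`|f z| `^ p)%:E).
  apply/measurable_EFinP; apply: (measurableT_comp (measurable_powR _)).
  exact: measurableT_comp.
pose M := t `^ (- (N + 1)).
apply: (@le_lt_trans _ _ (\int[mu]_z ((Wk 1 t y z)%:E + M%:E * (`|f z| `^ p)%:E))%E).
  apply: ge0_le_integral_any => z _; first by rewrite lee_fin mulr_ge0// Wk_ge0.
  rewrite -EFinM -EFinD lee_fin.
  have W0 := Wk_ge0 1 t y z; have WM : Wk 1 t y z <= M by exact: Wk_le.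
  have f0 : 0 <= `|f z| `^ p by exact: powR_ge0.
  have [f1|f1] := leP `|f z| 1.
    apply: (@le_trans _ _ (Wk 1 t y z)); first by rewrite ler_piMl.
    by rewrite lerDl mulr_ge0// (le_trans W0).
  apply: (@le_trans _ _ (M * `|f z| `^ p)); last by rewrite lerDr.
  rewrite mulrC ler_pM//.
  by rewrite -[leLHS]powRr1// ler_powR// ltW.
have M0 : 0 <= M by exact: powR_ge0.
rewrite ge0_integralD//=; last 4 first.
- by move=> z _; rewrite lee_fin Wk_ge0.
- exact: measurable_WkE.
- by move=> z _; rewrite mule_ge0// lee_fin ?powR_ge0.
- exact: emeasurable_funM.
apply: lte_add_pinfty.
  by apply: le_lt_trans (integral_Wk _ _ _) _ => //; rewrite ltry.
by rewrite ge0_integralZl_EFin// lte_mul_pinfty.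
Qed.

Lemma poisson_integrable_bounded f M : measurable_fun setT f ->
  (forall z, `|f z| <= M) -> poisson_integrable f.
Proof.
move=> mf fM; split => // y t t0.
have M0 : 0 <= M by exact: le_trans (fM 0).
apply: (@le_lt_trans _ _ (\int[mu]_z (M%:E * (Wk 1 t y z)%:E))%E).
  apply: ge0_le_integral_any => z _; first by rewrite lee_fin mulr_ge0// Wk_ge0.
  by rewrite -EFinM lee_fin ler_wpM2r ?Wk_ge0.
rewrite ge0_integralZl_EFin//; last 2 first.
- by move=> z _; rewrite lee_fin Wk_ge0.
- exact: measurable_WkE.
apply: lte_mul_pinfty => //.
by apply: le_lt_trans (integral_Wk _ _ _) _ => //; rewrite ltry.
Qed.

Lemma poisson_integrable_le f g (h : Rn -> R) : poisson_integrable f -> poisson_integrable g ->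
  measurable_fun setT h -> (forall z, `|h z| <= `|f z| + `|g z|) -> poisson_integrable h.
Proof.
move=> [mf hf] [mg hg] mh H; split => // y t t0.
have mW (k : Rn -> R) : measurable_fun setT k ->
    measurable_fun setT (fun z : Rn => (`|k z| * Wk 1 t y z)%:E).
  move=> mk; apply/measurable_EFinP; apply: measurable_funM.
    exact: measurableT_comp.
  by have /measurable_EFinP := measurable_WkE 1 t y.
apply: (@le_lt_trans _ _ (\int[mu]_z ((`|f z| * Wk 1 t y z)%:E + (`|g z| * Wk 1 t y z)%:E))%E).
  apply: ge0_le_integral_any => z _; first by rewrite lee_fin mulr_ge0// Wk_ge0.
  by rewrite -EFinD lee_fin -mulrDl ler_wpM2r ?Wk_ge0.
rewrite ge0_integralD//; try (by move=> z _; rewrite lee_fin mulr_ge0// Wk_ge0); try exact: mW.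
by rewrite lte_add_pinfty// ?hf// ?hg.
Qed.

Lemma poisson_integrable_Kern f y t : poisson_integrable f -> 0 < t ->
  mu.-integrable setT (fun z => (f z * Kern t y z)%:E).
Proof.
move=> [mf hf] t0; apply/integrableP; split.
  by apply/measurable_EFinP; apply: measurable_funM => //; exact: measurable_KernE.
have mW : measurable_fun setT (fun z : Rn => (`|f z| * Wk 1 t y z)%:E).
  apply/measurable_EFinP; apply: measurable_funM.
    exact: measurableT_comp.
  by have /measurable_EFinP := measurable_WkE 1 t y.
apply: (@le_lt_trans _ _ (\int[mu]_z ((@KernC R n)%:E * (`|f z| * Wk 1 t y z)%:E))%E).
  apply: ge0_le_integral_any => z _ //.
  rewrite -EFinM /= lee_fin normrM mulrCA ler_wpM2l//; exact: Kern_le.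
rewrite ge0_integralZl_EFin//; last 2 first.
- by move=> z _; rewrite lee_fin mulr_ge0// Wk_ge0.
- exact: KernC_ge0.
by apply: lte_mul_pinfty => //; [rewrite lee_fin KernC_ge0|exact: hf].
Qed.

Lemma Tk_le f y t : poisson_integrable f -> 0 < t ->
  (`|Tk f y t|%:E <= \int[mu]_z (`|f z| * `|Kern t y z|)%:E)%E.
Proof.
move=> pf t0; have intf := poisson_integrable_Kern y pf t0.
rewrite /Tk /Rintegral.
have fi : (\int[mu]_z (f z * Kern t y z)%:E)%E \is a fin_num by exact: integrable_fin_num.
rewrite -fine_abse// fineK ?abse_fin_num//.
apply: le_trans (le_abse_integral _ _ _) _ => //; first by case/integrableP: intf.
by under eq_integral do rewrite /= normrM.
Qed.

Lemma TkD f g y t : poisson_integrable f -> poisson_integrable g -> 0 < t ->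
  Tk (fun z => f z + g z) y t = Tk f y t + Tk g y t.
Proof.
move=> pf pg t0; rewrite /Tk -RintegralD//; try exact: poisson_integrable_Kern.
by apply: eq_Rintegral => z _; rewrite mulrDl.
Qed.

Lemma Abase_powR_le t (y z : V) : 0 < t -> Abase t y z `^ (- e) <= 2 `^ e * Wk 1 t y z.
Proof.
move=> t0; have d0 := dst_ge0 y z.
have td : 0 < (t + dst y z) ^+ 2 by rewrite exprn_gt0// ltr_wpDr.
apply: le_trans (ler_powRN _ _ (Abase_ge y z t0)) _; [by []|by rewrite divr_gt0|].
rewrite powRM ?(ltW td)// WkE1// mulrC ler_wpM2r ?Wk_ge0//.
by rewrite -powR_inv1// -powRrM mulN1r opprK.
Qed.

Lemma integrable_Pbase f y t : poisson_integrable f -> 0 < t ->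
  mu.-integrable setT (fun z => (f z * Pbase t y z)%:E).
Proof.
move=> [mf hf] t0; apply/integrableP; split.
  apply/measurable_EFinP; apply: measurable_funM => //.
  by apply: (measurable_Pbase (ft := cst t) (fy := cst (y : Rn)) (fz := id)).
have mW : measurable_fun setT (fun z : Rn => (`|f z| * Wk 1 t y z)%:E).
  apply/measurable_EFinP; apply: measurable_funM.
    exact: measurableT_comp.
  by have /measurable_EFinP := measurable_WkE 1 t y.
have c0 : 0 <= t * 2 `^ e by rewrite mulr_ge0 ?powR_ge0// ltW.
apply: (@le_lt_trans _ _ (\int[mu]_z ((t * 2 `^ e)%:E * (`|f z| * Wk 1 t y z)%:E))%E).
  apply: ge0_le_integral_any => z _ //.
  rewrite -EFinM /= lee_fin normrM mulrCA ler_wpM2l// /Pbase normrM gtr0_norm// ger0_norm ?powR_ge0//.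
  by rewrite -mulrA ler_wpM2l ?(ltW t0)// Abase_powR_le.
rewrite ge0_integralZl_EFin//; last first.
  by move=> z _; rewrite lee_fin mulr_ge0// Wk_ge0.
by apply: lte_mul_pinfty => //; exact: hf.
Qed.

(** Differentiation under the integral sign on ]t/2, 2t[. [Wk] decreases in t, so the value at t / 2
    dominates the derivative on the whole interval. *)
Lemma derive1_Pbase f y t : poisson_integrable f -> 0 < t ->
  is_derive t 1 (fun t' : R => \int[mu]_z (f z * Pbase t' y z)) (Tk f y t).
Proof.
move=> pf t0; have [mf hf] := pf.
have It : `](t / 2), (2 * t)[%classic t by rewrite /= in_itv/=; lra.
have posI x : `](t / 2), (2 * t)[%classic x -> 0 < x by rewrite /= in_itv/=; lra.
have intf x : `](t / 2), (2 * t)[%classic x ->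
    mu.-integrable setT (EFin \o (fun z => f z * Pbase x y z)).
  by move=> /posI x0; exact: integrable_Pbase.
have der x z : `](t / 2), (2 * t)[%classic x -> [set: Rn] z ->
    is_derive x 1 (fun x : R => f z * Pbase x y z) (f z * Kern x y z).
  move=> /posI x0 _; exact: (is_deriveZ (f z) (is_derive_Pbase y z x0)).
have derf x z : `](t / 2), (2 * t)[%classic x -> [set: Rn] z ->
    derivable (fun x : R => f z * Pbase x y z) x 1.
  by move=> Ix Bz; have [] := der x z Ix Bz.
pose G z := `|f z| * (KernC R n * Wk 1 (t / 2) y z).
have t20 : 0 < t / 2 by rewrite divr_gt0.
have G0 z : 0 <= G z by rewrite mulr_ge0// mulr_ge0 ?KernC_ge0 ?Wk_ge0.
have mW : measurable_fun setT (fun z : Rn => (`|f z| * Wk 1 (t / 2) y z)%:E).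
  apply/measurable_EFinP; apply: measurable_funM.
    exact: measurableT_comp.
  by have /measurable_EFinP := measurable_WkE 1 (t / 2) y.
have GE z : (G z)%:E = ((KernC R n)%:E * (`|f z| * Wk 1 (t / 2) y z)%:E)%E.
  by rewrite -EFinM /G mulrCA.
have intG : mu.-integrable setT (EFin \o G).
  apply/integrableP; split.
    rewrite (_ : _ \o _ = fun z => ((KernC R n)%:E * (`|f z| * Wk 1 (t / 2) y z)%:E)%E); last first.
      by apply/funext => z; exact: GE.
    exact: emeasurable_funM.
  under eq_integral do rewrite /= (ger0_norm (G0 _)) GE.
  rewrite ge0_integralZl_EFin//; last 2 first.
  - by move=> z _; rewrite lee_fin mulr_ge0// Wk_ge0.
  - exact: KernC_ge0.
  by apply: lte_mul_pinfty => //; [rewrite lee_fin KernC_ge0|exact: hf].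
have G_ub x z : `](t / 2), (2 * t)[%classic x -> [set: Rn] z ->
    `|partial1of2 (fun x z => f z * Pbase x y z) x z| <= G z.
  move=> Ix Bz; rewrite partial1of2E.
  have H := der x z Ix Bz; rewrite (@derive_val _ _ _ _ _ _ _ H) normrM /G ler_wpM2l//.
  apply: le_trans (Kern_le y z (posI _ Ix)) _; rewrite ler_wpM2l ?KernC_ge0//.
  by apply: le_Wk => //; move: Ix; rewrite /= in_itv/=; lra.
have D1 := derivable_under_integral measurableT It intf derf G0 intG G_ub.
have D2 := differentiation_under_integral measurableT It intf derf G0 intG G_ub.
apply: DeriveDef => //; rewrite -derive1E D2 /Tk; apply: eq_Rintegral => z _.
rewrite /= partial1of2E.
have H := der t z It Logic.I; exact: (@derive_val _ _ _ _ _ _ _ H).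
Qed.

Lemma dtPE f y t : poisson_integrable f -> 0 < t -> dtP f y t = C0 R n.+1 * Tk f y t.
Proof.
move=> pf t0; rewrite /dtP derive1E.
have H := derive1_Pbase y pf t0.
have H2 : is_derive t 1 (fun t' : R => C0 R n.+1 * \int[mu]_z (f z * Pbase t' y z)) (C0 R n.+1 * Tk f y t).
  exact: (is_deriveZ (C0 R n.+1) H).
(* The two functions of t' are compared for t' > 0 only, which is enough for the derivative at t. *)
have E : {near t, (fun t' => C0 R n.+1 * \int[mu]_z (f z * Pbase t' y z)) =1 (fun t' => poissonI f y t')}.
  near=> t'; have t'0 : 0 < t' by near: t'; exact: lt_nbhsr.
  rewrite /poissonI -RintegralZl//; last exact: integrable_Pbase.
  rewrite /Rintegral; congr fine; apply: eq_integral => z _.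
  by rewrite Pker_sub mulrCA.
rewrite -(near_eq_derive (1 : R) E); exact: (@derive_val _ _ _ _ _ _ _ H2).
Unshelve. all: end_near. Qed.

Lemma Pbase_aff t (y z : V) : 0 < t -> Pbase t y (aff y t z) = t ^- n.+1 * Pbase 1 0 z.
Proof.
move=> t0; rewrite /Pbase /Abase.
have -> : sqdist y (aff y t z) = t ^+ 2 * sqdist 0 z.
  by rewrite /sqdist big_distrr/=; apply: eq_bigr => i _; rewrite !mxE; ring.
have s0 : 0 <= 1 + sqdist 0 z.
  by rewrite addr_ge0// sumr_ge0// => i _; rewrite sqr_ge0.
rewrite -[X in X + _]mulr1 -mulrDr expr1n powRM ?sqr_ge0// mulrA mul1r; congr (_ * _).
rewrite powR_sq ?(ltW t0)// -{1}(powRr1 (ltW t0)) -powRD_gt0//.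
rewrite -(powR_mulrn _ (ltW t0)) -powRN; congr powR.
by rewrite -(natr1 n.+1); field.
Qed.

(** Dilation by t turns the integral of [Pbase t y] into that of [Pbase 1 0]. It is thus constant in
    t, and its derivative, the integral of [Kern], vanishes. *)
Lemma Rintegral_Kern0 y t : 0 < t -> \int[mu]_z Kern t y z = 0.
Proof.
move=> t0.
have p1 : poisson_integrable (fun=> 1) by apply: (@poisson_integrable_bounded _ 1) => // z; rewrite normr1.
have H := derive1_Pbase y p1 t0.
have E : {near t, (fun t' => \int[mu]_z (1 * Pbase t' y z)) =1 cst (\int[mu]_z Pbase 1 0 z)}.
  near=> t'; have t'0 : 0 < t' by near: t'; exact: lt_nbhsr.
  rewrite /Rintegral; congr fine.
  have tn : 0 < t' ^+ n.+1 by rewrite exprn_gt0.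
  have mP : measurable_fun setT (fun z : Rn => (Pbase t' y z)%:E).
    by apply/measurable_EFinP; apply: (measurable_Pbase (ft := cst t') (fy := cst (y : Rn)) (fz := id)).
  have P0 z : (0 <= (Pbase t' y z)%:E)%E by rewrite lee_fin mulr_ge0 ?powR_ge0// ltW.
  have mP1 : measurable_fun setT (fun z : Rn => (Pbase 1 0 z)%:E).
    by apply/measurable_EFinP; apply: (measurable_Pbase (ft := cst 1) (fy := cst (0 : Rn)) (fz := id)).
  have E1 : (\int[mu]_x (Pbase t' y (aff y t' x))%:E = \int[mu]_x ((t' ^- n.+1)%:E * (Pbase 1 0 x)%:E))%E.
    by apply: eq_integral => z _; rewrite -EFinM Pbase_aff.
  have := ge0_integral_aff y t'0 mP P0; rewrite E1.
  rewrite ge0_integralZl_EFin; first last.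
  - by rewrite invr_ge0 ltW.
  - exact: mP1.
  - by move=> z _; rewrite lee_fin mulr_ge0// powR_ge0.
  - exact: measurableT.
  have tn' : t' ^- n.+1 != 0 by rewrite invr_neq0// gt_eqF.
  move=> /(EFin_mulI tn') E2; apply: etrans (esym E2).
  by apply: eq_integral => z _; rewrite mul1r.
have H2 : Tk (fun=> 1) y t = 0.
  have <- := @derive_val _ _ _ _ _ _ _ H.
  by rewrite (near_eq_derive (1 : R) E) derive_cst.
by rewrite -H2 /Tk; apply: eq_Rintegral => z _; rewrite mul1r.
Unshelve. all: end_near. Qed.

End poisson.

Lemma fubini_swap d1 d2 (T1 : measurableType d1) (T2 : measurableType d2) (R : realType)
  (m1 : {sigma_finite_measure set T1 -> \bar R}) (m2 : {sigma_finite_measure set T2 -> \bar R})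
  (H : T1 -> T2 -> R) :
  measurable_fun [set: T1 * T2] (fun z => H z.1 z.2) ->
  (\int[m1]_x \int[m2]_y `|H x y|%:E < +oo)%E ->
  (\int[m1]_x \int[m2]_y (H x y)%:E = \int[m2]_y \int[m1]_x (H x y)%:E)%E.
Proof.
move=> mH fH.
have mE : measurable_fun [set: T1 * T2] (fun z => (H z.1 z.2)%:E) by exact/measurable_EFinP.
have iH : (m1 \x m2)%E.-integrable setT (fun z : T1 * T2 => (H z.1 z.2)%:E).
  exact: (integrable12ltyP m1 m2 mE).2 fH.
exact: (Fubini iH).
Qed.

(** * The TT* argument with Schur's test, for a kernel supported over a set of finite measure *)

Section schur.
Context d1 d2 (W : measurableType d1) (Z : measurableType d2) (R : realType).
Variables (nu : {sigma_finite_measure set W -> \bar R}) (mu : {sigma_finite_measure set Z -> \bar R}).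
Variables (a : W -> Z -> R) (f : Z -> R) (S : set W) (h : W -> R) (K C : R).
Hypothesis ma : measurable_fun [set: W * Z] (fun x => a x.1 x.2).
Hypothesis mf : measurable_fun setT f.
Hypothesis mS : measurable S.
(** The finite measure of S and the bound K serve to justify every use of Fubini's theorem and the
    finiteness of the integral of F^2; the resulting estimate depends on C alone and so passes to
    the limit along exhausting sets S. *)
Hypothesis nuS : (nu S < +oo)%E.
Hypothesis aS : forall w z, ~ S w -> a w z = 0.
Hypothesis K0 : 0 <= K.
Hypothesis aK : forall w z, `|a w z| <= K.
Hypothesis afK : forall w, (\int[mu]_z (`|a w z| * `|f z|)%:E <= K%:E)%E.
Hypothesis aaK : forall w w', (\int[mu]_z (`|a w z| * `|a w' z|)%:E <= K%:E)%E.
Hypothesis mh : measurable_fun setT h.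
Hypothesis h0 : forall w, 0 < h w.
Hypothesis C0 : 0 < C.
Let gram w w' : R := \int[mu]_z (a w z * a w' z).
Hypothesis schurC : forall w, S w -> (\int[nu]_w' (`|gram w w'| * h w')%:E <= (C * h w)%:E)%E.
Hypothesis f2 : (\int[mu]_z (f z ^+ 2)%:E < +oo)%E.

(** If T is the operator with kernel a, then F is T f and G is the adjoint of T applied to F. So the
    integral of F^2 equals that of f G, and T G is obtained from F through [gram]. *)
Let F w : R := \int[mu]_z (a w z * f z).
Let G z : R := \int[nu]_w (a w z * F w).

Let mparamE d (X : measurableType d) (H : X -> Z -> R) :
  measurable_fun [set: X * Z] (fun x => H x.1 x.2) ->
  measurable_fun setT (fun x => \int[mu]_z (H x z)%:E)%E.
Proof.
move=> mH; have mE : measurable_fun [set: X * Z] (fun x => (H x.1 x.2)%:E) by exact/measurable_EFinP.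
under eq_fun do rewrite integralE.
apply: emeasurable_funB.
  have /= := measurable_fun_fubini_tonelli_F (m2 := mu) _ (measurable_funepos mE) (fun x => funepos_ge0 _ x).
  by congr measurable_fun; apply/funext => x; apply: eq_integral => z _; rewrite !funeposE.
have /= := measurable_fun_fubini_tonelli_F (m2 := mu) _ (measurable_funeneg mE) (fun x => funeneg_ge0 _ x).
by congr measurable_fun; apply/funext => x; apply: eq_integral => z _; rewrite !funenegE.
Qed.

Let mparam d (X : measurableType d) (H : X -> Z -> R) :
  measurable_fun [set: X * Z] (fun x => H x.1 x.2) -> measurable_fun setT (fun x => \int[mu]_z H x z).
Proof. by move=> mH; rewrite /Rintegral; apply: measurableT_comp => //; exact: mparamE. Qed.

Let mparamW d (X : measurableType d) (H : X -> W -> R) :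
  measurable_fun [set: X * W] (fun x => H x.1 x.2) -> measurable_fun setT (fun x => \int[nu]_w H x w).
Proof.
move=> mH; rewrite /Rintegral; apply: measurableT_comp => //.
have mE : measurable_fun [set: X * W] (fun x => (H x.1 x.2)%:E) by exact/measurable_EFinP.
under eq_fun do rewrite integralE.
apply: emeasurable_funB.
  have /= := measurable_fun_fubini_tonelli_F (m2 := nu) _ (measurable_funepos mE) (fun x => funepos_ge0 _ x).
  by congr measurable_fun; apply/funext => x; apply: eq_integral => z _; rewrite !funeposE.
have /= := measurable_fun_fubini_tonelli_F (m2 := nu) _ (measurable_funeneg mE) (fun x => funeneg_ge0 _ x).
by congr measurable_fun; apply/funext => x; apply: eq_integral => z _; rewrite !funenegE.
Qed.

(** No integrability is asked for: when the integral is not finite, [fine] makes the left-hand side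
    0. *)
Lemma le_Rintegral_norm d (T : measurableType d) (m : {measure set T -> \bar R}) (u : T -> R) :
  measurable_fun setT u -> (`|\int[m]_x u x|%:E <= \int[m]_x `|u x|%:E)%E.
Proof.
move=> mu'; have mE : measurable_fun setT (fun x => (u x)%:E) by exact/measurable_EFinP.
have [fi|nfi] := boolP ((\int[m]_x (u x)%:E)%E \is a fin_num).
  by rewrite /Rintegral -fine_abse// fineK ?abse_fin_num//; exact: le_abse_integral.
rewrite /Rintegral (_ : fine _ = 0); first by rewrite normr0; exact: integral_ge0.
by move: nfi; case: (X in fine X).
Qed.

Let mF : measurable_fun setT F.
Proof.
apply: mparam; apply: measurable_funM => //.
exact: (measurableT_comp mf measurable_snd).
Qed.

Let maw w : measurable_fun setT (a w).
Proof. exact: (measurableT_comp ma (pair1_measurable w)). Qed.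

Let maz z : measurable_fun setT (a ^~ z).
Proof. exact: (measurableT_comp ma (pair2_measurable z)). Qed.

Let FK w : `|F w| <= K.
Proof.
rewrite -lee_fin; apply: le_trans (le_Rintegral_norm _ _) _.
  by apply: measurable_funM => //; exact: maw.
by under eq_integral do rewrite normrM; exact: afK.
Qed.

Let FS w : ~ S w -> F w = 0.
Proof.
by move=> nS; rewrite /F /Rintegral integral0_eq// => z _; rewrite aS// mul0r.
Qed.

Let mG : measurable_fun setT G.
Proof.
apply: mparamW; apply: measurable_funM.
  exact: (measurableT_comp ma (measurable_fun_pair measurable_snd measurable_fst)).
exact: (measurableT_comp mF measurable_snd).
Qed.

Let intS (u : W -> \bar R) (M : R) : 0 <= M -> (forall w, 0 <= u w)%E -> (forall w, ~ S w -> u w = 0%E) ->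
  (forall w, u w <= M%:E)%E -> (\int[nu]_w u w < +oo)%E.
Proof.
move=> M0 u0 uS uM; apply: (@le_lt_trans _ _ (\int[nu]_(w in S) (cst M%:E) w)%E).
  rewrite [leRHS]integral_mkcond; apply: ge0_le_integral_any => w _ //.
  rewrite patchE; case: ifPn => [_|]; first exact: uM.
  by move/negP => nS; rewrite uS// => Sw; apply: nS; rewrite inE.
by rewrite integral_cst// lte_mul_pinfty// lee_fin.
Qed.

Let I := (\int[nu]_w (F w ^+ 2)%:E)%E.

Let Ifin : (I < +oo)%E.
Proof.
apply: (@intS _ (K ^+ 2)) => [|w|w nS|w]; rewrite ?lee_fin ?sqr_ge0//.
  by rewrite FS// expr0n.
by rewrite -[leLHS]real_normK ?num_real// ler_sqr ?nnegrE.
Qed.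

Let intaf w : mu.-integrable setT (fun z => (a w z * f z)%:E).
Proof.
apply/integrableP; split.
  by apply/measurable_EFinP; apply: measurable_funM => //; exact: maw.
apply: le_lt_trans (ltry K); under eq_integral do rewrite /= normrM; exact: afK.
Qed.

Let intaF z : nu.-integrable setT (fun w => (a w z * F w)%:E).
Proof.
apply/integrableP; split.
  by apply/measurable_EFinP; apply: measurable_funM => //; exact: maz.
apply: (@intS _ (K * K)) => [|w|w nS|w] //=; rewrite ?mulr_ge0//.
  by rewrite FS// mulr0 normr0.
by rewrite lee_fin normrM ler_pM.
Qed.

Let intaa w w' : mu.-integrable setT (fun z => (a w z * a w' z)%:E).
Proof.
apply/integrableP; split.
  by apply/measurable_EFinP; apply: measurable_funM; exact: maw.
apply: le_lt_trans (ltry K); under eq_integral do rewrite /= normrM; exact: aaK.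
Qed.

Let c1 : measurable_fun [set: W * Z] (fun x => F x.1).
Proof. exact: (measurableT_comp mF measurable_fst). Qed.

Let mabs (u v : Z -> R) : measurable_fun setT u -> measurable_fun setT v ->
  measurable_fun setT (fun z => (`|u z| * `|v z|)%:E).
Proof.
move=> mu' mv; apply/measurable_EFinP.
by apply: measurable_funM; exact: measurableT_comp.
Qed.

Let E1 : I = (\int[mu]_z (f z * G z)%:E)%E.
Proof.
pose H w z := F w * (a w z * f z).
have mH : measurable_fun [set: W * Z] (fun x => H x.1 x.2).
  apply: measurable_funM => //; apply: measurable_funM => //.
  exact: (measurableT_comp mf measurable_snd).
have fH : (\int[nu]_w \int[mu]_z `|H w z|%:E < +oo)%E.
  apply: (@intS _ (K * K)) => [|w|w nS|w]; rewrite ?mulr_ge0//.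
  - exact: integral_ge0.
  - by rewrite integral0_eq// => z _; rewrite /H FS// mul0r normr0.
  rewrite (eq_integral (fun z => `|F w|%:E * (`|a w z| * `|f z|)%:E)%E); last first.
    by move=> z _; rewrite -EFinM /H !normrM.
  rewrite ge0_integralZl_EFin//; last exact: mabs.
  apply: le_trans (lee_wpmul2l _ (afK w)) _ => //.
  by rewrite -EFinM lee_fin ler_wpM2r.
have sw := fubini_swap mH fH.
transitivity (\int[nu]_w \int[mu]_z (H w z)%:E)%E.
  apply: eq_integral => w _; rewrite /H.
  under [RHS]eq_integral do rewrite EFinM.
  rewrite integralZl//= expr2 EFinM; congr (_ * _)%E.
  by rewrite /F /Rintegral fineK//; exact: integrable_fin_num.
rewrite sw; apply: eq_integral => z _; rewrite /H.
rewrite (eq_integral (fun w => (f z)%:E * (a w z * F w)%:E)%E); last first.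
  by move=> w _; rewrite -EFinM; congr EFin; ring.
rewrite integralZl//= EFinM; congr (_ * _)%E.
by rewrite /G /Rintegral fineK//; exact: integrable_fin_num.
Qed.

Let GE w : (\int[mu]_z (a w z * G z)%:E = \int[nu]_w' (F w' * gram w w')%:E)%E.
Proof.
pose H w' z := F w' * (a w z * a w' z).
have mH : measurable_fun [set: W * Z] (fun x => H x.1 x.2).
  apply: measurable_funM => //; apply: measurable_funM => //.
  exact: (measurableT_comp (maw w) measurable_snd).
have fH : (\int[nu]_w' \int[mu]_z `|H w' z|%:E < +oo)%E.
  apply: (@intS _ (K * K)) => [|w'|w' nS|w']; rewrite ?mulr_ge0//.
  - exact: integral_ge0.
  - by rewrite integral0_eq// => z _; rewrite /H FS// mul0r normr0.
  rewrite (eq_integral (fun z => `|F w'|%:E * (`|a w z| * `|a w' z|)%:E)%E); last first.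
    by move=> z _; rewrite -EFinM /H !normrM.
  rewrite ge0_integralZl_EFin//; last exact: mabs.
  apply: le_trans (lee_wpmul2l _ (aaK w w')) _ => //.
  by rewrite -EFinM lee_fin ler_wpM2r.
have sw := fubini_swap mH fH.
transitivity (\int[mu]_z \int[nu]_w' (H w' z)%:E)%E.
  apply: eq_integral => z _; rewrite /H.
  under [RHS]eq_integral do rewrite mulrCA (mulrC (F _)) EFinM.
  rewrite integralZl//= EFinM; congr (_ * _)%E.
  by rewrite /G /Rintegral fineK//; exact: integrable_fin_num.
rewrite -sw; apply: eq_integral => w' _; rewrite /H.
under eq_integral do rewrite EFinM.
rewrite integralZl//= EFinM; congr (_ * _)%E.
by rewrite /gram /Rintegral fineK//; exact: integrable_fin_num.
Qed.

Let mgram : measurable_fun [set: W * W] (fun x => gram x.1 x.2).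
Proof.
apply: (mparam (H := fun (x : W * W) z => a x.1 z * a x.2 z)); apply: measurable_funM.
  apply: (measurableT_comp ma (measurable_fun_pair _ measurable_snd)).
  exact: (measurableT_comp measurable_fst measurable_fst).
apply: (measurableT_comp ma (measurable_fun_pair _ measurable_snd)).
exact: (measurableT_comp measurable_snd measurable_fst).
Qed.

Let J := (\int[nu]_w \int[nu]_w' (`|F w| * `|F w'| * `|gram w w'|)%:E)%E.

(** Expanding one factor G and exchanging the integrals gives the integral of F times T G, that is,
    the quadratic form of [gram] in F. *)
Let E2 : (\int[mu]_z (G z ^+ 2)%:E <= J)%E.
Proof.
pose H w z := F w * (a w z * G z).
have mH : measurable_fun [set: W * Z] (fun x => H x.1 x.2).
  apply: measurable_funM => //; apply: measurable_funM => //.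
  exact: (measurableT_comp mG measurable_snd).
have nuSf : nu S \is a fin_num by rewrite ge0_fin_numE.
pose M := K * (K * fine (nu S)).
have M0 : 0 <= M by rewrite !mulr_ge0// fine_ge0.
(* Absolute convergence: G is expanded once more, and the integrals of |a w| |a w'| and of |F| over
   S are bounded. *)
have aGM w : (\int[mu]_z (`|a w z| * `|G z|)%:E <= M%:E)%E.
  apply: (@le_trans _ _ (\int[mu]_z \int[nu]_w' (`|F w'| * (`|a w z| * `|a w' z|))%:E)%E).
    apply: ge0_le_integral_any => z _; first by rewrite lee_fin mulr_ge0.
    rewrite (eq_integral (fun w' => `|a w z|%:E * `|a w' z * F w'|%:E)%E); last first.
      by move=> w' _; rewrite -EFinM normrM; congr EFin; ring.
    rewrite ge0_integralZl_EFin//; last first.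
      by apply/measurable_EFinP; apply: measurableT_comp => //; apply: measurable_funM => //; exact: maz.
    rewrite EFinM lee_wpmul2l//; apply: le_Rintegral_norm; apply: measurable_funM => //; exact: maz.
  pose H2 (w' : W) (z : Z) := (`|F w'| * (`|a w z| * `|a w' z|))%:E.
  have mH2 : measurable_fun [set: W * Z] (fun x => H2 x.1 x.2).
    apply/measurable_EFinP; apply: measurable_funM; first exact: measurableT_comp.
    apply: measurable_funM; last exact: measurableT_comp.
    by apply: measurableT_comp => //; exact: (measurableT_comp (maw w) measurable_snd).
  have H20 w' z : (0 <= H2 w' z)%E by rewrite lee_fin !mulr_ge0.
  rewrite -(tonelli_dom nu mu measurableT measurableT mH2 H20).
  apply: (@le_trans _ _ (\int[nu]_(w' in S) (cst (K * K)%:E) w')%E).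
    rewrite [leRHS]integral_mkcond; apply: ge0_le_integral_any => w' _; first exact: integral_ge0.
    rewrite patchE; case: ifPn => [_|].
      rewrite /H2; under eq_integral do rewrite EFinM.
      rewrite ge0_integralZl_EFin//; last exact: mabs.
      apply: le_trans (lee_wpmul2l _ (aaK w w')) _ => //.
      by rewrite -EFinM lee_fin ler_wpM2r.
    by rewrite notin_setE => nS; rewrite integral0_eq// => z _; rewrite /H2 FS// normr0 mul0r.
  by rewrite integral_cst// /M mulrA (EFinM (K * K)) fineK.
have fH : (\int[nu]_w \int[mu]_z `|H w z|%:E < +oo)%E.
  apply: (@intS _ (K * M)) => [|w|w nS|w]; rewrite ?(mulr_ge0 K0 M0)//.
  - exact: integral_ge0.
  - by rewrite integral0_eq// => z _; rewrite /H FS// mul0r normr0.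
  rewrite (eq_integral (fun z => `|F w|%:E * (`|a w z| * `|G z|)%:E)%E); last first.
    by move=> z _; rewrite -EFinM /H !normrM.
  rewrite ge0_integralZl_EFin//; last exact: mabs.
  apply: le_trans (lee_wpmul2l _ (aGM w)) _ => //.
  by rewrite -EFinM lee_fin ler_wpM2r.
have intaG w : mu.-integrable setT (fun z => (a w z * G z)%:E).
  apply/integrableP; split.
    by apply/measurable_EFinP; apply: measurable_funM => //; exact: maw.
  apply: le_lt_trans (ltry M); under eq_integral do rewrite /= normrM; exact: aGM.
have sw := fubini_swap mH fH.
have -> : (\int[mu]_z (G z ^+ 2)%:E = \int[nu]_w \int[mu]_z (H w z)%:E)%E.
  rewrite sw; apply: eq_integral => z _; rewrite /H.
  rewrite [RHS](eq_integral (fun w => (G z)%:E * (a w z * F w)%:E)%E); last first.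
    by move=> w _; rewrite -EFinM; congr EFin; ring.
  rewrite integralZl//= expr2 EFinM; congr (_ * _)%E.
  by rewrite /G /Rintegral fineK//; exact: integrable_fin_num.
apply: le_trans (lee_abs _) _; apply: le_trans (le_abse_integral _ _ _) _ => //.
  exact: mparamE.
apply: ge0_le_integral_any => w _ //.
rewrite /H; under eq_integral do rewrite EFinM.
rewrite integralZl//= GE abseM.
rewrite [leRHS](eq_integral (fun w' => `|F w|%:E * (`|F w'| * `|gram w w'|)%:E)%E); last first.
  by move=> w' _; rewrite -EFinM mulrA.
have mg : measurable_fun setT (fun w' => F w' * gram w w').
  by apply: measurable_funM => //; exact: (measurableT_comp mgram (pair1_measurable w)).
rewrite [leRHS]ge0_integralZl_EFin//; last first.
  by apply/measurable_EFinP; under eq_fun do rewrite -normrM; exact: measurableT_comp.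
rewrite lee_wpmul2l//; apply: le_trans (le_abse_integral _ _ _) _ => //.
  exact/measurable_EFinP.
by under eq_integral do rewrite /= normrM.
Qed.

Let gramC w w' : gram w w' = gram w' w.
Proof. by apply: eq_Rintegral => z _; rewrite mulrC. Qed.

(** Schur's test. The weighted inequality 2 |F(w)| |F(w')| <= F(w)^2 h(w') / h(w) + F(w')^2 h(w) /
    h(w') splits J into two halves, exchanged by the symmetry of [gram]; each is at most C I / 2 by
    [schurC]. *)
Let E3 : (J <= C%:E * I)%E.
Proof.
pose P w w' := (2^-1 * (F w ^+ 2 / h w * (`|gram w w'| * h w')))%:E.
have mg1 : measurable_fun [set: W * W] (fun x => `|gram x.1 x.2|) by exact: measurableT_comp.
have mhi : measurable_fun setT (fun w => F w ^+ 2 / h w).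
  apply: measurable_funM; first exact: measurable_funX.
  rewrite (_ : (fun w => (h w)^-1) = (fun w => h w `^ (-1))).
    exact: (measurableT_comp (measurable_powR _)).
  by apply/funext => w; rewrite powR_inv1// ltW.
have mP : measurable_fun [set: W * W] (fun x => P x.1 x.2).
  apply/measurable_EFinP; apply: measurable_funM => //; apply: measurable_funM.
    exact: (measurableT_comp mhi measurable_fst).
  by apply: measurable_funM => //; exact: (measurableT_comp mh measurable_snd).
have P0 w w' : (0 <= P w w')%E.
  rewrite lee_fin mulr_ge0// mulr_ge0//; first by rewrite divr_ge0 ?sqr_ge0 ?(ltW (h0 _)).
  by rewrite mulr_ge0 ?(ltW (h0 _)).
have step : (J <= \int[nu]_w \int[nu]_w' (P w w' + P w' w))%E.
  apply: ge0_le_integral_any => w _; first by apply: integral_ge0 => w' _; rewrite lee_fin !mulr_ge0.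
  apply: ge0_le_integral_any => w' _; first by rewrite lee_fin !mulr_ge0.
  rewrite -EFinD lee_fin (gramC w' w).
  have := h0 w; have := h0 w'; have := normr_ge0 (gram w w').
  rewrite -(real_normK (num_real (F w))) -(real_normK (num_real (F w'))).
  move: (`|F w|) (`|F w'|) (`|gram w w'|) (h w) (h w') => x y g p q g0 q0 p0.
  rewrite -subr_ge0.
  have -> : 2^-1 * (x ^+ 2 / p * (g * q)) + 2^-1 * (y ^+ 2 / q * (g * p)) - x * y * g =
     2^-1 * g * (x * q - y * p) ^+ 2 / (p * q).
    by field; rewrite !gt_eqF.
  by rewrite divr_ge0//; [rewrite mulr_ge0 ?sqr_ge0// mulr_ge0|rewrite mulr_ge0// ltW].
have half : (\int[nu]_w \int[nu]_w' P w w' <= (2^-1 * C)%:E * I)%E.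
  apply: (@le_trans _ _ (\int[nu]_w ((2^-1 * C)%:E * (F w ^+ 2)%:E))%E); last first.
    rewrite ge0_integralZl_EFin//; last 3 first.
    - by move=> w _; rewrite lee_fin sqr_ge0.
    - by apply/measurable_EFinP; exact: measurable_funX.
    - by rewrite mulr_ge0// ltW.
  apply: ge0_le_integral_any => w _; first exact: integral_ge0.
  have [Sw|nS] := pselect (S w); last first.
    rewrite FS// expr0n/= mule0 integral0_eq// => w' _.
    by rewrite /P FS// expr0n/= mul0r mul0r mulr0.
  rewrite (eq_integral (fun w' => (2^-1 * (F w ^+ 2 / h w))%:E * (`|gram w w'| * h w')%:E)%E); last first.
    by move=> w' _; rewrite -EFinM /P; congr EFin; ring.
  rewrite ge0_integralZl_EFin//; last 3 first.
  - by move=> w' _; rewrite lee_fin mulr_ge0// ltW.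
  - apply/measurable_EFinP; apply: measurable_funM => //.
    exact: (measurableT_comp mg1 (pair1_measurable w)).
  - by rewrite mulr_ge0// divr_ge0 ?sqr_ge0 ?(ltW (h0 _)).
  apply: le_trans (lee_wpmul2l _ (schurC Sw)) _.
    by rewrite lee_fin mulr_ge0// divr_ge0 ?sqr_ge0 ?(ltW (h0 _)).
  by rewrite -!EFinM lee_fin le_eqVlt; apply/orP; left; apply/eqP; field; rewrite gt_eqF.
apply: le_trans step _.
rewrite (eq_integral (fun w => \int[nu]_w' P w w' + \int[nu]_w' P w' w)%E); last first.
  move=> w _; rewrite ge0_integralD//.
    exact: (measurableT_comp mP (pair1_measurable w)).
  exact: (measurableT_comp mP (pair2_measurable w)).
rewrite ge0_integralD//; last 4 first.
- by move=> w _; exact: integral_ge0.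
- exact: (measurable_fun_fubini_tonelli_F (m2 := nu) (fun x : W * W => P x.1 x.2) mP (fun x => P0 x.1 x.2)).
- by move=> w _; exact: integral_ge0.
- exact: (measurable_fun_fubini_tonelli_G (m1 := nu) (fun x : W * W => P x.1 x.2) mP (fun x => P0 x.1 x.2)).
rewrite -(tonelli_dom nu nu measurableT measurableT mP P0).
apply: le_trans (leeD half half) _.
rewrite -ge0_muleDl ?lee_fin ?mulr_ge0// ?(ltW C0)// -EFinD -mulrDl.
by rewrite (_ : 2^-1 + 2^-1 = 1 :> R) ?mul1r//; field.
Qed.

(* The square integral of F is absorbed: int f G <= C/2 int f^2 + 1/(2C) int G^2,
   and int G^2 <= C int F^2 by Schur's test. *)
Lemma schur_TTstar : (\int[nu]_w (F w ^+ 2)%:E <= C%:E * \int[mu]_z (f z ^+ 2)%:E)%E.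
Proof.
rewrite -/I.
have I0 : (0 <= I)%E by apply: integral_ge0 => w _; rewrite lee_fin sqr_ge0.
have Ifn : I \is a fin_num by rewrite ge0_fin_numE.
set B := (\int[mu]_z (f z ^+ 2)%:E)%E.
have Bf : (B < +oo)%E := f2.
have B0 : (0 <= B)%E by apply: integral_ge0 => w _; rewrite lee_fin sqr_ge0.
have Bfn : B \is a fin_num by rewrite ge0_fin_numE.
have mf2 : measurable_fun setT (fun z => (f z ^+ 2)%:E) by apply/measurable_EFinP; exact: measurable_funX.
have mG2 : measurable_fun setT (fun z => (G z ^+ 2)%:E) by apply/measurable_EFinP; exact: measurable_funX.
have key : (I <= (C / 2)%:E * B + ((2 * C)^-1)%:E * (C%:E * I))%E.
  apply: (@le_trans _ _ (\int[mu]_z ((C / 2)%:E * (f z ^+ 2)%:E + ((2 * C)^-1)%:E * (G z ^+ 2)%:E))%E).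
    rewrite E1; apply: le_trans (lee_abs _) _; apply: le_trans (le_abse_integral _ _ _) _ => //.
      by apply/measurable_EFinP; exact: measurable_funM.
    apply: ge0_le_integral_any => z _ //.
    rewrite -!EFinM -EFinD lee_fin normrM.
    rewrite -(real_normK (num_real (f z))) -(real_normK (num_real (G z))).
    move: (`|f z|) (`|G z|) => x y; rewrite -subr_ge0.
    have -> : C / 2 * x ^+ 2 + (2 * C)^-1 * y ^+ 2 - x * y = (C * x - y) ^+ 2 / (2 * C).
      by field; rewrite gt_eqF.
    by rewrite divr_ge0 ?sqr_ge0// mulr_ge0// ltW.
  rewrite ge0_integralD//; last 4 first.
  - by move=> z _; rewrite -EFinM lee_fin mulr_ge0 ?sqr_ge0// divr_ge0// ltW.
  - exact: emeasurable_funM.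
  - by move=> z _; rewrite -EFinM lee_fin mulr_ge0 ?sqr_ge0// invr_ge0 mulr_ge0// ltW.
  - exact: emeasurable_funM.
  rewrite !ge0_integralZl_EFin//; try (by move=> z _; rewrite lee_fin sqr_ge0);
    try (by rewrite ?invr_ge0 mulr_ge0// ltW).
  apply: leeD => //; rewrite lee_wpmul2l ?lee_fin ?invr_ge0 ?mulr_ge0 ?(ltW C0)//.
  exact: le_trans E2 E3.
move: key; rewrite -(fineK Ifn) -(fineK Bfn) -!EFinM -EFinD !lee_fin.
rewrite (_ : (2 * C)^-1 * (C * fine I) = fine I / 2); last by field; rewrite gt_eqF.
by move: (fine I) (fine B) => i b; lra.
Qed.

End schur.

Lemma integral_powR_gt (R : realType) (a r : R) : 0 < a -> 0 < r ->
  (\int[lebesgue_measure]_(x in `]r, +oo[) (x `^ (- a - 1))%:E = (a^-1 * r `^ (- a))%:E)%E.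
Proof.
move=> a0 r0; have := @integral_shift_powR R 0 a r a0; rewrite add0r => /(_ r0).
rewrite (_ : (fun x : R => ((0 + x) `^ (- a - 1))%:E) = (fun x : R => (x `^ (- a - 1))%:E))//.
by apply/funext => x; rewrite add0r.
Qed.

(** * Almost orthogonality of the kernels at different scales *)

Section square_function.
Variables (R : realType) (n : nat).
Local Notation V := 'rV[R]_n.+1.
Local Notation Rn := (Rn R n.+1).
Local Notation mu := (@lebn R n.+1).
Local Notation leb := (@lebesgue_measure R).
Local Notation N := (n.+1%:R : R).
Implicit Types (t a b : R) (f g : Rn -> R).

Local Notation sigmaRn := (mu : {sigma_finite_measure set Rn -> \bar R}).

Lemma sqrt_dst_Wk_le t (y z : V) : 0 < t -> Num.sqrt (dst y z) * Wk 1 t y z <= Wk (1/2) t y z.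
Proof.
move=> t0; have d0 := dst_ge0 y z; have T0 : 0 < t + dst y z by rewrite ltr_wpDr.
rewrite (_ : Wk 1 t y z = Wk (1/2 + 1/2) t y z); last by congr Wk; field.
rewrite Wk_split// mulrCA ler_piMr ?Wk_ge0//.
rewrite powRN div1r powR12_sqrt ?(ltW T0)// ler_pdivrMr ?sqrtr_gt0// mul1r ler_sqrt//.
  by rewrite lerDr ltW.
exact: ltW.
Qed.

Lemma Kern_bounded t (y z : V) : 0 < t -> `|Kern t y z| <= KernC R n * t `^ (- (N + 1)).
Proof.
move=> t0; apply: le_trans (Kern_le y z t0) _.
by rewrite ler_wpM2l ?KernC_ge0// Wk_le.
Qed.

Definition gramC : R := KernC3 R n * KernC R n * (2 * (WkC n (3/2) * WkC n (1/2))).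

Lemma WkC_gt0 a : 0 < a -> 0 < WkC n a :> R.
Proof. by move=> a0; rewrite mulr_gt0 ?exprn_gt0// divr_gt0// ltr_wpDl. Qed.

Lemma KernC_gt0 : 0 < KernC R n.
Proof. by rewrite mulr_gt0 ?powR_gt0// ltr_wpDr. Qed.

Lemma gramC_gt0 : 0 < gramC.
Proof.
have h1 := KernC_gt0; have h2 : 0 < KernC3 R n.
  by rewrite ltr_wpDl ?KernC2_ge0// mulr_gt0.
by rewrite /gramC !mulr_gt0// WkC_gt0.
Qed.

Lemma integral_iter_le (p : Rn -> R) (q : Rn -> Rn -> R) (A B : R) :
  measurable_fun setT p -> measurable_fun [set: Rn * Rn] (fun x => q x.1 x.2) ->
  (forall u, 0 <= p u) -> (forall u v, 0 <= q u v) -> 0 <= B ->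
  (\int[mu]_u (p u)%:E <= A%:E)%E -> (forall u, \int[mu]_v (q u v)%:E <= B%:E)%E ->
  (\int[mu]_u \int[mu]_v (p u * q u v)%:E <= (A * B)%:E)%E.
Proof.
move=> mp mq p0 q0 B0 pA qB.
apply: (@le_trans _ _ (\int[mu]_u (B%:E * (p u)%:E))%E); last first.
  rewrite ge0_integralZl_EFin//; last 2 first.
  - by move=> u _; rewrite lee_fin.
  - exact/measurable_EFinP.
  by rewrite mulrC EFinM lee_wpmul2l.
apply: ge0_le_integral_any => u _; first by apply: integral_ge0 => v _; rewrite lee_fin mulr_ge0.
under eq_integral do rewrite EFinM.
rewrite ge0_integralZl_EFin//; last 2 first.
- by move=> v _; rewrite lee_fin.
- by apply/measurable_EFinP; exact: (measurableT_comp mq (pair1_measurable u)).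
by rewrite [leRHS]muleC lee_wpmul2l// lee_fin.
Qed.

Section double_kernel.
Variables (A B : Rn -> Rn -> R) (a b : R).
Hypothesis mA : measurable_fun [set: Rn * Rn] (fun x => A x.1 x.2).
Hypothesis mB : measurable_fun [set: Rn * Rn] (fun x => B x.1 x.2).
Hypothesis A0 : forall u v, 0 <= A u v.
Hypothesis B0 : forall u v, 0 <= B u v.
Hypothesis AC : forall u v, A u v = A v u.
Hypothesis BC : forall u v, B u v = B v u.
Hypothesis a0 : 0 <= a.
Hypothesis b0 : 0 <= b.
Hypothesis Aa : forall u, (\int[mu]_v (A u v)%:E <= a%:E)%E.
Hypothesis Bb : forall u, (\int[mu]_v (B u v)%:E <= b%:E)%E.

Let mA1 u : measurable_fun setT (A u).
Proof. exact: (measurableT_comp mA (pair1_measurable u)). Qed.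
Let mB1 u : measurable_fun setT (B u).
Proof. exact: (measurableT_comp mB (pair1_measurable u)). Qed.
Let mA2 u : measurable_fun setT (A ^~ u).
Proof. exact: (measurableT_comp mA (pair2_measurable u)). Qed.
Let mBs : measurable_fun [set: Rn * Rn] (fun x => B x.2 x.1).
Proof. by under eq_fun do rewrite BC. Qed.
Let mAs : measurable_fun [set: Rn * Rn] (fun x => A x.2 x.1).
Proof. by under eq_fun do rewrite AC. Qed.

Let split_sum (F G : Rn -> Rn -> R) :
  measurable_fun [set: Rn * Rn] (fun x => F x.1 x.2) ->
  measurable_fun [set: Rn * Rn] (fun x => G x.1 x.2) ->
  (forall u v, 0 <= F u v) -> (forall u v, 0 <= G u v) ->
  (\int[mu]_u \int[mu]_v (F u v + G u v)%:E =
   \int[mu]_u \int[mu]_v (F u v)%:E + \int[mu]_u \int[mu]_v (G u v)%:E)%E.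
Proof.
move=> mF mG F0 G0.
have E x : (\int[mu]_v (F x v + G x v)%:E = \int[mu]_v (F x v)%:E + \int[mu]_v (G x v)%:E)%E.
  under eq_integral do rewrite EFinD.
  rewrite ge0_integralD//; try (by move=> v _; rewrite lee_fin).
    by apply/measurable_EFinP; exact: (measurableT_comp mF (pair1_measurable x)).
  by apply/measurable_EFinP; exact: (measurableT_comp mG (pair1_measurable x)).
under eq_integral do rewrite E.
rewrite ge0_integralD//; try (by move=> v _; apply: integral_ge0 => w _; rewrite lee_fin).
  apply: measurable_integral_param; first exact/measurable_EFinP.
  by move=> u v; rewrite lee_fin.
apply: measurable_integral_param; first exact/measurable_EFinP.
by move=> u v; rewrite lee_fin.
Qed.

(** In the term with A y y' the variable z is integrated first; in the term with A y z the order is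
    exchanged and y' goes first. Either way one factor a and one factor b result. *)
Lemma double_kernel_narrow y :
  (\int[mu]_y' \int[mu]_z ((A y y' + A y z) * B y' z)%:E <= (2 * (a * b))%:E)%E.
Proof.
under eq_integral do under eq_integral do rewrite mulrDl.
rewrite split_sum; last 4 first.
- by apply: measurable_funM => //; exact: (measurableT_comp (mA1 y) measurable_fst).
- by apply: measurable_funM => //; exact: (measurableT_comp (mA1 y) measurable_snd).
- by move=> u v; rewrite mulr_ge0.
- by move=> u v; rewrite mulr_ge0.
rewrite mulr_natl mulr2n EFinD; apply: leeD; first exact: integral_iter_le.
rewrite (tonelli_dom sigmaRn sigmaRn measurableT measurableT (F := fun y' z => (A y z * B y' z)%:E)).
- apply: (integral_iter_le (q := fun z y' => B y' z)) => // u.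
  by under eq_integral do rewrite BC.
- apply/measurable_EFinP; apply: measurable_funM => //.
  exact: (measurableT_comp (mA1 y) measurable_snd).
- by move=> u v; rewrite lee_fin mulr_ge0.
Qed.

Lemma double_kernel_wide y' :
  (\int[mu]_y \int[mu]_z ((A y y' + A y z) * B y' z)%:E <= (2 * (a * b))%:E)%E.
Proof.
under eq_integral do under eq_integral do rewrite mulrDl.
rewrite split_sum; last 4 first.
- apply: measurable_funM; first exact: (measurableT_comp (mA2 y') measurable_fst).
  exact: (measurableT_comp (mB1 y') measurable_snd).
- by apply: measurable_funM => //; exact: (measurableT_comp (mB1 y') measurable_snd).
- by move=> u v; rewrite mulr_ge0.
- by move=> u v; rewrite mulr_ge0.
rewrite mulr_natl mulr2n EFinD; apply: leeD.
  apply: (integral_iter_le (q := fun _ z => B y' z)) => //.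
    exact: (measurableT_comp (mB1 y') measurable_snd).
  by under eq_integral do rewrite AC.
rewrite (tonelli_dom sigmaRn sigmaRn measurableT measurableT (F := fun y z => (A y z * B y' z)%:E)).
- rewrite mulrC; under eq_integral do under eq_integral do rewrite mulrC.
  apply: (integral_iter_le (q := fun z y => A y z)) => // u.
  by under eq_integral do rewrite AC.
- apply/measurable_EFinP; apply: measurable_funM => //.
  exact: (measurableT_comp (mB1 y') measurable_snd).
- by move=> u v; rewrite lee_fin mulr_ge0.
Qed.

End double_kernel.

Let KK0 : 0 <= KernC3 R n * KernC R n.
Proof. by rewrite mulr_ge0 ?KernC_ge0// addr_ge0 ?KernC2_ge0// mulr_ge0// KernC_ge0. Qed.

(* The mean value of the narrow kernel vanishes, so only the increment of the wide one contributes. *)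
Lemma gram_Kern_le t t' (y y' : Rn) : 0 < t -> 0 < t' ->
  (`| \int[mu]_z (Kern t y z * Kern t' y' z) |%:E <=
   (KernC3 R n * KernC R n)%:E *
   \int[mu]_z ((Wk (3/2) t y y' + Wk (3/2) t y z) * Wk (1/2) t' y' z)%:E)%E.
Proof.
move=> t0 t'0.
have pk : poisson_integrable (fun z : Rn => Kern t y z).
  by apply: poisson_integrable_bounded; [exact: measurable_KernE|move=> z; exact: Kern_bounded].
have pc : poisson_integrable (fun z : Rn => - Kern t y y').
  by apply: poisson_integrable_bounded => // z; exact: lexx.
have pd : poisson_integrable (fun z : Rn => Kern t y z + - Kern t y y').
  apply: poisson_integrable_le pk pc _ _ => [|z]; last exact: ler_normD.
  by apply: measurable_funD => //; exact: measurable_KernE.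
have -> : \int[mu]_z (Kern t y z * Kern t' y' z) =
    Tk (fun z : Rn => Kern t y z + - Kern t y y') y' t'.
  rewrite (TkD y' pk pc t'0) /Tk [X in _ + X](_ : _ = 0) ?addr0//.
  rewrite RintegralZl//=; first by rewrite Rintegral_Kern0// mulr0.
  have := poisson_integrable_Kern y' (@poisson_integrable_bounded R n (fun=> 1) 1 _ _) t'0.
  under [X in integrable _ _ X]eq_fun do rewrite mul1r.
  by apply => // z; rewrite normr1.
apply: le_trans (Tk_le y' pd t'0) _.
rewrite -ge0_integralZl_EFin//; last 2 first.
- by move=> z _; rewrite lee_fin mulr_ge0 ?addr_ge0 ?Wk_ge0.
- apply/measurable_EFinP; apply: measurable_funM; last by have /measurable_EFinP := measurable_WkE (1/2) t' y'.
  by apply: measurable_funD => //; have /measurable_EFinP := measurable_WkE (3/2) t y.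
apply: ge0_le_integral_any => z _; first by rewrite lee_fin mulr_ge0.
rewrite -EFinM lee_fin.
apply: (@le_trans _ _ (KernC3 R n * (Num.sqrt (dst z y') * (Wk (3/2) t y z + Wk (3/2) t y y'))
    * (KernC R n * Wk 1 t' y' z))).
  by apply: ler_pM => //; [exact: Kern_sub_sqrt_le|exact: Kern_le].
rewrite (dstC z y').
have := sqrt_dst_Wk_le y' z t'0.
have W1 := Wk_ge0 (3/2) t y z; have W2 := Wk_ge0 (3/2) t y y'.
move: KK0 W1 W2.
move: (Num.sqrt _) (Wk 1 t' y' z) (Wk (1/2) t' y' z) (Wk (3/2) t y z) (Wk (3/2) t y y') => s w w' a b.
move: (KernC3 R n) (KernC R n) => k3 k kk a0 b0 h.
rewrite [leLHS](_ : _ = (k3 * k) * ((b + a) * (s * w))); last by ring.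
by rewrite ler_wpM2l// ler_wpM2l// addr_ge0.
Qed.

Let mWk2 a t : measurable_fun [set: Rn * Rn] (fun x => Wk a t x.1 x.2).
Proof. exact: (measurable_Wk _ (ft := cst t) (fy := fst) (fz := snd)). Qed.

Let WkS a t (u v : Rn) : Wk a t u v = Wk a t v u.
Proof. by rewrite /Wk dstC. Qed.

Let gramCE t t' : gramC * (t `^ (- (3/2)) * t' `^ (- (1/2))) =
  KernC3 R n * KernC R n * (2 * (WkC n (3/2) * t `^ (- (3/2)) * (WkC n (1/2) * t' `^ (- (1/2))))).
Proof. by rewrite /gramC; ring. Qed.

Let fin_le_mul (c x : R) (y : \bar R) : 0 <= c -> (y <= x%:E)%E -> (c%:E * y <= (c * x)%:E)%E.
Proof. by move=> c0 yx; rewrite EFinM lee_wpmul2l. Qed.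

Let mgk t t' (y y' : Rn -> Rn) : measurable_fun setT y -> measurable_fun setT y' ->
  measurable_fun setT (fun u : Rn => (\int[mu]_z ((Wk (3/2) t (y u) (y' u) + Wk (3/2) t (y u) z) * Wk (1/2) t' (y' u) z)%:E)%E).
Proof.
move=> my my'; apply: measurable_integral_param; last by move=> u v; rewrite lee_fin mulr_ge0 ?addr_ge0 ?Wk_ge0.
have m1 := measurableT_comp my (measurable_fst : measurable_fun [set: Rn * Rn] fst).
have m2 := measurableT_comp my' (measurable_fst : measurable_fun [set: Rn * Rn] fst).
apply/measurable_EFinP; apply: measurable_funM; last exact: (measurable_Wk _ (ft := cst t')).
by apply: measurable_funD; exact: (measurable_Wk _ (ft := cst t)).
Qed.

Lemma integral_gram_Kern_wide t t' (y' : Rn) : 0 < t -> 0 < t' ->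
  (\int[mu]_y `| \int[mu]_z (Kern t y z * Kern t' y' z) |%:E
    <= (gramC * (t `^ (- (3/2)) * t' `^ (- (1/2))))%:E)%E.
Proof.
move=> t0 t'0; rewrite gramCE.
have a0 : 0 <= WkC n (3/2) * t `^ (- (3/2)) by rewrite mulr_ge0 ?powR_ge0// WkC_ge0.
have b0 : 0 <= WkC n (1/2) * t' `^ (- (1/2)) by rewrite mulr_ge0 ?powR_ge0// WkC_ge0.
have Aa u : (\int[mu]_v (Wk (3/2) t u v)%:E <= (WkC n (3/2) * t `^ (- (3/2)))%:E)%E by exact: integral_Wk.
have Bb u : (\int[mu]_v (Wk (1/2) t' u v)%:E <= (WkC n (1/2) * t' `^ (- (1/2)))%:E)%E by exact: integral_Wk.
have DK := @double_kernel_wide (Wk (3/2) t) (Wk (1/2) t') _ _ (mWk2 (3/2) t) (mWk2 (1/2) t')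
  (@Wk_ge0 _ _ _ _) (@Wk_ge0 _ _ _ _) (WkS (3/2) t) a0 b0 Aa Bb y'.
apply: le_trans (fin_le_mul KK0 DK).
rewrite -ge0_integralZl_EFin//; last 2 first.
- by move=> y _; apply: integral_ge0 => z _; rewrite lee_fin mulr_ge0 ?addr_ge0 ?Wk_ge0.
- exact: (@mgk t t' id (cst y')).
by apply: ge0_le_integral_any => y _; [rewrite lee_fin|exact: gram_Kern_le].
Qed.

Lemma integral_gram_Kern_narrow t t' (y : Rn) : 0 < t -> 0 < t' ->
  (\int[mu]_y' `| \int[mu]_z (Kern t y z * Kern t' y' z) |%:E
    <= (gramC * (t `^ (- (3/2)) * t' `^ (- (1/2))))%:E)%E.
Proof.
move=> t0 t'0; rewrite gramCE.
have a0 : 0 <= WkC n (3/2) * t `^ (- (3/2)) by rewrite mulr_ge0 ?powR_ge0// WkC_ge0.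
have b0 : 0 <= WkC n (1/2) * t' `^ (- (1/2)) by rewrite mulr_ge0 ?powR_ge0// WkC_ge0.
have Aa u : (\int[mu]_v (Wk (3/2) t u v)%:E <= (WkC n (3/2) * t `^ (- (3/2)))%:E)%E by exact: integral_Wk.
have Bb u : (\int[mu]_v (Wk (1/2) t' u v)%:E <= (WkC n (1/2) * t' `^ (- (1/2)))%:E)%E by exact: integral_Wk.
have DK := @double_kernel_narrow (Wk (3/2) t) (Wk (1/2) t') _ _ (mWk2 (3/2) t) (mWk2 (1/2) t')
  (@Wk_ge0 _ _ _ _) (@Wk_ge0 _ _ _ _) (WkS (1/2) t') b0 Aa Bb y.
apply: le_trans (fin_le_mul KK0 DK).
rewrite -ge0_integralZl_EFin//; last 2 first.
- by move=> y' _; apply: integral_ge0 => z _; rewrite lee_fin mulr_ge0 ?addr_ge0 ?Wk_ge0.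
- exact: (@mgk t t' (cst y) id).
by apply: ge0_le_integral_any => y' _; [rewrite lee_fin|exact: gram_Kern_le].
Qed.

(* t' is integrated against the weight t'^-1/2, for which both ranges t' < t and t < t' converge. *)
Lemma schur_weight t (y : Rn) : 0 < t ->
  (\int[leb]_(t' in `]0%R, +oo[) \int[mu]_y'
     (Num.sqrt t * Num.sqrt t' * `| \int[mu]_z (Kern t y z * Kern t' y' z) | * t' `^ (- (1/2)))%:E
   <= (4 * gramC * t `^ (- (1/2)))%:E)%E.
Proof.
move=> t0.
have st0 : 0 < Num.sqrt t by rewrite sqrtr_gt0.
have gC := ltW gramC_gt0.
have sE : Num.sqrt t = t `^ (1/2) by rewrite div1r powR12_sqrt ?ltW.
have E t' : 0 < t' -> (\int[mu]_y' (Num.sqrt t * Num.sqrt t' * `| \int[mu]_z (Kern t y z * Kern t' y' z) | * t' `^ (- (1/2)))%:E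
   = (Num.sqrt t)%:E * \int[mu]_y' `| \int[mu]_z (Kern t y z * Kern t' y' z) |%:E)%E.
  move=> t'0; rewrite -ge0_integralZl_EFin//; last first.
    apply/measurable_EFinP; apply: measurableT_comp => //.
    apply: measurable_Rintegral_param; apply: measurable_funM.
      exact: (measurable_Kern (ft := cst t) (fy := cst y) (fz := snd)).
    exact: (measurable_Kern (ft := cst t') (fy := fst) (fz := snd)).
  apply: eq_integral => y' _; rewrite -EFinM; congr EFin.
  rewrite powRN div1r powR12_sqrt ?(ltW t'0)//; field.
  by rewrite gt_eqF// sqrtr_gt0.
(* The larger of the two times is treated as the wide scale and receives the exponent -3/2: [Q] is
   the bound for t' < t, and [Q'], with the roles exchanged, the one for t' >= t. Against the weight
   each integrates to 2 gramC t^(-1/2). *)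
pose Q t' := (Num.sqrt t * gramC * (t `^ (- (3/2)) * t' `^ (- (1/2))))%:E.
pose Q' t' := (Num.sqrt t * gramC * (t `^ (- (1/2)) * t' `^ (- (3/2))))%:E.
have mp (c d : R) (D : set (measurableTypeR R)) : measurable_fun D (fun t' => (c * (d * t' `^ (- (1/2))))%:E).
  by apply/measurable_EFinP; apply: measurable_funTS; apply: measurable_funM => //; apply: measurable_funM => //; exact: measurable_powR.
have mp' (c d : R) (D : set (measurableTypeR R)) : measurable_fun D (fun t' => (c * (d * t' `^ (- (3/2))))%:E).
  by apply/measurable_EFinP; apply: measurable_funTS; apply: measurable_funM => //; apply: measurable_funM => //; exact: measurable_powR.
have Q0 u : (0 <= Q u)%E by rewrite lee_fin mulr_ge0 ?(mulr_ge0 (sqrtr_ge0 t) gC)// mulr_ge0 ?powR_ge0.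
have Q'0 u : (0 <= Q' u)%E by rewrite lee_fin mulr_ge0 ?(mulr_ge0 (sqrtr_ge0 t) gC)// mulr_ge0 ?powR_ge0.
apply: (@le_trans _ _ (\int[leb]_(t' in `]0%R, t[) Q t' + \int[leb]_(t' in `[t, +oo[) Q' t')%E).
  rewrite [leLHS]integral_mkcond.
  rewrite [X in (_ <= X + _)%E]integral_mkcond [X in (_ <= _ + X)%E]integral_mkcond.
  rewrite -ge0_integralD//=; last 4 first.
  - by move=> u _; rewrite patchE; case: ifP.
  - by apply/(measurable_restrictT _ (measurable_itv _)); exact: mp.
  - by move=> u _; rewrite patchE; case: ifP.
  - by apply/(measurable_restrictT _ (measurable_itv _)); exact: mp'.
  apply: ge0_le_integral_any => u _.
    rewrite patchE; case: ifP => // _; apply: integral_ge0 => z _.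
    by rewrite lee_fin !mulr_ge0 ?powR_ge0 ?sqrtr_ge0.
  have i1 : (u \in (`]0%R, +oo[)%classic) = (0 < u).
    by apply/idP/idP => [/set_mem|h]; [rewrite /= in_itv/= andbT|apply/mem_set; rewrite /= in_itv/= andbT].
  have i2 : (u \in (`]0%R, t[)%classic) = (0 < u) && (u < t).
    by apply/idP/idP => [/set_mem|h]; [rewrite /= in_itv|apply/mem_set; rewrite /= in_itv].
  have i3 : (u \in (`[t, +oo[)%classic) = (t <= u).
    by apply/idP/idP => [/set_mem|h]; [rewrite /= in_itv/= andbT|apply/mem_set; rewrite /= in_itv/= andbT].
  rewrite !patchE i1 i2 i3; case: ifPn => u0; last first.
    by rewrite adde_ge0//; case: ifP.
  rewrite E//=; have [ut|tu] := ltP u t.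
    rewrite adde0 /Q -mulrA; apply: fin_le_mul; first exact: ltW.
    exact: integral_gram_Kern_narrow.
  rewrite add0e /Q' -mulrA (mulrC (t `^ _)); apply: fin_le_mul; first exact: ltW.
  under eq_integral do under eq_Rintegral do rewrite mulrC.
  exact: integral_gram_Kern_wide.
have I1 : (\int[leb]_(t' in `]0%R, t[) Q t' <= (2 * gramC * t `^ (- (1/2)))%:E)%E.
  rewrite /Q; under eq_integral do rewrite mulrA EFinM.
  have c0 : 0 <= Num.sqrt t * gramC * t `^ (- (3/2)) by rewrite mulr_ge0 ?powR_ge0// (mulr_ge0 (sqrtr_ge0 t) gC).
  rewrite ge0_integralZl_EFin//; last 2 first.
  - by move=> u _; rewrite lee_fin powR_ge0.
  - by apply/measurable_EFinP; apply: measurable_funTS; exact: measurable_powR.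
  have := @integral_powR_lt R (1/2) t _ t0; rewrite (_ : 1/2 - 1 = - (1/2)); last by field.
  move=> /(_ ltac:(lra)) /(fin_le_mul c0) /le_trans; apply; rewrite lee_fin.
  rewrite sE.
  rewrite (_ : _ * _ * _ = ((1/2)^-1 * gramC * (t `^ (1/2) * (t `^ (- (3/2)) * t `^ (1/2))))); last by ring.
  rewrite -!powRD_gt0// (_ : 1/2 + (- (3/2) + 1/2) = - (1/2)); last by field.
  by rewrite (_ : (1/2)^-1 = 2)//; field.
have I2 : (\int[leb]_(t' in `[t, +oo[) Q' t' <= (2 * gramC * t `^ (- (1/2)))%:E)%E.
  rewrite -integral_itv_obnd_cbnd; last exact: mp'.
  rewrite /Q'; under eq_integral do rewrite mulrA EFinM.
  have c0 : 0 <= Num.sqrt t * gramC * t `^ (- (1/2)) by rewrite mulr_ge0 ?powR_ge0// (mulr_ge0 (sqrtr_ge0 t) gC).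
  rewrite ge0_integralZl_EFin//; last 2 first.
  - by move=> u _; rewrite lee_fin powR_ge0.
  - by apply/measurable_EFinP; apply: measurable_funTS; exact: measurable_powR.
  have := @integral_powR_gt R (1/2) t ltac:(lra) t0.
  rewrite (_ : - (1/2) - 1 = - (3/2)); last by field.
  move=> ->; rewrite -EFinM lee_fin sE.
  rewrite (_ : _ * _ * _ = ((1/2)^-1 * gramC * (t `^ (1/2) * (t `^ (- (1/2)) * t `^ (- (1/2)))))); last by ring.
  rewrite -!powRD_gt0// (_ : 1/2 + (- (1/2) + - (1/2)) = - (1/2)); last by field.
  by rewrite (_ : (1/2)^-1 = 2)//; field.
apply: le_trans (leeD I1 I2) _.
by rewrite -EFinD lee_fin le_eqVlt; apply/orP; left; apply/eqP; ring.
Qed.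

End square_function.

(** * The product measure as a sigma-finite measure *)

Section prod_measure.
Context d1 d2 (T1 : measurableType d1) (T2 : measurableType d2) (R : realType).
Variables (m1 : {sigma_finite_measure set T1 -> \bar R}) (m2 : {sigma_finite_measure set T2 -> \bar R}).

(** A named copy of the product, on which the sigma-finite structure asked for by the Schur section
    can be declared. *)
Definition prod_measure : set (T1 * T2)%type -> \bar R := (m1 \x m2)%E.

HB.instance Definition _ := Measure.copy prod_measure (m1 \x m2)%E.

Lemma prod_measure_sigma_finite : sigma_finite setT prod_measure.
Proof.
have /sigma_finiteP[F [TF ndF Foo]] := sigma_finiteT m1.
have /sigma_finiteP[G [TG ndG Goo]] := sigma_finiteT m2.
exists (fun k => F k `*` G k).
  rewrite -setXTT TF TG predeqE => -[x y]; split.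
    move=> [/= [i _ Fx] [j _ Gy]]; exists (maxn i j) => //; split.
    - by move: x Fx; exact/subsetPset/ndF/leq_maxl.
    - by move: y Gy; exact/subsetPset/ndG/leq_maxr.
  by move=> [k _ []/= ? ?]; split; exists k.
move=> k; have [mF ?] := Foo k; have [mG ?] := Goo k.
split; first exact: measurableX.
by rewrite [X in (X < _)%E](product_measure1E m1 m2 mF mG) lte_mul_pinfty// ge0_fin_numE.
Qed.

HB.instance Definition _ := Measure_isSigmaFinite.Build _ _ _ prod_measure prod_measure_sigma_finite.

End prod_measure.

Lemma Rintegral0_eq d (T : measurableType d) (R : realType) (m : {measure set T -> \bar R}) (F : T -> R) :
  (forall z, F z = 0) -> \int[m]_z F z = 0.
Proof. by move=> F0; rewrite /Rintegral integral0_eq// => z _; rewrite F0. Qed.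

(** * The L^2 bound for the square function, by truncation of the upper half-space *)

Section square_function_L2.
Variables (R : realType) (n : nat).
Local Notation Rn := (Rn R n.+1).
Local Notation mu := (@lebn R n.+1).
Local Notation leb := (@lebesgue_measure R).
Local Notation N := (n.+1%:R : R).
Local Notation sigmaRn := (mu : {sigma_finite_measure set Rn -> \bar R}).
Local Notation sigmaR := (leb : {sigma_finite_measure set (measurableTypeR R) -> \bar R}).
Local Notation nu := (prod_measure sigmaRn sigmaR).
Implicit Types (t a b : R) (f g : Rn -> R).

Definition upper : set (Rn * R) := [set w | 0 < w.2].

Lemma measurable_upper : measurable upper.
Proof.
rewrite (_ : upper = setT `*` `]0%R, +oo[%classic).
  by apply: measurableX => //; exact: measurable_itv.
by apply/seteqP; split => w /=; rewrite in_itv/= andbT// => -[].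
Qed.

Lemma measurable_fun_Kern_upper d (T : measurableType d) (w : T -> Rn * R) (z : T -> Rn) :
  measurable_fun setT w -> measurable_fun setT z ->
  measurable_fun setT (fun x => Kern (w x).2 (w x).1 (z x)).
Proof.
move=> mw mz; apply: measurable_Kern => //.
- exact: (measurableT_comp measurable_snd mw).
- exact: (measurableT_comp measurable_fst mw).
Qed.

Section truncation.
Variable f : Rn -> R.
Hypothesis mf : measurable_fun setT f.
Hypothesis pf : poisson_integrable f.

(** The sum of all quantities that must be bounded for the Schur section to apply: the position of
    w, the supremum of the kernel, and its integrals with and without |f|. It is finite at each
    point with t > 0, so its sublevel sets exhaust the upper half-space, and each of them lies in a
    bounded set. *)
Let size (w : Rn * R) : \bar R :=
  ((`|w.2| + dst 0 w.1 + w.2 `^ (1/2) * (KernC R n * w.2 `^ (- (N + 1))))%:E +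
   (w.2 `^ (1/2))%:E * (\int[mu]_z (`|Kern w.2 w.1 z| * `|f z|)%:E + \int[mu]_z (`|Kern w.2 w.1 z|)%:E))%E.

Let sl (k : nat) : set (Rn * R) := upper `&` [set w | (size w <= k%:R%:E)%E].

Let mK : measurable_fun [set: (Rn * R) * Rn] (fun x => `|Kern x.1.2 x.1.1 x.2|).
Proof.
apply: measurableT_comp => //.
exact: (measurable_fun_Kern_upper (w := fst) (z := snd)).
Qed.

Let mpw b : measurable_fun [set: Rn * R] (fun w => w.2 `^ b).
Proof. by apply: (measurableT_comp (measurable_powR _)). Qed.

Let msize : measurable_fun setT size.
Proof.
apply: emeasurable_funD.
  apply/measurable_EFinP; apply: measurable_funD; last first.
    by apply: measurable_funM => //; apply: measurable_funM.
  apply: measurable_funD; first exact: measurableT_comp.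
  exact: (measurable_fun_dst (f := cst (0 : Rn)) (g := fst)).
apply: emeasurable_funM; first exact/measurable_EFinP.
apply: emeasurable_funD.
  apply: measurable_integral_param; last by move=> *; rewrite lee_fin mulr_ge0.
  apply/measurable_EFinP; apply: measurable_funM => //.
  by apply: measurableT_comp => //; exact: (measurableT_comp mf measurable_snd).
apply: measurable_integral_param; last by move=> *; rewrite lee_fin.
exact/measurable_EFinP.
Qed.

Let msl k : measurable (sl k).
Proof.
apply: measurableI; first exact: measurable_upper.
by rewrite -[X in measurable X]setTI; exact: emeasurable_fun_infty_c.
Qed.

Let i1 (w : Rn * R) : (0 <= \int[mu]_z (`|Kern w.2 w.1 z| * `|f z|)%:E)%E.
Proof. by apply: integral_ge0 => z _; rewrite lee_fin mulr_ge0. Qed.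
Let i2 (w : Rn * R) : (0 <= \int[mu]_z (`|Kern w.2 w.1 z|)%:E)%E.
Proof. by apply: integral_ge0 => z _; rewrite lee_fin. Qed.
Let r1 (w : Rn * R) : 0 <= w.2 `^ (1/2) * (KernC R n * w.2 `^ (- (N + 1))).
Proof. by rewrite mulr_ge0 ?powR_ge0// mulr_ge0 ?powR_ge0// KernC_ge0. Qed.
Let r2 (w : Rn * R) : 0 <= `|w.2| + dst 0 w.1.
Proof. by rewrite addr_ge0// dst_ge0. Qed.
Let p1 (w : Rn * R) : 0 <= w.2 `^ (1/2). Proof. exact: powR_ge0. Qed.

Let slP k w : sl k w -> [/\ 0 < w.2, `|w.2| + dst 0 w.1 <= k%:R,
   w.2 `^ (1/2) * (KernC R n * w.2 `^ (- (N + 1))) <= k%:R,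
   ((w.2 `^ (1/2))%:E * \int[mu]_z (`|Kern w.2 w.1 z| * `|f z|)%:E <= k%:R%:E)%E &
   ((w.2 `^ (1/2))%:E * \int[mu]_z (`|Kern w.2 w.1 z|)%:E <= k%:R%:E)%E].
Proof.
case=> /= w0 H.
have h1 : ((`|w.2| + dst 0 w.1 + w.2 `^ (1/2) * (KernC R n * w.2 `^ (- (N + 1))))%:E <= k%:R%:E)%E.
  by apply: le_trans H; rewrite leeDl//; apply: mule_ge0; [rewrite lee_fin|rewrite adde_ge0].
have h2 : ((w.2 `^ (1/2))%:E * (\int[mu]_z (`|Kern w.2 w.1 z| * `|f z|)%:E + \int[mu]_z (`|Kern w.2 w.1 z|)%:E) <= k%:R%:E)%E.
  by apply: le_trans H; rewrite leeDr// lee_fin addr_ge0.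
split => //.
- by move: h1; rewrite lee_fin; apply: le_trans; rewrite lerDl.
- by move: h1; rewrite lee_fin; apply: le_trans; rewrite lerDr.
- by apply: le_trans h2; rewrite lee_wpmul2l ?lee_fin// leeDl.
- by apply: le_trans h2; rewrite lee_wpmul2l ?lee_fin// leeDr.
Qed.

Let sl_nu k : (nu (sl k) < +oo)%E.
Proof.
apply: (@le_lt_trans _ _ (nu (dball 0 k.+1%:R `*` `[0%R, k%:R]%classic))).
  apply: le_measure; rewrite ?inE.
  - exact: msl.
  - by apply: measurableX; [exact: measurable_dball|exact: measurable_itv].
  move=> w /slP[w0 h _ _ _]; split => /=.
    rewrite /dball/=; apply: (@le_lt_trans _ _ k%:R); last by rewrite ltr_nat.
    by apply: le_trans h; rewrite lerDr.
  rewrite in_itv/= (ltW w0)/=; apply: le_trans h; rewrite gtr0_norm// lerDl; exact: dst_ge0.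
rewrite [X in (X < _)%E]product_measure1E; [|exact: measurable_dball|exact: measurable_itv].
rewrite lte_mul_pinfty//; last by rewrite /= lebesgue_measure_itv/=; case: ifP; rewrite ltry.
rewrite ge0_fin_numE//; apply: le_lt_trans (lebn_dball_le _ _) _; by rewrite ?ltry.
Qed.

Let size_lty w : 0 < w.2 -> (size w < +oo)%E.
Proof.
move=> w0; rewrite /size lte_add_pinfty ?ltry// lte_mul_pinfty ?lee_fin// lte_add_pinfty//.
  case/integrableP: (poisson_integrable_Kern w.1 pf w0) => _.
  by under eq_integral do rewrite /= normrM mulrC.
have p1' : @poisson_integrable R n (fun=> 1) by apply: (@poisson_integrable_bounded _ _ _ 1) => // z; rewrite normr1.
case/integrableP: (poisson_integrable_Kern w.1 p1' w0) => _.
by under eq_integral do rewrite /= mul1r.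
Qed.

Let bigcup_sl : \bigcup_k sl k = upper.
Proof.
apply/seteqP; split => [w [k _ []]//|w w0].
have sf : size w \is a fin_num.
  rewrite ge0_fin_numE; first exact: size_lty.
  by apply: adde_ge0; [rewrite lee_fin addr_ge0|apply: mule_ge0; [rewrite lee_fin|exact: adde_ge0]].
exists (Num.truncn (fine (size w))).+1 => //; split => //=.
by rewrite -(fineK sf) lee_fin ltW// truncnS_gt.
Qed.

Let ndsl i j : (i <= j)%N -> sl i `<=` sl j.
Proof. by move=> ij w [w0 /= h]; split => //=; apply: le_trans h _; rewrite lee_fin ler_nat. Qed.

Hypothesis f2 : (\int[mu]_z (f z ^+ 2)%:E < +oo)%E.

Let a k (w : Rn * R) (z : Rn) : R := \1_(sl k) w * (w.2 `^ (1/2) * Kern w.2 w.1 z).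

(** The Schur weight t^(-1/2); the value 1 for t <= 0 keeps it positive everywhere. *)
Let h (w : Rn * R) : R := if 0 < w.2 then w.2 `^ (- (1/2)) else 1.

Let ma k : measurable_fun [set: (Rn * R) * Rn] (fun x => a k x.1 x.2).
Proof.
apply: measurable_funM.
  have m1 : measurable_fun setT (\1_(sl k) : Rn * R -> R) by exact: measurable_indic.
  exact: (measurableT_comp m1 measurable_fst).
apply: measurable_funM; first exact: (measurableT_comp (mpw (1/2)) measurable_fst).
exact: (measurable_fun_Kern_upper (w := fst) (z := snd)).
Qed.

Let aE k w z : sl k w -> a k w z = w.2 `^ (1/2) * Kern w.2 w.1 z.
Proof. by move=> sw; rewrite /a indicE (mem_set sw) (mul1r (_ * Kern _ _ _)). Qed.

Let a0 k w z : ~ sl k w -> a k w z = 0.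
Proof. by move=> sw; rewrite /a indicE memNset// mul0r. Qed.

Let square_function_sl k :
  (\int[nu]_(w in sl k) (w.2 * Tk f w.1 w.2 ^+ 2)%:E <= (4 * gramC R n)%:E * \int[mu]_z (f z ^+ 2)%:E)%E.
Proof.
pose kk : R := k%:R; have kk0 : 0 <= kk by [].
have aK w z : `|a k w z| <= kk.
  have [sw|nsw] := pselect (sl k w); last by rewrite a0// normr0.
  have [w0 _ h2 _ _] := slP sw; rewrite aE// normrM ger0_norm//.
  by apply: le_trans h2; rewrite ler_wpM2l// Kern_bounded.
have afK w : (\int[mu]_z (`|a k w z| * `|f z|)%:E <= kk%:E)%E.
  have [sw|nsw] := pselect (sl k w); last first.
    by rewrite integral0_eq ?lee_fin// => z _; rewrite a0// normr0 mul0r.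
  have [w0 _ _ h3 _] := slP sw; apply: le_trans h3.
  rewrite -ge0_integralZl_EFin//; last first.
    apply/measurable_EFinP; apply: measurable_funM; last exact: measurableT_comp.
    exact: (measurableT_comp mK (pair1_measurable w)).
  apply: ge0_le_integral_any => z _; first by rewrite lee_fin mulr_ge0.
  by rewrite -EFinM lee_fin aE// normrM ger0_norm// mulrA.
have aI w : (\int[mu]_z `|a k w z|%:E <= kk%:E)%E.
  have [sw|nsw] := pselect (sl k w); last first.
    by rewrite integral0_eq ?lee_fin// => z _; rewrite a0// normr0.
  have [w0 _ _ _ h3] := slP sw; apply: le_trans h3.
  rewrite -ge0_integralZl_EFin//; last first.
    by apply/measurable_EFinP; exact: (measurableT_comp mK (pair1_measurable w)).
  apply: ge0_le_integral_any => z _ //.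
  by rewrite -EFinM lee_fin aE// normrM ger0_norm.
(* kk bounds the kernel and its integrals, kk * kk the integral of a product of two kernels; K is
   above both. *)
pose K := kk + kk * kk; have K0 : 0 <= K by rewrite addr_ge0// mulr_ge0.
have kkK : kk <= K by rewrite lerDl mulr_ge0.
have aaK w w' : (\int[mu]_z (`|a k w z| * `|a k w' z|)%:E <= K%:E)%E.
  apply: (@le_trans _ _ (\int[mu]_z (kk%:E * `|a k w' z|%:E))%E).
    apply: ge0_le_integral_any => z _; first by rewrite lee_fin mulr_ge0.
    by rewrite -EFinM lee_fin ler_wpM2r.
  rewrite ge0_integralZl_EFin//; last first.
    apply/measurable_EFinP; apply: measurableT_comp => //.
    exact: (measurableT_comp (ma k) (pair1_measurable w')).
  apply: le_trans (lee_wpmul2l _ (aI w')) _ => //.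
  by rewrite -EFinM lee_fin lerDr.
have mh : measurable_fun setT h.
  by apply: measurable_fun_ifT => //; exact: measurable_fun_ltr.
have h0 w : 0 < h w by rewrite /h; case: ifPn => // w0; rewrite powR_gt0.
have C0 : 0 < 4 * gramC R n by rewrite mulr_gt0// gramC_gt0.
have schurC w : sl k w -> (\int[nu]_w' (`|\int[mu]_z (a k w z * a k w' z)| * h w')%:E
    <= (4 * gramC R n * h w)%:E)%E.
  move=> sw; have [w0 _ _ _ _] := slP sw.
  pose G (y' : Rn) (t' : R) : R := `| \int[mu]_z (Kern w.2 w.1 z * Kern t' y' z) |.
  pose U (w' : Rn * R) : \bar R :=
    if 0 < w'.2 then (w.2 `^ (1/2) * w'.2 `^ (1/2) * G w'.1 w'.2 * w'.2 `^ (- (1/2)))%:E else 0%E.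
  have mG : measurable_fun [set: Rn * R] (fun w' => G w'.1 w'.2).
    apply: measurableT_comp => //; apply: measurable_Rintegral_param.
    apply: measurable_funM; last exact: (measurable_fun_Kern_upper (w := fst) (z := snd)).
    exact: (measurable_fun_Kern_upper (w := cst w) (z := snd)).
  have mU : measurable_fun setT U.
    apply: measurable_fun_ifT => //; first exact: measurable_fun_ltr.
    apply/measurable_EFinP; apply: measurable_funM => //; apply: measurable_funM => //.
    exact: measurable_funM.
  have U0 w' : (0 <= U w')%E.
    rewrite /U /G; case: ifP => // _; rewrite lee_fin mulr_ge0 ?powR_ge0// mulr_ge0//.
    by rewrite mulr_ge0 ?powR_ge0.
  apply: (@le_trans _ _ (\int[nu]_w' U w')%E).
    apply: ge0_le_integral_any => w' _; first by rewrite lee_fin mulr_ge0// ltW.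
    have [sw'|nsw'] := pselect (sl k w'); last first.
      have -> : \int[mu]_z (a k w z * a k w' z) = 0.
        by apply: Rintegral0_eq => z; rewrite (a0 z nsw') mulr0.
      by rewrite normr0 mul0r; exact: U0.
    have [w'0 _ _ _ _] := slP sw'.
    rewrite /U w'0 lee_fin /h w'0 ler_wpM2r ?powR_ge0// /G.
    rewrite -[X in X * `|_|]ger0_norm ?mulr_ge0// -normrM -RintegralZl//; last first.
      have pk : poisson_integrable (fun z : Rn => Kern w.2 w.1 z).
        by apply: poisson_integrable_bounded; [exact: measurable_KernE|move=> z; exact: Kern_bounded].
      exact: poisson_integrable_Kern.
    rewrite le_eqVlt; apply/orP; left; apply/eqP; congr `| _ |.
    by apply: eq_Rintegral => z _; rewrite !aE//; ring.
  rewrite (fubini_tonelli2 (m1 := sigmaRn) (m2 := sigmaR))//= /fubini_G.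
  rewrite (_ : h w = w.2 `^ (- (1/2))); last by rewrite /h w0.
  apply: le_trans (schur_weight w.1 w0).
  rewrite [leRHS]integral_mkcond; apply: ge0_le_integral_any => t' _; first exact: integral_ge0.
  rewrite patchE; case: ifPn => [|].
    move=> /set_mem; rewrite /= in_itv/= andbT => t'0.
    apply: ge0_le_integral_any => y' _ //.
    rewrite /U/= t'0 lee_fin /G.
    by rewrite !div1r !powR12_sqrt ?(ltW w0) ?(ltW t'0)// lexx.
  rewrite notin_setE/= in_itv/= andbT => /negP t'0.
  by rewrite integral0_eq// => y' _; rewrite /U/= (negbTE t'0).
have afK' w : (\int[mu]_z (`|a k w z| * `|f z|)%:E <= K%:E)%E.
  by apply: le_trans (afK w) _; rewrite lee_fin.
have H := @schur_TTstar _ _ _ _ R nu sigmaRn (a k) f (sl k) h K (4 * gramC R n) (ma k) mf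
  (msl k) (sl_nu k) (@a0 k) K0 (fun w z => le_trans (aK w z) kkK) afK' aaK mh h0 C0 schurC f2.
apply: le_trans H; rewrite integral_mkcond; apply: ge0_le_integral_any => w _.
  rewrite patchE; case: ifPn => // /set_mem[w0 _].
  by rewrite lee_fin mulr_ge0 ?sqr_ge0// ltW.
rewrite patchE; case: ifPn => [/set_mem sw|_]; last by rewrite lee_fin sqr_ge0.
have [w0 _ _ _ _] := slP sw.
have -> : \int[mu]_z (a k w z * f z) = w.2 `^ (1/2) * Tk f w.1 w.2.
  rewrite /Tk -RintegralZl//; last exact: poisson_integrable_Kern.
  by apply: eq_Rintegral => z _; rewrite aE//; ring.
rewrite lee_fin exprMn -[X in _ <= X * _]powR_mulrn// -powRrM.
by rewrite (_ : 1/2 * 2%:R = 1 :> R) ?powRr1// ?ltW//; field.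
Qed.

(** The bound on [sl k] does not depend on k, so monotone convergence carries it to the
    half-space. *)
Lemma square_function_L2_aux :
  (\int[nu]_(w in upper) (w.2 * Tk f w.1 w.2 ^+ 2)%:E <= (4 * gramC R n)%:E * \int[mu]_z (f z ^+ 2)%:E)%E.
Proof.
have mT : measurable_fun [set: Rn * R] (fun w => (w.2 * Tk f w.1 w.2 ^+ 2)%:E).
  apply/measurable_EFinP; apply: measurable_funM => //; apply: measurable_funX.
  exact: measurable_Tk.
have T0 (w : Rn * R) : 0 < w.2 -> (0 <= (w.2 * Tk f w.1 w.2 ^+ 2)%:E)%E.
  by move=> w0; rewrite lee_fin mulr_ge0 ?sqr_ge0// ltW.
rewrite -bigcup_sl.
have cv : (\int[nu]_(w in sl k) (w.2 * Tk f w.1 w.2 ^+ 2)%:E)%E @[k --> \oo] -->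
    (\int[nu]_(w in \bigcup_k sl k) (w.2 * Tk f w.1 w.2 ^+ 2)%:E)%E.
  apply: ge0_nondecreasing_set_cvg_integral => [i j ij|i|i|i x []] //.
  - by apply/subsetPset; exact: ndsl.
  - exact: msl.
  - exact: measurable_funTS.
  - by move=> x0 _; exact: T0.
rewrite -(cvg_lim _ cv)//; apply: lime_le; last by apply: nearW => k; exact: square_function_sl.
apply: ereal_nondecreasing_is_cvgn => i j ij.
apply: ge0_subset_integral_any => [|x [x0 _]]; [exact: ndsl|exact: T0].
Qed.

End truncation.

Lemma square_function_L2 f : measurable_fun setT f ->
  (\int[nu]_(w in upper) (w.2 * Tk f w.1 w.2 ^+ 2)%:E <= (4 * gramC R n)%:E * \int[mu]_z (f z ^+ 2)%:E)%E.
Proof.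
move=> mf; have C0 : 0 < 4 * gramC R n by rewrite mulr_gt0// gramC_gt0.
have [f2|] := boolP (\int[mu]_z (f z ^+ 2)%:E < +oo)%E; last first.
  by rewrite -leNgt leye_eq => /eqP ->; rewrite gt0_muley ?lte_fin// leey.
apply: square_function_L2_aux => //.
apply: (@poisson_integrable_Lp _ _ _ 2) => //; first by rewrite ler1n.
apply: le_lt_trans f2; apply: ge0_le_integral_any => z _; rewrite lee_fin ?powR_ge0//.
by rewrite powR_mulrn// real_normK ?num_real.
Qed.

End square_function_L2.

(** * Strong type from a truncated weak type, by integration over levels *)

Section layer_cake.
Variable R : realType.
Local Notation leb := (@lebesgue_measure R).
Local Notation sigmaR := (leb : {sigma_finite_measure set (measurableTypeR R) -> \bar R}).
Local Notation pos := (`]0%R, +oo[%classic : set (measurableTypeR R)).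

Lemma posE (t : R) : (t \in pos) = (0 < t).
Proof.
by apply/idP/idP => [/set_mem|h]; [rewrite /= in_itv/= andbT|apply/mem_set; rewrite /= in_itv/= andbT].
Qed.

Lemma posP (t : R) : pos t <-> 0 < t.
Proof. by rewrite /= in_itv/= andbT. Qed.

(** Keeping only the levels between u / 2 and u, of length u / 2, loses a factor 2^q but treats
    finite and infinite x alike. *)
Lemma half_powR_le_integral (q u : R) (x : \bar R) : 1 <= q -> 0 < u -> (u%:E <= x)%E ->
  (((u / 2) `^ q)%:E <= \int[leb]_(l in pos) (if (l%:E < x)%E then (l `^ (q - 1))%:E else 0))%E.
Proof.
move=> q1 u0 ux.
apply: (@le_trans _ _ (\int[leb]_(l in `](u / 2)%R, u[) (cst ((u / 2) `^ (q - 1))%:E l))%E).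
  rewrite integral_cst//= lebesgue_measure_itv/= lte_fin ifT; last by lra.
  rewrite -EFinB -EFinM lee_fin (_ : u - u / 2 = u / 2); last by field.
  rewrite -[X in _ <= _ * X]powRr1; last by lra.
  by rewrite -powRD_gt0 ?divr_gt0// subrK.
rewrite integral_mkcond [leRHS]integral_mkcond; apply: ge0_le_integral_any => l _.
  by rewrite patchE; case: ifP => // _; rewrite lee_fin powR_ge0.
rewrite !patchE posE; case: ifPn => [/set_mem|_]; last first.
  by case: ifP => // _; case: ifP => // _; rewrite lee_fin powR_ge0.
rewrite /= in_itv/= => /andP[ul lu]; have l0 : 0 < l by lra.
rewrite l0 (lt_le_trans _ ux) ?lte_fin// lee_fin.
by apply: ge0_ler_powR; rewrite ?nnegrE; lra.
Qed.

Lemma poweR_le_integral (q : R) (x : \bar R) : 1 <= q -> (0 <= x)%E ->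
  (poweR x q <= (2 `^ q)%:E * \int[leb]_(l in pos) (if (l%:E < x)%E then (l `^ (q - 1))%:E else 0))%E.
Proof.
move=> q1 x0; set I := (\int[leb]_(l in _) _)%E.
have I0 : (0 <= I)%E by apply: integral_ge0 => l _; case: ifP => // _; rewrite lee_fin powR_ge0.
have p0 : 0 < 2 `^ q :> R by rewrite powR_gt0.
case: x x0 @I I0 => [r| |] x0 I I0; last by move: x0; rewrite leNgt ltNy0.
  have r0 : 0 <= r by rewrite -lee_fin.
  move: r0; rewrite le_eqVlt => /predU1P[<-|r0].
    by rewrite poweR_EFin powR0 ?mule_ge0 ?lee_fin ?(ltW p0)//; lra.
  have := half_powR_le_integral q1 r0 (lexx _).
  move=> /(lee_wpmul2l (ltW p0 : (0 <= (2 `^ q)%:E)%E)); apply: le_trans.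
  rewrite -EFinM lee_fin -powRM ?divr_ge0 ?(ltW r0)// mulrCA mulfV// mulr1//.
suff -> : I = +oo%E by rewrite gt0_muley ?lte_fin// leey.
apply/eqyP => A A0.
(* This u satisfies (u / 2)^q = A, and A is arbitrary, so the integral over levels is infinite. *)
have := @half_powR_le_integral q (2 * A `^ (q^-1)) +oo%E q1 _ (leey _).
rewrite mulr_gt0 ?powR_gt0// => /(_ isT); apply: le_trans.
rewrite (_ : 2 * A `^ q^-1 / 2 = A `^ q^-1); last by field.
by rewrite -powRrM mulVf ?powRr1 ?(ltW A0)// gt_eqF//; lra.
Qed.

Context d1 d2 (T1 : measurableType d1) (T2 : measurableType d2).
Variables (m1 : {sigma_finite_measure set T1 -> \bar R}) (m2 : {sigma_finite_measure set T2 -> \bar R}).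

(** The interpolation step of Marcinkiewicz between weak type r and a sup bound. In the hypothesis
    the sup bound has already removed the part of G below c l. Integrated against l^(q-1), the
    right-hand side becomes an integral of l^(q-r-1) over l < G / c, convergent at 0 because r < q.
    It is used with r = 2 for the square function and with r = 1 for the maximal function. *)
Lemma layer_cake (F : T1 -> \bar R) (om : T1 -> R) (G : T2 -> R) (r q A c : R) :
  measurable_fun setT F -> measurable_fun setT om -> measurable_fun setT G ->
  (forall x, 0 <= F x)%E -> (forall x, 0 <= om x) -> (forall z, 0 <= G z) ->
  0 < r -> r < q -> 1 <= q -> 0 <= A -> 0 < c ->
  (forall l, 0 < l -> (\int[m1]_x (if (l%:E < F x)%E then (om x)%:E else 0) <=
     (A * l `^ (- r))%:E * \int[m2]_z (if (c * l < G z)%R then (G z `^ r)%:E else 0))%E) ->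
  (\int[m1]_x (poweR (F x) q * (om x)%:E) <=
    (2 `^ q * A * ((q - r)^-1 * c `^ (- (q - r))))%:E * \int[m2]_z (G z `^ q)%:E)%E.
Proof.
move=> mF mom mG F0 om0 G0 r0 rq q1 A0 c0 H.
have p0 : 0 <= 2 `^ q :> R by exact: powR_ge0.
pose P (x : T1) (l : R) : \bar R := if (l%:E < F x)%E then (om x * l `^ (q - 1))%:E else 0%E.
pose Q (z : T2) (l : R) : \bar R := if c * l < G z then (l `^ (q - r - 1) * G z `^ r)%:E else 0%E.
have mp b (T : Type) d (T' : measurableType d) (u : T' -> R) : measurable_fun setT u -> measurable_fun setT (fun x => u x `^ b).
  by move=> mu; exact: (measurableT_comp (measurable_powR _)).
have mP : measurable_fun [set: T1 * R] (fun x => P x.1 x.2).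
  apply: measurable_fun_ifT => //.
    apply: measurable_fun_lte; first by apply/measurable_EFinP.
    exact: (measurableT_comp mF measurable_fst).
  apply/measurable_EFinP; apply: measurable_funM; first exact: (measurableT_comp mom measurable_fst).
  exact: (mp _ unit).
have mQ : measurable_fun [set: T2 * R] (fun x => Q x.1 x.2).
  apply: measurable_fun_ifT => //.
    apply: measurable_fun_ltr; first exact: measurable_funM.
    exact: (measurableT_comp mG measurable_fst).
  apply/measurable_EFinP; apply: measurable_funM; first exact: (mp _ unit).
  by apply: (mp _ unit); exact: (measurableT_comp mG measurable_fst).
have P0 x l : (0 <= P x l)%E by rewrite /P; case: ifP => // _; rewrite lee_fin mulr_ge0 ?powR_ge0.
have Q0 z l : (0 <= Q z l)%E by rewrite /Q; case: ifP => // _; rewrite lee_fin mulr_ge0 ?powR_ge0.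
have step1 : (\int[m1]_x (poweR (F x) q * (om x)%:E) <= (2 `^ q)%:E * \int[m1]_x \int[leb]_(l in pos) P x l)%E.
  rewrite -ge0_integralZl_EFin//; last 2 first.
  - by move=> x _; exact: integral_ge0.
  - have := measurable_fun_fubini_tonelli_F (m2 := sigmaR) (fun x : T1 * R => (if (0 < x.2)%R then P x.1 x.2 else 0)%E).
    rewrite /fubini_F /= => mS; rewrite (_ : (fun x : T1 => _) = (fun x => (\int[leb]_y (if (0 < y)%R then P x y else 0))%E)).
      apply: mS; last by move=> x; case: ifP.
      by apply: measurable_fun_ifT => //; exact: measurable_fun_ltr.
    apply/funext => x; rewrite (integral_if _ setT) setTI; congr (integral _ _ _).
    by apply/seteqP; split => l /=; rewrite in_itv/= andbT.
  apply: ge0_le_integral_any => x _; first by rewrite mule_ge0 ?poweR_ge0// lee_fin.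
  have PE : (\int[leb]_(l in pos) P x l = (om x)%:E * \int[leb]_(l in pos) (if (l%:E < F x)%E then (l `^ (q - 1))%:E else 0))%E.
    rewrite -ge0_integralZl_EFin//; last 2 first.
    - by move=> l _; case: ifP => // _; rewrite lee_fin powR_ge0.
    - apply: measurable_funTS; apply: measurable_fun_ifT => //.
        by apply: measurable_fun_lte => //; exact: measurable_cst.
      by apply/measurable_EFinP; exact: measurable_powR.
    by apply: eq_integral => l _; rewrite /P; case: ifP => _; rewrite ?mule0// -EFinM.
  by rewrite PE muleCA muleC lee_wpmul2l ?lee_fin//; exact: poweR_le_integral.
apply: le_trans step1 _.
rewrite (tonelli_dom m1 sigmaR measurableT (measurable_itv _) mP P0).
apply: (@le_trans _ _ ((2 `^ q)%:E * \int[leb]_(l in pos) (A%:E * \int[m2]_z Q z l))%E).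
  rewrite lee_wpmul2l ?lee_fin//; apply: ge0_le_integral_any => l /posP l0; first exact: integral_ge0.
  have lp : 0 <= l `^ (q - 1) by exact: powR_ge0.
  rewrite (eq_integral (fun x => (l `^ (q - 1))%:E * (if (l%:E < F x)%E then (om x)%:E else 0))%E); last first.
    by move=> x _; rewrite /P; case: ifP => _; rewrite ?mule0// -EFinM mulrC.
  rewrite ge0_integralZl_EFin//; last 2 first.
  - by move=> x _; case: ifP => // _; rewrite lee_fin.
  - by apply: measurable_fun_ifT => //; [exact: measurable_fun_lte|exact/measurable_EFinP].
  apply: le_trans (lee_wpmul2l _ (H _ l0)) _; first by rewrite lee_fin.
  rewrite [X in (_ <= _ * X)%E](eq_integral (fun z => (l `^ (q - r - 1))%:E * (if (c * l < G z)%R then (G z `^ r)%:E else 0))%E); last first.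
    by move=> z _; rewrite /Q; case: ifP => _; rewrite ?mule0// -EFinM.
  rewrite [X in (_ <= _ * X)%E]ge0_integralZl_EFin//; last 3 first.
  - by move=> z _; case: ifP => // _; rewrite lee_fin powR_ge0.
  - apply: measurable_fun_ifT => //; first exact: measurable_fun_ltr.
    by apply/measurable_EFinP; exact: (mp _ unit).
  - exact: powR_ge0.
  rewrite !muleA -!EFinM (_ : l `^ (q - 1) * (A * l `^ (- r)) = A * l `^ (q - r - 1))//.
  by rewrite mulrCA -powRD_gt0//; congr (_ * _ `^ _); ring.
rewrite ge0_integralZl_EFin//; last 2 first.
- by move=> l _; exact: integral_ge0.
- apply: measurable_funTS.
  exact: (measurable_fun_fubini_tonelli_G (m1 := m2) (fun x : T2 * R => Q x.1 x.2) mQ (fun x => Q0 x.1 x.2)).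
rewrite -(tonelli_dom m2 sigmaR measurableT (measurable_itv _) mQ Q0).
rewrite muleA -EFinM [X in (_ <= X * _)%E]EFinM -muleA lee_wpmul2l ?lee_fin ?mulr_ge0//.
have k0 : 0 <= (q - r)^-1 * c `^ (- (q - r)) by rewrite mulr_ge0 ?powR_ge0// invr_ge0; lra.
rewrite -ge0_integralZl_EFin//; last 2 first.
- by move=> z _; rewrite lee_fin powR_ge0.
- by apply/measurable_EFinP; exact: (mp _ unit).
apply: ge0_le_integral_any => z _; first exact: integral_ge0.
have := G0 z; rewrite le_eqVlt => /predU1P[Gz|Gz].
  rewrite integral0_eq ?mule_ge0 ?lee_fin ?powR_ge0// => l /posP l0.
  by rewrite /Q -Gz ltNge mulr_ge0// ltW.
have Gc : 0 < G z / c by rewrite divr_gt0.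
rewrite (_ : (\int[leb]_(l in pos) Q z l = (G z `^ r)%:E * \int[leb]_(l in `]0%R, (G z / c)%R[) (l `^ (q - r - 1))%:E)%E); last first.
  rewrite -ge0_integralZl_EFin//; last 3 first.
  - by move=> l _; rewrite lee_fin powR_ge0.
  - by apply/measurable_EFinP; apply: measurable_funTS; exact: measurable_powR.
  - exact: powR_ge0.
  rewrite [LHS]integral_mkcond [RHS]integral_mkcond; apply: eq_integral => l _.
  rewrite !patchE posE /Q.
  have -> : (l \in `]0%R, (G z / c)[%classic) = (0 < l) && (c * l < G z).
    apply/idP/idP => [/set_mem|h]; first by rewrite /= in_itv/= ltr_pdivlMr// mulrC.
    by apply/mem_set; rewrite /= in_itv/= ltr_pdivlMr// mulrC.
  by case: ifPn => //= l0; case: ifP => // _; rewrite -EFinM mulrC.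
have qr : 0 < q - r by lra.
apply: le_trans (lee_wpmul2l _ (integral_powR_lt qr Gc)) _; first by rewrite lee_fin powR_ge0.
rewrite -!EFinM lee_fin powRM ?invr_ge0 ?(ltW c0) ?(ltW Gz)//.
rewrite -[c^-1]powR_inv1 ?(ltW c0)// -powRrM mulN1r.
rewrite [leLHS](_ : _ = (q - r)^-1 * c `^ (- (q - r)) * (G z `^ r * G z `^ (q - r))); last by ring.
by rewrite -powRD_gt0// subrKC.
Qed.

End layer_cake.

(** * A Jensen inequality with a weight of bounded mass *)

Section jensen.
Context d (T : measurableType d) (R : realType) (m : {measure set T -> \bar R}).

Lemma le_adde_powR (x L q : R) : 0 <= x -> 0 < L -> 1 <= q -> x <= L + L `^ (1 - q) * x `^ q.
Proof.
move=> x0 L0 q1; have [xL|Lx] := leP x L.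
  by apply: ler_wpDr => //; rewrite mulr_ge0 ?powR_ge0.
apply: ler_wpDl; first exact: ltW.
have xp : 0 < x by lra.
have -> : x `^ q = x `^ (q - 1) * x.
  by rewrite -[X in _ * X]powRr1// -powRD_gt0// subrK.
rewrite mulrA ler_peMl// (_ : 1 - q = - (q - 1)); last by ring.
rewrite powRN mulrC ler_pdivlMr ?powR_gt0// mul1r.
by apply: ge0_ler_powR; rewrite ?nnegrE; lra.
Qed.

(** Hoelder's inequality up to the factor 2^q: the linear bound [le_adde_powR] is integrated against
    w for every level L, and L is then chosen to balance the two terms. *)
Lemma jensen_powR (D : set T) (phi w : T -> R) (q B : R) : measurable D ->
  measurable_fun setT phi -> measurable_fun setT w ->
  (forall x, 0 <= phi x) -> (forall x, D x -> 0 <= w x) -> 1 <= q -> 0 < B ->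
  (\int[m]_(x in D) (w x)%:E <= B%:E)%E ->
  (poweR (\int[m]_(x in D) (phi x * w x)%:E) q <=
   (2 `^ q * B `^ (q - 1))%:E * \int[m]_(x in D) (phi x `^ q * w x)%:E)%E.
Proof.
move=> mD mphi mw phi0 w0 q1 B0 wB.
set I := (\int[m]_(x in D) (phi x `^ q * w x)%:E)%E.
have I0 : (0 <= I)%E by apply: integral_ge0 => x Dx; rewrite lee_fin mulr_ge0 ?powR_ge0// w0.
have c0 : 0 < 2 `^ q * B `^ (q - 1) by rewrite mulr_gt0// powR_gt0.
have mpq : measurable_fun D (fun x => (phi x `^ q * w x)%:E).
  apply/measurable_EFinP; apply: measurable_funTS; apply: measurable_funM => //.
  exact: (measurableT_comp (measurable_powR _)).
have key L : 0 < L -> (\int[m]_(x in D) (phi x * w x)%:E <= (L * B)%:E + (L `^ (1 - q))%:E * I)%E.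
  move=> L0.
  apply: (@le_trans _ _ (\int[m]_(x in D) (L%:E * (w x)%:E + (L `^ (1 - q))%:E * (phi x `^ q * w x)%:E))%E).
    apply: ge0_le_integral_any => x Dx; first by rewrite lee_fin mulr_ge0// w0.
    rewrite -!EFinM -EFinD lee_fin mulrA -mulrDl ler_wpM2r ?w0//.
    exact: le_adde_powR.
  have mwD : measurable_fun D (fun x => (w x)%:E) by apply/measurable_EFinP; exact: measurable_funTS.
  rewrite ge0_integralD//; last 4 first.
  - by move=> x Dx; rewrite -EFinM lee_fin mulr_ge0 ?w0// ltW.
  - exact: emeasurable_funM.
  - by move=> x Dx; rewrite -EFinM lee_fin !mulr_ge0 ?powR_ge0 ?w0.
  - exact: emeasurable_funM.
  rewrite !ge0_integralZl_EFin ?(ltW L0) ?powR_ge0//; last first.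
    by move=> x Dx; rewrite lee_fin mulr_ge0 ?powR_ge0 ?w0.
  by apply: leeD => //; rewrite EFinM lee_wpmul2l// lee_fin ltW.
have [Iy|] := eqVneq I +oo%E; first by rewrite Iy gt0_muley ?leey// lte_fin.
rewrite -ltey => If; have Ifn : I \is a fin_num by rewrite ge0_fin_numE.
pose i := fine I; have iE : I = i%:E by rewrite fineK.
have i0 : 0 <= i by rewrite fine_ge0.
have J0 : (0 <= \int[m]_(x in D) (phi x * w x)%:E)%E.
  by apply: integral_ge0 => x Dx; rewrite lee_fin mulr_ge0// w0.
move: i0; rewrite le_eqVlt => /predU1P[i0|i0].
  rewrite iE -i0 mule0 (_ : (\int[m]_(x in D) (phi x * w x)%:E)%E = 0%E).
    by rewrite poweR_EFin powR0//; lra.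
  apply/eqP; rewrite eq_le J0 andbT; apply/lee_addgt0Pr => e e0; rewrite add0e.
  have := key (e / B) (divr_gt0 e0 B0).
  by rewrite iE -i0 mule0 adde0 mulfVK// gt_eqF.
(* With L^q = i / B both terms, L B and L^(1-q) i, are equal. *)
pose L := (i / B) `^ (q^-1).
have iB : 0 < i / B by rewrite divr_gt0.
have L0 : 0 < L by rewrite powR_gt0.
have q0 : q != 0 by rewrite gt_eqF//; lra.
have Lq : L `^ q = i / B by rewrite /L -powRrM mulVf// powRr1// ltW.
have K := key L L0.
have E : (L * B)%:E + ((L `^ (1 - q))%:E * I)%E = (2 * L * B)%:E.
  rewrite iE -EFinM -EFinD; congr EFin.
  rewrite powRD_gt0// powRr1 ?(ltW L0)// powRN Lq; field.
  by rewrite !gt_eqF.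
rewrite E in K; rewrite iE -EFinM.
apply: (@le_trans _ _ (poweR (2 * L * B)%:E q)).
  by apply: gt0_ler_poweR => //; rewrite ?in_itv/= ?leey ?J0 ?lee_fin//; rewrite ?mulr_ge0 ?(ltW L0) ?(ltW B0)//; lra.
rewrite poweR_EFin lee_fin !powRM ?mulr_ge0 ?(ltW L0) ?(ltW B0)// Lq.
have -> : B `^ q = B `^ (q - 1) * B.
  by rewrite -[X in _ * X]powRr1 ?(ltW B0)// -powRD_gt0// subrK.
by rewrite le_eqVlt; apply/orP; left; apply/eqP; field; rewrite gt_eqF.
Qed.

End jensen.

(** * The L^q bound for the square function of a bounded function *)

Section good_part.
Variables (R : realType) (n : nat).
Local Notation V := 'rV[R]_n.+1.
Local Notation Rn := (Rn R n.+1).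
Local Notation mu := (@lebn R n.+1).
Local Notation leb := (@lebesgue_measure R).
Local Notation N := (n.+1%:R : R).
Local Notation sigmaRn := (mu : {sigma_finite_measure set Rn -> \bar R}).
Local Notation sigmaR := (leb : {sigma_finite_measure set (measurableTypeR R) -> \bar R}).
Local Notation nu := (prod_measure sigmaRn sigmaR).
Local Notation pos := (`]0%R, +oo[%classic : set (measurableTypeR R)).

(** Where |x-y| >= d one has |x-y| >= (d + |x-y|) / 2, so the truncated power is at most 2^(N+a)
    [Wk a d]. *)
Lemma integral_far a d (y : V) : 0 < a -> 0 < d ->
  (\int[mu]_x (if d <= dst y x then dst y x `^ (- (N + a)) else 0)%:E
   <= (2 `^ (N + a) * WkC n a * d `^ (- a))%:E)%E.
Proof.
move=> a0 d0; have Na : 0 < N + a by rewrite ltr_wpDl.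
apply: (@le_trans _ _ (\int[mu]_x ((2 `^ (N + a))%:E * (Wk a d y x)%:E))%E).
  apply: ge0_le_integral_any => x _; first by rewrite lee_fin; case: ifP => // _; exact: powR_ge0.
  rewrite -EFinM lee_fin; case: ifPn => [dx|_]; last by rewrite mulr_ge0 ?powR_ge0 ?Wk_ge0.
  have x0 : 0 < dst y x by exact: lt_le_trans dx.
  rewrite /Wk.
  have -> : 2 `^ (N + a) = (2^-1 : R) `^ (- (N + a)).
    by rewrite -powR_inv1// -powRrM mulrNN mul1r.
  rewrite -powRM ?invr_ge0 ?addr_ge0 ?(ltW d0) ?(ltW x0)//.
  by apply: ler_powRN; [exact: ltW| rewrite mulr_gt0 ?invr_gt0 ?addr_gt0|lra].
rewrite ge0_integralZl_EFin ?powR_ge0//; last 2 first.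
- by move=> x _; rewrite lee_fin Wk_ge0.
- exact: measurable_WkE.
by rewrite -mulrA EFinM lee_wpmul2l ?lee_fin ?powR_ge0//; exact: integral_Wk.
Qed.

Section bounded.
Variables (g : Rn -> R) (K : R).
Hypothesis mg : measurable_fun setT g.
Hypothesis gK : forall z, `|g z| <= K.

(** Chosen so that the part of g below height c l contributes at most l / 2 to t |Tk g|. *)
Let c : R := (2 * (KernC R n * WkC n 1))^-1.
Let c0 : 0 < c.
Proof. by rewrite invr_gt0 !mulr_gt0 ?KernC_gt0 ?WkC_gt0. Qed.

Let big (l : R) (z : Rn) : R := if c * l < `|g z| then g z else 0.
Let small (l : R) (z : Rn) : R := if c * l < `|g z| then 0 else g z.

Let mcond l : measurable_fun [set: Rn] (fun z => c * l < `|g z|).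
Proof. by apply: measurable_fun_ltr => //; exact: measurableT_comp. Qed.

Lemma Tk_small_le l y t : 0 < l -> 0 < t -> t * `|Tk (small l) y t| <= l / 2.
Proof.
move=> l0 t0; have cl : 0 <= c * l by rewrite mulr_ge0// ltW.
have ms : measurable_fun [set: Rn] (small l) by exact: measurable_fun_ifT.
have sb z : `|small l z| <= c * l by rewrite /small; case: ltP => //; rewrite normr0.
have ps : poisson_integrable (small l) by exact: poisson_integrable_bounded ms sb.
rewrite mulrC -ler_pdivlMr// -lee_fin; apply: le_trans (Tk_le y ps t0) _.
apply: (@le_trans _ _ (\int[mu]_z ((c * l * KernC R n)%:E * (Wk 1 t y z)%:E))%E).
  apply: ge0_le_integral_any => z _; rewrite -?EFinM lee_fin ?mulr_ge0//.
  by have -> : c * l * KernC R n * Wk 1 t y z = (c * l) * (KernC R n * Wk 1 t y z); [rewrite mulrA|apply: ler_pM; rewrite ?normr_ge0 ?sb ?Kern_le].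
have k0 := @KernC_gt0 R n; have w0 := @WkC_gt0 R n _ ltr01.
rewrite ge0_integralZl_EFin//; last 3 first.
- by move=> x _; rewrite lee_fin Wk_ge0.
- exact: measurable_WkE.
- by rewrite mulr_ge0// ltW.
apply: le_trans (lee_wpmul2l _ (integral_Wk y ltr01 t0)) _; first by rewrite lee_fin mulr_ge0// ltW.
rewrite -EFinM lee_fin le_eqVlt; apply/orP; left; apply/eqP.
rewrite powR_inv1 ?(ltW t0)// /c; field.
by rewrite !gt_eqF.
Qed.

(** t |Tk g| is the quantity with a sup bound independent of the scale; the weight [om] = 1/t turns
    F^q into t^(q-1) |Tk g|^q. *)
Let F (w : Rn * R) : R := if 0 < w.2 then w.2 * `|Tk g w.1 w.2| else 0.
Let om (w : Rn * R) : R := if 0 < w.2 then w.2^-1 else 0.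

(** If t |Tk g| > l, the part of g above c l alone gives t |Tk| >= l / 2, hence 1/t <= 4 l^-2 t
    |Tk|^2 there. The L^2 bound with its constant 4 gramC then yields 16 gramC. *)
Lemma Tk_weak_type l : 0 < l ->
  (\int[nu]_w (if (l%:E < (F w)%:E)%E then (om w)%:E else 0) <=
   (16 * gramC R n * l `^ (- 2))%:E * \int[mu]_z (if (c * l < `|g z|)%R then (`|g z| `^ 2)%:E else 0))%E.
Proof.
move=> l0; have cl : 0 <= c * l by rewrite mulr_ge0// ltW.
have ms : measurable_fun [set: Rn] (small l) by exact: measurable_fun_ifT.
have mb : measurable_fun [set: Rn] (big l) by exact: measurable_fun_ifT.
have sb z : `|small l z| <= c * l by rewrite /small; case: ltP => //; rewrite normr0.
have bb z : `|big l z| <= K by rewrite /big; case: ifP => // _; rewrite normr0 (le_trans _ (gK z)).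
have ps : poisson_integrable (small l) by exact: poisson_integrable_bounded ms sb.
have pb : poisson_integrable (big l) by exact: poisson_integrable_bounded mb bb.
have gE : g = fun z => big l z + small l z.
  by apply/funext => z; rewrite /big /small; case: ifP; rewrite ?addr0 ?add0r.
have G0 := @gramC_gt0 R n.
have l20 : 0 <= 4 * l `^ (- 2) by rewrite mulr_ge0 ?powR_ge0.
pose Y : \bar R := (\int[nu]_(w in @upper R n) ((4 * l `^ (- 2))%:E * (w.2 * Tk (big l) w.1 w.2 ^+ 2)%:E))%E.
apply: (@le_trans _ _ Y); rewrite {}/Y.
  rewrite [leRHS]integral_mkcond; apply: ge0_le_integral_any => w _.
    by case: ifP => // _; rewrite lee_fin /om; case: ifP => // w0; rewrite invr_ge0 ltW.
  have [w0|w0] := pselect (@upper R n w); rewrite patchE; [rewrite mem_set//|rewrite memNset//]; last first.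
    have -> : F w = 0 by rewrite /F; case: ifP => // h; case: w0.
    by rewrite lte_fin ltNge (ltW l0).
  rewrite lte_fin; case: ifPn => [lF|_]; last first.
    by rewrite -EFinM lee_fin (mulr_ge0 l20)// mulr_ge0 ?sqr_ge0// ltW.
  move: lF; rewrite /F /om w0 -EFinM lee_fin => lF.
  have w20 : 0 < w.2 by exact: w0.
  have h : l / 2 <= w.2 * `|Tk (big l) w.1 w.2|.
    have := Tk_small_le w.1 l0 w20; move: lF; rewrite [in Tk g _ _]gE TkD// => lF h.
    have := ler_normD (Tk (big l) w.1 w.2) (Tk (small l) w.1 w.2).
    move=> /(ler_wpM2l (ltW w20)); rewrite mulrDr => h'.
    by lra.
  have h2 : (l / 2) ^+ 2 <= (w.2 * `|Tk (big l) w.1 w.2|) ^+ 2.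
    by rewrite ler_sqr// ?nnegrE ?(le_trans _ h)//; lra.
  rewrite powRN powR_mulrn ?(ltW l0)// || rewrite (_ : - 2 = - 2%:R)//.
  rewrite -[leLHS]mul1r ler_pdivrMr//.
  have l2 : 0 < l ^+ 2 by rewrite exprn_gt0.
  move: h2; rewrite (exprMn _ w.2) real_normK ?num_real// => h2.
  rewrite [leRHS](_ : _ = 4 * (w.2 ^+ 2 * Tk (big l) w.1 w.2 ^+ 2) / l ^+ 2); last by ring.
  rewrite ler_pdivlMr// mul1r.
  by rewrite (_ : l ^+ 2 = 4 * (l / 2) ^+ 2) ?ler_pM2l//; field.
rewrite ge0_integralZl_EFin//; last 3 first.
- exact: measurable_upper.
- by move=> w w0; rewrite lee_fin mulr_ge0 ?sqr_ge0// ltW.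
- apply/measurable_EFinP; apply: measurable_funTS; apply: measurable_funM => //.
  by apply: measurable_funX; exact: measurable_Tk.
apply: le_trans (lee_wpmul2l _ (square_function_L2 mb)) _; first by rewrite lee_fin.
rewrite muleA -EFinM (_ : 4 * l `^ (- 2) * (4 * gramC R n) = 16 * gramC R n * l `^ (- 2)); last by ring.
have C0 : 0 <= 16 * gramC R n * l `^ (- 2) by rewrite mulr_ge0 ?powR_ge0// mulr_ge0// ltW.
rewrite lee_wpmul2l ?lee_fin//.
rewrite le_eqVlt; apply/orP; left; apply/eqP; apply: eq_integral => z _.
rewrite /big; case: ifP => _; last by rewrite expr0n.
by rewrite powR_mulrn// real_normK ?num_real.
Qed.

(** The level integral needs 2 < q and its constant carries (q - 2)^-1; at q = 2 the L^2 bound is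
    itself the estimate. *)
Definition goodC (q : R) : R :=
  if q == 2 then 4 * gramC R n else 2 `^ q * (16 * gramC R n) * ((q - 2)^-1 * c `^ (- (q - 2))).

Lemma square_function_Lq (q : R) : 2 <= q ->
  (\int[mu]_y \int[leb]_(t in pos) (t `^ (q - 1) * `|Tk g y t| `^ q)%:E
   <= (goodC q)%:E * \int[mu]_z (`|g z| `^ q)%:E)%E.
Proof.
move=> q2.
have mT : measurable_fun [set: Rn * R] (fun w => Tk g w.1 w.2) by exact: measurable_Tk.
have mp b d (T' : measurableType d) (u : T' -> R) : measurable_fun setT u -> measurable_fun setT (fun x => u x `^ b).
  by move=> mu; exact: (measurableT_comp (measurable_powR _)).
have mF : measurable_fun [set: Rn * R] (fun w => (w.2 `^ (q - 1) * `|Tk g w.1 w.2| `^ q)%:E).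
  apply/measurable_EFinP; apply: measurable_funM; first exact: mp.
  by apply: mp; exact: measurableT_comp.
have F0 w : (0 <= (w.2 `^ (q - 1) * `|Tk g w.1 w.2| `^ q)%:E)%E.
  by rewrite lee_fin mulr_ge0 ?powR_ge0.
have -> : (\int[mu]_y \int[leb]_(t in pos) (t `^ (q - 1) * `|Tk g y t| `^ q)%:E)%E =
    (\int[nu]_w (if (0 < w.2)%R then (w.2 `^ (q - 1) * `|Tk g w.1 w.2| `^ q)%:E else 0))%E.
  rewrite [RHS](fubini_tonelli1 (m1 := sigmaRn) (m2 := sigmaR)); last 2 first.
  - by apply: measurable_fun_ifT => //; exact: measurable_fun_ltr.
  - by move=> w; case: ifP.
  apply: eq_integral => y _; rewrite /fubini_F/= (integral_if _ setT) setTI; congr (integral _ _ _).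
  by apply/seteqP; split => t /=; rewrite in_itv/= andbT.
have := q2; rewrite le_eqVlt => /predU1P[<-|q2'].
  rewrite /goodC eqxx.
  have := square_function_L2 mg.
  rewrite (eq_integral (fun z => (`|g z| `^ 2)%:E)); last first.
    by move=> z _; rewrite powR_mulrn// real_normK ?num_real.
  apply: le_trans; rewrite [leRHS]integral_mkcond.
  apply: ge0_le_integral_any => w _; first by case: ifP => // _; rewrite lee_fin mulr_ge0 ?powR_ge0.
  rewrite patchE; case: ifPn => w0; last by case: ifPn => // /set_mem w0'; rewrite w0' in w0.
  rewrite mem_set// lee_fin powR_mulrn// real_normK ?num_real//.
  by rewrite (_ : 2 - 1 = 1 :> R) ?powRr1 ?(ltW w0)//; lra.
rewrite /goodC gt_eqF//; have q1 : 1 <= q by lra.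
have := @layer_cake R _ _ _ _ nu sigmaRn (fun w => (F w)%:E) om (fun z => `|g z|) 2 q (16 * gramC R n) c.
move=> /(_ _ _ _ _ _ _ _ _ _ _ _ Tk_weak_type) h.
apply: le_trans (h _ _ _ _ _ _ _ _ _ _ _) => //.
- rewrite le_eqVlt; apply/orP; left; apply/eqP; apply: eq_integral => w _.
  rewrite /F /om; case: ifP => w0; last by rewrite mule0.
  rewrite poweR_EFin -EFinM powRM ?(ltW w0)//; congr EFin.
  rewrite -powR_inv1 ?(ltW w0)// mulrAC -powRD_gt0//.
- apply/measurable_EFinP; apply: measurable_fun_ifT => //; first exact: measurable_fun_ltr.
  by apply: measurable_funM => //; exact: measurableT_comp.
- rewrite (_ : om = fun w => if 0 < w.2 then w.2 `^ (-1) else 0).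
    by apply: measurable_fun_ifT; [exact: measurable_fun_ltr|exact: mp|exact: measurable_cst].
  by apply/funext => w; rewrite /om; case: ifP => // w0; rewrite powR_inv1// ltW.
- exact: measurableT_comp.
- by move=> w; rewrite lee_fin /F; case: ifP => // w0; rewrite mulr_ge0// ltW.
- by move=> w; rewrite /om; case: ifP => // w0; rewrite invr_ge0 ltW.
- by rewrite mulr_ge0// ltW// gramC_gt0.
Qed.

End bounded.

End good_part.

(** * A Hardy inequality in the time variable *)

Section hardy.
Variables (R : realType) (n : nat).
Local Notation V := 'rV[R]_n.+1.
Local Notation Rn := (Rn R n.+1).
Local Notation mu := (@lebn R n.+1).
Local Notation leb := (@lebesgue_measure R).
Local Notation N := (n.+1%:R : R).
Local Notation sigmaRn := (mu : {sigma_finite_measure set Rn -> \bar R}).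
Local Notation sigmaR := (leb : {sigma_finite_measure set (measurableTypeR R) -> \bar R}).
Local Notation pos := (`]0%R, +oo[%classic : set (measurableTypeR R)).
Variables (c s q : R).

Definition hardyC : R :=
  2 `^ q * ((s / 2)^-1 * c `^ (s / 2)) `^ (q - 1) *
  (2 `^ (N + s * (q + 1) / 2) * WkC n (s * (q + 1) / 2) * c `^ (s * (q + 1) / 2)).

(** One splits t^s = t^(1+s/2) t^(s/2-1) and uses [jensen_powR] with the weight t^(s/2-1), whose
    mass on ]0, c |x-y|[ is of order |x-y|^(s/2). The kernel |x-y|^-(N+sq) then retains the excess
    decay a = s (q+1) / 2 > 0. So, for fixed t, the integral over |x-y| > t / c converges and is of
    order t^(-a), which leaves t^(q-1) phi^q. *)
Lemma hardy (phi : R -> R) (y : V) : measurable_fun setT phi -> (forall t, 0 <= phi t) ->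
  0 < c -> 0 < s -> 1 <= q ->
  (\int[mu]_x ((dst x y `^ (- (N + s * q)))%:E *
      poweR (\int[leb]_(t in `]0%R, (c * dst x y)%R[) (phi t * t `^ s)%:E) q)
   <= hardyC%:E * \int[leb]_(t in pos) (t `^ (q - 1) * phi t `^ q)%:E)%E.
Proof.
move=> mphi phi0 c0 s0 q1.
have mp b d (T' : measurableType d) (u : T' -> R) : measurable_fun setT u -> measurable_fun setT (fun x => u x `^ b).
  by move=> mu; exact: (measurableT_comp (measurable_powR _)).
pose a := s * (q + 1) / 2; have a0 : 0 < a by rewrite /a divr_gt0// mulr_gt0//; lra.
pose b := s / 2; have b0 : 0 < b by rewrite /b divr_gt0.
pose B (d : R) := b^-1 * (c * d) `^ b.
pose psi t := t `^ (q + a - 1) * phi t `^ q.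
have psi0 t : 0 <= psi t by rewrite mulr_ge0 ?powR_ge0.
have mpsi : measurable_fun [set: R] psi by apply: measurable_funM; exact: mp.
pose C1 : R := 2 `^ q * (b^-1 * c `^ b) `^ (q - 1).
have C10 : 0 <= C1 by rewrite mulr_ge0 ?powR_ge0.
pose H (x : Rn) (t : R) : \bar R := (if t < c * dst x y then dst x y `^ (- (N + a)) * psi t else 0)%:E.
have H0 x t : (0 <= H x t)%E by rewrite lee_fin; case: ifP => // _; rewrite mulr_ge0 ?powR_ge0.
have mH : measurable_fun [set: Rn * R] (fun w => H w.1 w.2).
  have md : measurable_fun [set: Rn * R] (fun w : Rn * R => dst w.1 (y : Rn)).
    by apply: measurable_fun_dst => //; exact: measurable_fst.
  apply/measurable_EFinP; apply: measurable_fun_ifT => //.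
    by apply: measurable_fun_ltr => //; exact: measurable_funM.
  apply: measurable_funM; first exact: mp.
  exact: (measurableT_comp mpsi measurable_snd).
apply: (@le_trans _ _ (\int[mu]_x (C1%:E * \int[leb]_(t in pos) H x t))%E).
  apply: ge0_le_integral_any => x _; first by rewrite mule_ge0 ?poweR_ge0// lee_fin powR_ge0.
  (* For x = y the convention that 0 to a nonzero power is 0 makes the left-hand side vanish. *)
  have := dst_ge0 x y; rewrite le_eqVlt => /predU1P[<-|d0].
    rewrite powR0 ?mul0e ?mule_ge0 ?lee_fin ?integral_ge0//.
    by rewrite oppr_eq0 gt_eqF// ltr_wpDl// mulr_gt0//; lra.
  have cd0 : 0 < c * dst x y by rewrite mulr_gt0.
  have B0 : 0 < B (dst x y) by rewrite mulr_gt0 ?invr_gt0// powR_gt0.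
  have E t : 0 < t -> phi t * t `^ s = (phi t * t `^ (1 + b)) * t `^ (b - 1).
    by move=> t0; rewrite -mulrA -powRD_gt0//; congr (_ * _ `^ _); rewrite /b; field.
  have -> : (\int[leb]_(t in `]0%R, (c * dst x y)%R[) (phi t * t `^ s)%:E = \int[leb]_(t in `]0%R, (c * dst x y)%R[) (phi t * t `^ (1 + b) * t `^ (b - 1))%:E)%E.
    by apply: eq_integral => t /set_mem; rewrite /= in_itv/= => /andP[t0 _]; rewrite E.
  have J := @jensen_powR _ _ R leb `]0%R, (c * dst x y)%R[%classic (fun t => phi t * t `^ (1 + b)) (fun t => t `^ (b - 1)) q
    (B (dst x y)) (measurable_itv _).
  apply: (@le_trans _ _ ((dst x y `^ (- (N + s * q)))%:E * ((2 `^ q * B (dst x y) `^ (q - 1))%:E *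
      \int[leb]_(t in `]0%R, (c * dst x y)%R[) ((phi t * t `^ (1 + b)) `^ q * t `^ (b - 1))%:E))%E).
    rewrite lee_wpmul2l ?lee_fin ?powR_ge0//; apply: J => //.
    - by apply: measurable_funM => //; exact: mp.
    - by move=> t; rewrite mulr_ge0 ?powR_ge0.
    - by move=> t _; exact: powR_ge0.
    - exact: integral_powR_lt.
  rewrite muleA -EFinM.
  have -> : dst x y `^ (- (N + s * q)) * (2 `^ q * B (dst x y) `^ (q - 1)) = C1 * dst x y `^ (- (N + a)).
    have bc0 : 0 <= b^-1 * c `^ b by rewrite mulr_ge0 ?invr_ge0 ?(ltW b0) ?powR_ge0.
    have -> : B (dst x y) = b^-1 * c `^ b * dst x y `^ b by rewrite /B (powRM _ (ltW c0) (ltW d0)) mulrA.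
    rewrite /C1 (powRM _ bc0 (powR_ge0 _ _)).
    rewrite -[dst x y `^ b `^ _]powRrM.
    rewrite (_ : - (N + a) = - (N + s * q) + b * (q - 1)); last by rewrite /a /b; field.
    by rewrite [in RHS](powRD_gt0 _ _ d0); ring.
  rewrite EFinM -muleA lee_wpmul2l ?lee_fin//.
  rewrite -ge0_integralZl_EFin ?powR_ge0//; last 2 first.
  - by move=> t _; rewrite lee_fin mulr_ge0 ?powR_ge0.
  - apply/measurable_EFinP; apply: measurable_funTS; apply: measurable_funM; apply: mp => //.
    by apply: measurable_funM => //; exact: mp.
  rewrite integral_mkcond [leRHS]integral_mkcond; apply: ge0_le_integral_any => t _; rewrite !patchE.
    by case: ifP => // _; rewrite -EFinM lee_fin mulr_ge0 ?powR_ge0// mulr_ge0 ?powR_ge0.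
  rewrite posE; case: ifPn => [/set_mem|_]; last by case: ifP => // _; exact: H0.
  rewrite /= in_itv/= => /andP[t0 td]; rewrite t0 /H td -EFinM lee_fin /psi.
  rewrite le_eqVlt; apply/orP; left; apply/eqP; congr (_ * _).
  rewrite powRM ?powR_ge0// -powRrM mulrAC -mulrA -powRD_gt0// mulrC -?mulrA; congr (_ `^ _ * _).
  by rewrite /a /b; field.
have C1m : (\int[mu]_x (C1%:E * \int[leb]_(t in pos) H x t) = C1%:E * \int[mu]_x \int[leb]_(t in pos) H x t)%E.
  rewrite ge0_integralZl_EFin//; first by move=> x _; exact: integral_ge0.
  have := measurable_fun_fubini_tonelli_F (m2 := sigmaR) (fun w : Rn * R => (if (0 < w.2)%R then H w.1 w.2 else 0)%E).
  rewrite /fubini_F /= => mS; rewrite (_ : (fun x : Rn => _) = (fun x => (\int[leb]_t (if (0 < t)%R then H x t else 0))%E)).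
    apply: mS; last by move=> x; case: ifP.
    by apply: measurable_fun_ifT => //; exact: measurable_fun_ltr.
  apply/funext => x; rewrite (integral_if _ setT) setTI; congr (integral _ _ _).
  by apply/seteqP; split => l /=; rewrite in_itv/= andbT.
rewrite C1m (tonelli_dom sigmaRn sigmaR measurableT (measurable_itv _) mH H0).
pose C2 : R := 2 `^ (N + a) * WkC n a * c `^ a.
have C20 : 0 <= C2 by rewrite mulr_ge0 ?powR_ge0// mulr_ge0 ?powR_ge0// WkC_ge0.
rewrite (_ : hardyC%:E = C1%:E * C2%:E)%E// -muleA lee_wpmul2l ?lee_fin//.
rewrite -ge0_integralZl_EFin//; last 2 first.
- by move=> t _; rewrite lee_fin mulr_ge0 ?powR_ge0.
- by apply/measurable_EFinP; apply: measurable_funTS; apply: measurable_funM; exact: mp.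
apply: ge0_le_integral_any => t /posP t0; first exact: integral_ge0.
apply: (@le_trans _ _ (\int[mu]_x ((psi t)%:E * (if t / c <= dst y x then dst y x `^ (- (N + a)) else 0)%:E))%E).
  apply: ge0_le_integral_any => x _; first exact: H0.
  rewrite -EFinM lee_fin ler_pdivrMr// [dst y x * c]mulrC (dstC y).
  case: ltP => [td|_]; first by rewrite (ltW td) mulrC.
  by rewrite mulr_ge0//; case: ifP => // _; exact: powR_ge0.
rewrite ge0_integralZl_EFin//; last 2 first.
- by move=> x _; rewrite lee_fin; case: ifP => // _; exact: powR_ge0.
- have md : measurable_fun [set: Rn] (fun x : Rn => dst (y : Rn) x) by exact: measurable_fun_dst.
  apply/measurable_EFinP; apply: measurable_fun_ifT => //; last exact: mp.
  exact: measurable_fun_ler.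
apply: le_trans (lee_wpmul2l _ (integral_far y a0 (divr_gt0 t0 c0))) _; first by rewrite lee_fin.
rewrite -!EFinM lee_fin le_eqVlt; apply/orP; left; apply/eqP.
rewrite -/a powRM ?invr_ge0 ?(ltW t0) ?(ltW c0)//.
have -> : c^-1 `^ (- a) = c `^ a by rewrite -powR_inv1 ?(ltW c0)// -powRrM mulN1r opprK.
rewrite /psi (_ : q + a - 1 = (q - 1) + a); last by ring.
have e : t `^ (q - 1 + a) * t `^ (- a) = t `^ (q - 1) by rewrite -powRD_gt0// addrK.
by rewrite /C2 -e; ring.
Qed.

End hardy.

Lemma seq_argmax (R : realDomainType) (T : eqType) (f : T -> R) (x0 : T) (s : seq T) :
  exists2 x, x \in x0 :: s & forall y, y \in x0 :: s -> f y <= f x.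
Proof.
elim: s x0 => [|x1 s IH] x0; first by exists x0; rewrite ?mem_head// => y; rewrite inE => /eqP ->.
have [x xs xmax] := IH x1; have [h|h] := leP (f x) (f x0).
  exists x0; rewrite ?mem_head// => y; rewrite inE => /predU1P[->//|/xmax yx].
  exact: le_trans yx h.
exists x; first by rewrite inE xs orbT.
by move=> y; rewrite inE => /predU1P[->|/xmax//]; exact: ltW.
Qed.

Lemma measurable_fun_mem d d' (T : measurableType d) (T' : measurableType d') (A : set T) (h : T' -> T) :
  measurable A -> measurable_fun setT h -> measurable_fun setT (fun x => h x \in A).
Proof.
move=> mA mh; apply: (measurable_fun_bool true).
rewrite (_ : _ @^-1` _ = h @^-1` A) ?setTI.
  by rewrite -[X in measurable X]setTI; exact: mh.
by apply/seteqP; split => w /= hw; [exact: set_mem hw|exact: mem_set hw].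
Qed.

(** * The centred maximal function over cubes *)

Section maximal.
Variables (R : realType) (n : nat).
Local Notation V := 'rV[R]_n.+1.
Local Notation Rn := (Rn R n.+1).
Local Notation mu := (@lebn R n.+1).
Local Notation N := (n.+1%:R : R).
Local Notation sigmaRn := (mu : {sigma_finite_measure set Rn -> \bar R}).
Local Notation cball := (cball R n).
Implicit Types (v : Rn -> \bar R) (lam r : R).

(** The strict inequality survives a small increase of the radius. This room gives openness of the
    level sets and allows rational centres and radii. *)
Lemma ltr_exprn_radius lam r (S : \bar R) : 0 < lam -> 0 < r -> ((lam * r ^+ n.+1)%:E < S)%E ->
  exists2 d, 0 < d & ((lam * (r + d) ^+ n.+1)%:E < S)%E.
Proof.
move=> l0 r0; case: S => [S| |] //; last by exists 1 => //; rewrite ltry.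
rewrite lte_fin mulrC -ltr_pdivlMr// => h.
have e0 : 0 < S / lam by apply: lt_trans h; rewrite exprn_gt0.
pose r1 := (S / lam) `^ (N^-1).
have r1N : r1 ^+ n.+1 = S / lam.
  by rewrite -powR_mulrn ?powR_ge0// /r1 -powRrM mulVf// powRr1// ltW.
have rr : r < r1.
  by rewrite -(ltr_pXn2r (ltn0Sn n)) ?nnegrE ?powR_ge0 ?(ltW r0)// r1N.
exists ((r1 - r) / 2); first by rewrite divr_gt0// subr_gt0.
rewrite lte_fin mulrC -ltr_pdivlMr// -r1N ltr_pXn2r ?nnegrE ?powR_ge0//; lra.
Qed.

(** A level set of the centred maximal function, normalised by r^(n+1) instead of the measure of the
    cube, so the definition does not involve [cball]. *)
Definition maxset v lam : set Rn :=
  [set y | exists2 r, 0 < r & ((lam * r ^+ n.+1)%:E < \int[mu]_(z in dball y r) v z)%E].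

Lemma dball_subset (x y : V) r d : dst x y <= d -> dball y r `<=` dball x (r + d).
Proof.
move=> xy z; rewrite /dball/= => h; apply: le_lt_trans (dst_triangle y x z) _.
by rewrite addrC ltr_leD.
Qed.

Section ge0.
Variable v : Rn -> \bar R.
Hypothesis mv : measurable_fun setT v.
Hypothesis v0 : forall z, (0 <= v z)%E.

Lemma open_maxset lam : 0 < lam -> open (maxset v lam : set V).
Proof.
move=> l0; apply/open_dstP => x [r r0 /(ltr_exprn_radius l0 r0)[d d0 h]].
exists d => // z xz; exists (r + d); first exact: addr_gt0.
apply: lt_le_trans h _; apply: ge0_subset_integral_any => //.
by apply: dball_subset; rewrite dstC ltW.
Qed.

Lemma measurable_maxset lam : 0 < lam -> measurable (maxset v lam).
Proof. by move=> l0; apply: measurable_open; exact: open_maxset. Qed.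

Lemma maxsetP lam (x : V) r : ~ maxset v lam x -> 0 < r ->
  (\int[mu]_(z in dball x r) v z <= (lam * r ^+ n.+1)%:E)%E.
Proof. by move=> nx r0; rewrite leNgt; apply/negP => h; apply: nx; exists r. Qed.

Let heavy lam (b : V * R) := 0 < b.2 /\ ((lam * b.2 ^+ n.+1)%:E < \int[mu]_(z in dball b.1 b.2) v z)%E.
Let union (L : seq (V * R)) : set Rn := \big[setU/set0]_(b <- L) dball b.1 b.2.

Let unionP L x : union L x <-> exists2 b, b \in L & dball b.1 b.2 x.
Proof.
rewrite /union -bigcup_seq; split => [[b bL h]|[b bL h]]; exists b => //.
Qed.

Let measurable_union L : measurable (union L).
Proof. by apply: bigsetU_measurable => b _; exact: measurable_dball. Qed.

(** Vitali's greedy selection, by induction on the number of cubes: a largest cube b is selected,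
    the cubes too near to it lie in its triple, and the induction hypothesis applies to the
    remaining ones, whose union is disjoint from b. The integrals of v therefore add up. *)
Lemma finite_covering lam (L : seq (V * R)) : 0 < lam -> (forall b, b \in L -> heavy lam b) ->
  (mu (union L) <= (3 ^+ n.+1 * cball / lam)%:E * \int[mu]_(z in union L) v z)%E.
Proof.
move=> l0; have C0 : 0 <= 3 ^+ n.+1 * cball / lam.
  by rewrite divr_ge0 ?(ltW l0)// mulr_ge0 ?exprn_ge0 ?cball_ge0.
have [m] := ubnP (size L); elim: m L => // m IH L sL hL.
case: L sL hL => [|b0 L0] sL hL.
  by rewrite /union big_nil lebn_set0 integral_set0 mule0.
set L := b0 :: L0 in sL hL *.
have [b bL bmax] := seq_argmax snd b0 L0; rewrite -/L in bL bmax.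
(* The cubes at distance at least the sum of the radii, hence disjoint from b. The cube b itself is
   filtered out, its distance to itself being 0, so L' is strictly shorter. *)
pose L' := [seq b' <- L | b.2 + b'.2 <= dst b.1 b'.1].
have [b_gt0 hb] := hL _ bL.
have L'L : {subset L' <= L} by move=> x; rewrite mem_filter => /andP[].
have sL' : (size L' < m)%N.
  rewrite -ltnS; apply: leq_trans sL; rewrite ltnS size_filter; set P := (X in count X _).
  rewrite -(count_predC P L) -[X in (X < _)%N]addn0 ltn_add2l -has_count.
  by apply/hasP; exists b => //=; rewrite /P dstxx -ltNge addr_gt0.
have h1 := IH L' sL' (fun b' b'L => hL _ (L'L _ b'L)).
have disj : [disjoint dball b.1 b.2 & union L'].
  apply/disj_setPS => x [xb /unionP[b' ]]; rewrite mem_filter => /andP[h _] xb'.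
  have := dst_triangle x b.1 b'.1; rewrite (dstC x).
  by move: xb xb'; rewrite /dball/=; lra.
have cover : union L `<=` dball b.1 (3 * b.2) `|` union L'.
  move=> x /unionP[b' b'L xb']; have [h|h] := leP (b.2 + b'.2) (dst b.1 b'.1).
    by right; apply/unionP; exists b' => //; rewrite mem_filter h.
  left; rewrite /dball/=; have := dst_triangle b'.1 b.1 x; have := bmax _ b'L.
  by move: xb'; rewrite /dball/=; lra.
apply: le_trans (le_lebn cover) _.
have hU : (mu (dball b.1 (3 * b.2)%R `|` union L') <= mu (dball b.1 (3 * b.2)%R) + mu (union L'))%E.
  by apply: (@measureU2 _ _ _ sigmaRn) => //; exact: measurable_dball.
apply: le_trans hU _.
have sub : dball b.1 b.2 `|` union L' `<=` union L.
  move=> x [xb|/unionP[b' b'L xb']]; apply/unionP; first by exists b.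
  by exists b' => //; exact: L'L.
apply: (@le_trans _ _ ((3 ^+ n.+1 * cball / lam)%:E * \int[mu]_(z in dball b.1 b.2 `|` union L') v z)%E); last first.
  by rewrite lee_wpmul2l ?lee_fin//; exact: ge0_subset_integral_any.
have -> : (\int[mu]_(z in dball b.1 b.2 `|` union L') v z =
    \int[mu]_(z in dball b.1 b.2) v z + \int[mu]_(z in union L') v z)%E.
  by rewrite ge0_integral_setU//; [exact: measurable_dball|exact: measurable_funTS].
rewrite ge0_muleDr ?integral_ge0//; apply: leeD => //.
rewrite lebn_dball ?mulr_gt0//.
apply: (@le_trans _ _ ((3 ^+ n.+1 * cball / lam)%:E * (lam * b.2 ^+ n.+1)%:E)%E); last first.
  by rewrite lee_wpmul2l ?lee_fin// ltW.
rewrite -EFinM lee_fin le_eqVlt; apply/orP; left; apply/eqP; rewrite exprMn; field.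
by rewrite gt_eqF.
Qed.

(** Each point of the set lies in a heavy cube with rational centre and radius. These are
    enumerated, finite unions of them obey [finite_covering], and continuity from below passes to
    the countable union. *)
Lemma weak_type_maxset lam : 0 < lam ->
  (mu (maxset v lam) <= (3 ^+ n.+1 * cball / lam)%:E * \int[mu]_z v z)%E.
Proof.
move=> l0; have C0 : 0 <= 3 ^+ n.+1 * cball / lam.
  by rewrite divr_ge0 ?(ltW l0)// mulr_ge0 ?exprn_ge0 ?cball_ge0.
pose bl (c : 'rV[rat]_n.+1 * rat) : V * R := (map_mx ratr c.1, ratr c.2).
pose cand (i : nat) : seq (V * R) :=
  if unpickle i is Some c then if `[< heavy lam (bl c) >] then [:: bl c] else [::] else [::].
pose L (k : nat) : seq (V * R) := flatten [seq cand i | i <- iota 0 k].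
have hL k b : b \in L k -> heavy lam b.
  move=> /flatten_mapP[i _]; rewrite /cand; case: unpickle => // c.
  by case: ifPn => // /asboolP h; rewrite inE => /eqP ->.
have ndL : nondecreasing_seq (fun k => union (L k)).
  move=> i j ij; apply/subsetPset => x /unionP[b /flatten_mapP[k ki bk] bx].
  apply/unionP; exists b => //; apply/flatten_mapP; exists k => //.
  by move: ki; rewrite !mem_iota/= !add0n => /leq_trans; exact.
have sub : maxset v lam `<=` \bigcup_k union (L k).
  move=> y [r r0 /(ltr_exprn_radius l0 r0)[d d0 h]].
  have [r' ] := @rat_in_itvoo R r (r + d) ltac:(lra).
  rewrite in_itv/= => /andP[rr rd].
  (* A centre c at distance less than r' - r makes the cube of radius r' about c contain that of
     radius r about y, while r' < r + d keeps it heavy. *)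
  have [c hc] := @dst_rat R n y (ratr r' - r) ltac:(lra).
  have hv : heavy lam (bl (c, r')).
    split => /=; first lra.
    apply: le_lt_trans (lt_le_trans h _) => //.
      by rewrite lee_fin ler_pM2l// lerXn2r ?nnegrE; lra.
    apply: ge0_subset_integral_any => // z; rewrite /dball/= => yz.
    by have := dst_triangle y (map_mx ratr c) z; rewrite (dstC (map_mx ratr c) y); lra.
  exists (pickle (c, r')).+1 => //; apply/unionP; exists (bl (c, r')).
    apply/flatten_mapP; exists (pickle (c, r')); first by rewrite mem_iota/= add0n.
    by rewrite /cand pickleK; case: asboolP => // _; rewrite mem_head.
  by rewrite /dball/= dstC; lra.
apply: le_trans (le_lebn sub) _.
have cv := @nondecreasing_cvg_mu _ _ _ sigmaRn (fun k => union (L k)) (fun k => measurable_union (L k))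
  (bigcup_measurable (fun k _ => measurable_union (L k))) ndL.
rewrite -(cvg_lim _ cv)//; apply: lime_le; first by apply/cvg_ex; eexists; exact: cv.
apply: nearW => k /=; apply: le_trans (finite_covering l0 (hL k)) _.
by rewrite lee_wpmul2l ?lee_fin//; exact: ge0_subset_integral_any.
Qed.

Definition maxfun (y : Rn) : \bar R :=
  ereal_sup [set (((r ^+ n.+1)^-1)%:E * \int[mu]_(z in dball y r) v z)%E | r in [set r : R | 0 < r]].

Lemma maxfun_gtP lam y : (lam%:E < maxfun y)%E <-> maxset v lam y.
Proof.
have E r : 0 < r -> (lam%:E < ((r ^+ n.+1)^-1)%:E * \int[mu]_(z in dball y r) v z)%E =
    ((lam * r ^+ n.+1)%:E < \int[mu]_(z in dball y r) v z)%E.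
  move=> r0; have rN : 0 < r ^+ n.+1 by rewrite exprn_gt0.
  by rewrite muleC lte_pdivlMr// EFinM.
split => [|[r r0 h]].
  by rewrite /maxfun => /ereal_sup_gt[_ [r r0 <-]]; rewrite E// => h; exists r.
by apply: lt_le_trans (ereal_sup_ubound _); last (by exists r); rewrite /= E.
Qed.

Lemma maxfun_ge0 y : (0 <= maxfun y)%E.
Proof.
apply: le_trans (ereal_sup_ubound _); last by exists 1 => /=.
by rewrite mule_ge0 ?lee_fin ?invr_ge0 ?exprn_ge0// integral_ge0.
Qed.

Lemma le_maxfun y r : 0 < r ->
  (\int[mu]_(z in dball y r) v z <= (r ^+ n.+1)%:E * maxfun y)%E.
Proof.
move=> r0; have rN : 0 < r ^+ n.+1 by rewrite exprn_gt0.
have h : (((r ^+ n.+1)^-1)%:E * \int[mu]_(z in dball y r) v z <= maxfun y)%E.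
  by apply: ereal_sup_ubound; exists r.
have := @lee_wpmul2l R (r ^+ n.+1)%:E (ltW rN : (0 <= (r ^+ n.+1)%:E)%E) _ _ h.
by rewrite muleA -EFinM mulfV ?gt_eqF// mul1e.
Qed.

Lemma measurable_maxfun : measurable_fun setT maxfun.
Proof.
apply: (measurability _ (ErealGenOInfty.measurableE R)) => _ [_ [lam ->] <-].
rewrite setTI; have [l0|l0] := ltP lam 0.
  rewrite (_ : _ @^-1` _ = setT); first exact: measurableT.
  apply/seteqP; split => // y _ /=; rewrite in_itv/= andbT.
  by apply: lt_le_trans (maxfun_ge0 y); rewrite lte_fin.
(* The level sets are known to be open for positive levels only; the approximation by lam + 1/(k+1)
   includes lam = 0. *)
have cover : maxfun @^-1` `]lam%:E, +oo[ = \bigcup_k maxset v (lam + k.+1%:R^-1).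
  apply/seteqP; split => y /=.
    rewrite in_itv/= andbT => h.
    move: h; case E : (maxfun y) => [m| |] // h.
      have [k k0 hk] : exists2 k : nat, 0 < (k.+1%:R^-1 : R) & k.+1%:R^-1 < m - lam.
        by apply: natSinv_lt; rewrite subr_gt0.
      by exists k => //; apply/maxfun_gtP; rewrite E lte_fin -ltrBrDl.
    by exists 0%N => //; apply/maxfun_gtP; rewrite E ltry.
  move=> [k _ /maxfun_gtP h]; rewrite in_itv/= andbT; apply: lt_trans h.
  by rewrite lte_fin ltrDl.
rewrite cover; apply: bigcup_measurable => k _; apply: measurable_maxset.
by rewrite ltr_wpDl.
Qed.

End ge0.

(** With k = 1 / (2 (cball + 1)) the part of g below k l adds at most l / 2 to any average, so the
    level l of the maximal function is governed by the level l / 2 for the part of g above k l. The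
    weak type bound for that part feeds [layer_cake] with r = 1. *)
Lemma maxfun_Lp (p : R) (g : Rn -> R) : 1 < p -> measurable_fun setT g -> (forall z, 0 <= g z) ->
  (\int[mu]_y poweR (maxfun (EFin \o g) y) p <=
   (2 `^ p * (2 * (3 ^+ n.+1 * cball)) * ((p - 1)^-1 * ((2 * (cball + 1))^-1) `^ (- (p - 1))))%:E *
   \int[mu]_z (g z `^ p)%:E)%E.
Proof.
move=> p1 mg g0; have c0 := @cball_ge0 R n.
have k0 : 0 < (2 * (cball + 1))^-1 :> R by rewrite invr_gt0 mulr_gt0// ltr_wpDl.
have mEg : measurable_fun setT (EFin \o g) by exact/measurable_EFinP.
have := @layer_cake R _ _ _ _ sigmaRn sigmaRn (maxfun (EFin \o g)) (cst 1) g 1 p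
  (2 * (3 ^+ n.+1 * cball)) (2 * (cball + 1))^-1.
have -> : (\int[mu]_y poweR (maxfun (EFin \o g) y) p = \int[sigmaRn]_y (poweR (maxfun (EFin \o g) y) p * (cst 1 y)%:E))%E.
  by apply: eq_integral => y _; rewrite mule1.
apply => //.
- by apply: measurable_maxfun => // z; rewrite lee_fin.
- by apply: maxfun_ge0 => z; rewrite lee_fin.
- exact: ltW.
- by rewrite !mulr_ge0 ?exprn_ge0.
move=> l l0; set k := (2 * (cball + 1))^-1 in k0 *.
pose h z : \bar R := if k * l < g z then (g z)%:E else 0%E.
have h0 z : (0 <= h z)%E by rewrite /h; case: ifP => // _; rewrite lee_fin.
have mh : measurable_fun setT h.
  by apply: measurable_fun_ifT => //; exact: measurable_fun_ltr.
have sub : maxset (EFin \o g) l `<=` maxset h (l / 2).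
  move=> y [r r0 hr]; exists r => //.
  have le : (\int[mu]_(z in dball y r) (EFin \o g) z <= \int[mu]_(z in dball y r) h z + (k * l * (cball * r ^+ n.+1))%:E)%E.
    apply: (@le_trans _ _ (\int[mu]_(z in dball y r) (h z + (cst (k * l)%:E z)))%E).
      apply: ge0_le_integral_any => z _ /=; first by rewrite lee_fin.
      rewrite /h; case: ltP => gz; first by rewrite leeDl// lee_fin mulr_ge0// ltW.
      by rewrite add0e lee_fin.
    have -> : ((k * l * (cball * r ^+ n.+1))%:E = \int[mu]_(z in dball y r) cst (k * l)%:E z)%E.
      transitivity ((k * l)%:E * mu (dball y r))%E; first by rewrite lebn_dball// -EFinM.
      by rewrite integral_cst//; exact: measurable_dball.
    have kl0 : 0 <= k * l by rewrite mulr_ge0// ltW.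
    have md : measurable (dball y r) by exact: measurable_dball.
    by rewrite ge0_integralD//; exact: measurable_funTS.
  have kc : k * cball <= 2^-1.
    rewrite /k invfM -mulrA ler_piMr ?invr_ge0//.
    by rewrite mulrC ler_pdivrMr ?mul1r ?lerDl// ltr_wpDl.
  have rN : 0 < r ^+ n.+1 by rewrite exprn_gt0.
  have := lt_le_trans hr le.
  case: (\int[mu]_(z in dball y r) h z)%E => [a| |] H; [|by rewrite ltry|by move: H]; move: H.
  rewrite -EFinD !lte_fin => H.
  have : k * l * (cball * r ^+ n.+1) <= 2^-1 * (l * r ^+ n.+1).
    by rewrite [leLHS](_ : _ = k * cball * (l * r ^+ n.+1)) ?ler_wpM2r// ?mulr_ge0 ?(ltW l0) ?(ltW rN)//; ring.
  by rewrite (_ : l / 2 * r ^+ n.+1 = l * r ^+ n.+1 - 2^-1 * (l * r ^+ n.+1)); [lra|field].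
apply: (@le_trans _ _ (mu (maxset (EFin \o g) l))).
  rewrite (integral_if _ setT) setTI (_ : [set y | _] = maxset (EFin \o g) l); last first.
    by apply/seteqP; split => y /maxfun_gtP; apply => //= z; rewrite lee_fin.
  have mS : measurable (maxset (EFin \o g) l) by apply: measurable_maxset => // z; rewrite lee_fin.
  have -> : (\int[mu]_(x in maxset (EFin \o g) l) (cst 1 x)%:E = mu (maxset (EFin \o g) l))%E.
    by rewrite (eq_integral (cst 1%:E))// integral_cst ?mul1e.
  exact: lexx.
apply: le_trans (le_lebn sub) _.
apply: le_trans (weak_type_maxset mh h0 _) _; first by rewrite divr_gt0.
rewrite powR_inv1 ?(ltW l0)// (_ : 3 ^+ n.+1 * cball / (l / 2) = 2 * (3 ^+ n.+1 * cball) / l); last first.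
  by field; rewrite gt_eqF.
rewrite lee_wpmul2l//; first by rewrite lee_fin divr_ge0 ?(ltW l0)// !mulr_ge0 ?exprn_ge0.
apply: ge0_le_integral_any => z _; first exact: h0.
by rewrite /h; case: ifP => // _; rewrite powRr1.
Qed.

Lemma measurable_box (a b : V) : measurable (box a b).
Proof.
rewrite (_ : box a b = \bigcap_(i in [set: 'I_n.+1]) [set x : Rn | a ord0 i <= (x : V) ord0 i <= b ord0 i]); last first.
  by apply/seteqP; split => x h i; [move=> _; exact: h|exact: h].
apply: fin_bigcap_measurable => [|i _]; first exact: finite_finset.
rewrite (_ : [set x | _] = [set: Rn] `&` (fun x : Rn => (x : V) ord0 i) @^-1` `[a ord0 i, b ord0 i]%classic).
  by apply: measurable_coord => //; exact: measurable_itv.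
by rewrite setTI; apply/seteqP; split => x /=; rewrite in_itv.
Qed.

(** A quantitative form of the density theorem. The measure of A in a cube of radius rho, integrated
    over the centre, is the measure of A times that of the cube. The centres that matter fill at
    most 2^(n+1) vol(a, b). If A were sparse in the cubes of radius 2 rho about its own points, this
    integral would come out too small by a factor 2. Half the shortest side is taken for rho, so
    that enlarging the box by rho at most doubles each side. *)
Lemma exists_dense_point (A : set Rn) (a b : V) : measurable A -> A `<=` box a b ->
  (forall i, a ord0 i <= b ord0 i) -> (0 < mu A)%E -> ((vol a b)%:E <= 2%:E * mu A)%E -> 0 < cball ->
  exists r z, [/\ 0 < r, A z & ((cball * (4 ^- n.+1 / 4) * r ^+ n.+1)%:E <= mu (A `&` dball z r))%E].
Proof.
move=> mA Ab ab A0 vA c0.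
have vp : 0 < vol a b.
  rewrite -lte_fin; apply: lt_le_trans (lebn_box_le ab); exact: lt_le_trans A0 (le_lebn Ab).
have sd i : 0 < b ord0 i - a ord0 i.
  rewrite lt_def subr_ge0 ab andbT; apply: contraTneq vp => h.
  by rewrite /vol (bigD1 i)//= h mul0r ltxx.
pose i0 := [arg min_(i < (ord0 : 'I_n.+1)) (b ord0 i - a ord0 i)]%O.
have hi0 i : b ord0 i0 - a ord0 i0 <= b ord0 i - a ord0 i.
  by rewrite /i0; case: arg_minP => // j _; exact.
pose rho := (b ord0 i0 - a ord0 i0) / 2; have rho0 : 0 < rho by rewrite divr_gt0.
pose Q : set Rn := box (a - const_mx rho) (b + const_mx rho).
have Qv : (mu Q <= (2 ^+ n.+1 * vol a b)%:E)%E.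
  apply: le_trans (lebn_box_le _) _; first by move=> i; rewrite !mxE; have := ab i; lra.
  rewrite lee_fin /vol; have -> : 2 ^+ n.+1 = \prod_(i < n.+1) 2 :> R by rewrite prodr_const card_ord.
  rewrite -big_split/=; apply: ler_prod => i _; rewrite !mxE.
  have := hi0 i; have := sd i; have := sd i0; rewrite /rho => h0 h1 h2.
  by apply/andP; split; lra.
have Af : mu A \is a fin_num.
  rewrite ge0_fin_numE//; apply: le_lt_trans (le_lebn Ab) _.
  by apply: le_lt_trans (lebn_box_le ab) _; rewrite ltry.
pose al := fine (mu A); have alE : mu A = al%:E by rewrite fineK.
have al0 : 0 < al by rewrite -lte_fin -alE.
pose c := cball * rho ^+ n.+1; have cp : 0 < c by rewrite mulr_gt0// exprn_gt0.
(* Calibrated so that k 2^(n+1) 2 al = c al / 2, half of the exact total. *)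
pose k := 2 ^- n.+1 / 4 * c; have k0 : 0 < k by rewrite mulr_gt0// divr_gt0// invr_gt0 exprn_gt0.
have kE : cball * (4 ^- n.+1 / 4) * (2 * rho) ^+ n.+1 = k.
  rewrite /k /c exprMn (_ : 4 ^+ n.+1 = 2 ^+ n.+1 * 2 ^+ n.+1); first by field; rewrite expf_neq0.
  by rewrite -exprMn; congr (_ ^+ _); ring.
apply: contrapT => no.
have small z : A z -> (mu (A `&` dball z (2 * rho)) < k%:E)%E.
  move=> Az; rewrite ltNge; apply/negP => h; apply: no; exists (2 * rho), z.
  by rewrite kE mulr_gt0.
pose H (x z : Rn) : \bar R := if dst x z < rho then 1%E else 0%E.
have H0 x z : (0 <= H x z)%E by rewrite /H; case: ifP.
have mH : measurable_fun [set: Rn * Rn] (fun w => H w.1 w.2).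
  apply: measurable_fun_ifT => //; apply: measurable_fun_ltr => //.
  exact: measurable_fun_dst.
have uE x : (\int[mu]_(z in A) H x z = mu (A `&` dball x rho))%E.
  rewrite /H integral_if integral_cst ?mul1e//.
  by apply: measurableI => //; exact: measurable_dball.
have total : (\int[mu]_x \int[mu]_(z in A) H x z = (c * al)%:E)%E.
  rewrite (tonelli_dom sigmaRn sigmaRn measurableT mA mH H0).
  rewrite (eq_integral (cst c%:E)); last first.
    move=> z _; rewrite /H (integral_if _ setT) setTI.
    rewrite (_ : [set x | _] = dball z rho); last first.
      by apply/seteqP; split => x; rewrite /dball/= dstC.
    transitivity (1%:E * mu (dball z rho))%E; last by rewrite mul1e lebn_dball.
    by rewrite integral_cst//; exact: measurable_dball.
  by transitivity (c%:E * mu A)%E; [rewrite integral_cst|rewrite alE -EFinM].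
have mu_u : measurable_fun setT (fun x : Rn => \int[mu]_(z in A) H x z)%E.
  have := measurable_integral_param (F := fun x z : Rn => if z \in A then H x z else 0%E).
  rewrite (_ : (fun x : Rn => (\int[mu]_(z in A) H x z)%E) =
    (fun x => (\int[mu]_z (if z \in A then H x z else 0))%E)); last first.
    by apply/funext => x; rewrite integral_mkcond.
  apply; last by move=> x z; case: ifP.
  apply: measurable_fun_ifT => //.
  exact: (measurable_fun_mem mA measurable_snd).
pose U := [set x : Rn | (0 < \int[mu]_(z in A) H x z)%E].
have mU : measurable U by rewrite -[U]setTI; apply: emeasurable_fun_o_infty.
have UQ : U `<=` Q.
  move=> x; rewrite /U/= uE => h.
  have [z [Az xz]] : A `&` dball x rho !=set0.
    by apply/set0P; apply: contraTneq h => ->; rewrite lebn_set0 ltxx.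
  move=> i; have /andP[z1 z2] := Ab _ Az i; rewrite !mxE.
  have := le_lt_trans (dst_coord x z i) xz; rewrite ltr_norml => /andP[x1 x2]; lra.
have ub x : (\int[mu]_(z in A) H x z <= if x \in U then k%:E else 0)%E.
  case: ifPn => [/set_mem|]; rewrite ?notin_setE /U/= uE; last by move/negP; rewrite -leNgt.
  move=> h; have [z [Az xz]] : A `&` dball x rho !=set0.
    by apply/set0P; apply: contraTneq h => ->; rewrite lebn_set0 ltxx.
  apply: ltW; apply: le_lt_trans (small _ Az); apply: le_lebn; apply: setIS => w xw.
  move: xz xw; rewrite /dball/= => xz xw.
  by have := dst_triangle x z w; rewrite (dstC z x); lra.
have : (\int[mu]_x \int[mu]_(z in A) H x z <= (k * (2 ^+ n.+1 * (2 * al)))%:E)%E.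
  apply: (@le_trans _ _ (\int[mu]_(x in U) cst k%:E x)%E).
    rewrite [leRHS]integral_mkcond; apply: ge0_le_integral_any => x _; first exact: integral_ge0.
    by rewrite patchE; exact: ub.
  rewrite integral_cst// (EFinM k) lee_wpmul2l ?lee_fin ?(ltW k0)//.
  apply: le_trans (le_lebn UQ) _; apply: le_trans Qv _.
  by rewrite lee_fin ler_pM2l ?exprn_gt0// -lee_fin EFinM -alE.
rewrite total lee_fin leNgt; apply/negP; rewrite negbK.
rewrite (_ : k * _ = c * al / 2); last by rewrite /k; field; rewrite expf_neq0.
by rewrite ltr_pdivrMr// ltr_pMr ?ltr1n// mulr_gt0.
Qed.

(** Stands in for the differentiation theorem, with a constant larger than 1. Otherwise a bounded
    piece of the exceptional set would fill more than half of some box, hence be dense near one of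
    its points z. Since g is large on the piece, the average of g about z would then exceed lam,
    although z is outside the level set. The factor 8 4^(n+1) / cball is twice the reciprocal of the
    density in [exists_dense_point]. *)
Lemma ae_le_off_maxset (g : Rn -> R) lam : measurable_fun setT g -> (forall z, 0 <= g z) ->
  0 < lam -> 0 < cball ->
  mu ([set z | 8 * 4 ^+ n.+1 / cball * lam < g z] `\` maxset (EFin \o g) lam) = 0%E.
Proof.
move=> mg g0 l0 c0; set E := _ `\` _.
have C0 : 0 < 8 * 4 ^+ n.+1 / cball * lam by rewrite mulr_gt0// divr_gt0// mulr_gt0// exprn_gt0.
have mE : measurable E.
  apply: measurableD.
    rewrite (_ : [set z | _] = [set: Rn] `&` g @^-1` `]8 * 4 ^+ n.+1 / cball * lam, +oo[%classic); last first.
      by rewrite setTI; apply/seteqP; split => z /=; rewrite in_itv/= andbT.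
    by apply: mg => //; exact: measurable_itv.
  by apply: measurable_maxset => // z; rewrite lee_fin.
have low (A : set Rn) z r : measurable A -> A `<=` E -> A z -> 0 < r ->
    ((8 * 4 ^+ n.+1 / cball)%:E * mu (A `&` dball z r) <= (r ^+ n.+1)%:E)%E.
  move=> mA AE Az r0.
  have mI : measurable (A `&` dball z r) by apply: measurableI => //; exact: measurable_dball.
  have [_ nz] := AE _ Az.
  have h : ((8 * 4 ^+ n.+1 / cball * lam)%:E * mu (A `&` dball z r) <= (lam * r ^+ n.+1)%:E)%E.
    rewrite -integral_cst//; apply: le_trans (maxsetP nz r0).
    apply: (@le_trans _ _ (\int[mu]_(z in A `&` dball z r) (EFin \o g) z)%E).
      apply: ge0_le_integral_any => w [/AE[gw _] _]; first by rewrite lee_fin ltW.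
      by rewrite lee_fin ltW.
    by apply: ge0_subset_integral_any => // w _; rewrite lee_fin.
  have lV : (0 <= (lam^-1)%:E)%E by rewrite lee_fin invr_ge0 ltW.
  have := lee_wpmul2l lV h; rewrite muleA -!EFinM.
  by rewrite mulKf ?gt_eqF// mulrC mulfK ?gt_eqF.
apply: contrapT => /eqP E0.
have [k Ek] : exists k : nat, mu (E `&` dball 0 k.+1%:R) != 0%E.
  apply: contrapT => no; move/eqP : E0; apply; apply/eqP; rewrite eq_le lebn_ge0 andbT.
  apply: (@le_trans _ _ (mu (\bigcup_k (E `&` dball 0 k.+1%:R)))).
    apply: le_lebn => x Ex; exists (Num.truncn (dst 0 x)) => //; split => //.
    by rewrite /dball/= truncnS_gt.
  apply: le_trans (lebn_sigma_subadditive _) _; rewrite eseries0// => k _ _.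
  by apply/eqP/negPn/negP => h; apply: no; exists k.
set A := E `&` _ in Ek.
have mA : measurable A by apply: measurableI => //; exact: measurable_dball.
have A0 : (0 < mu A)%E by rewrite lt_def Ek lebn_ge0.
have Af : mu A \is a fin_num.
  rewrite ge0_fin_numE//; apply: (@le_lt_trans _ _ (mu (dball 0 k.+1%:R))).
    by apply: le_lebn => x [].
  by rewrite lebn_dball// ltry.
have lt2 : (mu A < 2%:E * mu A)%E.
  by rewrite -(fineK Af) -EFinM lte_fin ltr_pMl ?ltr1n// -lte_fin fineK.
have [_ [a [b [ab Aab ->]]] hsum] := ereal_inf_lt lt2.
(* A cover of total volume less than twice the measure of A has a box that A fills by more than
   half. *)
have [j hj] : exists j, ((vol (a j) (b j))%:E < 2%:E * mu (A `&` box (a j) (b j)))%E.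
  apply: contrapT => no; move: hsum; apply/negP; rewrite -leNgt.
  apply: (@le_trans _ _ (2%:E * \sum_(k <oo) mu (A `&` box (a k) (b k)))%E).
    rewrite lee_wpmul2l ?lee_fin//; apply: le_trans (lebn_sigma_subadditive _).
    by apply: le_lebn => x Ax; have [i _ xi] := Aab _ Ax; exists i.
  rewrite -nneseriesZl; last by move=> i _; exact: lebn_ge0.
  apply: lee_nneseries => [i _ _|i _]; first by rewrite mule_ge0 ?lebn_ge0.
  by rewrite leNgt; apply/negP => h; apply: no; exists i.
have mAj : measurable (A `&` box (a j) (b j)) by apply: measurableI => //; exact: measurable_box.
have Aj0 : (0 < mu (A `&` box (a j) (b j)))%E.
  rewrite lt_def lebn_ge0 andbT; apply: contraTneq hj => ->.
  by rewrite mule0 -leNgt lee_fin vol_ge0.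
have [r [z [r0 Az hz]]] := exists_dense_point mAj (@subIsetr _ _ _) (ab j) Aj0 (ltW hj) c0.
have := low _ z r mAj (fun x h => proj1 (proj1 h)) Az r0; apply/negP; rewrite -ltNge.
have K0 : 0 <= 8 * 4 ^+ n.+1 / cball by rewrite divr_ge0 ?(ltW c0)// mulr_ge0// exprn_ge0.
apply: lt_le_trans (lee_wpmul2l (K0 : (0 <= (8 * 4 ^+ n.+1 / cball)%:E)%E) hz).
rewrite -EFinM lte_fin (_ : 8 * 4 ^+ n.+1 / cball * _ = 2 * r ^+ n.+1); last first.
  by field; rewrite expf_neq0//= gt_eqF.
by rewrite ltr_pMl ?exprn_gt0// ltr1n.
Qed.

End maximal.

(** * The distance to the complement of Om and averages at that scale *)

Section boundary_distance.
Variables (R : realType) (n : nat).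
Local Notation V := 'rV[R]_n.+1.
Local Notation Rn := (Rn R n.+1).
Local Notation mu := (@lebn R n.+1).
Local Notation sigmaRn := (mu : {sigma_finite_measure set Rn -> \bar R}).
Local Notation cball := (cball R n).
Implicit Types (x y z : V) (f : Rn -> R).

Lemma measurable_lipschitz (h : Rn -> R) : (forall z z' : Rn, h z <= dst z z' + h z') ->
  measurable_fun setT h.
Proof.
move=> hL; apply: (measurability _ (RGenOInfty.measurableE R)) => _ [_ [c ->] <-].
rewrite setTI; apply: measurable_open; apply/open_dstP => z /=.
rewrite in_itv/= andbT => cz; exists (h z - c); first by rewrite subr_gt0.
by move=> z' zz'; rewrite in_itv/= andbT; have := hL z z'; lra.
Qed.

Variable Om : set Rn.
Hypothesis oOm : open (Om : set V).
Hypothesis Om_proper : exists x, ~ Om x.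

Definition bdist z : R := inf [set dst z x | x in ~` Om].

Let lb0 z : lbound [set dst z x | x in ~` Om] 0.
Proof. by move=> _ [x _ <-]; exact: dst_ge0. Qed.

Let has_inf_dst z : has_inf [set dst z x | x in ~` Om].
Proof. by split; [have [x nx] := Om_proper; exists (dst z x), x|exists 0; exact: lb0]. Qed.

Lemma bdist_ge0 z : 0 <= bdist z.
Proof. by apply: lb_le_inf; [case: (has_inf_dst z)|exact: lb0]. Qed.

Lemma bdist_le z x : ~ Om x -> bdist z <= dst z x.
Proof. by move=> nx; apply: ge_inf; [exists 0; exact: lb0|exists x]. Qed.

Lemma bdist_gt0P z : 0 < bdist z <-> Om z.
Proof.
split=> [h|Oz].
  by apply: contrapT => /(bdist_le z); rewrite dstxx leNgt h.
have [r r0 hr] := (open_dstP _).1 oOm _ Oz.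
apply: lt_le_trans r0 _; apply: lb_le_inf; first by case: (has_inf_dst z).
by move=> _ [x nx <-]; rewrite leNgt; apply/negP => /hr.
Qed.

Lemma bdist0 z : ~ Om z -> bdist z = 0.
Proof. by move=> nz; apply/eqP; rewrite eq_le bdist_ge0 -(dstxx z) bdist_le. Qed.

Lemma bdist_near z : exists x, ~ Om x /\ dst z x <= 2 * bdist z.
Proof.
have [Oz|nz] := pselect (Om z); last by exists z; rewrite dstxx mulr_ge0 ?bdist_ge0.
have d0 : 0 < bdist z by apply/bdist_gt0P.
have [_ [x nx <-] h] := inf_adherent d0 (has_inf_dst z).
by exists x; split => //; rewrite mulr2n mulrDl mul1r ltW.
Qed.

Lemma bdist_lip z z' : bdist z <= dst z z' + bdist z'.
Proof.
rewrite -lerBlDl; apply: lb_le_inf; first by case: (has_inf_dst z').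
move=> _ [x nx <-]; rewrite lerBlDl; apply: le_trans (bdist_le z nx) _.
exact: dst_triangle.
Qed.

Lemma measurable_bdist : measurable_fun [set: Rn] (bdist : Rn -> R).
Proof. by apply: measurable_lipschitz => z z'; exact: bdist_lip. Qed.

(* Averaging against this kernel replaces the mean values over Whitney cubes: since bdist is
   1-Lipschitz, its values at x and z are comparable wherever the kernel does not vanish. *)
Definition avg x z : R := if dst x z < bdist z / 10 then (cball * (bdist z / 10) ^+ n.+1)^-1 else 0.

Lemma avg_ge0 x z : 0 <= avg x z.
Proof.
rewrite /avg; case: ifP => // _; rewrite invr_ge0 mulr_ge0 ?cball_ge0// exprn_ge0//.
by rewrite divr_ge0// bdist_ge0.
Qed.

Lemma avg_comparable x z : dst x z < bdist z / 10 ->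
  [/\ 0 < bdist z, 9 / 10 * bdist z <= bdist x & bdist x <= 11 / 10 * bdist z].
Proof.
move=> h; have := dst_ge0 x z; have := bdist_lip x z; have := bdist_lip z x.
by rewrite (dstC z x) => h1 h2 h3; split; lra.
Qed.

Lemma avgP x z : avg x z != 0 -> dst x z < bdist z / 10.
Proof. by rewrite /avg; case: ifP => //; rewrite eqxx. Qed.

Lemma measurable_avg d (T : measurableType d) (hx hz : T -> Rn) :
  measurable_fun setT hx -> measurable_fun setT hz ->
  measurable_fun setT (fun w => avg (hx w) (hz w)).
Proof.
move=> mx mz; have mb : measurable_fun setT (fun w => bdist (hz w) / 10).
  by apply: measurable_funM => //; exact: (measurableT_comp measurable_bdist mz).
apply: measurable_fun_ifT => //.
  by apply: measurable_fun_ltr => //; exact: measurable_fun_dst.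
rewrite (_ : (fun w => _) = (fun w => (cball * (bdist (hz w) / 10) ^+ n.+1) `^ (-1))).
  apply: (measurableT_comp (measurable_powR _)); apply: measurable_funM => //.
  exact: measurable_funX.
apply/funext => w; rewrite powR_inv1// mulr_ge0 ?cball_ge0// exprn_ge0//.
by rewrite divr_ge0// bdist_ge0.
Qed.

Hypothesis cball_gt0 : 0 < cball.

(** The normalisation is in the first variable: the mass of f at z is spread evenly over a cube
    around z. In z, for fixed x, the kernel has only comparable mass. *)
Lemma integral_avg z : Om z -> (\int[mu]_x (avg x z)%:E = 1)%E.
Proof.
move=> /bdist_gt0P d0; have e0 : 0 < bdist z / 10 by rewrite divr_gt0.
have m0 : 0 < cball * (bdist z / 10) ^+ n.+1 by rewrite mulr_gt0// exprn_gt0.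
transitivity (\int[mu]_(x in dball z (bdist z / 10)) cst ((cball * (bdist z / 10) ^+ n.+1)^-1)%:E x)%E.
  rewrite [RHS]integral_mkcond; apply: eq_integral => x _; rewrite patchE /avg dstC.
  case: ifPn => h; first by rewrite mem_set.
  by rewrite memNset//; exact/negP.
transitivity (((cball * (bdist z / 10) ^+ n.+1)^-1)%:E * mu (dball z (bdist z / 10)%R))%E.
  by rewrite integral_cst//; exact: measurable_dball.
by rewrite lebn_dball// -EFinM mulVf// gt_eqF.
Qed.

Lemma avg_off x z : ~ Om x -> avg x z = 0.
Proof.
move=> nx; apply/eqP; apply: contrapT => /negP/avgP/avg_comparable[z0 h _].
by have := bdist0 nx; lra.
Qed.

(** On the support bdist x <= (11/10) bdist z, which trades the radius depending on z for one
    depending on x. *)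
Lemma avg_le x z : 0 < bdist x ->
  avg x z <= (if dst x z < bdist x then (cball * (bdist x / 11) ^+ n.+1)^-1 else 0).
Proof.
move=> x0; rewrite /avg; case: ifPn => [h|_]; last first.
  case: ifP => // _; rewrite invr_ge0 mulr_ge0 ?cball_ge0// exprn_ge0//.
  by rewrite divr_ge0// ltW.
have [z0 h1 h2] := avg_comparable h.
have -> : dst x z < bdist x by lra.
rewrite lef_pV2 ?posrE ?mulr_gt0 ?exprn_gt0 ?divr_gt0//.
rewrite ler_pM2l// lerXn2r ?nnegrE; lra.
Qed.

Section averages.
Variable f : Rn -> R.
Hypothesis mf : measurable_fun setT f.

(** The cube of radius bdist x about x lies in the cube of radius 3 bdist x about a point outside
    Om, where averages are controlled; 33 = 3 * 11, with 11 from [avg_le]. *)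
Lemma integral_avg_le K x : 0 <= K ->
  (forall x r, ~ Om x -> 0 < r -> (\int[mu]_(z in dball x r) `|f z|%:E <= (K * r ^+ n.+1)%:E)%E) ->
  (\int[mu]_z (avg x z * `|f z|)%:E <= (33 ^+ n.+1 * K / cball)%:E)%E.
Proof.
move=> K0 hK; have C0 : 0 <= 33 ^+ n.+1 * K / cball.
  by rewrite divr_ge0 ?(ltW cball_gt0)// mulr_ge0// exprn_ge0.
have [Ox|nx] := pselect (Om x); last first.
  by rewrite integral0_eq ?lee_fin// => z _; rewrite avg_off// mul0r.
have x0 : 0 < bdist x by apply/bdist_gt0P.
pose c := (cball * (bdist x / 11) ^+ n.+1)^-1.
have c0 : 0 <= c by rewrite invr_ge0 mulr_ge0 ?(ltW cball_gt0)// exprn_ge0// divr_ge0// ltW.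
apply: (@le_trans _ _ (\int[mu]_(z in dball x (bdist x)) (c%:E * `|f z|%:E))%E).
  rewrite [leRHS]integral_mkcond; apply: ge0_le_integral_any => z _.
    by rewrite lee_fin mulr_ge0// avg_ge0.
  have := @avg_le x z x0; rewrite patchE; case: ifPn => h.
    by rewrite mem_set// -EFinM lee_fin -/c => h'; rewrite ler_wpM2r.
  rewrite memNset; last exact/negP.
  by move=> h'; rewrite lee_fin mulr_le0_ge0.
rewrite ge0_integralZl_EFin//; last 2 first.
- exact: measurable_dball.
- by apply/measurable_EFinP; apply: measurable_funTS; exact: measurableT_comp.
have [x' [nx' xx']] := bdist_near x.
have sub : dball x (bdist x) `<=` dball x' (3 * bdist x).
  by move=> z; rewrite /dball/=; have := dst_triangle x x' z; rewrite (dstC x' x); lra.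
apply: (@le_trans _ _ (c%:E * (K * (3 * bdist x) ^+ n.+1)%:E)%E).
  rewrite lee_wpmul2l ?lee_fin//; apply: le_trans (hK _ _ nx' _); last by rewrite mulr_gt0.
  exact: ge0_subset_integral_any.
rewrite -EFinM lee_fin le_eqVlt; apply/orP; left; apply/eqP; rewrite /c !exprMn exprVn.
rewrite (_ : 33 = 3 * 11); last by ring.
rewrite exprMn; field; rewrite !expf_neq0 ?gt_eqF//.
Qed.

(* Comparable values of h on the support of the averaging kernel let f be replaced by its averages. *)
Lemma integral_le_avg (h : Rn -> R) c : measurable_fun setT h -> (forall z, 0 <= h z) -> 0 <= c ->
  (forall x z, dst x z < bdist z / 10 -> h z <= c * h x) ->
  (\int[mu]_(z in Om) (`|f z| * h z)%:E <=
   c%:E * \int[mu]_x ((\int[mu]_z (avg x z * `|f z|)%:E) * (h x)%:E))%E.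
Proof.
move=> mh h0 c0 hh.
pose F (x z : Rn) : \bar R := (avg x z * `|f z| * h x)%:E.
have mA : measurable_fun [set: Rn * Rn] (fun w => avg w.1 w.2) by exact: measurable_avg.
have mF : measurable_fun [set: Rn * Rn] (fun w => F w.1 w.2).
  apply/measurable_EFinP; apply: measurable_funM; last exact: (measurableT_comp mh measurable_fst).
  by apply: measurable_funM => //; apply: measurableT_comp => //; exact: (measurableT_comp mf measurable_snd).
have F0 x z : (0 <= F x z)%E by rewrite lee_fin mulr_ge0// mulr_ge0// avg_ge0.
have -> : (\int[mu]_x ((\int[mu]_z (avg x z * `|f z|)%:E) * (h x)%:E) = \int[mu]_x \int[mu]_z F x z)%E.
  apply: eq_integral => x _; rewrite muleC -ge0_integralZl_EFin//.
  - by apply: eq_integral => z _; rewrite /F -EFinM mulrC.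
  - by move=> z _; rewrite lee_fin mulr_ge0// avg_ge0.
  - apply/measurable_EFinP; apply: measurable_funM; last exact: measurableT_comp.
    by apply: (measurable_avg (hx := cst (x : Rn)) (hz := id)).
rewrite (tonelli_dom sigmaRn sigmaRn measurableT measurableT mF F0).
rewrite -ge0_integralZl_EFin//; last 2 first.
- by move=> z _; exact: integral_ge0.
- exact: (measurable_fun_fubini_tonelli_G (m1 := sigmaRn) (fun w : Rn * Rn => F w.1 w.2) mF (fun w => F0 w.1 w.2)).
rewrite [leLHS]integral_mkcond; apply: ge0_le_integral_any => z _; rewrite patchE.
  by case: ifP => // _; rewrite lee_fin mulr_ge0.
case: ifPn => [/set_mem Oz|_]; last by rewrite mule_ge0 ?lee_fin ?integral_ge0.
apply: (@le_trans _ _ (\int[mu]_x ((`|f z| * h z)%:E * (avg x z)%:E))%E).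
  rewrite ge0_integralZl_EFin ?integral_avg ?mule1 ?mulr_ge0//.
  - by move=> x _; rewrite lee_fin avg_ge0.
  - by apply/measurable_EFinP; apply: (measurable_avg (hx := id) (hz := cst (z : Rn))).
rewrite -ge0_integralZl_EFin//; last first.
  exact: (measurableT_comp mF (pair2_measurable z)).
apply: ge0_le_integral_any => x _; rewrite -EFinM lee_fin; first by rewrite mulr_ge0 ?avg_ge0// mulr_ge0.
have [->|/avgP/hh hz] := eqVneq (avg x z) 0; first by rewrite mulr0 mul0r mul0r mulr0.
rewrite [leRHS](_ : _ = `|f z| * (c * h x) * avg x z); last by ring.
by rewrite ler_wpM2r ?avg_ge0// ler_wpM2l.
Qed.

End averages.

End boundary_distance.

Lemma EFin_Rintegral d (T : measurableType d) (R : realType) (m : {measure set T -> \bar R}) (u : T -> R) :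
  m.-integrable setT (fun x => (u x)%:E) -> (\int[m]_x u x)%:E = (\int[m]_x (u x)%:E)%E.
Proof. by move=> iu; rewrite /Rintegral fineK//; exact: integrable_fin_num. Qed.

(** * The decomposition of f into a bounded part and a remainder living on Om *)

Section calderon_zygmund.
Variables (R : realType) (n : nat).
Local Notation V := 'rV[R]_n.+1.
Local Notation Rn := (Rn R n.+1).
Local Notation mu := (@lebn R n.+1).
Local Notation sigmaRn := (mu : {sigma_finite_measure set Rn -> \bar R}).
Local Notation cball := (cball R n).
Variables (f : Rn -> R) (Om : set Rn) (K M : R).
Hypothesis pf : poisson_integrable f.
Hypothesis oOm : open (Om : set V).
Hypothesis Om_proper : exists x, ~ Om x.
Hypothesis cball_gt0 : 0 < cball.
Hypothesis K0 : 0 <= K.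
Hypothesis hK : forall x r, ~ Om x -> 0 < r ->
  (\int[mu]_(z in dball x r) `|f z|%:E <= (K * r ^+ n.+1)%:E)%E.
Hypothesis M0 : 0 <= M.
Hypothesis hM : mu ([set z | M < `|f z|] `\` Om) = 0%E.

Local Notation avg := (avg Om).
Local Notation bdist := (bdist Om).

Let mf : measurable_fun setT f. Proof. by case: pf. Qed.

Let mOm : measurable Om. Proof. exact: measurable_open. Qed.

Let mmem : measurable_fun [set: Rn] (fun x : Rn => x \in Om).
Proof. exact: measurable_fun_mem. Qed.

Definition avgC : R := 33 ^+ n.+1 * K / cball.

Lemma avgC_ge0 : 0 <= avgC.
Proof. by rewrite divr_ge0 ?(ltW cball_gt0)// mulr_ge0// exprn_ge0. Qed.

Let favg (x : Rn) : R := \int[mu]_z (avg x z * f z).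
(** Off Om the bound |f| <= M holds almost everywhere only; cutting at M changes f on a null set and
    makes the good part bounded at every point. *)
Let goff (x : Rn) : R := if x \in Om then 0 else if `|f x| <= M then f x else 0.
Let fon (x : Rn) : R := if x \in Om then f x else 0.
Let foff (x : Rn) : R := if x \in Om then 0 else f x.

Definition cz_good (x : Rn) : R := favg x + goff x.

Let measurable_avgf : measurable_fun [set: Rn * Rn] (fun w => avg w.1 w.2 * f w.2).
Proof.
apply: measurable_funM; last exact: (measurableT_comp mf measurable_snd).
exact: measurable_avg.
Qed.

Let mfavg : measurable_fun setT favg.
Proof. exact: (measurable_Rintegral_param (F := fun x z : Rn => avg x z * f z)). Qed.

Let mgoff : measurable_fun setT goff.
Proof.
apply: measurable_fun_ifT => //; apply: measurable_fun_ifT => //.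
by apply: measurable_fun_ler => //; exact: measurableT_comp.
Qed.

Lemma measurable_cz_good : measurable_fun setT cz_good.
Proof. exact: measurable_funD. Qed.

Lemma integral_avg_f_le x : (\int[mu]_z (avg x z * `|f z|)%:E <= avgC%:E)%E.
Proof. exact: integral_avg_le. Qed.

Let favg_le x : `|favg x| <= avgC.
Proof.
rewrite -lee_fin; apply: le_trans (integral_avg_f_le x).
apply: le_trans (le_Rintegral_norm _ _) _; first exact: (measurableT_comp measurable_avgf (pair1_measurable x)).
apply: ge0_le_integral_any => z _ //.
by rewrite normrM ger0_norm// avg_ge0.
Qed.

Let goff_le x : `|goff x| <= M.
Proof. by rewrite /goff; do 2?[case: ifPn => //]; rewrite ?normr0. Qed.

Lemma cz_good_le x : `|cz_good x| <= avgC + M.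
Proof. by apply: le_trans (ler_normD _ _) _; exact: lerD. Qed.

Lemma cz_goodE_off x : ~ Om x -> `|cz_good x| <= `|f x|.
Proof.
move=> nx; rewrite /cz_good (_ : favg x = 0) ?add0r.
  by rewrite /goff; case: ifP; rewrite ?normr0//; case: ifP; rewrite ?normr0.
by apply: Rintegral0_eq => z; rewrite avg_off// mul0r.
Qed.

Section at_point.
Variables (y : V) (t : R).
Hypothesis t0 : 0 < t.

Let k (x : Rn) : R := Kern t y x.
Let mk : measurable_fun setT k. Proof. exact: measurable_KernE. Qed.

Let H (x z : Rn) : R := avg x z * f z * k x.

Let mH : measurable_fun [set: Rn * Rn] (fun w => H w.1 w.2).
Proof. by apply: measurable_funM => //; exact: (measurableT_comp mk measurable_fst). Qed.

Let int_k : (\int[mu]_x `|k x|%:E < +oo)%E.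
Proof.
apply: (@le_lt_trans _ _ (\int[mu]_x ((KernC R n)%:E * (Wk 1 t y x)%:E))%E).
  by apply: ge0_le_integral_any => x _ //; rewrite -EFinM lee_fin; exact: Kern_le.
rewrite ge0_integralZl_EFin ?KernC_ge0//; last 2 first.
- by move=> x _; rewrite lee_fin Wk_ge0.
- exact: measurable_WkE.
apply: lte_mul_pinfty; rewrite ?lee_fin ?KernC_ge0//.
by apply: le_lt_trans (integral_Wk y ltr01 t0) _; rewrite ltry.
Qed.

Let HfinE x : (\int[mu]_z `|H x z|%:E = `|k x|%:E * \int[mu]_z (avg x z * `|f z|)%:E)%E.
Proof.
rewrite -ge0_integralZl_EFin//.
- by apply: eq_integral => z _; rewrite -EFinM /H !normrM (ger0_norm (avg_ge0 _ _ _))// mulrC.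
- by move=> z _; rewrite lee_fin mulr_ge0// avg_ge0.
- apply/measurable_EFinP; apply: measurable_funM; last exact: measurableT_comp.
  by apply: (measurable_avg _ _ (hx := cst (x : Rn)) (hz := id)).
Qed.

Let Hfin : (\int[mu]_x \int[mu]_z `|H x z|%:E < +oo)%E.
Proof.
apply: (@le_lt_trans _ _ (\int[mu]_x (avgC%:E * `|k x|%:E))%E).
  apply: ge0_le_integral_any => x _; first exact: integral_ge0.
  by rewrite HfinE muleC lee_wpmul2r// integral_avg_f_le.
rewrite ge0_integralZl_EFin ?avgC_ge0//; last first.
  by apply/measurable_EFinP; exact: measurableT_comp.
by apply: lte_mul_pinfty; rewrite ?lee_fin ?avgC_ge0.
Qed.

Let kavg (z : Rn) : R := \int[mu]_x (avg x z * k x).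

Let int_avgk z : mu.-integrable setT (fun x : Rn => (avg x z * k x)%:E).
Proof.
have mA : measurable_fun setT (fun x : Rn => avg x z).
  by apply: (measurable_avg _ _ (hx := id) (hz := cst (z : Rn))).
apply/integrableP; split; first by apply/measurable_EFinP; exact: measurable_funM.
pose c : R := (cball * (bdist z / 10) ^+ n.+1)^-1.
have c0 : 0 <= c by rewrite invr_ge0 mulr_ge0 ?(ltW cball_gt0)// exprn_ge0// divr_ge0// bdist_ge0.
apply: (@le_lt_trans _ _ (\int[mu]_x (c%:E * `|k x|%:E))%E).
  apply: ge0_le_integral_any => x _ //.
  rewrite -EFinM /= lee_fin normrM ler_wpM2r// (ger0_norm (avg_ge0 _ _ _))// /avg.
  by case: ifP.
rewrite ge0_integralZl_EFin//; last by apply/measurable_EFinP; exact: measurableT_comp.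
exact: lte_mul_pinfty.
Qed.

(** The averaging is moved from f to the kernel by Fubini's theorem; absolute convergence comes from
    the bound on the averages of |f| and the integrability of [Kern]. *)
Let Tk_favg : Tk favg y t = \int[mu]_z (f z * kavg z).
Proof.
congr fine.
have sw := @fubini_swap _ _ _ _ R sigmaRn sigmaRn H mH Hfin.
transitivity (\int[mu]_x \int[mu]_z (H x z)%:E)%E.
  apply: eq_integral => x _.
  have int_af : mu.-integrable setT (fun z : Rn => (avg x z * f z)%:E).
    apply/integrableP; split.
      by apply/measurable_EFinP; exact: (measurableT_comp measurable_avgf (pair1_measurable x)).
    apply: (@le_lt_trans _ _ avgC%:E); last by rewrite ltry.
    apply: le_trans (integral_avg_f_le x); apply: ge0_le_integral_any => z _; first exact: abse_ge0.
    by rewrite abse_EFin lee_fin normrM (ger0_norm (avg_ge0 _ _ _)).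
  rewrite (eq_integral (fun z : Rn => (avg x z * f z)%:E * (k x)%:E)%E); last first.
    by move=> z _; rewrite -EFinM.
  rewrite (integralZr measurableT int_af (k x)) EFinM; congr (_ * _)%E.
  exact: (EFin_Rintegral int_af).
rewrite sw; apply: eq_integral => z _.
rewrite (eq_integral (fun x : Rn => (f z)%:E * (avg x z * k x)%:E)%E); last first.
  by move=> x _; rewrite -EFinM /H; congr EFin; ring.
rewrite (integralZl measurableT (int_avgk z) (f z)) EFinM; congr (_ * _)%E.
exact: esym (EFin_Rintegral (int_avgk z)).
Qed.

Let int_fkavg : mu.-integrable setT (fun z : Rn => (f z * kavg z)%:E).
Proof.
have mkavg : measurable_fun setT kavg.
  apply: (measurable_Rintegral_param (F := fun z x : Rn => avg x z * k x)).
  apply: measurable_funM; last exact: (measurableT_comp mk measurable_snd).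
  exact: measurable_avg.
apply/integrableP; split; first by apply/measurable_EFinP; exact: measurable_funM.
have mHn : measurable_fun [set: Rn * Rn] (fun w => `|H w.1 w.2|%:E).
  by apply/measurable_EFinP; exact: measurableT_comp.
apply: le_lt_trans Hfin.
rewrite (tonelli_dom sigmaRn sigmaRn measurableT measurableT mHn)//.
apply: ge0_le_integral_any => z _ //=.
rewrite normrM EFinM.
rewrite (eq_integral (fun x : Rn => `|f z|%:E * `|avg x z * k x|%:E)%E); last first.
  by move=> x _; rewrite -EFinM -normrM; congr (`|_|%:E); rewrite /H; ring.
have mA : measurable_fun setT (fun x : Rn => avg x z * k x).
  by have /integrableP[/measurable_EFinP] := int_avgk z.
rewrite ge0_integralZl_EFin//; last by apply/measurable_EFinP; exact: measurableT_comp.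
by rewrite lee_wpmul2l//; exact: le_Rintegral_norm.
Qed.

Let Tk_off : Tk foff y t = Tk goff y t.
Proof.
congr fine; apply: (@ae_eq_integral _ _ _ sigmaRn setT) => //.
- apply/measurable_EFinP; apply: measurable_funM => //.
  exact: measurable_fun_ifT.
- by apply/measurable_EFinP; apply: measurable_funM.
- exists ([set z | M < `|f z|] `\` Om); split => //.
    apply: measurableD => //.
    rewrite (_ : [set z | _] = [set: Rn] `&` (fun z => `|f z|) @^-1` `]M, +oo[%classic); last first.
      by rewrite setTI; apply/seteqP; split => z /=; rewrite in_itv/= andbT.
    have mn : measurable_fun setT (fun z : Rn => `|f z|) by exact: measurableT_comp.
    by apply: mn => //; exact: measurable_itv.
  move=> z /= h; split; last by move=> Oz; apply: h => _; rewrite /foff /goff mem_set.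
  rewrite ltNge; apply/negP => fM; apply: h => _; rewrite /foff /goff.
  by case: ifP => //; rewrite fM.
Qed.

(** The parts off Om cancel up to a null set. On Om what remains is f(z) times the difference of the
    kernel at z and its average, and as [avg] has integral 1 in x this is an average of kernel
    increments. *)
Lemma Tk_sub_cz_good_le :
  (`|Tk f y t - Tk cz_good y t|%:E <=
   \int[mu]_(z in Om) (`|f z|%:E * \int[mu]_x (avg x z * `|Kern t y z - Kern t y x|)%:E))%E.
Proof.
have pon : poisson_integrable fon.
  apply: (poisson_integrable_le pf pf); first exact: measurable_fun_ifT.
  by move=> z; rewrite /fon; case: ifP => // _; rewrite ?lerDl ?normr0 ?addr_ge0.
have poff : poisson_integrable foff.
  apply: (poisson_integrable_le pf pf); first exact: measurable_fun_ifT.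
  by move=> z; rewrite /foff; case: ifP => // _; rewrite ?lerDl ?normr0 ?addr_ge0.
have pavg : poisson_integrable favg by exact: poisson_integrable_bounded favg_le.
have pgoff : poisson_integrable goff by exact: poisson_integrable_bounded goff_le.
have fE : f = fun z => fon z + foff z.
  by apply/funext => z; rewrite /fon /foff; case: ifP; rewrite ?addr0 ?add0r.
rewrite {1}fE TkD// (TkD y pavg pgoff t0) Tk_off opprD addrACA subrr addr0.
rewrite Tk_favg /Tk -RintegralB; [|exact: measurableT|exact: (poisson_integrable_Kern y pon t0)|exact: int_fkavg].
apply: le_trans (le_Rintegral_norm _ _) _.
  apply: measurable_funB.
    by have /integrableP[/measurable_EFinP] := poisson_integrable_Kern y pon t0.
  by have /integrableP[/measurable_EFinP] := int_fkavg.
rewrite [leRHS]integral_mkcond; apply: ge0_le_integral_any => z _ //; rewrite patchE /fon.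
case: ifPn => [/set_mem Oz|]; last first.
  rewrite notin_setE => nz; rewrite mul0r sub0r normrN (_ : kavg z = 0) ?mulr0 ?normr0//.
  apply: Rintegral0_eq => x; rewrite (_ : avg x z = 0) ?mul0r//; apply/eqP.
  apply: contrapT => /negP/avgP/(avg_comparable Om_proper)[z0 _ _]; apply: nz.
  exact/(bdist_gt0P oOm Om_proper).
have mA : measurable_fun setT (fun x : Rn => avg x z).
  by apply: (measurable_avg _ _ (hx := id) (hz := cst (z : Rn))).
rewrite -mulrBr normrM EFinM lee_wpmul2l//.
have A1 : \int[mu]_x avg x z = 1 by rewrite /Rintegral integral_avg.
have iA : mu.-integrable setT (fun x : Rn => (avg x z)%:E).
  apply/integrableP; split; first exact/measurable_EFinP.
  under eq_integral do rewrite /= (ger0_norm (avg_ge0 _ _ _))//.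
  by rewrite integral_avg// ltry.
have iAk : mu.-integrable setT (fun x : Rn => (avg x z * Kern t y z)%:E).
  have := integrableZr measurableT (Kern t y z) iA.
  by apply: eq_integrable => // x _; rewrite EFinM.
have -> : Kern t y z - kavg z = \int[mu]_x (avg x z * (Kern t y z - Kern t y x)).
  rewrite /kavg -[X in X - _]mul1r -A1 -RintegralZr// -RintegralB//; last exact: int_avgk.
  by apply: eq_Rintegral => x _; rewrite -mulrBr.
apply: le_trans (le_Rintegral_norm _ _) _.
  by apply: measurable_funM => //; apply: measurable_funB.
by apply: ge0_le_integral_any => x _ //; rewrite normrM (ger0_norm (avg_ge0 _ _ _)).
Qed.

End at_point.

End calderon_zygmund.

(** * Splitting the averaged kernel increments into a far and a near part *)

Section far_near.
Variables (R : realType) (n : nat).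
Local Notation V := 'rV[R]_n.+1.
Local Notation Rn := (Rn R n.+1).
Local Notation mu := (@lebn R n.+1).
Local Notation leb := (@lebesgue_measure R).
Local Notation N := (n.+1%:R : R).
Local Notation sigmaRn := (mu : {sigma_finite_measure set Rn -> \bar R}).
Local Notation cball := (cball R n).
Variables (f : Rn -> R) (Om : set Rn) (K : R).
Hypothesis mf : measurable_fun setT f.
Hypothesis oOm : open (Om : set V).
Hypothesis Om_proper : exists x, ~ Om x.
Hypothesis cball_gt0 : 0 < cball.
Hypothesis K0 : 0 <= K.
Hypothesis hK : forall x r, ~ Om x -> 0 < r ->
  (\int[mu]_(z in dball x r) `|f z|%:E <= (K * r ^+ n.+1)%:E)%E.

Local Notation avg := (avg Om).
Local Notation bdist := (bdist Om).
Local Notation avgC := (avgC n K).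

Let mOm : measurable Om. Proof. exact: measurable_open. Qed.

Let mb : measurable_fun [set: Rn] (bdist : Rn -> R). Proof. exact: measurable_bdist. Qed.

Let mfn : measurable_fun setT (fun z => `|f z|). Proof. exact: measurableT_comp. Qed.

Let b0 z : 0 <= bdist z. Proof. exact: bdist_ge0. Qed.

Definition far_weight (y : V) (t : R) (z : V) : R := bdist z * Wk 2 (t + bdist z) y z.

Definition far (y : V) (t : R) : \bar R := (\int[mu]_z (`|f z| * far_weight y t z)%:E)%E.

(** The condition 0 < [bdist z] expresses z in Om, by [bdist_gt0P]. *)
Definition near_set (y : V) : set Rn := [set z | (0 < bdist z) && (dst y z < 2 * bdist y)].

Definition near (y : V) (t : R) : \bar R :=
  (\int[mu]_(z in near_set y) ((`|f z| + avgC) * Wk 1 t y z)%:E)%E.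

Lemma far_weight_ge0 y t z : 0 <= far_weight y t z.
Proof. by rewrite mulr_ge0// Wk_ge0. Qed.

Lemma measurable_far_weight d (T : measurableType d) (ft : T -> R) (fy fz : T -> Rn) :
  measurable_fun setT ft -> measurable_fun setT fy -> measurable_fun setT fz ->
  measurable_fun setT (fun w => far_weight (fy w) (ft w) (fz w)).
Proof.
move=> mt my mz; have mbz := measurableT_comp mb mz.
by apply: measurable_funM => //; apply: measurable_Wk => //; exact: measurable_funD.
Qed.

Lemma far_weight_le y t z : 0 < t -> far_weight y t z <= Wk 1 t y z.
Proof.
move=> t0; rewrite /far_weight /Wk; have d0 := dst_ge0 y z; have z0 := b0 z.
have e0 : 0 < t + bdist z + dst y z by lra.
rewrite (_ : - (N + 2) = - (N + 1) - 1); last by ring.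
rewrite powRD_gt0// powR_inv1 ?(ltW e0)// mulrCA.
apply: (@le_trans _ _ ((t + bdist z + dst y z) `^ (- (N + 1)))).
  by rewrite ler_piMr ?powR_ge0// ler_pdivrMr// mul1r; lra.
by apply: ler_powRN; [rewrite addr_ge0//|lra|lra].
Qed.

Let c1 : R := KernC2 R n * 3 `^ (N + 2).

Let c1_ge0 : 0 <= c1. Proof. by rewrite mulr_ge0 ?KernC2_ge0 ?powR_ge0. Qed.

(** Where y is closer to z than half of bdist z, displacements of order bdist z need not be small
    against t + |y-z|; cancellation is given up and both kernel values are kept. *)
Let nearW (y : V) (t : R) (z : V) : \bar R :=
  if dst y z < bdist z / 2 then ((Wk 1 t y z)%:E + \int[mu]_x (avg x z * Wk 1 t y x)%:E)%E else 0%E.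

Let nearW_ge0 y t z : (0 <= nearW y t z)%E.
Proof.
rewrite /nearW; case: ifP => // _; rewrite adde_ge0 ?lee_fin ?Wk_ge0// integral_ge0// => x _.
by rewrite lee_fin mulr_ge0 ?Wk_ge0// avg_ge0.
Qed.

(** If |y-z| >= bdist z / 2, the displacement, below bdist z / 10, is within the range of
    [Kern_sub_le]; as t + bdist z + |y-z| <= 3 (t + |y-z|), the result has the form of [far_weight]
    with the factor 3^(N+2). Otherwise [Kern_le] is used twice. *)
Lemma integral_avg_Kern_sub_le y t z : 0 < t -> Om z ->
  (\int[mu]_x (avg x z * `|Kern t y z - Kern t y x|)%:E <=
   (c1 * far_weight y t z)%:E + (KernC R n)%:E * nearW y t z)%E.
Proof.
move=> t0 Oz; have z0 : 0 < bdist z by apply/bdist_gt0P.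
have mA : measurable_fun setT (fun x : Rn => avg x z).
  by apply: (measurable_avg _ _ (hx := id) (hz := cst (z : Rn))).
have A0 x : 0 <= avg x z by exact: avg_ge0.
have mAE : measurable_fun setT (fun x : Rn => (avg x z)%:E) by exact/measurable_EFinP.
have A0E (x : Rn) : [set: Rn] x -> (0 <= (avg x z)%:E)%E by rewrite lee_fin.
have [far_z|near_z] := leP (bdist z / 2) (dst y z).
  rewrite /nearW ltNge far_z/= mule0 adde0.
  apply: (@le_trans _ _ (\int[mu]_x ((c1 * far_weight y t z)%:E * (avg x z)%:E))%E).
    apply: ge0_le_integral_any => x _; first by rewrite lee_fin mulr_ge0.
    rewrite -EFinM lee_fin mulrC.
    have [->|/avgP h] := eqVneq (avg x z) 0; first by rewrite !mulr0.
    rewrite ler_wpM2r//.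
    have d0 := dst_ge0 y z.
    apply: le_trans (Kern_sub_le _ _) _ => //; first by rewrite dstC; lra.
    rewrite /c1 -mulrA ler_wpM2l ?KernC2_ge0// /far_weight mulrCA.
    apply: ler_pM; rewrite ?dst_ge0 ?Wk_ge0//; first by rewrite dstC; lra.
    rewrite /Wk.
    have -> : 3 `^ (N + 2) = (3^-1 : R) `^ (- (N + 2)).
      by rewrite -powR_inv1// -powRrM mulrNN mul1r.
    rewrite -powRM ?invr_ge0 ?addr_ge0 ?(ltW t0)//.
    by apply: ler_powRN; [rewrite addr_ge0|rewrite mulr_gt0 ?invr_gt0//; lra|lra].
  have cw : 0 <= c1 * far_weight y t z by rewrite mulr_ge0// far_weight_ge0.
  by rewrite (ge0_integralZl_EFin _ measurableT A0E mAE cw) integral_avg// mule1.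
rewrite /nearW near_z.
apply: (@le_trans _ _ ((KernC R n)%:E * ((Wk 1 t y z)%:E + \int[mu]_x (avg x z * Wk 1 t y x)%:E))%E); last first.
  by rewrite leeDr// lee_fin mulr_ge0// far_weight_ge0.
have mW : measurable_fun setT (fun x : Rn => avg x z * Wk 1 t y x).
  by apply: measurable_funM => //; apply/measurable_EFinP; exact: measurable_WkE.
have -> : ((Wk 1 t y z)%:E + \int[mu]_x (avg x z * Wk 1 t y x)%:E =
    \int[mu]_x ((Wk 1 t y z)%:E * (avg x z)%:E + (avg x z * Wk 1 t y x)%:E))%E.
  rewrite ge0_integralD//; last 4 first.
  - by move=> x _; rewrite -EFinM lee_fin mulr_ge0 ?Wk_ge0.
  - by apply: emeasurable_funM => //; exact/measurable_EFinP.
  - by move=> x _; rewrite lee_fin mulr_ge0 ?Wk_ge0.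
  - exact/measurable_EFinP.
  by rewrite (ge0_integralZl_EFin _ measurableT A0E mAE (Wk_ge0 _ _ _ _)) integral_avg// mule1.
rewrite -ge0_integralZl_EFin ?KernC_ge0//; last 2 first.
- by move=> x _; rewrite -EFinM -EFinD lee_fin addr_ge0// mulr_ge0 ?Wk_ge0.
- apply: emeasurable_funD; last exact/measurable_EFinP.
  by apply: emeasurable_funM => //; exact/measurable_EFinP.
apply: ge0_le_integral_any => x _; first by rewrite lee_fin mulr_ge0.
rewrite -(EFinM (Wk _ _ _ _)) -EFinD -EFinM lee_fin.
rewrite [Wk 1 t y z * _]mulrC -mulrDr mulrCA mulrDr.
rewrite ler_wpM2l//; apply: le_trans (ler_normB _ _) _.
by apply: lerD; exact: Kern_le.
Qed.

Let mWz y t : measurable_fun setT (fun z : Rn => Wk 1 t y z).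
Proof. by apply/measurable_EFinP; exact: measurable_WkE. Qed.

Let mcond y : measurable_fun [set: Rn] (fun z : Rn => dst y z < bdist z / 2).
Proof.
apply: measurable_fun_ltr; last exact: measurable_funM.
exact: (measurable_fun_dst (f := cst (y : Rn)) (g := id)).
Qed.

Lemma measurable_near_set y : measurable (near_set y).
Proof.
have m1 : measurable_fun [set: Rn] (fun z : Rn => (0 < bdist z) && (dst y z < 2 * bdist y)).
  apply: measurable_and; first exact: measurable_fun_ltr.
  apply: measurable_fun_ltr => //.
  exact: (measurable_fun_dst (f := cst (y : Rn)) (g := id)).
rewrite (_ : near_set y = [set: Rn] `&` (fun z : Rn => (0 < bdist z) && (dst y z < 2 * bdist y)) @^-1` [set true]).
  exact: m1.
by rewrite setTI; apply/seteqP; split.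
Qed.

(** The averaged term is integrated in z first, where the averages of |f| are at most [avgC]. Both z
    and the points x of its averaging cube fall in [near_set y]: bdist z <= 2 bdist y, and |y-x| <
    (1/2 + 1/10) bdist z. *)
Lemma integral_nearW_le y t : 0 < t ->
  (\int[mu]_(z in Om) (`|f z|%:E * nearW y t z) <= near y t)%E.
Proof.
move=> t0; have aC := avgC_ge0 cball_gt0 K0.
have mns := measurable_near_set y.
pose u (z : Rn) : R := if dst y z < bdist z / 2 then `|f z| else 0.
have u0 z : 0 <= u z by rewrite /u; case: ifP.
have mu_ : measurable_fun setT u by exact: measurable_fun_ifT.
pose F (x z : Rn) : \bar R := (u z * (avg x z * Wk 1 t y x))%:E.
have F0 x z : (0 <= F x z)%E by rewrite lee_fin mulr_ge0// mulr_ge0 ?Wk_ge0// avg_ge0.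
have mF : measurable_fun [set: Rn * Rn] (fun w => F w.1 w.2).
  apply/measurable_EFinP; apply: measurable_funM; first exact: (measurableT_comp mu_ measurable_snd).
  apply: measurable_funM; first exact: measurable_avg.
  exact: (measurableT_comp (mWz y t) measurable_fst).
have mFz z : measurable_fun setT (fun x => F x z) by exact: (measurableT_comp mF (pair2_measurable z)).
have E z : (`|f z|%:E * nearW y t z = (u z * Wk 1 t y z)%:E + \int[mu]_x F x z)%E.
  rewrite /nearW /F /u; case: ifP => h; last first.
    by rewrite mule0 mul0r add0e integral0_eq// => x _; rewrite mul0r.
  rewrite ge0_muleDr ?lee_fin ?Wk_ge0//; last first.
    by apply: integral_ge0 => x _; rewrite lee_fin mulr_ge0 ?Wk_ge0// avg_ge0.
  rewrite -EFinM; congr (_ + _)%E.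
  rewrite -ge0_integralZl_EFin//.
    by move=> x _; rewrite lee_fin mulr_ge0 ?Wk_ge0// avg_ge0.
  apply/measurable_EFinP; apply: measurable_funM => //.
  by apply: (measurable_avg _ _ (hx := id) (hz := cst (z : Rn))).
have mIF : measurable_fun setT (fun z => \int[mu]_x F x z)%E.
  exact: (measurable_fun_fubini_tonelli_G (m1 := sigmaRn) (fun w : Rn * Rn => F w.1 w.2) mF (fun w => F0 w.1 w.2)).
have muW : measurable_fun setT (fun z : Rn => (u z * Wk 1 t y z)%:E).
  by apply/measurable_EFinP; exact: measurable_funM.
apply: (@le_trans _ _ (\int[mu]_z ((u z * Wk 1 t y z)%:E + \int[mu]_x F x z))%E).
  rewrite [leLHS]integral_mkcond; apply: ge0_le_integral_any => z _; rewrite patchE.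
    by case: ifP => // _; rewrite mule_ge0.
  case: ifP => _; first by rewrite E.
  by rewrite adde_ge0 ?lee_fin ?mulr_ge0 ?Wk_ge0// integral_ge0.
rewrite ge0_integralD//; last 2 first.
- by move=> z _; rewrite lee_fin mulr_ge0 ?Wk_ge0.
- by move=> z _; exact: integral_ge0.
rewrite -(tonelli_dom sigmaRn sigmaRn measurableT measurableT mF F0).
have -> : near y t = (\int[mu]_(z in near_set y) (`|f z| * Wk 1 t y z)%:E +
    \int[mu]_(z in near_set y) (avgC * Wk 1 t y z)%:E)%E.
  rewrite /near -ge0_integralD//.
  - by apply: eq_integral => z _; rewrite -EFinD mulrDl.
  - by move=> z _; rewrite lee_fin mulr_ge0 ?Wk_ge0.
  - by apply/measurable_EFinP; apply: measurable_funTS; exact: measurable_funM.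
  - by move=> z _; rewrite lee_fin mulr_ge0 ?Wk_ge0.
  - by apply/measurable_EFinP; apply: measurable_funTS; exact: measurable_funM.
have geom z : dst y z < bdist z / 2 -> bdist z / 2 <= bdist y.
  by move=> h; have := bdist_lip Om_proper z y; rewrite (dstC z y); lra.
apply: leeD.
  rewrite [leRHS]integral_mkcond; apply: ge0_le_integral_any => z _.
    by rewrite lee_fin mulr_ge0 ?Wk_ge0.
  rewrite patchE /u; case: ifPn => h.
    rewrite mem_set// /near_set/=; have := geom _ h; have := dst_ge0 y z.
    by move=> h1 h2; apply/andP; split; lra.
  rewrite mul0r; case: ifP => // _; rewrite lee_fin mulr_ge0 ?Wk_ge0//.
rewrite [leRHS]integral_mkcond; apply: ge0_le_integral_any => x _; first exact: integral_ge0.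
rewrite patchE; case: ifPn => [/set_mem xn|]; last first.
  rewrite notin_setE => xn; rewrite integral0_eq// => z _; rewrite /F /u.
  case: ifP => h; last by rewrite mul0r.
  have [->|/avgP xz] := eqVneq (avg x z) 0; first by rewrite mul0r mulr0.
  exfalso; apply: xn; rewrite /near_set/=.
  have [z0 h1 _] := avg_comparable Om_proper xz.
  have := geom _ h; have := dst_triangle z y x; rewrite (dstC z x) => h2 h3.
  by apply/andP; split; lra.
apply: (@le_trans _ _ ((Wk 1 t y x)%:E * \int[mu]_z (avg x z * `|f z|)%:E)%E).
  rewrite -ge0_integralZl_EFin ?Wk_ge0//; last 2 first.
  - by move=> z _; rewrite lee_fin mulr_ge0// avg_ge0.
  - apply/measurable_EFinP; apply: measurable_funM => //.
    by apply: (measurable_avg _ _ (hx := cst (x : Rn)) (hz := id)).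
  apply: ge0_le_integral_any => z _ //; rewrite -EFinM lee_fin.
  rewrite [leRHS](_ : _ = `|f z| * (avg x z * Wk 1 t y x)); last by ring.
  rewrite ler_wpM2r ?mulr_ge0 ?Wk_ge0 ?avg_ge0// /u; case: ifP => //.
by rewrite muleC EFinM lee_wpmul2r ?lee_fin ?Wk_ge0//; exact: integral_avg_le.
Qed.

Lemma integral_avg_Kern_sub_far_near y t : 0 < t ->
  (\int[mu]_(z in Om) (`|f z|%:E * \int[mu]_x (avg x z * `|Kern t y z - Kern t y x|)%:E) <=
   (KernC2 R n * 3 `^ (N + 2))%:E * far y t + (KernC R n)%:E * near y t)%E.
Proof.
move=> t0; have KC := KernC_ge0 R n.
have mnW : measurable_fun setT (fun z : Rn => nearW y t z).
  apply: measurable_fun_ifT => //; apply: emeasurable_funD; first exact: measurable_WkE.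
  apply: (measurable_integral_param (F := fun z x : Rn => (avg x z * Wk 1 t y x)%:E)) => [|z x].
    apply/measurable_EFinP; apply: measurable_funM; first exact: measurable_avg.
    exact: (measurableT_comp (mWz y t) measurable_snd).
  by rewrite lee_fin mulr_ge0 ?Wk_ge0// avg_ge0.
have mfE : measurable_fun setT (fun z : Rn => `|f z|%:E) by exact/measurable_EFinP.
have mfw : measurable_fun setT (fun z : Rn => (`|f z| * far_weight y t z)%:E).
  apply/measurable_EFinP; apply: measurable_funM => //.
  by apply: (measurable_far_weight (ft := cst t) (fy := cst (y : Rn)) (fz := id)).
have fw0 (z : Rn) : (0 <= (`|f z| * far_weight y t z)%:E)%E by rewrite lee_fin mulr_ge0// far_weight_ge0.
apply: (@le_trans _ _ (\int[mu]_(z in Om) (c1%:E * (`|f z| * far_weight y t z)%:E +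
    (KernC R n)%:E * (`|f z|%:E * nearW y t z)))%E).
  apply: ge0_le_integral_any => z Oz.
    apply: mule_ge0; first by rewrite lee_fin.
    by apply: integral_ge0 => x _; rewrite lee_fin (mulr_ge0 (avg_ge0 Om_proper _ _)).
  apply: le_trans (lee_wpmul2l _ (integral_avg_Kern_sub_le y t0 Oz)) _; first by rewrite lee_fin.
  rewrite ge0_muleDr; last 2 first.
  - by rewrite lee_fin mulr_ge0// far_weight_ge0.
  - by rewrite mule_ge0// lee_fin.
  by rewrite -!EFinM mulrCA muleCA.
rewrite ge0_integralD//; last 4 first.
- by move=> z _; rewrite mule_ge0// lee_fin.
- by apply: measurable_funTS; exact: emeasurable_funM.
- by move=> z _; rewrite !mule_ge0// lee_fin.
- by apply: measurable_funTS; do 2?apply: emeasurable_funM.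
have m1 : measurable_fun Om (fun z : Rn => (`|f z| * far_weight y t z)%:E) by exact: measurable_funTS.
have m2 : measurable_fun Om (fun z : Rn => (`|f z|%:E * nearW y t z)%E).
  by apply: measurable_funTS; exact: emeasurable_funM.
rewrite ge0_integralZl_EFin// ge0_integralZl_EFin//; last by move=> z _; rewrite mule_ge0.
apply: leeD; rewrite lee_wpmul2l ?lee_fin//; last exact: integral_nearW_le.
exact: ge0_subset_integral_any.
Qed.

End far_near.

(** * Estimates of the far and the near part *)

Section far_near_estimates.
Variables (R : realType) (n : nat).
Local Notation V := 'rV[R]_n.+1.
Local Notation Rn := (Rn R n.+1).
Local Notation mu := (@lebn R n.+1).
Local Notation leb := (@lebesgue_measure R).
Local Notation N := (n.+1%:R : R).
Local Notation sigmaRn := (mu : {sigma_finite_measure set Rn -> \bar R}).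
Local Notation sigmaR := (leb : {sigma_finite_measure set (measurableTypeR R) -> \bar R}).
Local Notation pos := (`]0%R, +oo[%classic : set (measurableTypeR R)).
Local Notation cball := (cball R n).

Section average.
Variables (f : Rn -> R) (p al : R).
Hypothesis mf : measurable_fun setT f.
Hypothesis p1 : 1 <= p.
Hypothesis al0 : 0 < al.

(** Hoelder's inequality in linear form: |f| <= al + al^(1-p) |f|^p is integrated over D. *)
Lemma Lp_average_le (D : set Rn) (a b : R) : measurable D -> 0 <= a -> 0 <= b ->
  (mu D <= a%:E)%E -> (\int[mu]_(z in D) (`|f z| `^ p)%:E <= (al `^ p * b)%:E)%E ->
  (\int[mu]_(z in D) `|f z|%:E <= ((a + b) * al)%:E)%E.
Proof.
move=> mD a0 b0 Da Db.
have mfp : measurable_fun D (fun z => (`|f z| `^ p)%:E).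
  apply/measurable_EFinP; apply: measurable_funTS; apply: (measurableT_comp (measurable_powR _)).
  exact: measurableT_comp.
apply: (@le_trans _ _ (\int[mu]_(z in D) (cst al%:E z + (al `^ (1 - p))%:E * (`|f z| `^ p)%:E))%E).
  apply: ge0_le_integral_any => z _; first by rewrite lee_fin.
  by rewrite /cst -EFinM -EFinD lee_fin le_adde_powR.
have c0 : 0 <= al `^ (1 - p) by exact: powR_ge0.
rewrite ge0_integralD//; last 3 first.
- by move=> z _; rewrite /cst lee_fin ltW.
- by move=> z _; rewrite -EFinM lee_fin mulr_ge0 ?powR_ge0.
- exact: emeasurable_funM.
have -> : ((a + b) * al)%:E = (al%:E * a%:E + (al `^ (1 - p))%:E * (al `^ p * b)%:E)%E.
  rewrite -!EFinM -EFinD; congr EFin; rewrite mulrA -powRD_gt0// subrK powRr1 ?(ltW al0)//.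
  by ring.
apply: leeD; first by rewrite integral_cst// lee_wpmul2l// lee_fin ltW.
by rewrite ge0_integralZl_EFin// lee_wpmul2l.
Qed.

End average.

Variables (f : Rn -> R) (Om : set Rn) (p q s al : R).
Hypothesis mf : measurable_fun setT f.
Hypothesis oOm : open (Om : set V).
Hypothesis Om_proper : exists x, ~ Om x.
Hypothesis cball_gt0 : 0 < cball.
Hypothesis p1 : 1 < p.
Hypothesis pq : p < q.
Hypothesis q2 : 2 <= q.
Hypothesis sE : s = N * (p^-1 - q^-1).
Hypothesis al0 : 0 < al.
Hypothesis hp : forall x r, ~ Om x -> 0 < r ->
  (\int[mu]_(z in dball x r) (`|f z| `^ p)%:E <= (al `^ p * r ^+ n.+1)%:E)%E.

Definition meanC : R := cball + 1.

Lemma integral_dball_le x r : ~ Om x -> 0 < r ->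
  (\int[mu]_(z in dball x r) `|f z|%:E <= (meanC * al * r ^+ n.+1)%:E)%E.
Proof.
move=> nx r0; have rN : 0 <= r ^+ n.+1 by rewrite exprn_ge0// ltW.
have := @Lp_average_le f p al mf (ltW p1) al0 (dball x r) (cball * r ^+ n.+1) (r ^+ n.+1).
rewrite (_ : (cball * r ^+ n.+1 + r ^+ n.+1) * al = meanC * al * r ^+ n.+1); last by rewrite /meanC; ring.
apply => //; [exact: measurable_dball|by rewrite mulr_ge0// ltW|by rewrite lebn_dball|exact: hp].
Qed.

Lemma meanC_gt0 : 0 < meanC. Proof. by rewrite ltr_wpDl// ltW. Qed.

Local Notation avg := (avg Om).
Local Notation bdist := (bdist Om).
Local Notation K := (meanC * al).
Local Notation avgC := (avgC n K).
Local Notation far := (far f Om).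
Local Notation near := (near f Om K).
Local Notation near_set := (near_set Om).

Let K0 : 0 <= K. Proof. by rewrite mulr_ge0 ?(ltW al0)// ltW// meanC_gt0. Qed.

Let mOm : measurable Om. Proof. exact: measurable_open. Qed.

Let mb : measurable_fun [set: Rn] (bdist : Rn -> R). Proof. exact: measurable_bdist. Qed.

Let b0 z : 0 <= bdist z. Proof. exact: bdist_ge0. Qed.

Let mfn : measurable_fun setT (fun z => `|f z|). Proof. exact: measurableT_comp. Qed.

Definition meanratio : R := 33 ^+ n.+1 * meanC / cball.

Lemma avgCE : avgC = meanratio * al.
Proof. by rewrite /avgC /meanratio; ring. Qed.

Lemma meanratio_gt0 : 0 < meanratio.
Proof. by rewrite divr_gt0// mulr_gt0 ?exprn_gt0// meanC_gt0. Qed.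

Let mfw d (T : measurableType d) (ft : T -> R) (fy fz : T -> Rn) :
  measurable_fun setT ft -> measurable_fun setT fy -> measurable_fun setT fz ->
  measurable_fun setT (fun w => (`|f (fz w)| * far_weight Om (fy w) (ft w) (fz w))%:E).
Proof.
move=> mt my mz; apply/measurable_EFinP; apply: measurable_funM.
  exact: (measurableT_comp mfn mz).
exact: measurable_far_weight.
Qed.

Let fw0 y t z : (0 <= (`|f z| * far_weight Om y t z)%:E)%E.
Proof. by rewrite lee_fin mulr_ge0// far_weight_ge0. Qed.

Lemma far_ge0 y t : (0 <= far y t)%E. Proof. exact: integral_ge0. Qed.

Lemma measurable_far : measurable_fun [set: Rn * R] (fun w => far w.1 w.2).
Proof.
apply: (measurable_integral_param (F := fun (w : Rn * R) (z : Rn) => (`|f z| * far_weight Om w.1 w.2 z)%:E)) => //.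
apply: mfw => //.
- exact: (measurableT_comp measurable_snd measurable_fst).
- exact: (measurableT_comp measurable_fst measurable_fst).
Qed.

Definition farC : R := 2 `^ (N + 3) * meanratio * WkC n 1.

Lemma farC_gt0 : 0 < farC.
Proof. by rewrite mulr_gt0 ?WkC_gt0// mulr_gt0 ?powR_gt0// meanratio_gt0. Qed.

(** The values of [far_weight] at x and z are comparable on the support of [avg], with factor 2 for
    the distance and 2^(N+2) for the power. So |f| may be replaced by its averages, which are O(al),
    and [far_weight] is then bounded by [Wk 1]. *)
Lemma far_le y t : 0 < t -> (far y t <= (farC * al / t)%:E)%E.
Proof.
move=> t0.
have mh : measurable_fun setT (fun z : Rn => far_weight Om y t z).
  by apply: (measurable_far_weight _ _ (ft := cst t) (fy := cst (y : Rn)) (fz := id)).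
have fwE z : ~ Om z -> far_weight Om y t z = 0.
  by move=> nz; rewrite /far_weight (bdist0 Om_proper nz) mul0r.
have -> : far y t = (\int[mu]_(z in Om) (`|f z| * far_weight Om y t z)%:E)%E.
  rewrite [RHS]integral_mkcond; apply: eq_integral => z _; rewrite patchE.
  by case: ifPn => //; rewrite notin_setE => /fwE ->; rewrite mulr0.
have c0 : 0 <= 2 `^ (N + 3) :> R by exact: powR_ge0.
apply: le_trans (integral_le_avg oOm Om_proper cball_gt0 mf mh (far_weight_ge0 Om_proper y t) c0 _) _.
  move=> x z h; have [z0 h1 h2] := avg_comparable Om_proper h.
  have d0 := dst_ge0 y z; have d1 := dst_ge0 y x; have d2 := dst_triangle z y x.
  rewrite (dstC z x) in d2.
  rewrite /far_weight (_ : N + 3 = 1 + (N + 2)); last by ring.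
  rewrite (powRD_gt0 _ _ (ltr0Sn R 1)) powRr1// mulrACA; apply: ler_pM; rewrite ?Wk_ge0 ?(ltW z0)//; first lra.
  rewrite /Wk.
  have -> : 2 `^ (N + 2) = (2^-1 : R) `^ (- (N + 2)).
    by rewrite -powR_inv1// -powRrM mulrNN mul1r.
  rewrite -powRM ?invr_ge0//; last by lra.
  by apply: ler_powRN; [rewrite addr_ge0|lra|lra].
apply: (@le_trans _ _ ((2 `^ (N + 3))%:E * \int[mu]_x (avgC%:E * (Wk 1 t y x)%:E))%E).
  rewrite lee_wpmul2l ?lee_fin//; apply: ge0_le_integral_any => x _.
    apply: mule_ge0; last by rewrite lee_fin far_weight_ge0.
    by apply: integral_ge0 => z _; rewrite lee_fin mulr_ge0// avg_ge0.
  apply: lee_pmul; rewrite ?lee_fin ?far_weight_ge0//.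
  - by apply: integral_ge0 => z _; rewrite lee_fin mulr_ge0// avg_ge0.
  - by apply: integral_avg_le => // x' r; exact: integral_dball_le.
  - exact: far_weight_le.
have aC : 0 <= avgC by rewrite avgCE mulr_ge0 ?(ltW al0)// ltW// meanratio_gt0.
have W0 (x : Rn) : [set: Rn] x -> (0 <= (Wk 1 t y x)%:E)%E by rewrite lee_fin Wk_ge0.
rewrite (ge0_integralZl_EFin _ measurableT W0 (measurable_WkE _ _ _) aC) muleA -EFinM.
have h0 : (0 <= (2 `^ (N + 3) * avgC)%:E)%E by rewrite lee_fin mulr_ge0.
apply: le_trans (lee_wpmul2l h0 (integral_Wk y ltr01 t0)) _.
rewrite -EFinM lee_fin avgCE powR_inv1 ?(ltW t0)// /farC le_eqVlt; apply/orP; left; apply/eqP; ring.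
Qed.

(** For fixed z the integral of [far_weight] in y is of order bdist z (t + bdist z)^-2, and
    integrating in t > 0 removes bdist z altogether. *)
Lemma integral_far_le :
  (\int[mu]_y \int[leb]_(t in pos) far y t <= (WkC n 2)%:E * \int[mu]_(z in Om) `|f z|%:E)%E.
Proof.
have mF1 (y : Rn) : measurable_fun [set: R * Rn] (fun w => (`|f w.2| * far_weight Om y w.1 w.2)%:E).
  exact: (mfw (ft := fst) (fy := cst y) (fz := snd)).
have mF2 : measurable_fun [set: Rn * Rn] (fun w => (\int[leb]_(t in pos) (`|f w.2| * far_weight Om w.1 t w.2)%:E)%E).
  have := measurable_fun_fubini_tonelli_F (m2 := sigmaR) (fun w : (Rn * Rn) * R =>
    (if (0 < w.2)%R then (`|f w.1.2| * far_weight Om w.1.1 w.2 w.1.2)%:E else 0)%E).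
  rewrite /fubini_F /= => mS; rewrite (_ : (fun w : Rn * Rn => _) =
    (fun w => (\int[leb]_t (if (0 < t)%R then (`|f w.2| * far_weight Om w.1 t w.2)%:E else 0))%E)).
    apply: mS; last by move=> w; case: ifP.
    apply: measurable_fun_ifT => //; first exact: measurable_fun_ltr.
    apply: mfw => //.
    - exact: (measurableT_comp measurable_fst measurable_fst).
    - exact: (measurableT_comp measurable_snd measurable_fst).
  apply/funext => w; rewrite (integral_if _ setT) setTI; congr (integral _ _ _).
  by apply/seteqP; split => l /=; rewrite in_itv/= andbT.
have -> : (\int[mu]_y \int[leb]_(t in pos) far y t =
    \int[mu]_y \int[mu]_z \int[leb]_(t in pos) (`|f z| * far_weight Om y t z)%:E)%E.
  apply: eq_integral => y _.
  exact: (tonelli_dom sigmaR sigmaRn (measurable_itv _) measurableT (mF1 y) (fun t z => fw0 y t z)).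
rewrite (tonelli_dom sigmaRn sigmaRn (F := fun y z : Rn => (\int[leb]_(t in pos) (`|f z| * far_weight Om y t z)%:E)%E)
  measurableT measurableT mF2); last by move=> y z; exact: integral_ge0.
rewrite -ge0_integralZl_EFin ?WkC_ge0//; last first.
  by apply/measurable_EFinP; exact: measurable_funTS.
rewrite [leRHS]integral_mkcond; apply: ge0_le_integral_any => z _.
  by apply: integral_ge0 => y _; exact: integral_ge0.
rewrite patchE; case: ifPn => [/set_mem Oz|]; last first.
  rewrite notin_setE => nz; rewrite integral0_eq// => y _; rewrite integral0_eq// => t _.
  by rewrite /far_weight (bdist0 Om_proper nz) mul0r mulr0.
have z0 : 0 < bdist z by apply/bdist_gt0P.
have mF3 : measurable_fun [set: Rn * R] (fun w => (`|f z| * far_weight Om w.1 w.2 z)%:E).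
  exact: (mfw (ft := snd) (fy := fst) (fz := cst (z : Rn))).
rewrite (tonelli_dom sigmaRn sigmaR measurableT (measurable_itv _) mF3 (fun y t => fw0 y t z)).
have c0 : 0 <= `|f z| * bdist z by rewrite mulr_ge0.
apply: (@le_trans _ _ (\int[leb]_(t in pos) ((`|f z| * bdist z * WkC n 2)%:E * ((bdist z + t) `^ (- 1 - 1))%:E))%E).
  apply: ge0_le_integral_any => t /posP t0; first exact: integral_ge0.
  have tb : 0 < t + bdist z by rewrite addr_gt0.
  have W0 (x : Rn) : [set: Rn] x -> (0 <= (Wk 2 (t + bdist z) z x)%:E)%E by rewrite lee_fin Wk_ge0.
  rewrite (eq_integral (fun y : Rn => (`|f z| * bdist z)%:E * (Wk 2 (t + bdist z) z y)%:E)%E); last first.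
    by move=> y _; rewrite -EFinM /far_weight /Wk (dstC y) mulrA.
  rewrite (ge0_integralZl_EFin _ measurableT W0 (measurable_WkE _ _ _) c0).
  apply: le_trans (lee_wpmul2l _ (integral_Wk z _ tb)) _; rewrite ?lee_fin//.
  rewrite mulrA addrC le_eqVlt; apply/orP; left; apply/eqP; congr (_ * _ `^ _).
  by ring.
rewrite ge0_integralZl_EFin ?mulr_ge0 ?WkC_ge0//; last 2 first.
- by move=> t _; rewrite lee_fin powR_ge0.
- apply/measurable_EFinP; apply: measurable_funTS; apply: (measurableT_comp (measurable_powR _)).
  exact: measurable_funD.
rewrite integral_shift_powR ?addr0// -!EFinM lee_fin invr1 mul1r powR_inv1 ?(ltW z0)//.
by rewrite le_eqVlt; apply/orP; left; apply/eqP; field; rewrite gt_eqF.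
Qed.

(** t^(q-1) far^q = (t far)^(q-1) far: the uniform bound takes care of the first factor and the L^1
    bound of the second. *)
Lemma integral_far_Lq :
  (\int[mu]_y \int[leb]_(t in pos) (t `^ (q - 1) * (fine (far y t)) `^ q)%:E <=
   ((farC * al) `^ (q - 1) * WkC n 2)%:E * \int[mu]_(z in Om) `|f z|%:E)%E.
Proof.
have C0 : 0 <= (farC * al) `^ (q - 1) by exact: powR_ge0.
have qp : 0 < q by exact: lt_le_trans q2.
have q0 : q != 0 by rewrite gt_eqF.
apply: (@le_trans _ _ (((farC * al) `^ (q - 1))%:E * \int[mu]_y \int[leb]_(t in pos) far y t)%E); last first.
  by rewrite EFinM -muleA lee_wpmul2l ?lee_fin//; exact: integral_far_le.
have mft y : measurable_fun pos (far y).
  by apply: measurable_funTS; exact: (measurableT_comp measurable_far (pair1_measurable (y : Rn))).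
rewrite -ge0_integralZl_EFin//; last 2 first.
- by move=> y _; apply: integral_ge0 => t _; exact: far_ge0.
- have := measurable_fun_fubini_tonelli_F (m2 := sigmaR) (fun w : Rn * R => (if (0 < w.2)%R then far w.1 w.2 else 0)%E).
  rewrite /fubini_F /= => mS; rewrite (_ : (fun x : Rn => _) = (fun x => (\int[leb]_t (if (0 < t)%R then far x t else 0))%E)).
    apply: mS; last by move=> w; case: ifP => // _; exact: far_ge0.
    by apply: measurable_fun_ifT => //; [exact: measurable_fun_ltr|exact: measurable_far].
  apply/funext => x; rewrite (integral_if _ setT) setTI; congr (integral _ _ _).
  by apply/seteqP; split => l /=; rewrite in_itv/= andbT.
apply: ge0_le_integral_any => y _.
  by apply: integral_ge0 => t _; rewrite lee_fin mulr_ge0 ?powR_ge0.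
rewrite -ge0_integralZl_EFin//; last by move=> t _; exact: far_ge0.
apply: ge0_le_integral_any => t /posP t0; first by rewrite lee_fin mulr_ge0 ?powR_ge0.
have le := far_le y t0; have ge := far_ge0 y t.
have fin : far y t \is a fin_num by rewrite ge0_fin_numE// (le_lt_trans le)// ltry.
rewrite -[in leRHS](fineK fin) -EFinM lee_fin.
have := fine_ge0 ge; move: le; rewrite -{1}(fineK fin) lee_fin; move: (fine _) => F le F0.
move: F0; rewrite le_eqVlt => /predU1P[<-|F0]; first by rewrite (powR0 q0) !mulr0.
have -> : F `^ q = F `^ (q - 1) * F by rewrite -[X in _ * X]powRr1 ?(ltW F0)// -powRD_gt0// subrK.
rewrite mulrA ler_wpM2r ?(ltW F0)// -powRM ?(ltW t0) ?(ltW F0)//.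
have fa : 0 <= farC * al by rewrite (mulr_ge0 (ltW farC_gt0))// ltW.
have tF : 0 <= t * F by rewrite (mulr_ge0 (ltW t0))// ltW.
apply: ge0_ler_powR; rewrite ?nnegrE//.
  by rewrite subr_ge0 (le_trans _ q2)// ler1n.
by rewrite mulrC -ler_pdivlMr.
Qed.

(** Drops the dependence of [near_set] on y, so that one maximal function serves all points y. *)
Definition beta (z : Rn) : R := if z \in Om then `|f z| + avgC else 0.

Let aC : 0 <= avgC.
Proof. by rewrite avgCE mulr_ge0 ?(ltW al0)// ltW// meanratio_gt0. Qed.

Lemma beta_ge0 z : 0 <= beta z.
Proof. by rewrite /beta; case: ifP => // _; rewrite addr_ge0. Qed.

Lemma measurable_beta : measurable_fun setT beta.
Proof.
apply: measurable_fun_ifT => //; first exact: measurable_fun_mem.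
exact: measurable_funD.
Qed.

Let mEbeta : measurable_fun setT (EFin \o beta).
Proof. by apply/measurable_EFinP; exact: measurable_beta. Qed.

Let Ebeta0 z : (0 <= (EFin \o beta) z)%E. Proof. by rewrite lee_fin beta_ge0. Qed.

Local Notation maxbeta := (maxfun (EFin \o beta)).
Local Notation e := (N / p).

Let near_ge0 y t : (0 <= near y t)%E.
Proof. by apply: integral_ge0 => z _; rewrite lee_fin mulr_ge0 ?Wk_ge0// addr_ge0. Qed.

(** The mass of [beta] in a cube of radius r about y is at most m r^N; the radial integral with
    exponents b = N and a = 1 gives the constant N + 1. *)
Lemma near_le_max y t m : maxbeta y = m%:E -> 0 < t -> (near y t <= ((N + 1) * m / t)%:E)%E.
Proof.
move=> Mm t0; have m0 : 0 <= m by rewrite -lee_fin -Mm; exact: maxfun_ge0.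
have := @ge0_integral_dst_powR R n (EFin \o beta) y m t 1 N mEbeta Ebeta0 m0 t0 ltr01 (ler0n _ _).
rewrite divr1 powR_inv1 ?(ltW t0)// => h; apply: le_trans (h _).
  rewrite [near y t]integral_mkcond; apply: ge0_le_integral_any => z _; rewrite patchE.
    by case: ifP => // _; rewrite lee_fin mulr_ge0 ?Wk_ge0// addr_ge0.
  case: ifPn => [/set_mem/andP[z0 _]|_]; last by rewrite mule_ge0 ?Ebeta0// lee_fin powR_ge0.
  by rewrite /beta /= mem_set ?EFinM//; exact/bdist_gt0P.
move=> r r0; rewrite powR_mulrn ?(ltW r0)// mulrC EFinM -Mm.
exact: le_maxfun.
Qed.

Lemma powRD_le (a b : R) : 0 <= a -> 0 <= b -> 0 <= p -> (a + b) `^ p <= 2 `^ p * (a `^ p + b `^ p).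
Proof.
move=> a0 b0' p0; have [ab|ba] := leP a b.
  apply: (@le_trans _ _ ((2 * b) `^ p)).
    by apply: ge0_ler_powR; rewrite ?nnegrE ?addr_ge0 ?mulr_ge0//; lra.
  by rewrite powRM// ler_pM2l ?powR_gt0// lerDr powR_ge0.
apply: (@le_trans _ _ ((2 * a) `^ p)).
  by apply: ge0_ler_powR; rewrite ?nnegrE ?addr_ge0 ?mulr_ge0//; lra.
by rewrite powRM// ler_pM2l ?powR_gt0// lerDl powR_ge0.
Qed.

Let p0 : 0 < p. Proof. exact: lt_trans p1. Qed.
Let q0 : 0 < q. Proof. exact: lt_trans pq. Qed.

Definition nearpC : R := 2 `^ p * (4 ^+ n.+1 + meanratio `^ p * (cball * 2 ^+ n.+1)).

Let nearpC_ge0 : 0 <= nearpC.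
Proof.
rewrite mulr_ge0 ?powR_ge0// addr_ge0 ?exprn_ge0// mulr_ge0 ?powR_ge0//.
by rewrite mulr_ge0 ?exprn_ge0// ltW.
Qed.

Let mpow (u : Rn -> R) b : measurable_fun setT u -> measurable_fun setT (fun z => (u z `^ b)%:E).
Proof. by move=> mu_; apply/measurable_EFinP; exact: (measurableT_comp (measurable_powR _)). Qed.

(** Some point outside Om lies within 2 bdist y of y, and the cube of radius 4 bdist y about it
    contains the one considered; this is the origin of 4^(n+1). *)
Lemma integral_near_Lp y : 0 < bdist y ->
  (\int[mu]_(z in dball y (2 * bdist y)) ((`|f z| + avgC) `^ p)%:E <=
   (nearpC * (al `^ p * bdist y ^+ n.+1))%:E)%E.
Proof.
move=> d0; have dd : 0 < 2 * bdist y by rewrite mulr_gt0.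
have mB := measurable_dball y (2 * bdist y).
apply: (@le_trans _ _ (\int[mu]_(z in dball y (2 * bdist y)) ((2 `^ p)%:E * ((`|f z| `^ p)%:E + cst (avgC `^ p)%:E z)))%E).
  apply: ge0_le_integral_any => z _; first by rewrite lee_fin powR_ge0.
  by rewrite /cst -EFinD -EFinM lee_fin; apply: powRD_le => //; exact: ltW.
have mfp : measurable_fun (dball y (2 * bdist y)) (fun z => (`|f z| `^ p)%:E).
  by apply: measurable_funTS; exact: mpow.
rewrite ge0_integralZl_EFin ?powR_ge0//; last 2 first.
- by move=> z _; rewrite /cst -EFinD lee_fin addr_ge0 ?powR_ge0.
- exact: emeasurable_funD.
rewrite ge0_integralD//; last by move=> z _; rewrite lee_fin powR_ge0.
rewrite (_ : (nearpC * (al `^ p * bdist y ^+ n.+1))%:E = (2 `^ p)%:E * ((4 ^+ n.+1 * (al `^ p * bdist y ^+ n.+1))%:E +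
  (meanratio `^ p * (cball * 2 ^+ n.+1) * (al `^ p * bdist y ^+ n.+1))%:E))%E; last first.
  by rewrite -EFinD -EFinM; congr EFin; rewrite /nearpC; ring.
rewrite lee_wpmul2l ?lee_fin ?powR_ge0//.
have [x [nx yx]] := bdist_near oOm Om_proper y.
apply: leeD.
  apply: (@le_trans _ _ (\int[mu]_(z in dball x (4 * bdist y)) (`|f z| `^ p)%:E)%E).
    apply: ge0_subset_integral_any => [|z _]; last by rewrite lee_fin powR_ge0.
    by move=> z; rewrite /dball/=; have := dst_triangle y x z; rewrite (dstC x y); lra.
  apply: le_trans (hp nx _) _; first by rewrite mulr_gt0.
  by rewrite lee_fin exprMn mulrCA.
have -> : (\int[mu]_(z in dball y (2 * bdist y)) cst (avgC `^ p)%:E z = (avgC `^ p)%:E * mu (dball y (2 * bdist y)%R))%E.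
  by rewrite integral_cst.
rewrite lebn_dball// -EFinM lee_fin avgCE powRM ?(ltW al0) ?(ltW meanratio_gt0)// exprMn.
by rewrite le_eqVlt; apply/orP; left; apply/eqP; ring.
Qed.

Let e_gt0 : 0 < e. Proof. by rewrite divr_gt0. Qed.

Definition decayC : R := (N + 1) / (e + 1) * (cball + nearpC).

Let decayC_ge0 : 0 <= decayC.
Proof.
have e1 : 0 <= (N + 1) / (e + 1) by rewrite mulr_ge0 ?invr_ge0 ?addr_ge0// ltW.
by rewrite (mulr_ge0 e1)// addr_ge0// ltW.
Qed.

(** The L^p bound at scale bdist y and Hoelder's inequality give mass O(al bdist(y)^(N/p) r^(N -
    N/p)) in a cube of radius r. The radial integral with b = N - N/p and a = N/p + 1 converts this
    into decay t^(-(N/p+1)). *)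
Lemma near_le_decay y t : 0 < t ->
  (near y t <= (decayC * (al * bdist y `^ e) * t `^ (- (e + 1)))%:E)%E.
Proof.
move=> t0; have := b0 y; rewrite le_eqVlt => /predU1P[d0|d0].
  rewrite /near (_ : near_set y = set0).
    rewrite integral_set0 lee_fin mulr_ge0 ?powR_ge0//.
    by rewrite (mulr_ge0 decayC_ge0)// mulr_ge0 ?powR_ge0// ltW.
  apply/seteqP; split => z //= /andP[_]; rewrite -d0 mulr0 ltNge.
  by rewrite dst_ge0.
have mns := measurable_near_set Om_proper y.
pose g (z : Rn) : R := `|f z| + avgC.
have g0 z : 0 <= g z by rewrite addr_ge0.
have mg : measurable_fun setT g by exact: measurable_funD.
pose v (z : Rn) : \bar R := ((EFin \o g) \_ (near_set y)) z.
have v0 z : (0 <= v z)%E by rewrite /v patchE; case: ifP => // _; rewrite lee_fin.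
have mv : measurable_fun setT v.
  by apply/(measurable_restrictT _ mns); apply: measurable_funTS; exact/measurable_EFinP.
have eN : e <= N by rewrite ler_pdivrMr// ler_peMr// ltW.
have A0 : 0 <= (cball + nearpC) * (al * bdist y `^ e).
  by apply: mulr_ge0; [rewrite addr_ge0// ltW|rewrite mulr_ge0 ?powR_ge0// ltW].
have := @ge0_integral_dst_powR R n v y ((cball + nearpC) * (al * bdist y `^ e)) t (e + 1) (N - e)
  mv v0 A0 t0.
rewrite (_ : N - e + (e + 1) = N + 1); last by ring.
move=> H; rewrite (_ : decayC * (al * bdist y `^ e) = (N + 1) / (e + 1) * ((cball + nearpC) * (al * bdist y `^ e))); last first.
  by rewrite /decayC [RHS]mulrA.
apply: le_trans (H _ _ _).
- rewrite /near [leLHS]integral_mkcond; apply: ge0_le_integral_any => z _; rewrite patchE.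
    by case: ifP => // _; rewrite lee_fin (mulr_ge0 (g0 z))// Wk_ge0.
  by rewrite /v patchE; case: ifP => _; rewrite ?mul0e// /= EFinM.
- by rewrite ltr_pwDr// ltW.
- by rewrite subr_ge0.
move=> r r0; have rN : 0 < r ^+ n.+1 by rewrite exprn_gt0.
(* The height with al'^p r^N = al^p bdist(y)^N, for which [Lp_average_le] is balanced on the cube of
   radius r. *)
pose al' := al * (bdist y / r) `^ e.
have dr : 0 < bdist y / r by rewrite divr_gt0.
have al'0 : 0 < al' by rewrite mulr_gt0// powR_gt0.
have al'p : al' `^ p = al `^ p * (bdist y ^+ n.+1 / r ^+ n.+1).
  rewrite /al' powRM ?(ltW al0) ?powR_ge0// -powRrM divfK ?gt_eqF// powR_mulrn ?(ltW dr)//.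
  by rewrite expr_div_n.
have -> : (\int[mu]_(z in dball y r) v z = \int[mu]_(z in dball y r `&` near_set y) `|g z|%:E)%E.
  rewrite /v -integral_mkcondr; apply: eq_integral => z _.
  by rewrite /= ger0_norm.
have mD : measurable (dball y r `&` near_set y) by apply: measurableI => //; exact: measurable_dball.
apply: le_trans (@Lp_average_le g p al' mg (ltW p1) al'0 _ (cball * r ^+ n.+1) (nearpC * r ^+ n.+1) mD _ _ _ _) _.
- by rewrite mulr_ge0// ltW.
- by rewrite mulr_ge0// ltW.
- by rewrite -(lebn_dball y r0); apply: le_lebn => z [].
- rewrite al'p (_ : _ * _ * _ = nearpC * (al `^ p * bdist y ^+ n.+1)); last by field; rewrite gt_eqF.
  apply: le_trans (integral_near_Lp d0).
  apply: (@le_trans _ _ (\int[mu]_(z in dball y (2 * bdist y)) (`|g z| `^ p)%:E)%E).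
    apply: ge0_subset_integral_any => [|z _]; last by rewrite lee_fin powR_ge0.
    by move=> z [_ /andP[]].
  by apply: ge0_le_integral_any => z _; rewrite lee_fin ?powR_ge0// ger0_norm.
rewrite lee_fin -mulrDl -!mulrA ler_wpM2l ?addr_ge0 ?(ltW cball_gt0)//.
rewrite /al' (powRM _ (ltW d0)) ?invr_ge0 ?(ltW r0)//.
have -> : r^-1 `^ e = (r `^ e)^-1 by rewrite -[r^-1]powR_inv1 ?(ltW r0)// -powRrM mulN1r powRN.
have -> : r `^ (N - e) = r ^+ n.+1 / r `^ e by rewrite (powRD_gt0 _ _ r0) powRN powR_mulrn// ltW.
by rewrite le_eqVlt; apply/orP; left; apply/eqP; ring.
Qed.

Let s0 : 0 < s.
Proof. by rewrite sE mulr_gt0// subr_gt0 ltf_pV2 ?posrE. Qed.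

Let es : e - s = N / q. Proof. by rewrite sE; ring. Qed.

Definition timeC : R := 2 `^ s * (N + 1) / s + decayC * (q / N).

(** Hedberg's argument: the bound by the maximal function is integrable against t^s near 0, the
    decay bound at infinity since N/p - s = N/q > 0. The exponents on the right come from (p / N) s
    = 1 - p / q. *)
Lemma integral_near_le y m : maxbeta y = m%:E -> 0 < m -> 0 < bdist y ->
  (\int[leb]_(t in pos) (near y t * (t `^ s)%:E) <=
   (timeC * (bdist y `^ s * al `^ (1 - p / q) * m `^ (p / q)))%:E)%E.
Proof.
move=> Mm m0 d0.
(* The time at which m / t equals al bdist(y)^(N/p) t^(-(N/p+1)), so that both integrals are
   multiples of m tau^s. *)
pose tau := bdist y * (al / m) `^ (p / N).
have am : 0 < al / m by rewrite divr_gt0.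
have tau0 : 0 < tau by rewrite mulr_gt0// powR_gt0.
have es0 : 0 < e - s by rewrite es divr_gt0.
have N10 : 0 <= N + 1 by rewrite addr_ge0.
have dC0 : 0 <= decayC * (al * bdist y `^ e).
  by rewrite (mulr_ge0 decayC_ge0)// mulr_ge0 ?powR_ge0// ltW.
pose F1 (t : R) : \bar R := (((N + 1) * m)%:E * (t `^ (s - 1))%:E)%E.
pose F2 (t : R) : \bar R := ((decayC * (al * bdist y `^ e))%:E * (t `^ (- (e - s) - 1))%:E)%E.
have F10 t : (0 <= F1 t)%E by rewrite mule_ge0 ?lee_fin ?powR_ge0// mulr_ge0// ltW.
have F20 t : (0 <= F2 t)%E by rewrite mule_ge0 ?lee_fin ?powR_ge0.
have mp b D : measurable_fun D (fun t : R => (t `^ b)%:E).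
  by apply/measurable_EFinP; apply: measurable_funTS; exact: measurable_powR.
have mF1 D : measurable_fun D F1 by apply: emeasurable_funM.
have mF2 D : measurable_fun D F2 by apply: emeasurable_funM.
have mI1 : measurable (`]0%R, (2 * tau)%R[%classic : set (measurableTypeR R)) by exact: measurable_itv.
have mI2 : measurable (`]tau, +oo[%classic : set (measurableTypeR R)) by exact: measurable_itv.
(* The first range is enlarged to 2 tau in order to place t = tau inside an open interval; this
   accounts for 2^s in [timeC]. *)
apply: (@le_trans _ _ (\int[leb]_t ((F1 \_ `]0%R, (2 * tau)%R[) t + (F2 \_ `]tau, +oo[) t))%E).
  rewrite [leLHS]integral_mkcond; apply: ge0_le_integral_any => t _; rewrite patchE posE.
    by case: ifP => // _; rewrite mule_ge0// lee_fin powR_ge0.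
  have G1 : (0 <= (F1 \_ `]0%R, (2 * tau)%R[) t)%E by rewrite patchE; case: ifP.
  have G2 : (0 <= (F2 \_ `]tau, +oo[) t)%E by rewrite patchE; case: ifP.
  case: ifPn => t0; last by rewrite adde_ge0.
  have ts0 : (0 <= (t `^ s)%:E)%E by rewrite lee_fin powR_ge0.
  have [tt|tt] := leP t tau.
    apply: le_trans (leeDl _ G2); rewrite patchE mem_set; last by rewrite /= in_itv/=; apply/andP; split; lra.
    apply: le_trans (lee_wpmul2r ts0 (near_le_max Mm t0)) _.
    rewrite /F1 -!EFinM lee_fin -[t^-1]powR_inv1 ?(ltW t0)// (_ : s - 1 = -1 + s); last by ring.
    by rewrite [in leRHS]powRD_gt0// !mulrA.
  apply: le_trans (leeDr _ G1); rewrite patchE mem_set; last by rewrite /= in_itv/= tt.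
  apply: le_trans (lee_wpmul2r ts0 (near_le_decay _ t0)) _.
  rewrite /F2 -!EFinM lee_fin (_ : - (e - s) - 1 = - (e + 1) + s); last by ring.
  by rewrite [in leRHS]powRD_gt0// !mulrA.
rewrite ge0_integralD//; last 4 first.
- by move=> t _; rewrite patchE; case: ifP.
- by apply/(measurable_restrictT F1 mI1); exact: mF1.
- by move=> t _; rewrite patchE; case: ifP.
- by apply/(measurable_restrictT F2 mI2); exact: mF2.
have Nm0 : 0 <= (N + 1) * m by rewrite mulr_ge0// ltW.
rewrite -!integral_mkcond !ge0_integralZl_EFin//; try exact: mp; try by move=> t _; rewrite lee_fin powR_ge0.
have t20 : 0 < 2 * tau by rewrite mulr_gt0.
have h1 : (0 <= ((N + 1) * m)%:E)%E by rewrite lee_fin mulr_ge0// ltW.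
apply: le_trans (leeD (lee_wpmul2l h1 (integral_powR_lt s0 t20)) (lexx _)) _.
rewrite integral_powR_gt// -!EFinM -EFinD lee_fin.
have X1 : m * tau `^ s = bdist y `^ s * al `^ (1 - p / q) * m `^ (p / q).
  rewrite /tau powRM ?(ltW d0) ?powR_ge0// -powRrM.
  have -> : p / N * s = 1 - p / q by rewrite sE; field; rewrite !gt_eqF.
  rewrite powRM ?(ltW al0) ?invr_ge0 ?(ltW m0)//.
  have -> : m^-1 `^ (1 - p / q) = m `^ (p / q - 1).
    by rewrite -powR_inv1 ?(ltW m0)// -powRrM mulN1r opprB.
  rewrite mulrC -!mulrA -[X in _ * (_ * (_ * X))]powRr1 ?(ltW m0)// -powRD_gt0// subrK.
  by [].
have X2 : al * bdist y `^ e * tau `^ (- (e - s)) = m * tau `^ s.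
  have -> : tau `^ (- (e - s)) = tau `^ s * tau `^ (- e).
    by rewrite -powRD_gt0//; congr (_ `^ _); ring.
  rewrite [tau `^ (- e)]powRN {2}/tau powRM ?(ltW d0) ?powR_ge0// -powRrM.
  have -> : p / N * e = 1 by field; rewrite !gt_eqF.
  rewrite powRr1 ?(ltW am)//; field.
  by rewrite !gt_eqF// powR_gt0.
rewrite powRM ?(ltW tau0)// -X1 es.
rewrite [leLHS](_ : _ = 2 `^ s * (N + 1) / s * (m * tau `^ s) + decayC * (N / q)^-1 * (al * bdist y `^ e * tau `^ (- (N / q)))); last by ring.
rewrite -es X2 es /timeC mulrDl invf_div le_eqVlt; apply/orP; left; apply/eqP; ring.
Qed.

Let poweR0q : poweR 0 q = 0%E :> \bar R.
Proof. by rewrite (poweR_EFin 0 q) powR0// gt_eqF. Qed.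

Lemma poweR_integral_near_le y : 0 < bdist y ->
  (poweR (\int[leb]_(t in pos) (near y t * (t `^ s)%:E)) q <=
   (timeC `^ q * (bdist y `^ (s * q) * al `^ (q - p)))%:E * poweR (maxbeta y) p)%E.
Proof.
move=> d0; have I0 : (0 <= \int[leb]_(t in pos) (near y t * (t `^ s)%:E))%E.
  by apply: integral_ge0 => t _; rewrite mule_ge0// lee_fin powR_ge0.
have M0 := maxfun_ge0 Ebeta0 y.
have tC : 0 < timeC.
  rewrite ltr_pwDl//; first by rewrite divr_gt0// mulr_gt0 ?powR_gt0// addr_gt0.
  by rewrite (mulr_ge0 decayC_ge0)// divr_ge0// ltW.
have Cp : 0 < timeC `^ q * (bdist y `^ (s * q) * al `^ (q - p)).
  by rewrite mulr_gt0 ?powR_gt0// mulr_gt0 ?powR_gt0.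
case E : (maxbeta y) => [m| |]; last by move: M0; rewrite E.
- have m0 : 0 <= m by rewrite -lee_fin -E.
  move: m0; rewrite le_eqVlt => /predU1P[m0|m0].
    rewrite integral0_eq; first by rewrite poweR0q mule_ge0 ?lee_fin ?(ltW Cp)// powR_ge0.
    move=> t /posP t0; have := near_le_max E t0; rewrite -m0 mulr0 mul0r => h.
    by rewrite (_ : near y t = 0%E) ?mul0e//; apply/eqP; rewrite eq_le h near_ge0.
  have h := integral_near_le E m0 d0.
  apply: (@le_trans _ _ (poweR (timeC * (bdist y `^ s * al `^ (1 - p / q) * m `^ (p / q)))%:E q)).
    apply: gt0_ler_poweR => //; rewrite ?in_itv/= ?leey ?I0 ?andbT//; first exact: ltW.
    exact: le_trans I0 h.
  rewrite !poweR_EFin -EFinM lee_fin powRM ?mulr_ge0 ?powR_ge0 ?(ltW tC)//.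
  rewrite (powRM _ (mulr_ge0 (powR_ge0 _ _) (powR_ge0 _ _)) (powR_ge0 _ _)).
  rewrite (powRM _ (powR_ge0 _ _) (powR_ge0 _ _)) -!powRrM.
  rewrite (_ : p / q * q = p); last by rewrite divfK// gt_eqF.
  rewrite (_ : (1 - p / q) * q = q - p); last by rewrite mulrBl mul1r divfK// gt_eqF.
  by rewrite le_eqVlt; apply/orP; left; apply/eqP; ring.
- have -> : poweR +oo%E p = +oo%E :> \bar R.
    by rewrite poweRyr// gt_eqF.
  by rewrite gt0_muley ?lte_fin// leey.
Qed.

Definition nearC : R := timeC `^ q * (2 `^ (N + s * q) * WkC n (s * q)).

Lemma nearC_ge0 : 0 <= nearC.
Proof. by rewrite mulr_ge0 ?powR_ge0// mulr_ge0 ?powR_ge0// WkC_ge0// mulr_gt0. Qed.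

(** For x outside Om, |x-y| >= bdist y, so integrating |x-y|^-(N+sq) in x gives O(bdist(y)^(-sq)),
    which cancels the factor bdist(y)^(sq) of [poweR_integral_near_le]. *)
Lemma integral_near_Lq :
  (\int[mu]_(x in ~` Om) \int[mu]_y ((dst x y `^ (- (N + s * q)))%:E *
     poweR (\int[leb]_(t in pos) (near y t * (t `^ s)%:E)) q) <=
   (nearC * al `^ (q - p))%:E * \int[mu]_y poweR (maxbeta y) p)%E.
Proof.
have sq0 : 0 < s * q by rewrite mulr_gt0.
pose B (y : Rn) : R := timeC `^ q * (bdist y `^ (s * q) * al `^ (q - p)).
have B0 y : 0 <= B y by rewrite mulr_ge0 ?powR_ge0// mulr_ge0 ?powR_ge0.
pose G (y : Rn) : \bar R := ((B y)%:E * poweR (maxbeta y) p)%E.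
have G0 y : (0 <= G y)%E by rewrite mule_ge0 ?lee_fin ?B0// poweR_ge0.
have mpM : measurable_fun setT (fun y : Rn => poweR (maxbeta y) p).
  by apply: (measurableT_comp (measurable_poweR _)); exact: measurable_maxfun.
have mG : measurable_fun setT G.
  apply: emeasurable_funM => //; apply/measurable_EFinP; apply: measurable_funM => //.
  apply: measurable_funM => //.
  by apply: (measurableT_comp (measurable_powR _)).
pose H (x y : Rn) : \bar R := ((dst x y `^ (- (N + s * q)))%:E * G y)%E.
have H0 x y : (0 <= H x y)%E by rewrite mule_ge0// lee_fin powR_ge0.
have mH : measurable_fun [set: Rn * Rn] (fun w => H w.1 w.2).
  apply: emeasurable_funM; last exact: (measurableT_comp mG measurable_snd).
  apply/measurable_EFinP; apply: (measurableT_comp (measurable_powR _)).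
  exact: measurable_fun_dst.
have mC : measurable (~` Om) by exact: measurableC.
apply: (@le_trans _ _ (\int[mu]_(x in ~` Om) \int[mu]_y H x y)%E).
  apply: ge0_le_integral_any => x nx.
    by apply: integral_ge0 => y _; rewrite mule_ge0 ?poweR_ge0// lee_fin powR_ge0.
  apply: ge0_le_integral_any => y _; first by rewrite mule_ge0 ?poweR_ge0// lee_fin powR_ge0.
  rewrite /H lee_wpmul2l ?lee_fin ?powR_ge0//.
  have := b0 y; rewrite le_eqVlt => /predU1P[d0|d0]; last exact: poweR_integral_near_le.
  rewrite integral0_eq; first by rewrite poweR0q.
  move=> t _; rewrite /near (_ : near_set y = set0) ?integral_set0 ?mul0e//.
  apply/seteqP; split => z //= /andP[_]; rewrite -d0 mulr0 ltNge.
  by rewrite dst_ge0.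
rewrite (tonelli_dom sigmaRn sigmaRn mC measurableT mH H0).
have C0 : 0 <= nearC * al `^ (q - p) by rewrite mulr_ge0 ?nearC_ge0 ?powR_ge0.
rewrite -ge0_integralZl_EFin//; last by move=> y _; exact: poweR_ge0.
apply: ge0_le_integral_any => y _; first exact: integral_ge0.
have := b0 y; rewrite le_eqVlt => /predU1P[d0|d0].
  rewrite integral0_eq ?mule_ge0 ?poweR_ge0 ?lee_fin//.
  by move=> x _; rewrite /H /G /B -d0 (powR0 (lt0r_neq0 sq0)) mul0r mulr0 mul0e mule0.
have mdy : measurable_fun [set: Rn] (fun x : Rn => dst (y : Rn) x) by exact: measurable_fun_dst.
have mfar : measurable_fun setT (fun x : Rn => (if bdist y <= dst y x then dst y x `^ (- (N + s * q)) else 0)%:E).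
  apply/measurable_EFinP; apply: measurable_fun_ifT => //; first exact: measurable_fun_ler.
  by apply: (measurableT_comp (measurable_powR _)).
apply: (@le_trans _ _ (\int[mu]_x ((if bdist y <= dst y x then dst y x `^ (- (N + s * q)) else 0)%:E * G y))%E).
  rewrite [leLHS]integral_mkcond; apply: ge0_le_integral_any => x _; rewrite patchE.
    by case: ifP => // _; exact: H0.
  have L0 : 0 <= (if bdist y <= dst y x then dst y x `^ (- (N + s * q)) else 0 : R).
    by case: ifP => // _; exact: powR_ge0.
  case: ifPn => [/set_mem nx|_]; last by rewrite mule_ge0.
  by rewrite (bdist_le y nx) /H dstC.
rewrite ge0_integralZr//; last by move=> x _; rewrite lee_fin; case: ifP => // _; exact: powR_ge0.
apply: le_trans (lee_wpmul2r (G0 y) (integral_far y sq0 d0)) _.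
rewrite /G muleA -EFinM /B lee_wpmul2r ?poweR_ge0// lee_fin /nearC.
have dd : bdist y `^ (- (s * q)) * bdist y `^ (s * q) = 1 by rewrite -powRD_gt0// addNr powRr0.
rewrite le_eqVlt; apply/orP; left; apply/eqP.
rewrite [RHS](_ : _ = timeC `^ q * (2 `^ (N + s * q) * WkC n (s * q)) * al `^ (q - p) * (bdist y `^ (- (s * q)) * bdist y `^ (s * q))).
  by ring.
by rewrite dd mulr1.
Qed.

End far_near_estimates.

(** * The operator for general integrands, and passage to the sup distance *)

Section truncated.
Variables (R : realType) (n : nat).
Local Notation V := 'rV[R]_n.+1.
Local Notation Rn := (Rn R n.+1).
Local Notation mu := (@lebn R n.+1).
Local Notation leb := (@lebesgue_measure R).
Local Notation N := (n.+1%:R : R).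
Local Notation sigmaRn := (mu : {sigma_finite_measure set Rn -> \bar R}).
Local Notation sigmaR := (leb : {sigma_finite_measure set (measurableTypeR R) -> \bar R}).
Local Notation pos := (`]0%R, +oo[%classic : set (measurableTypeR R)).

Lemma poweRD_le (q : R) (a b : \bar R) : 0 <= q -> (0 <= a)%E -> (0 <= b)%E ->
  (poweR (a + b) q <= (2 `^ q)%:E * (poweR a q + poweR b q))%E.
Proof.
move=> q0 a0 b0.
have key (x y : \bar R) : (0 <= x)%E -> (x <= y)%E -> (poweR (x + y) q <= (2 `^ q)%:E * (poweR x q + poweR y q))%E.
  move=> x0 xy; have y0 := le_trans x0 xy.
  apply: (@le_trans _ _ (poweR (2%:E * y) q)).
    apply: gt0_ler_poweR => //; rewrite ?in_itv/= ?leey ?adde_ge0 ?mule_ge0 ?lee_fin//.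
    by rewrite -[2](natr1 1) EFinD ge0_muleDl// !mul1e leeD2r.
  rewrite poweRM ?lee_fin// poweR_EFin lee_wpmul2l ?lee_fin ?powR_ge0//.
  by rewrite leeDr// poweR_ge0.
by have [ab|/ltW ba] := leP a b; [exact: key|rewrite addeC [X in (_ * X)%E]addeC; exact: key].
Qed.

Variables (c s q : R).
Hypothesis c0 : 0 < c.
Hypothesis s0 : 0 < s.
Hypothesis q1 : 1 <= q.

Definition trunc (Phi : Rn -> R -> \bar R) (x y : Rn) : \bar R :=
  (\int[leb]_(t in `]0%R, (c * dst x y)%R[) (Phi y t * (t `^ s)%:E))%E.

(** The q-th power of the operator studied, with the sup distance and with Phi in place of the
    absolute derivative. The constant c exceeds 2 so as to absorb the comparison of norms. *)
Definition trunc_op (Phi : Rn -> R -> \bar R) (x : Rn) : \bar R :=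
  (\int[mu]_y ((dst x y `^ (- (N + s * q)))%:E * poweR (trunc Phi x y) q))%E.

Section measurability.
Variable Phi : Rn -> R -> \bar R.
Hypothesis Phi0 : forall y t, (0 <= Phi y t)%E.
Hypothesis mPhi : measurable_fun [set: Rn * R] (fun w => Phi w.1 w.2).

Lemma trunc_ge0 x y : (0 <= trunc Phi x y)%E.
Proof. by apply: integral_ge0 => t _; rewrite mule_ge0 ?lee_fin ?powR_ge0. Qed.

Lemma measurable_trunc : measurable_fun [set: Rn * Rn] (fun w => trunc Phi w.1 w.2).
Proof.
have := measurable_fun_fubini_tonelli_F (m2 := sigmaR) (fun w : (Rn * Rn) * R =>
  (if ((0 < w.2) && (w.2 < c * dst w.1.1 w.1.2))%R then Phi w.1.2 w.2 * (w.2 `^ s)%:E else 0)%E).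
rewrite /fubini_F /= => mS; rewrite (_ : (fun w : Rn * Rn => _) =
  (fun w => (\int[leb]_t (if ((0 < t) && (t < c * dst w.1 w.2))%R then Phi w.2 t * (t `^ s)%:E else 0))%E)).
  apply: mS; last by move=> w; case: ifP => // _; rewrite mule_ge0 ?lee_fin ?powR_ge0.
  have md : measurable_fun [set: (Rn * Rn) * R] (fun w : (Rn * Rn) * R => dst w.1.1 w.1.2).
    apply: measurable_fun_dst.
    - exact: (measurableT_comp measurable_fst measurable_fst).
    - exact: (measurableT_comp measurable_snd measurable_fst).
  apply: measurable_fun_ifT => //.
    apply: measurable_and; first exact: measurable_fun_ltr.
    by apply: measurable_fun_ltr => //; exact: measurable_funM.
  apply: emeasurable_funM.
    have mp : measurable_fun [set: (Rn * Rn) * R] (fun w : (Rn * Rn) * R => (w.1.2, w.2)).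
      by apply: measurable_fun_pair => //; exact: (measurableT_comp measurable_snd measurable_fst).
    exact: (measurableT_comp mPhi mp).
  by apply/measurable_EFinP; exact: (measurableT_comp (measurable_powR _) measurable_snd).
by apply/funext => w; rewrite (integral_if _ setT) setTI; congr (integral _ _ _).
Qed.

Let dpow_ge0 (x y : V) : (0 <= (dst x y `^ (- (N + s * q)))%:E :> \bar R)%E.
Proof. by rewrite lee_fin powR_ge0. Qed.

Lemma trunc_integrand_ge0 x y : (0 <= (dst x y `^ (- (N + s * q)))%:E * poweR (trunc Phi x y) q)%E.
Proof. by rewrite mule_ge0 ?poweR_ge0. Qed.

Lemma measurable_trunc_integrand : measurable_fun [set: Rn * Rn] (fun w =>
  (dst w.1 w.2 `^ (- (N + s * q)))%:E * poweR (trunc Phi w.1 w.2) q)%E.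
Proof.
apply: emeasurable_funM; last exact: (measurableT_comp (measurable_poweR _) measurable_trunc).
apply/measurable_EFinP; apply: (measurableT_comp (measurable_powR _)).
exact: measurable_fun_dst.
Qed.

Lemma trunc_op_ge0 x : (0 <= trunc_op Phi x)%E.
Proof. by apply: integral_ge0 => y _; exact: trunc_integrand_ge0. Qed.

Lemma measurable_trunc_op : measurable_fun setT (trunc_op Phi).
Proof.
exact: (measurable_integral_param (F := fun x y : Rn => ((dst x y `^ (- (N + s * q)))%:E * poweR (trunc Phi x y) q)%E)
  measurable_trunc_integrand trunc_integrand_ge0).
Qed.

End measurability.

(** After exchanging the integrals, [hardy] applies for each fixed y. *)
Lemma integral_trunc_op_le (phi : Rn -> R -> R) :
  measurable_fun [set: Rn * R] (fun w => phi w.1 w.2) -> (forall y t, 0 <= phi y t) ->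
  (\int[mu]_x trunc_op (fun y t => (phi y t)%:E) x <=
   (hardyC n c s q)%:E * \int[mu]_y \int[leb]_(t in pos) (t `^ (q - 1) * phi y t `^ q)%:E)%E.
Proof.
move=> mphi phi0.
have mPhi : measurable_fun [set: Rn * R] (fun w => (phi w.1 w.2)%:E) by exact/measurable_EFinP.
have Phi0 (y : Rn) (t : R) : (0 <= (phi y t)%:E)%E by rewrite lee_fin.
rewrite /trunc_op (tonelli_dom sigmaRn sigmaRn (F := fun x y : Rn =>
  ((dst x y `^ (- (N + s * q)))%:E * poweR (trunc (fun y t => (phi y t)%:E) x y) q)%E)
  measurableT measurableT (measurable_trunc_integrand Phi0 mPhi)); last first.
  exact: trunc_integrand_ge0.
have hC : 0 <= hardyC n c s q.
  have a0 : 0 < s * (q + 1) / 2 by rewrite divr_gt0// mulr_gt0// ltr_wpDl// (le_trans ler01).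
  apply: mulr_ge0; first by rewrite mulr_ge0 ?powR_ge0.
  by rewrite mulr_ge0 ?powR_ge0// mulr_ge0 ?powR_ge0// WkC_ge0.
have m2 : measurable_fun [set: Rn * R] (fun w => (w.2 `^ (q - 1) * phi w.1 w.2 `^ q)%:E).
  apply/measurable_EFinP; apply: measurable_funM.
    exact: (measurableT_comp (measurable_powR _) measurable_snd).
  exact: (measurableT_comp (measurable_powR _) mphi).
rewrite -ge0_integralZl_EFin//; last 2 first.
- by move=> y _; apply: integral_ge0 => t _; rewrite lee_fin mulr_ge0 ?powR_ge0.
- have := measurable_fun_fubini_tonelli_F (m2 := sigmaR) (fun w : Rn * R =>
    (if (0 < w.2)%R then (w.2 `^ (q - 1) * phi w.1 w.2 `^ q)%:E else 0)%E).
  rewrite /fubini_F /= => mS; rewrite (_ : (fun x : Rn => _) =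
    (fun x => (\int[leb]_t (if (0 < t)%R then (t `^ (q - 1) * phi x t `^ q)%:E else 0))%E)).
    apply: mS; last by move=> w; case: ifP => // _; rewrite lee_fin mulr_ge0 ?powR_ge0.
    by apply: measurable_fun_ifT => //; exact: measurable_fun_ltr.
  apply/funext => x; rewrite (integral_if _ setT) setTI; congr (integral _ _ _).
  by apply/seteqP; split => l /=; rewrite in_itv/= andbT.
apply: ge0_le_integral_any => y _.
  by apply: integral_ge0 => x _; exact: trunc_integrand_ge0.
apply: le_trans (hardy y (measurableT_comp mphi (pair1_measurable y)) (phi0 y) c0 s0 q1).
rewrite le_eqVlt; apply/orP; left; apply/eqP; apply: eq_integral => x _.
congr (_ * poweR _ q)%E; apply: eq_integral => t _; exact: EFinM.
Qed.

(* The kernel in the definition of Rsq uses the Euclidean norm; dst is the sup norm. *)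
Lemma Rsq_integral_le (f : Rn -> R) (k : R) (Phi : Rn -> R -> \bar R) (x : V) : 2 * N <= c -> 0 <= k ->
  (forall y t, 0 <= Phi y t)%E -> measurable_fun [set: Rn * R] (fun w => Phi w.1 w.2) ->
  (forall y t, 0 < t -> (`|dtP f y t|%:E <= k%:E * Phi y t)%E) ->
  (\int[mu]_y ((powR (enorm (x - (y : V))) (- (N + s * q)))%:E *
    poweR (\int[leb]_(t in [set t : R | (0 < t < 2 * enorm (x - (y : V)))%R]) (`|dtP f y t| * powR t s)%:E) q)
   <= (k `^ q)%:E * trunc_op Phi x)%E.
Proof.
move=> cN k0 Phi0 mPhi hPhi.
rewrite /trunc_op -ge0_integralZl_EFin ?powR_ge0//; last 2 first.
- by move=> y _; exact: trunc_integrand_ge0.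
- exact: (measurableT_comp (measurable_trunc_integrand Phi0 mPhi) (pair1_measurable (x : Rn))).
apply: ge0_le_integral_any => y _; first by rewrite mule_ge0 ?poweR_ge0// lee_fin powR_ge0.
have d0 := dst_ge0 x y; have de := dst_le_enorm x y; have ed := enorm_le_dst x y.
rewrite muleCA; apply: lee_pmul; rewrite ?poweR_ge0 ?lee_fin ?powR_ge0//.
  move: d0; rewrite le_eqVlt => /predU1P[d0|d0].
    have -> : enorm (x - (y : V)) = dst x y.
      by apply/eqP; rewrite eq_le de andbT -d0 (le_trans ed)// -d0 mulr0.
    exact: lexx.
  apply: ler_powRN => //; by rewrite addr_ge0// mulr_ge0 ?(ltW s0)// (le_trans ler01).
have T0 := trunc_ge0 Phi0 x y.
rewrite -poweR_EFin -poweRM ?lee_fin//.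
have le : (\int[leb]_(t in [set t : R | (0 < t < 2 * enorm (x - (y : V)))%R]) (`|dtP f y t| * powR t s)%:E
    <= k%:E * trunc Phi x y)%E.
  have mt : measurable_fun `]0%R, (c * dst x y)%R[%classic (fun t : R => Phi y t * (t `^ s)%:E)%E.
    apply: measurable_funTS; apply: emeasurable_funM.
      exact: (measurableT_comp mPhi (pair1_measurable y)).
    by apply/measurable_EFinP; exact: measurable_powR.
  rewrite /trunc -ge0_integralZl_EFin//; last first.
    by move=> t _; rewrite mule_ge0 ?lee_fin ?powR_ge0.
  apply: (@le_trans _ _ (\int[leb]_(t in `]0%R, (c * dst x y)%R[) (`|dtP f y t| * powR t s)%:E)%E).
    apply: ge0_subset_integral_any => [|t _]; last by rewrite lee_fin mulr_ge0 ?powR_ge0.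
    move=> t /= /andP[t0 te]; rewrite in_itv/= t0/=; apply: lt_le_trans te _.
    apply: (@le_trans _ _ (2 * (N * dst x y))); first by rewrite ler_pM2l.
    by rewrite mulrA ler_wpM2r.
  apply: ge0_le_integral_any => t; rewrite /= in_itv/= => /andP[t0 _].
    by rewrite lee_fin mulr_ge0 ?powR_ge0.
  by rewrite EFinM muleA lee_wpmul2r ?lee_fin ?powR_ge0//; exact: hPhi.
have I0 : (0 <= \int[leb]_(t in [set t : R | (0 < t < 2 * enorm (x - (y : V)))%R]) (`|dtP f y t| * powR t s)%:E)%E.
  by apply: integral_ge0 => t _; rewrite lee_fin mulr_ge0 ?powR_ge0.
apply: gt0_ler_poweR => //; rewrite ?in_itv/= ?leey ?I0 ?andbT//; first exact: le_trans q1.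
by rewrite mule_ge0 ?lee_fin.
Qed.

Lemma trunc_opD_le (Phi Psi : Rn -> R -> \bar R) (x : Rn) :
  (forall y t, 0 <= Phi y t)%E -> measurable_fun [set: Rn * R] (fun w => Phi w.1 w.2) ->
  (forall y t, 0 <= Psi y t)%E -> measurable_fun [set: Rn * R] (fun w => Psi w.1 w.2) ->
  (trunc_op (fun y t => Phi y t + Psi y t) x <= (2 `^ q)%:E * (trunc_op Phi x + trunc_op Psi x))%E.
Proof.
move=> Phi0 mPhi Psi0 mPsi; have q0 : 0 <= q by exact: le_trans q1.
have m1 := measurableT_comp (measurable_trunc_integrand Phi0 mPhi) (pair1_measurable x).
have m2 := measurableT_comp (measurable_trunc_integrand Psi0 mPsi) (pair1_measurable x).
have p1 y := trunc_integrand_ge0 Phi x y; have p2 y := trunc_integrand_ge0 Psi x y.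
rewrite /trunc_op -ge0_integralD//.
rewrite -ge0_integralZl_EFin ?powR_ge0//; last 2 first.
- by move=> y _; rewrite adde_ge0.
- exact: emeasurable_funD.
apply: ge0_le_integral_any => y _; first by rewrite mule_ge0 ?poweR_ge0// lee_fin powR_ge0.
rewrite -ge0_muleDr ?poweR_ge0// muleCA lee_wpmul2l ?lee_fin ?powR_ge0//.
have -> : trunc (fun y t => Phi y t + Psi y t)%E x y = (trunc Phi x y + trunc Psi x y)%E.
  have mt (Th : Rn -> R -> \bar R) : measurable_fun [set: Rn * R] (fun w => Th w.1 w.2) ->
      measurable_fun `]0%R, (c * dst x y)%R[%classic (fun t : R => Th y t * (t `^ s)%:E)%E.
    move=> mTh; apply: measurable_funTS; apply: emeasurable_funM.
      exact: (measurableT_comp mTh (pair1_measurable y)).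
    by apply/measurable_EFinP; exact: measurable_powR.
  rewrite /trunc -ge0_integralD//; last 4 first.
  - by move=> t _; rewrite mule_ge0 ?lee_fin ?powR_ge0.
  - exact: mt.
  - by move=> t _; rewrite mule_ge0 ?lee_fin ?powR_ge0.
  - exact: mt.
  by apply: eq_integral => t _; rewrite ge0_muleDl.
by apply: poweRD_le => //; exact: trunc_ge0.
Qed.

End truncated.

(** * Chebyshev's inequality for a sum of three operators *)

Section weak_combination.
Context d (T : measurableType d) (R : realType) (m : {measure set T -> \bar R}).
Variables (D : set T) (H1 H2 H3 : T -> \bar R) (k a lam A1 A2 A3 : R).

(** The nesting reproduces two applications of [trunc_opD_le], with a = 2^q. *)
Definition weak_comb (x : T) : \bar R := (k%:E * (a%:E * (H1 x + a%:E * (H2 x + H3 x))))%E.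

Lemma measurable_weak_comb : measurable_fun setT H1 -> measurable_fun setT H2 -> measurable_fun setT H3 ->
  measurable_fun setT weak_comb.
Proof.
move=> m1 m2 m3; do 2 (apply: emeasurable_funM => //); apply: emeasurable_funD => //.
by apply: emeasurable_funM => //; exact: emeasurable_funD.
Qed.

Lemma weak_comb_chebyshev : measurable D ->
  measurable_fun setT H1 -> measurable_fun setT H2 -> measurable_fun setT H3 ->
  (forall x, 0 <= H1 x)%E -> (forall x, 0 <= H2 x)%E -> (forall x, 0 <= H3 x)%E ->
  0 <= k -> 0 <= a -> 0 < lam ->
  (\int[m]_(x in D) H1 x <= A1%:E)%E -> (\int[m]_(x in D) H2 x <= A2%:E)%E ->
  (\int[m]_(x in D) H3 x <= A3%:E)%E ->
  (lam%:E * m (D `&` [set x | (lam%:E <= weak_comb x)%E]) <= (k * (a * (A1 + a * (A2 + A3))))%:E)%E.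
Proof.
move=> mD m1 m2 m3 p1 p2 p3 k0 a0 lam0 le1 le2 le3.
have ck : (0 <= k%:E)%E by rewrite lee_fin.
have ca : (0 <= a%:E)%E by rewrite lee_fin.
have p23 x : (0 <= H2 x + H3 x)%E by exact: adde_ge0.
have p23' x : (0 <= a%:E * (H2 x + H3 x))%E by exact: mule_ge0.
have p123 x : (0 <= H1 x + a%:E * (H2 x + H3 x))%E by exact: adde_ge0.
have pc x : (0 <= weak_comb x)%E by do 2 apply: mule_ge0 => //.
have mc := measurable_weak_comb m1 m2 m3.
have mS : measurable (D `&` [set x | (lam%:E <= weak_comb x)%E]).
  apply: measurableI => //; rewrite -[X in measurable X]setTI.
  exact: emeasurable_fun_c_infty.
rewrite -integral_cst//.
apply: (@le_trans _ _ (\int[m]_(x in D) weak_comb x)%E).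
  apply: (@le_trans _ _ (\int[m]_(x in D `&` [set x | (lam%:E <= weak_comb x)%E]) weak_comb x)%E).
    by apply: ge0_le_integral_any => x [_ h] //; rewrite lee_fin ltW.
  by apply: ge0_subset_integral_any => // x [].
have m1' : measurable_fun D H1 by exact: measurable_funTS.
have m2' : measurable_fun D H2 by exact: measurable_funTS.
have m3' : measurable_fun D H3 by exact: measurable_funTS.
have m23 : measurable_fun D (fun x => H2 x + H3 x)%E by exact: emeasurable_funD.
have m23' : measurable_fun D (fun x => a%:E * (H2 x + H3 x))%E by exact: emeasurable_funM.
have m123 : measurable_fun D (fun x => H1 x + a%:E * (H2 x + H3 x))%E by exact: emeasurable_funD.
rewrite /weak_comb ge0_integralZl_EFin//; last 2 first.
- by move=> x _; exact: mule_ge0.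
- exact: emeasurable_funM.
rewrite ge0_integralZl_EFin// ge0_integralD// ge0_integralZl_EFin// ge0_integralD//.
rewrite !EFinM EFinD EFinM EFinD.
by do 2 apply: lee_wpmul2l => //; apply: leeD => //; apply: lee_wpmul2l => //; exact: leeD.
Qed.

End weak_combination.

(** * Assembly of the weak type estimate *)

Section weak_type.
Variables (R : realType) (n : nat).
Local Notation V := 'rV[R]_n.+1.
Local Notation Rn := (Rn R n.+1).
Local Notation mu := (@lebn R n.+1).
Local Notation leb := (@lebesgue_measure R).
Local Notation N := (n.+1%:R : R).
Local Notation sigmaRn := (mu : {sigma_finite_measure set Rn -> \bar R}).
Local Notation pos := (`]0%R, +oo[%classic : set (measurableTypeR R)).
Local Notation cball := (cball R n).
Variables p q s : R.
Hypothesis p1 : 1 < p.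
Hypothesis pq : p < q.
Hypothesis q2 : 2 <= q.
Hypothesis sE : s = N * (p^-1 - q^-1).
Hypothesis cball_gt0 : 0 < cball.

Let p0 : 0 < p. Proof. exact: lt_trans p1. Qed.
Let q0 : 0 < q. Proof. exact: lt_le_trans q2. Qed.
Let q1 : 1 <= q. Proof. by apply: le_trans q2; rewrite ler1n. Qed.
Let s0 : 0 < s. Proof. by rewrite sE mulr_gt0// subr_gt0 ltf_pV2 ?posrE. Qed.

Let c : R := 2 * N.
Let c0 : 0 < c. Proof. by rewrite mulr_gt0. Qed.

Let W : R := 3 ^+ n.+1 * cball.
Let W0 : 0 <= W. Proof. by rewrite mulr_ge0 ?exprn_ge0// ltW. Qed.

(** The p-th root appears because [ae_le_off_maxset] is applied to |f|^p at level al^p; off Om it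
    gives |f| <= MC al almost everywhere. *)
Let MC : R := (8 * 4 ^+ n.+1 / cball) `^ (p^-1).
Let gC : R := meanratio R n + MC.
Let gC_gt0 : 0 < gC. Proof. by rewrite ltr_pwDl ?meanratio_gt0// powR_ge0. Qed.

Let kC : R := `|C0 R n.+1| * (1 + KernC2 R n * 3 `^ (N + 2) + KernC R n).

Let good_const : R := hardyC n c s q * (goodC n q * (gC `^ (q - p) * (gC `^ p * W + 1))).
Let far_const : R := hardyC n c s q * (farC R n `^ (q - 1) * WkC n 2 * (W + 1)).
Let near_const : R := nearC n p q s *
  ((2 `^ p * (2 * (3 ^+ n.+1 * cball)) * ((p - 1)^-1 * ((2 * (cball + 1))^-1) `^ (- (p - 1)))) *
   (2 `^ p * (1 + meanratio R n `^ p * W))).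

Let total_const : R := kC `^ q * (2 `^ q * (good_const + 2 `^ q * (far_const + near_const))).

Section one_function.
Variables (f : Rn -> R) (al : R).
Hypothesis mf : measurable_fun setT f.
Hypothesis al0 : 0 < al.
Hypothesis fp : (\int[mu]_x (`|f x| `^ p)%:E < +oo)%E.

Let i : R := fine (\int[mu]_x (`|f x| `^ p)%:E).
Let iE : (\int[mu]_x (`|f x| `^ p)%:E = i%:E)%E.
Proof.
by rewrite fineK// ge0_fin_numE// integral_ge0// => x _; rewrite lee_fin powR_ge0.
Qed.
Let i0 : 0 <= i.
Proof. by apply: fine_ge0; apply: integral_ge0 => x _; rewrite lee_fin powR_ge0. Qed.

Let v : Rn -> \bar R := EFin \o (fun x => `|f x| `^ p).
Let mfp : measurable_fun setT (fun x => `|f x| `^ p).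
Proof. by apply: (measurableT_comp (measurable_powR _)); exact: measurableT_comp. Qed.
Let mv : measurable_fun setT v. Proof. exact/measurable_EFinP. Qed.
Let v0 x : (0 <= v x)%E. Proof. by rewrite lee_fin powR_ge0. Qed.

Let Om : set Rn := maxset v (al `^ p).
Let lam0 : 0 < al `^ p. Proof. exact: powR_gt0. Qed.
Let oOm : open (Om : set V). Proof. exact: open_maxset. Qed.
Let mOm : measurable Om. Proof. exact: measurable_open. Qed.

Let muOm : (mu Om <= (W * (al `^ (- p) * i))%:E)%E.
Proof.
apply: le_trans (weak_type_maxset mv v0 lam0) _.
by rewrite iE -EFinM lee_fin powRN -/W mulrA.
Qed.

(** Om has finite measure, whereas large cubes have arbitrarily large measure; r is chosen so that
    cball r, hence cball r^(n+1), exceeds the bound on the measure of Om. *)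
Let Om_proper : exists x, ~ Om x.
Proof.
apply: contrapT => no; pose r := W * (al `^ (- p) * i) / cball + 1.
have B0 : 0 <= W * (al `^ (- p) * i) by rewrite mulr_ge0// mulr_ge0// powR_ge0.
have r1 : 1 <= r by rewrite lerDr divr_ge0// ltW.
have h : (mu (dball (0 : V) r) <= (W * (al `^ (- p) * i))%:E)%E.
  apply: le_trans muOm; apply: le_lebn => x _.
  by apply: contrapT => nx; apply: no; exists x.
move: h; rewrite lebn_dball ?(lt_le_trans ltr01)// lee_fin leNgt => /negP; apply.
apply: (@lt_le_trans _ _ (cball * r)); last by rewrite ler_pM2l// ler_eXnr.
by rewrite /r mulrDr mulr1 [cball * _]mulrC divfK ?gt_eqF// ltrDl.
Qed.

Let hp x r : ~ Om x -> 0 < r ->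
  (\int[mu]_(z in dball x r) (`|f z| `^ p)%:E <= (al `^ p * r ^+ n.+1)%:E)%E.
Proof. exact: maxsetP. Qed.

Let K : R := meanC R n * al.
Let K0 : 0 <= K. Proof. by rewrite mulr_ge0 ?(ltW al0)// ltW// meanC_gt0. Qed.
Let hK x r : ~ Om x -> 0 < r -> (\int[mu]_(z in dball x r) `|f z|%:E <= (K * r ^+ n.+1)%:E)%E.
Proof. exact: (integral_dball_le mf cball_gt0 p1 al0 hp). Qed.

Let M : R := MC * al.
Let M0 : 0 <= M. Proof. by rewrite mulr_ge0 ?powR_ge0// ltW. Qed.

Let hM : mu ([set z | M < `|f z|] `\` Om) = 0%E.
Proof.
apply/eqP; rewrite eq_le lebn_ge0 andbT.
rewrite -(ae_le_off_maxset mfp (fun z => powR_ge0 _ _) lam0 cball_gt0); apply: le_lebn.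
move=> z [/= Mz nz]; split => //=.
have C0' : 0 < 8 * 4 ^+ n.+1 / cball by rewrite divr_gt0// mulr_gt0// exprn_gt0.
rewrite (_ : _ * _ = M `^ p).
  by apply: gt0_ltr_powR; rewrite ?nnegrE.
by rewrite /M /MC powRM ?powR_ge0 ?(ltW al0)// -powRrM mulVf ?gt_eqF// powRr1// ltW.
Qed.

Let pf : poisson_integrable f. Proof. by apply: (poisson_integrable_Lp (p := p)) => //; exact: ltW. Qed.

Local Notation avgC := (avgC n K).
Local Notation far := (far f Om).
Local Notation near := (near f Om K).
Local Notation g := (cz_good f Om M).

Let mg : measurable_fun setT g. Proof. exact: measurable_cz_good. Qed.

Let gCE : avgC + M = gC * al. Proof. by rewrite avgCE mulrDl. Qed.

Let g_le z : `|g z| <= gC * al. Proof. by rewrite -gCE; exact: cz_good_le. Qed.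

Let aC : 0 <= avgC. Proof. exact: avgC_ge0. Qed.

(** |g|^q <= (gC al)^(q-p) |g|^p. The integral of |g|^p is bounded on Om by the sup of |g| and the
    measure of Om, and outside by |g| <= |f|. *)
Let good_Lq : (\int[mu]_z (`|g z| `^ q)%:E <= (gC `^ (q - p) * (gC `^ p * W + 1) * (al `^ (q - p) * i))%:E)%E.
Proof.
have ga : 0 < gC * al by rewrite mulr_gt0.
have c1 : 0 <= (gC * al) `^ (q - p) by exact: powR_ge0.
have mi : measurable_fun setT ((cst ((gC * al) `^ p)%:E) \_ Om).
  by apply/(measurable_restrictT _ mOm); exact: measurable_cst.
have i00 x : (0 <= ((cst ((gC * al) `^ p)%:E) \_ Om) x)%E.
  by rewrite patchE; case: ifP => // _; rewrite lee_fin powR_ge0.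
apply: (@le_trans _ _ (\int[mu]_z (((gC * al) `^ (q - p))%:E * (((cst ((gC * al) `^ p)%:E) \_ Om) z + v z)))%E).
  apply: ge0_le_integral_any => z _; first by rewrite lee_fin powR_ge0.
  apply: (@le_trans _ _ (((gC * al) `^ (q - p))%:E * (`|g z| `^ p)%:E)%E).
    rewrite -EFinM lee_fin; have := normr_ge0 (g z); rewrite le_eqVlt => /predU1P[<-|gz].
      by rewrite !powR0 ?mulr0// gt_eqF.
    have -> : `|g z| `^ q = `|g z| `^ (q - p) * `|g z| `^ p by rewrite -powRD_gt0// subrK.
    rewrite ler_wpM2r ?powR_ge0//.
    by apply: ge0_ler_powR; rewrite ?nnegrE ?(ltW ga)// subr_ge0 ltW.
  rewrite lee_wpmul2l ?lee_fin//; rewrite patchE; case: ifPn => [_|].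
    apply: (le_trans _ (leeDl _ (v0 z))).
    by rewrite lee_fin; apply: ge0_ler_powR; rewrite ?nnegrE ?(ltW ga) ?(ltW p0).
  rewrite notin_setE => nz; rewrite add0e lee_fin; apply: ge0_ler_powR; rewrite ?nnegrE ?(ltW p0)//.
  exact: cz_goodE_off.
rewrite ge0_integralZl_EFin//; last 2 first.
- by move=> z _; rewrite adde_ge0.
- exact: emeasurable_funD.
rewrite ge0_integralD//.
have -> : (\int[mu]_z ((cst ((gC * al) `^ p)%:E) \_ Om) z = ((gC * al) `^ p)%:E * mu Om)%E.
  by rewrite -integral_mkcond integral_cst.
have gp : (0 <= ((gC * al) `^ p)%:E)%E by rewrite lee_fin powR_ge0.
apply: (@le_trans _ _ (((gC * al) `^ (q - p))%:E * (((gC * al) `^ p)%:E * (W * (al `^ (- p) * i))%:E + i%:E))%E).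
  rewrite lee_wpmul2l ?lee_fin//; apply: leeD; last by rewrite -iE.
  by rewrite lee_wpmul2l.
rewrite [leLHS](_ : _ = ((gC * al) `^ (q - p) * ((gC * al) `^ p * (W * (al `^ (- p) * i)) + i))%:E)//.
rewrite lee_fin !(powRM _ (ltW gC_gt0) (ltW al0)) powRN.
rewrite le_eqVlt; apply/orP; left; apply/eqP; field.
by rewrite gt_eqF.
Qed.

Let integral_Om : (\int[mu]_(z in Om) `|f z|%:E <= ((W + 1) * (al `^ (1 - p) * i))%:E)%E.
Proof.
have ai : 0 <= al `^ (- p) * i by rewrite mulr_ge0 ?powR_ge0.
have Wai : 0 <= W * (al `^ (- p) * i) by rewrite mulr_ge0.
have := Lp_average_le mf (ltW p1) al0 mOm Wai ai muOm _.
have -> : (W * (al `^ (- p) * i) + al `^ (- p) * i) * al = (W + 1) * (al `^ (1 - p) * i).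
  by rewrite (powRD_gt0 _ _ al0) powRr1 ?(ltW al0)//; ring.
apply; rewrite mulrA -powRD_gt0// addrN powRr0 mul1r -iE.
by apply: ge0_subset_integral_any => // z _; rewrite lee_fin powR_ge0.
Qed.

Let beta_Lp : (\int[mu]_z (beta f Om al z `^ p)%:E <= (2 `^ p * (1 + meanratio R n `^ p * W) * i)%:E)%E.
Proof.
have mi : measurable_fun setT ((cst (avgC `^ p)%:E) \_ Om).
  by apply/(measurable_restrictT _ mOm); exact: measurable_cst.
have i00 x : (0 <= ((cst (avgC `^ p)%:E) \_ Om) x)%E.
  by rewrite patchE; case: ifP => // _; rewrite lee_fin powR_ge0.
apply: (@le_trans _ _ (\int[mu]_z ((2 `^ p)%:E * (v z + ((cst (avgC `^ p)%:E) \_ Om) z)))%E).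
  apply: ge0_le_integral_any => z _; first by rewrite lee_fin powR_ge0.
  rewrite patchE /beta; case: ifPn => _.
    by rewrite /cst -EFinD -EFinM lee_fin; apply: powRD_le => //; exact: ltW.
  by rewrite adde0 powR0 ?gt_eqF// mule_ge0// lee_fin powR_ge0.
rewrite ge0_integralZl_EFin ?powR_ge0//; last 2 first.
- by move=> z _; rewrite adde_ge0.
- exact: emeasurable_funD.
rewrite ge0_integralD//.
have -> : (\int[mu]_z ((cst (avgC `^ p)%:E) \_ Om) z = (avgC `^ p)%:E * mu Om)%E.
  by rewrite -integral_mkcond integral_cst.
apply: (@le_trans _ _ ((2 `^ p)%:E * (i%:E + (avgC `^ p)%:E * (W * (al `^ (- p) * i))%:E))%E).
  rewrite lee_wpmul2l ?lee_fin ?powR_ge0//; apply: leeD; first by rewrite -iE.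
  by rewrite lee_wpmul2l ?lee_fin ?powR_ge0.
have mr0 : 0 <= meanratio R n by exact/ltW/meanratio_gt0.
rewrite [leLHS](_ : _ = (2 `^ p * (i + avgC `^ p * (W * (al `^ (- p) * i))))%:E)// lee_fin avgCE powRM ?(ltW al0)// powRN.
rewrite le_eqVlt; apply/orP; left; apply/eqP; field.
by rewrite gt_eqF.
Qed.

Let Phi1 (y : Rn) (t : R) : \bar R := `|Tk g y t|%:E.
(** Real values are needed for [integral_trunc_op_le]; by [far_le] nothing is lost for t > 0. *)
Let Phi2 (y : Rn) (t : R) : \bar R := (fine (far y t))%:E.
Let Phi3 (y : Rn) (t : R) : \bar R := near y t.

Let Phi10 y t : (0 <= Phi1 y t)%E. Proof. by rewrite lee_fin. Qed.
Let Phi20 y t : (0 <= Phi2 y t)%E. Proof. by rewrite lee_fin fine_ge0// far_ge0. Qed.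
Let Phi30 y t : (0 <= Phi3 y t)%E.
Proof. by apply: integral_ge0 => z _; rewrite lee_fin mulr_ge0 ?Wk_ge0// addr_ge0. Qed.

Let mTg : measurable_fun [set: Rn * R] (fun w => `|Tk g w.1 w.2|).
Proof. by apply: measurableT_comp => //; exact: measurable_Tk. Qed.
Let mfar : measurable_fun [set: Rn * R] (fun w => fine (far w.1 w.2)).
Proof. by apply: measurableT_comp => //; exact: measurable_far. Qed.
Let mPhi1 : measurable_fun [set: Rn * R] (fun w => Phi1 w.1 w.2). Proof. exact/measurable_EFinP. Qed.
Let mPhi2 : measurable_fun [set: Rn * R] (fun w => Phi2 w.1 w.2). Proof. exact/measurable_EFinP. Qed.
Let mPhi3 : measurable_fun [set: Rn * R] (fun w => Phi3 w.1 w.2).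
Proof.
have mb : measurable_fun [set: Rn] (bdist Om : Rn -> R) by exact: measurable_bdist.
pose F (w : Rn * R) (z : Rn) : \bar R :=
  (if (0 < bdist Om z) && (dst w.1 z < 2 * bdist Om w.1) then (`|f z| + avgC) * Wk 1 w.2 w.1 z else 0)%:E.
have := measurable_integral_param (F := F).
rewrite (_ : (fun w : Rn * R => Phi3 w.1 w.2) = (fun w => \int[mu]_z F w z)%E).
  apply => [|w z]; last by rewrite lee_fin; case: ifP => // _; rewrite mulr_ge0 ?Wk_ge0// addr_ge0.
  have m11 : measurable_fun [set: (Rn * R) * Rn] (fun w : (Rn * R) * Rn => w.1.1).
    exact: (measurableT_comp measurable_fst measurable_fst).
  have m12 : measurable_fun [set: (Rn * R) * Rn] (fun w : (Rn * R) * Rn => w.1.2).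
    exact: (measurableT_comp measurable_snd measurable_fst).
  apply/measurable_EFinP; apply: measurable_fun_ifT => //.
    apply: measurable_and.
      by apply: measurable_fun_ltr => //; exact: (measurableT_comp mb measurable_snd).
    apply: measurable_fun_ltr; first exact: measurable_fun_dst.
    by apply: measurable_funM => //; exact: (measurableT_comp mb m11).
  apply: measurable_funM; last exact: measurable_Wk.
  apply: measurable_funD => //; apply: measurableT_comp => //.
  exact: (measurableT_comp mf measurable_snd).
apply/funext => w; rewrite /Phi3 /near integral_mkcond; apply: eq_integral => z _; rewrite patchE /F.
case: ifPn => [/set_mem h|]; first by rewrite h.
by rewrite notin_setE => /negP/negbTE h; rewrite h.
Qed.

Let dtP_le y t : 0 < t -> (`|dtP f y t|%:E <= kC%:E * (Phi1 y t + (Phi2 y t + Phi3 y t)))%E.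
Proof.
move=> t0; have c1 : 0 <= KernC2 R n * 3 `^ (N + 2) by rewrite mulr_ge0 ?KernC2_ge0 ?powR_ge0.
have KC := KernC_ge0 R n.
have far_fin : far y t \is a fin_num.
  rewrite ge0_fin_numE ?far_ge0//.
  by apply: le_lt_trans (far_le mf oOm Om_proper cball_gt0 p1 al0 hp y t0) _; rewrite ltry.
rewrite dtPE// normrM EFinM /kC [X in (_ <= X * _)%E]EFinM -muleA lee_wpmul2l ?lee_fin//.
have h : (`|Tk f y t - Tk g y t|%:E <= (KernC2 R n * 3 `^ (N + 2))%:E * Phi2 y t + (KernC R n)%:E * Phi3 y t)%E.
  apply: le_trans (Tk_sub_cz_good_le pf oOm Om_proper cball_gt0 K0 hK M0 hM y t0) _.
  rewrite /Phi2 fineK//.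
  exact: (integral_avg_Kern_sub_far_near mf oOm Om_proper cball_gt0 K0 hK y t0).
apply: (@le_trans _ _ (Phi1 y t + `|Tk f y t - Tk g y t|%:E)%E).
  by rewrite /Phi1 -EFinD lee_fin -{1}(subrK (Tk g y t) (Tk f y t)) addrC ler_normD.
apply: (le_trans (leeD (lexx _) h)).
have B1 : 1 <= 1 + KernC2 R n * 3 `^ (N + 2) + KernC R n by rewrite -addrA lerDl addr_ge0.
have B2 : KernC2 R n * 3 `^ (N + 2) <= 1 + KernC2 R n * 3 `^ (N + 2) + KernC R n.
  by rewrite addrAC lerDr addr_ge0.
have B3 : KernC R n <= 1 + KernC2 R n * 3 `^ (N + 2) + KernC R n by rewrite lerDr addr_ge0.
rewrite (ge0_muleDr _ (Phi10 y t) (adde_ge0 (Phi20 y t) (Phi30 y t))) (ge0_muleDr _ (Phi20 y t) (Phi30 y t)).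
apply: leeD; first by rewrite -[leLHS]mul1e lee_wpmul2r// lee_fin.
by apply: leeD; rewrite lee_wpmul2r// lee_fin.
Qed.

Local Notation H1 := (trunc_op c s q Phi1).
Local Notation H2 := (trunc_op c s q Phi2).
Local Notation H3 := (trunc_op c s q Phi3).
Let mH1 : measurable_fun setT H1. Proof. exact: measurable_trunc_op. Qed.
Let mH2 : measurable_fun setT H2. Proof. exact: measurable_trunc_op. Qed.
Let mH3 : measurable_fun setT H3. Proof. exact: measurable_trunc_op. Qed.

Let hC0 : 0 <= hardyC n c s q.
Proof.
have a0 : 0 < s * (q + 1) / 2 by rewrite divr_gt0// mulr_gt0// ltr_wpDl// (le_trans ler01).
apply: mulr_ge0; first by rewrite mulr_ge0 ?powR_ge0.
by rewrite mulr_ge0 ?powR_ge0// mulr_ge0 ?powR_ge0// WkC_ge0.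
Qed.

Let goodC0 : 0 <= goodC n q.
Proof.
have G0 := @gramC_gt0 R n.
rewrite /goodC; case: ifPn => [_|q2']; first by rewrite mulr_ge0// ltW.
have q2'' : 0 <= (q - 2)^-1 by rewrite invr_ge0 subr_ge0.
by rewrite mulr_ge0 ?(mulr_ge0 q2'') ?powR_ge0// mulr_ge0 ?powR_ge0// mulr_ge0// ltW.
Qed.

Let H1_le : (\int[mu]_x H1 x <= (good_const * (al `^ (q - p) * i))%:E)%E.
Proof.
apply: le_trans (integral_trunc_op_le c0 s0 q1 mTg (fun y t => normr_ge0 _)) _.
rewrite /good_const -mulrA (EFinM (hardyC _ _ _ _)) lee_wpmul2l ?lee_fin//.
apply: le_trans (square_function_Lq mg g_le q2) _.
have gC0 : (0 <= (goodC n q)%:E)%E by rewrite lee_fin.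
apply: le_trans (lee_wpmul2l gC0 good_Lq) _.
by rewrite -EFinM lee_fin le_eqVlt; apply/orP; left; apply/eqP; ring.
Qed.

Let H2_le : (\int[mu]_x H2 x <= (far_const * (al `^ (q - p) * i))%:E)%E.
Proof.
have fz (y : Rn) t : 0 <= fine (far y t) by have := Phi20 y t; rewrite lee_fin.
apply: le_trans (integral_trunc_op_le c0 s0 q1 mfar fz) _.
rewrite /far_const -mulrA (EFinM (hardyC _ _ _ _)) lee_wpmul2l ?lee_fin//.
apply: le_trans (integral_far_Lq mf oOm Om_proper cball_gt0 p1 q2 al0 hp) _.
have fC := farC_gt0 cball_gt0.
have h : (0 <= ((farC R n * al) `^ (q - 1) * WkC n 2)%:E)%E by rewrite lee_fin mulr_ge0 ?powR_ge0 ?WkC_ge0.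
apply: le_trans (lee_wpmul2l h integral_Om) _.
rewrite -EFinM lee_fin powRM ?(ltW fC) ?(ltW al0)//.
have -> : al `^ (q - p) = al `^ (q - 1) * al `^ (1 - p) by rewrite -powRD_gt0//; congr (_ `^ _); ring.
by rewrite le_eqVlt; apply/orP; left; apply/eqP; ring.
Qed.

Let H3_le : (\int[mu]_(x in ~` Om) H3 x <= (near_const * (al `^ (q - p) * i))%:E)%E.
Proof.
have nt (y : Rn) t : (0 <= Phi3 y t * (t `^ s)%:E)%E by rewrite mule_ge0 ?lee_fin ?powR_ge0.
apply: (@le_trans _ _ (\int[mu]_(x in ~` Om) \int[mu]_y ((dst x y `^ (- (N + s * q)))%:E *
     poweR (\int[leb]_(t in pos) (near y t * (t `^ s)%:E)) q))%E).
  apply: ge0_le_integral_any => x _; first exact: trunc_op_ge0.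
  apply: ge0_le_integral_any => y _; first exact: trunc_integrand_ge0.
  rewrite lee_wpmul2l ?lee_fin ?powR_ge0//; apply: gt0_ler_poweR; first exact: ltW.
  - by rewrite in_itv/= leey andbT; exact: trunc_ge0.
  - by rewrite in_itv/= leey andbT; apply: integral_ge0 => t _; exact: nt.
  (* The near part is integrable against t^s up to infinity, so the truncation in t is simply
     dropped. *)
  apply: ge0_subset_integral_any => [t|t _]; last exact: nt.
  by rewrite /= !in_itv/= => /andP[->].
apply: le_trans (integral_near_Lq mf oOm Om_proper cball_gt0 p1 pq sE al0 hp) _.
have nC : 0 <= nearC n p q s by exact: nearC_ge0.
have h : (0 <= (nearC n p q s * al `^ (q - p))%:E)%E by rewrite lee_fin mulr_ge0 ?powR_ge0.
have mbeta : measurable_fun setT (beta f Om al) by exact: measurable_beta.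
have beta0 z : 0 <= beta f Om al z by exact: beta_ge0.
apply: le_trans (lee_wpmul2l h (maxfun_Lp p1 mbeta beta0)) _.
set C := 2 `^ p * _ * _.
have C0' : 0 <= C.
  rewrite mulr_ge0 ?mulr_ge0 ?powR_ge0 ?exprn_ge0 ?(ltW cball_gt0)// invr_ge0 subr_ge0.
  exact: ltW.
have h2 : (0 <= C%:E)%E by rewrite lee_fin.
apply: le_trans (lee_wpmul2l h (lee_wpmul2l h2 beta_Lp)) _.
rewrite -!EFinM lee_fin /near_const -/C.
by rewrite le_eqVlt; apply/orP; left; apply/eqP; ring.
Qed.

Let kC0 : 0 <= kC.
Proof.
by rewrite mulr_ge0// addr_ge0 ?KernC_ge0// addr_ge0// mulr_ge0 ?KernC2_ge0 ?powR_ge0.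
Qed.

Local Notation Hsum := (weak_comb H1 H2 H3 (kC `^ q) (2 `^ q)).

Let Rsq_le (x : V) : (al%:E < Rsq s q f x)%E -> ((al `^ q)%:E <= Hsum x)%E.
Proof.
rewrite /Rsq; set J := (\int[mu]_y _)%E => h.
have J0 : (0 <= J)%E by apply: integral_ge0 => y _; rewrite mule_ge0 ?poweR_ge0// lee_fin powR_ge0.
have JH : (J <= Hsum x)%E.
  have Phi0 y t : (0 <= Phi1 y t + (Phi2 y t + Phi3 y t))%E by rewrite adde_ge0// adde_ge0.
  have m23 : measurable_fun [set: Rn * R] (fun w => Phi2 w.1 w.2 + Phi3 w.1 w.2)%E by exact: emeasurable_funD.
  have mPhi : measurable_fun [set: Rn * R] (fun w => Phi1 w.1 w.2 + (Phi2 w.1 w.2 + Phi3 w.1 w.2))%E.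
    exact: emeasurable_funD.
  have cN : 2 * N <= c by exact: lexx.
  have P23 y t : (0 <= Phi2 y t + Phi3 y t)%E by exact: adde_ge0.
  apply: le_trans (Rsq_integral_le (c := c) s0 q1 x cN kC0 Phi0 mPhi dtP_le) _.
  rewrite /weak_comb; apply: lee_wpmul2l; first by rewrite lee_fin powR_ge0.
  apply: le_trans (trunc_opD_le c s q1 x Phi10 mPhi1 P23 m23) _.
  apply: lee_wpmul2l; first by rewrite lee_fin powR_ge0.
  apply: leeD; first exact: lexx.
  exact: (trunc_opD_le c s q1 x Phi20 mPhi2 Phi30 mPhi3).
apply: le_trans JH; rewrite leNgt; apply/negP => Jlt.
move: h; apply/negP; rewrite -leNgt.
have -> : al%:E = poweR (al `^ q)%:E q^-1.
  by rewrite poweR_EFin -powRrM mulfV ?gt_eqF// powRr1// ltW.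
apply: gt0_ler_poweR; rewrite ?invr_ge0 ?(ltW q0) ?in_itv/= ?leey ?J0 ?lee_fin ?powR_ge0//.
exact: ltW.
Qed.

(** [lebn] is monotone on arbitrary sets, so the level set of [Rsq] is compared directly with the
    measurable union of Om and E, where E is a level set of the measurable [weak_comb]. Chebyshev's
    inequality at height al^q, applied outside Om, turns al^(q-p) into al^(-p). *)
Lemma Rsq_weak_type : (mu [set x : Rn | (al%:E < Rsq s q f x)%E] <=
  ((W + total_const) * al `^ (- p))%:E * \int[mu]_x (`|f x| `^ p)%:E)%E.
Proof.
pose E : set Rn := ~` Om `&` [set x | ((al `^ q)%:E <= Hsum x)%E].
have alq : 0 < al `^ q by exact: powR_gt0.
have Ele : ((al `^ q)%:E * mu E <= (total_const * (al `^ (q - p) * i))%:E)%E.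
  have mC : measurable (~` Om) by exact: measurableC.
  have k0 : 0 <= kC `^ q by exact: powR_ge0.
  have a0 : 0 <= 2 `^ q :> R by exact: powR_ge0.
  have le1 : (\int[mu]_(x in ~` Om) H1 x <= (good_const * (al `^ (q - p) * i))%:E)%E.
    by apply: le_trans H1_le; apply: ge0_subset_integral_any => // x _; exact: trunc_op_ge0.
  have le2 : (\int[mu]_(x in ~` Om) H2 x <= (far_const * (al `^ (q - p) * i))%:E)%E.
    by apply: le_trans H2_le; apply: ge0_subset_integral_any => // x _; exact: trunc_op_ge0.
  have -> : total_const * (al `^ (q - p) * i) = kC `^ q * (2 `^ q * (good_const * (al `^ (q - p) * i) +
      2 `^ q * (far_const * (al `^ (q - p) * i) + near_const * (al `^ (q - p) * i)))).
    by rewrite /total_const; ring.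
  have pH1 x : (0 <= H1 x)%E by exact: trunc_op_ge0.
  have pH2 x : (0 <= H2 x)%E by exact: trunc_op_ge0.
  have pH3 x : (0 <= H3 x)%E by exact: trunc_op_ge0.
  exact: (weak_comb_chebyshev (m := sigmaRn) mC mH1 mH2 mH3 pH1 pH2 pH3 k0 a0 alq le1 le2 H3_le).
have Ele' : (mu E <= (total_const * (al `^ (- p) * i))%:E)%E.
  have aV : (0 <= ((al `^ q)^-1)%:E)%E by rewrite lee_fin invr_ge0 ltW.
  have := lee_wpmul2l aV Ele; rewrite muleA -!EFinM mulVf ?gt_eqF// mul1e => h.
  apply: le_trans h _; rewrite lee_fin (powRD_gt0 _ _ al0).
  by rewrite le_eqVlt; apply/orP; left; apply/eqP; field; rewrite gt_eqF.
apply: (@le_trans _ _ (mu (Om `|` E))).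
  apply: le_lebn => x /= hx; have [Ox|nx] := pselect (Om x); first by left.
  by right; split => //; exact: Rsq_le.
apply: (@le_trans _ _ (mu Om + mu E)%E).
  apply: (@measureU2 _ _ _ sigmaRn) => //; apply: measurableI; first exact: measurableC.
  rewrite -[X in measurable X]setTI; apply: emeasurable_fun_c_infty => //.
  exact: (measurable_weak_comb _ _ mH1 mH2 mH3).
apply: le_trans (leeD muOm Ele') _; rewrite iE -EFinD -EFinM lee_fin.
by rewrite le_eqVlt; apply/orP; left; apply/eqP; ring.
Qed.

End one_function.

Lemma Rsq_weak_type_const : exists C : R, forall (al : R) (f : Rn -> R), 0 < al ->
  measurable_fun [set: Rn] f -> (\int[mu]_x (`|f x| `^ p)%:E < +oo)%E ->
  (mu [set x : Rn | (al%:E < Rsq s q f x)%E] <=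
   (C * al `^ (- p))%:E * \int[mu]_x (`|f x| `^ p)%:E)%E.
Proof. by exists (W + total_const) => al f al0 mf fp; exact: Rsq_weak_type. Qed.

End weak_type.

Theorem theorem5 (R : realType) (n : nat) (p q s : R) :
  1 < p -> p < q -> 2 <= q -> s = n%:R * (p^-1 - q^-1) -> 0 < s < 1 ->
  exists C : R, forall (alpha : R) (f : Rn R n -> R),
    0 < alpha ->
    measurable_fun [set: Rn R n] f ->
    (\int[lebn n]_x (powR `|f x| p)%:E < +oo)%E ->
    (lebn n [set x : Rn R n | (alpha%:E < Rsq s q f x)%E]
      <= (C * powR alpha (- p))%:E * \int[lebn n]_x (powR `|f x| p)%:E)%E.
Proof.
case: n => [|n] p1 pq q2 sE /andP[s0 s1]; first by move: s0; rewrite sE mul0r ltxx.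
(* A null unit ball would make lebn vanish identically; this saves computing its measure. *)
have [c0|c0] := eqVneq (cball R n) 0.
  exists 0 => al f _ _ _; rewrite lebn_cball0// mul0r mul0e.
  exact: lexx.
apply: Rsq_weak_type_const => //.
by rewrite lt_def c0 cball_ge0.
Qed.
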